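(* Let $\tau\in\mathbb{H}$ and let $\lambda_0\in\sigma(L_\tau^3)$ with $Q_3(\lambda_0;\tau)\neq 0$. Then $\lambda_0$ is an inner intersection point of $\sigma(L_\tau^3)$ if and only if $\lambda_0$ satisfies the cubic equation $$f(\lambda):=\frac{4}{15}\lambda^3+\frac{8}{5}\eta_1\lambda^2-3g_2\lambda+9g_3-6\eta_1g_2=0,$$ where $\eta_1=\eta_1(\tau)$, $g_2=g_2(\tau)$, $g_3=g_3(\tau)$.
   Context: For $\tau\in\mathbb{H}=\{\operatorname{Im}\tau>0\}$ let $\wp(z;\tau)$ be the Weierstrass function with periods $\omega_1=1$, $\omega_2=\tau$, let $\omega_3=1+\tau$, $e_k=e_k(\tau)=\wp(\omega_k/2;\tau)$, and let $g_2,g_3$ be the invariants: $\wp'^2=4\wp^3-g_2\wp-g_3=4\prod_k(\wp-e_k)$. Let $\zeta(z;\tau)$ be the odd Weierstrass zeta function ($\zeta'=-\wp$) and $\eta_1(\tau)=2\zeta(\tfrac12;\tau)$. $L_\tau^3=\frac{d^2}{dx^2}-12\wp(x+z_0;\tau)$ is the Lamé operator in $L^2(\mathbb{R},\mathbb{C})$, where $z_0\in\mathbb{C}$ is chosen so that $\wp(x+z_0;\tau)$ has no singularities on $\mathbb{R}$ (the spectrum $\sigma(L_\tau^3)$ does not depend on $z_0$). It is known that $\sigma(L_\tau^3)=\{\lambda\in\mathbb{C}: -2\le\Delta(\lambda)\le 2\}$, where the Hill discriminant $\Delta(\lambda)$ is the trace of the monodromy matrix of $L_\tau^3y=\lambda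 y$ with respect to $x\mapsto x+1$, and that $\sigma(L_\tau^3)$ is a finite union of simple analytic arcs (the spectral arcs), one of them semi-infinite and the others bounded. The spectral polynomial is $Q_3(\lambda;\tau)=\lambda\prod_{k=1}^3\left(\lambda^2-6e_k\lambda+15(3e_k^2-g_2)\right)$. The number of semi-arcs meeting at $\lambda_0\in\sigma(L_\tau^3)$ is the number of local branches of $\sigma(L_\tau^3)$ emanating from $\lambda_0$, i.e. the number of connected components of $(\sigma(L_\tau^3)\cap D)\setminus\{\lambda_0\}$ for all sufficiently small discs $D$ centred at $\lambda_0$. An inner intersection point is a point of $\sigma(L_\tau^3)$ that is an intersection point of different spectral arcs but not an endpoint of any of them; equivalently, it is met by $2k$ semi-arcs for some integer $k\ge 2$. *)

(* Defs.v *)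
From HB Require Import structures.
From mathcomp Require Import all_boot all_order all_algebra.
From mathcomp Require Import complex.
From mathcomp Require Import all_classical all_reals all_analysis.

Set Implicit Arguments.
Unset Strict Implicit.
Unset Printing Implicit Defensive.

Import Order.TTheory GRing.Theory Num.Theory.
Import numFieldNormedType.Exports.

Local Open Scope classical_set_scope.
Local Open Scope complex_scope.
Local Open Scope ring_scope.

(* R[i] carries the topology of its modulus. *)
HB.instance Definition _ (R : realType) := NormedModule.copy R[i] R[i]^o.

Section Weierstrass.
Context {R : realType}.
Implicit Types (tau z : R[i]) (F : R[i] -> R[i]).

Definition lattice tau : set R[i] :=
  [set z | exists m n : int, z = m%:~R + n%:~R * tau].

Definition zrange (N : nat) : seq int :=
  [seq i%:Z - N%:Z | i <- iota 0 N.*2.+1].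

(* Sum of F over the nonzero lattice points, along the boxes |m|, |n| <= N; it
   is only applied to absolutely convergent sums, so the exhaustion is
   immaterial. *)
Definition lattice_sum tau F : R[i] :=
  lim ((fun N : nat => \sum_(m <- zrange N)
          \sum_(n <- zrange N | (m != 0) || (n != 0))
            F (m%:~R + n%:~R * tau)) @ \oo).

Definition wp tau z : R[i] :=
  z ^- 2 + lattice_sum tau (fun w => (z - w) ^- 2 - w ^- 2).

Definition wzeta tau z : R[i] :=
  z^-1 + lattice_sum tau (fun w => (z - w)^-1 + w^-1 + z / w ^+ 2).

Definition eta1 tau : R[i] := 2 * wzeta tau (1 / 2).

Definition g2 tau : R[i] := 60 * lattice_sum tau (fun w => w ^- 4).

Definition g3 tau : R[i] := 140 * lattice_sum tau (fun w => w ^- 6).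

(* omega tau 0, 1, 2 and e tau 0, 1, 2 are omega_1, omega_2, omega_3 and
   e_1, e_2, e_3. *)
Definition omega tau (k : 'I_3) : R[i] := nth 0 [:: 1; tau; 1 + tau] k.

Definition e tau (k : 'I_3) : R[i] := wp tau (omega tau k / 2).

Definition spectral_poly tau (lambda : R[i]) : R[i] :=
  lambda * \prod_(k < 3)
    (lambda ^+ 2 - 6 * e tau k * lambda + 15 * (3 * e tau k ^+ 2 - g2 tau)).

End Weierstrass.

Section Spectrum.
Context {R : realType}.
Implicit Types (f h y : R -> R[i]).

Local Notation mu := (@lebesgue_measure R).

Definition L2norm f : \bar R := 'N[mu]_(2%:E)[(fun x => (Normc.normc (f x))%:E)]%E.

Definition L2 f : Prop :=
  [/\ measurable_fun setT (fun x => complex.Re (f x)),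
      measurable_fun setT (fun x => complex.Im (f x)) &
      (L2norm f < +oo)%E].

Definition cRintegral (a b : R) f : R[i] :=
  (\int[mu]_(x in `[a, b]) complex.Re (f x)) +i*
  (\int[mu]_(x in `[a, b]) complex.Im (f x)).

(* For locally integrable f: y is locally absolutely continuous and y' = f
   almost everywhere. *)
Definition primitive_of f y : Prop :=
  forall a b : R, a <= b -> y b - y a = cRintegral a b f.

(* y belongs to the Sobolev space H^2(R, C) and has second derivative d2y. *)
Definition H2_second_derivative y d2y : Prop :=
  exists dy, [/\ L2 y, L2 dy, L2 d2y, primitive_of dy y & primitive_of d2y dy].

(* An unbounded operator in L^2(R, C) is given by its graph: A y h means that y
   is in the domain of A and A y = h almost everywhere. The resolvent set is the
   set of lambda for which A - lambda is a bijection from the domain of A onto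
   L^2(R, C), with a bounded inverse. *)
Definition resolvent_set (A : (R -> R[i]) -> (R -> R[i]) -> Prop) : set R[i] :=
  [set lambda | exists M : R, forall f, L2 f ->
    exists y, [/\ A y (fun x => lambda * y x + f x),
      forall y1, A y1 (fun x => lambda * y1 x + f x) ->
        {ae mu, forall x, y1 x = y x} &
      (L2norm y <= M%:E * L2norm f)%E]].

Definition spectrum A : set R[i] := ~` resolvent_set A.

(* The operator d^2/dx^2 - 12 wp(x + z0; tau) with domain H^2(R, C). *)
Definition lame (tau z0 : R[i]) y h : Prop :=
  exists2 d2y, H2_second_derivative y d2y &
    {ae mu, forall x, h x = d2y x - 12 * wp tau (x%:C + z0) * y x}.

End Spectrum.

Section SemiArcs.
Context {R : realType}.
Implicit Types (S : set R[i]) (lambda : R[i]).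

Definition components S : set (set R[i]) :=
  [set connected_component S x | x in S].

Definition semi_arcs S lambda (n : nat) : Prop :=
  \forall r \near (0 : R)^'+,
    (components ((S `&` ball lambda r%:C) `\ lambda) #= `I_n)%card.

Definition inner_intersection_point S lambda : Prop :=
  S lambda /\ exists2 k : nat, (2 <= k)%N & semi_arcs S lambda (2 * k).

End SemiArcs.

(* Main.v *)
(* Products of two solutions of y'' = (12 wp + l) y satisfy a third-order linear equation, one solution
   of which is a polynomial Phi in wp and l. The first integral w^2 = Phi'^2 - 2 Phi Phi'' + 4 (12 wp + l) Phi^2
   is a constant multiple of Q_3(l), and the operator y |-> Phi y' - Phi' y / 2 maps solutions to solutions
   and has square w^2 / 4. Hence, when Q_3(l) <> 0, its two eigenfunctions are independent Floquet solutions
   with multipliers rho and 1 / rho, and l belongs to the spectrum if and only if |rho| = 1: otherwise the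
   Green kernel made of the two decaying solutions inverts the operator, and if |rho| = 1 the function
   conj(y+) times a bump is not in its range. Comparing Wronskians at 0 and 1 for two nearby parameters
   gives rho' / rho = (int_0^1 Phi) / w, and integrating Phi over a period turns the numerator into
   - f(l) / 60. If l0 is a root of f of multiplicity n, the function |rho|^2 - 1 therefore looks
   near l0 like the real part of c (l - l0)^(n+1), and its zero set consists of 2 (n + 1) arcs issuing
   from l0; this number is at least 4 exactly when f(l0) = 0. *)
Require Import Defs.
From HB Require Import structures.
From mathcomp Require Import all_boot all_order all_algebra.
From mathcomp Require Import complex.
From mathcomp Require Import all_classical all_reals all_analysis.
From mathcomp Require Import measurable_realfun.
From mathcomp Require Import ring lra zify.
Set Implicit Arguments.
Unset Strict Implicit.
Unset Printing Implicit Defensive.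
Import Order.TTheory GRing.Theory Num.Theory.
Import numFieldNormedType.Exports.

Local Open Scope classical_set_scope.
Local Open Scope complex_scope.
Local Open Scope ring_scope.

(** Everything about [wp] has to come from its lattice sums. Identities between elliptic functions
    follow from Liouville's theorem, which rests on the mean value property over circles: the radial
    derivative of a circular mean is an angular derivative and integrates to 0. Identifying the
    first integral with Q_3 needs the symmetric functions of the e_k, hence that these are distinct;
    otherwise [wp] would be constant along a path towards its pole, or bounded near it. The spectrum
    is defined by a bounded inverse in L^2, so the criterion |rho| = 1 has to be proved in both
    directions. The root w is chosen locally, and the Floquet solutions are only shown to be
    continuous in l; the Wronskian of y+ at one parameter with y- at another still yields the
    derivative of rho. The arcs are counted in polar coordinates: on each small circle |rho|^2 - 1
    is strictly monotone in the angle inside 2 (n + 1) sectors and has a strict sign between them.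
    Each sector thus carries one arc, a graph over the radius, and Lipschitz functions separate the
    arcs, which are therefore the components. *)

Notation re := complex.Re.
Notation im := complex.Im.
Notation nc := Normc.normc.

(** * The modulus as a real number, and the topology of [R[i]] expressed by it *)

Section Modulus.
Context {R : realType}.
Implicit Types (x y z : R[i]).

Lemma normcE' z : `|z| = (nc z)%:C. Proof. by []. Qed.

Lemma nc_sqrtE z : nc z = Num.sqrt (re z ^+ 2 + im z ^+ 2).
Proof. by case: z. Qed.

Lemma nc_ge0 z : 0 <= nc z. Proof. by rewrite nc_sqrtE sqrtr_ge0. Qed.

Lemma nc_sqr z : nc z ^+ 2 = re z ^+ 2 + im z ^+ 2.
Proof. by rewrite nc_sqrtE sqr_sqrtr// addr_ge0// sqr_ge0. Qed.

Lemma ncD x y : nc (x + y) <= nc x + nc y. Proof. exact: le_normcD. Qed.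
Lemma ncN x : nc (- x) = nc x. Proof. exact: normcN. Qed.
Lemma ncB x y : nc (x - y) <= nc x + nc y.
Proof. by rewrite -(ncN y); exact: ncD. Qed.
Lemma ncBC x y : nc (x - y) = nc (y - x). Proof. by rewrite -ncN opprB. Qed.
Lemma ncM x y : nc (x * y) = nc x * nc y. Proof. exact: Normc.normcM. Qed.
Lemma ncV x : nc x^-1 = (nc x)^-1. Proof. exact: Normc.normcV. Qed.
Lemma nc0 : nc (0 : R[i]) = 0. Proof. exact: Normc.normc0. Qed.
Lemma nc1 : nc (1 : R[i]) = 1. Proof. exact: Normc.normc1. Qed.

Lemma ncX x n : nc (x ^+ n) = nc x ^+ n.
Proof. by elim: n => [|n IH]; rewrite ?expr0 ?nc1// !exprS ncM IH. Qed.

Lemma nc_real (r : R) : nc r%:C = `|r|.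
Proof. by rewrite nc_sqrtE /= expr0n/= addr0 sqrtr_sqr. Qed.

Lemma nc_nat n : nc (n%:R : R[i]) = n%:R.
Proof.
have -> : (n%:R : R[i]) = (n%:R : R)%:C by rewrite rmorph_nat.
by rewrite nc_real ger0_norm.
Qed.

Lemma nc_int (m : int) : nc (m%:~R : R[i]) = `|m|%:~R.
Proof.
have -> : (m%:~R : R[i]) = (m%:~R : R)%:C by rewrite rmorph_int.
by rewrite nc_real intr_norm.
Qed.

Lemma nc_eq0 z : (nc z == 0) = (z == 0).
Proof. by apply/eqP/eqP => [/Normc.eq0_normc|->]; rewrite ?nc0. Qed.

Lemma nc_gt0 z : (0 < nc z) = (z != 0).
Proof. by rewrite lt_neqAle nc_ge0 andbT eq_sym nc_eq0. Qed.

Lemma nc_re z : `|re z| <= nc z.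
Proof.
rewrite nc_sqrtE -sqrtr_sqr ler_sqrt ?lerDl ?sqr_ge0//.
by rewrite addr_ge0 ?sqr_ge0.
Qed.

Lemma nc_im z : `|im z| <= nc z.
Proof.
rewrite nc_sqrtE -sqrtr_sqr ler_sqrt ?lerDr ?sqr_ge0//.
by rewrite addr_ge0 ?sqr_ge0.
Qed.

Lemma nc_le_reim z : nc z <= `|re z| + `|im z|.
Proof.
have p : 0 <= `|re z| + `|im z| by rewrite addr_ge0.
rewrite -(ler_pXn2r (n := 2)) ?nnegrE ?nc_ge0// nc_sqr sqrrD !real_normK ?num_real//.
by rewrite lerD2r lerDl mulrn_wge0// mulr_ge0.
Qed.

Lemma nc_sum (I : Type) (s : seq I) (P : pred I) (F : I -> R[i]) :
  nc (\sum_(i <- s | P i) F i) <= \sum_(i <- s | P i) nc (F i).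
Proof.
elim/big_ind2: _ => [|a b c d ab cd|//]; first by rewrite nc0.
exact: le_trans (ncD _ _) (lerD ab cd).
Qed.

Lemma ncBl x y : nc x - nc y <= nc (x - y).
Proof. by rewrite lerBlDr (le_trans _ (ncD _ _))// subrK. Qed.

Lemma archi_nat (r : R) : exists N, forall n, (N <= n)%N -> r < n%:R.
Proof.
exists (Num.Def.trunc r).+1 => n hn; apply: lt_le_trans (truncnS_gt r) _.
by rewrite ler_nat.
Qed.

Lemma complexP x y : re x = re y -> im x = im y -> x = y.
Proof. by case: x => a b; case: y => c d /= -> ->. Qed.

Lemma reD x y : re (x + y) = re x + re y. Proof. by case: x; case: y. Qed.
Lemma imD x y : im (x + y) = im x + im y. Proof. by case: x; case: y. Qed.
Lemma reN x : re (- x) = - re x. Proof. by case: x. Qed.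
Lemma imN x : im (- x) = - im x. Proof. by case: x. Qed.
Lemma reM x y : re (x * y) = re x * re y - im x * im y.
Proof. by case: x; case: y. Qed.
Lemma imM x y : im (x * y) = re x * im y + im x * re y.
Proof. by case: x; case: y. Qed.
Lemma re_conj x : re x^*%C = re x. Proof. by case: x. Qed.
Lemma im_conj x : im x^*%C = - im x. Proof. by case: x. Qed.
Lemma mul_conj z : z * z^*%C = (nc z ^+ 2)%:C.
Proof.
by apply: complexP; rewrite ?reM ?imM re_conj im_conj /= ?nc_sqr; ring.
Qed.

Lemma ball_nc z (e : R) x : ball z e%:C x = (nc (z - x) < e).
Proof. by rewrite propeqE /ball /= /ball_ /= normcE' ltcR. Qed.

Lemma nbhs_nc z (A : set R[i]) :
  nbhs z A <-> exists2 e : R, 0 < e & forall x, nc (z - x) < e -> A x.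
Proof.
split=> [/nbhs_ballP[e e0 eA]|[e e0 eA]].
  (* Positivity in the order of [R[i]] forces a vanishing imaginary part, so that the radius is
     real. *)
  have er : e = (re e)%:C by case: e e0 {eA} => a b /=; rewrite ltcE /= => /andP[/eqP ->].
  exists (re e); first by move: e0; rewrite /= ltcE => /andP[].
  by move=> x xe; apply: eA; rewrite er ball_nc.
apply/nbhs_ballP; exists e%:C; first by rewrite /= ltcE /= eqxx.
by move=> x; rewrite ball_nc; exact: eA.
Qed.

Lemma open_nc (A : set R[i]) : open A <->
  forall z, A z -> exists2 e : R, 0 < e & forall x, nc (z - x) < e -> A x.
Proof.
rewrite openE; split=> h z Az; first by apply/nbhs_nc; exact: h.
by apply/nbhs_nc; exact: h.
Qed.

Lemma cvgn_nc (u : nat -> R[i]) l :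
  (forall e : R, 0 < e -> exists N, forall n, (N <= n)%N -> nc (u n - l) < e) ->
  u @ \oo --> l.
Proof.
move=> h A /nbhs_nc[e e0 eA]; have [N hN] := h e e0.
by exists N => // n /hN; rewrite ncBC; exact: eA.
Qed.

Lemma lim_nc (u : nat -> R[i]) l :
  (forall e : R, 0 < e -> exists N, forall n, (N <= n)%N -> nc (u n - l) < e) ->
  lim (u @ \oo) = l.
Proof. by move=> h; apply/cvg_lim; [exact: norm_hausdorff|exact: cvgn_nc]. Qed.

End Modulus.

(** * Derivatives of complex-valued functions of a real variable *)

Section Derivative.
Context {R : realType}.
Implicit Types (f g : R -> R[i]) (a b l : R[i]) (t : R).

Lemma is_deriveP (g : R -> R) (d t : R) : is_derive t (1 : R) g d <->
  forall e, 0 < e -> exists2 del, 0 < del &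
    forall s, `|s| < del -> `|g (t + s) - g t - d * s| <= e * `|s|.
Proof.
split=> [gd e e0|h].
  have [dg gv] := gd.
  have : (fun h => h^-1 *: (g (h *: (1 : R) + t) - g t)) @ 0^' --> d.
    by rewrite -gv.
  move=> /cvgrPdist_le /(_ e e0) /nbhs_ballP[del /= del0 hd].
  exists del => // s sd; have [->|s0] := eqVneq s 0.
    by rewrite addr0 subrr mulr0 subr0 normr0 mulr0.
  have := hd s; rewrite /ball /= sub0r normrN => /(_ sd s0).
  rewrite /GRing.scale /= mulr1 (addrC s t) distrC => h.
  rewrite (_ : _ - _ - _ = (s^-1 * (g (t + s) - g t) - d) * s); last by field.
  by rewrite normrM ler_wpM2r.
have H : (fun h => h^-1 *: (g (h *: (1 : R) + t) - g t)) @ 0^' --> d.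
  apply/cvgrPdist_le => e e0; have [del del0 hd] := h e e0.
  apply/nbhs_ballP; exists del => //= s.
  rewrite /ball /= sub0r normrN => sd s0; have hs := hd s sd.
  rewrite /GRing.scale /= mulr1 (addrC s t) distrC; move: hs.
  have -> : g (t + s) - g t - d * s = (s^-1 * (g (t + s) - g t) - d) * s by field.
  by rewrite normrM ler_pM2r ?normr_gt0.
split; first by apply/cvg_ex; exists d.
by apply/cvg_lim; [exact: Rhausdorff|].
Qed.

(** Differentiability is imposed on both components, so that the rules for real derivatives apply;
    [cderP] recovers the estimate of the remainder in modulus. *)
Definition cder f l t :=
  is_derive t (1 : R) (fun x => re (f x)) (re l) /\
  is_derive t (1 : R) (fun x => im (f x)) (im l).

Lemma cderP f l t : cder f l t <->
  forall e, 0 < e -> exists2 del, 0 < del &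
    forall s, `|s| < del -> nc (f (t + s) - f t - l * s%:C) <= e * `|s|.
Proof.
have reE s : re (f (t + s) - f t - l * s%:C) = re (f (t + s)) - re (f t) - re l * s.
  by rewrite !(reD,reN,reM) /= mulr0 subr0.
have imE s : im (f (t + s) - f t - l * s%:C) = im (f (t + s)) - im (f t) - im l * s.
  by rewrite !(imD,imN,imM) /= mulr0 add0r.
split=> [[/is_deriveP hr /is_deriveP hi] e e0|h].
  have e2 : 0 < e / 2 by rewrite divr_gt0.
  have [d1 d10 h1] := hr _ e2; have [d2 d20 h2] := hi _ e2.
  exists (Num.min d1 d2); first by rewrite lt_min d10.
  move=> s; rewrite lt_min => /andP[s1 s2].
  apply: le_trans (nc_le_reim _) _; rewrite reE imE.
  by rewrite (splitr e) mulrDl lerD ?h1 ?h2.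
by split; apply/is_deriveP => e e0; have [d d0 hd] := h e e0; exists d => // s /hd;
  apply: le_trans; rewrite -?reE -?imE; [exact: nc_re|exact: nc_im].
Qed.

Lemma cder_ext f g l t : f =1 g -> cder f l t -> cder g l t.
Proof. by move=> /funext ->. Qed.

Lemma cder_eq f l l' t : cder f l t -> l = l' -> cder f l' t.
Proof. by move=> ? <-. Qed.

Lemma is_derive_ext (f g : R -> R) (d d' t : R) :
  is_derive t (1 : R) f d -> f =1 g -> d = d' -> is_derive t (1 : R) g d'.
Proof. by move=> ? /funext <- <-. Qed.

Lemma cder_cst a t : cder (fun=> a) 0 t.
Proof. by split; exact: is_derive_cst. Qed.

Lemma cderD f g a b t : cder f a t -> cder g b t -> cder (fun x => f x + g x) (a + b) t.
Proof.
move=> [f1 f2] [g1 g2]; split.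
  by apply: is_derive_ext (is_deriveD f1 g1) _ _ => [x|]; rewrite reD.
by apply: is_derive_ext (is_deriveD f2 g2) _ _ => [x|]; rewrite imD.
Qed.

Lemma cderN f a t : cder f a t -> cder (fun x => - f x) (- a) t.
Proof.
move=> [f1 f2]; split.
  by apply: is_derive_ext (is_deriveN f1) _ _ => [x|]; rewrite reN.
by apply: is_derive_ext (is_deriveN f2) _ _ => [x|]; rewrite imN.
Qed.

Lemma cderB f g a b t : cder f a t -> cder g b t -> cder (fun x => f x - g x) (a - b) t.
Proof. by move=> fa gb; exact: cderD fa (cderN gb). Qed.

Lemma cderM f g a b t : cder f a t -> cder g b t ->
  cder (fun x => f x * g x) (a * g t + f t * b) t.
Proof.
move=> [f1 f2] [g1 g2]; split.
  apply: is_derive_ext (is_deriveB (is_deriveM f1 g1) (is_deriveM f2 g2)) _ _ => [x|].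
    by rewrite reM.
  by rewrite !(reD,reM) /GRing.scale /=; ring.
apply: is_derive_ext (is_deriveD (is_deriveM f1 g2) (is_deriveM f2 g1)) _ _ => [x|].
  by rewrite imM.
by rewrite !(imD,imM) /GRing.scale /=; ring.
Qed.

Lemma cderZ c f a t : cder f a t -> cder (fun x => c * f x) (c * a) t.
Proof.
by move=> fa; apply: cder_eq (cderM (cder_cst c t) fa) _; rewrite mul0r add0r.
Qed.

Lemma cderX f a t n : cder f a t ->
  cder (fun x => f x ^+ n) (n%:R * a * f t ^+ n.-1) t.
Proof.
move=> fa; elim: n => [|n IH].
  by rewrite !mul0r; apply: cder_ext (cder_cst 1 t) => x; rewrite expr0.
apply: cder_eq; first by apply: cder_ext (cderM fa IH) => x; rewrite exprS.
case: n {IH} => [|n] /=; first by rewrite !expr0; ring.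
by rewrite exprS -[n.+2%:R]natr1; ring.
Qed.

Lemma cder_real (g : R -> R) d t : is_derive t (1 : R) g d ->
  cder (fun x => (g x)%:C) d%:C t.
Proof. by move=> gd; split => //=; exact: is_derive_cst. Qed.

Lemma cder_shift f a t c : cder f a (t + c) -> cder (fun x => f (x + c)) a t.
Proof.
move=> /cderP h; apply/cderP => e e0; have [d d0 hd] := h e e0.
by exists d => // s /hd; rewrite (addrAC t).
Qed.

Lemma cder_opp f a t : cder f a (- t) -> cder (fun x => f (- x)) (- a) t.
Proof.
move=> /cderP h; apply/cderP => e e0; have [d d0 hd] := h e e0.
exists d => // s sd; have := hd (- s).
by rewrite normrN rmorphN mulrN mulNr opprD; apply.
Qed.

Lemma is_derive_cont (g : R -> R) d t : is_derive t (1 : R) g d -> {for t, continuous g}.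
Proof.
by move=> [dg _]; apply/differentiable_continuous; rewrite -derivable1_diffP.
Qed.

Lemma le_derive (g h : R -> R) (dg dh : R -> R) (x y : R) : x <= y ->
  (forall t, x <= t <= y -> is_derive t (1 : R) g (dg t)) ->
  (forall t, x <= t <= y -> is_derive t (1 : R) h (dh t)) ->
  (forall t, x <= t <= y -> dg t <= dh t) ->
  g y - g x <= h y - h x.
Proof.
move=> xy hg hh hle.
have H t : x <= t <= y -> is_derive t (1 : R) (h - g) (dh t - dg t).
  by move=> tt; apply: is_deriveB; [exact: hh|exact: hg].
have [||c cxy] := @MVT_segment R (h - g) (fun t => dh t - dg t) x y xy.
- move=> t; rewrite in_itv /= => /andP[/ltW a /ltW b].
  by apply: H; rewrite a b.
- apply: derivable_within_continuous => t; rewrite in_itv /= => tt.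
  by have [] := H t tt.
- rewrite !fctE => E; have : 0 <= (dh c - dg c) * (y - x).
    rewrite mulr_ge0 ?subr_ge0//; apply: hle.
    by move: cxy; rewrite in_itv.
  by rewrite -E; lra.
Qed.

(** A mean value inequality with a majorant of the derivative. The factor 2 comes from treating real
    and imaginary parts separately. *)
Lemma cder_dom f (f' : R -> R[i]) (g g' : R -> R) (x y : R) : x <= y ->
  (forall t, x <= t <= y -> cder f (f' t) t) ->
  (forall t, x <= t <= y -> is_derive t (1 : R) g (g' t)) ->
  (forall t, x <= t <= y -> nc (f' t) <= g' t) ->
  nc (f y - f x) <= 2 * (g y - g x).
Proof.
move=> xy hf hg hb; apply: le_trans (nc_le_reim _) _.
have key (h h' : R -> R) : (forall t, x <= t <= y -> is_derive t (1 : R) h (h' t)) ->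
    (forall t, x <= t <= y -> `|h' t| <= g' t) -> `|h y - h x| <= g y - g x.
  move=> hh hb'; rewrite ler_norml; apply/andP; split; last first.
    apply: (le_derive xy hh hg) => t tt.
    by apply: le_trans (hb' t tt); rewrite ler_norm.
  rewrite lerNl opprB -opprB addrC.
  rewrite [leLHS](_ : _ = (- h) y - (- h) x); last by rewrite !fctE; ring.
  apply: (le_derive xy (dg := fun t => - h' t) _ hg) => t tt.
    by apply: is_deriveN; exact: hh.
  by apply: le_trans (hb' t tt); rewrite lerNl lerNnormlW.
rewrite mulrDl mul1r !(reD,imD,reN,imN); apply: lerD.
  apply: (key (fun t => re (f t)) (fun t => re (f' t))) => t tt.
    by have [] := hf t tt.
  by apply: le_trans (hb t tt); exact: nc_re.
apply: (key (fun t => im (f t)) (fun t => im (f' t))) => t tt.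
  by have [] := hf t tt.
by apply: le_trans (hb t tt); exact: nc_im.
Qed.

Lemma cder_bound f (f' : R -> R[i]) (K x y : R) : x <= y ->
  (forall t, x <= t <= y -> cder f (f' t) t) ->
  (forall t, x <= t <= y -> nc (f' t) <= K) ->
  nc (f y - f x) <= 2 * K * (y - x).
Proof.
move=> xy hf hb.
have := @cder_dom f f' (fun t => K * t) (fun=> K) x y xy hf _ hb.
rewrite -mulrBr mulrA; apply => t _.
apply: is_derive_ext (is_deriveM (is_derive_cst K t (1 : R)) (is_derive_id t (1 : R))) _ _ => //=.
by rewrite /GRing.scale /= mulr0 addr0 mulr1.
Qed.

Lemma cder0_cst f (x y : R) : x <= y ->
  (forall t, x <= t <= y -> cder f 0 t) -> f y = f x.
Proof.
move=> xy hf; apply/eqP; rewrite -subr_eq0 -nc_eq0 eq_le nc_ge0 andbT.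
have := cder_bound (f' := fun=> 0) (K := 0) xy hf.
by rewrite mulr0 mul0r; apply => t _; rewrite nc0.
Qed.

End Derivative.

(** * Lattice sums *)
Section BoxSums.
Context {R : realType}.
Variable tau : R[i].
Implicit Types (z w : R[i]) (F : R[i] -> R[i]) (m n : int) (N : nat).

Definition lat m n : R[i] := m%:~R + n%:~R * tau.
Definition nonzero m n := (m != 0) || (n != 0).

Definition box_sum F N : R[i] :=
  \sum_(m <- zrange N) \sum_(n <- zrange N | nonzero m n) F (lat m n).

Lemma zrangeS (V : zmodType) (g : int -> V) N :
  \sum_(m <- zrange N.+1) g m =
  g (- (N.+1)%:Z) + \sum_(m <- zrange N) g m + g (N.+1)%:Z.
Proof.
rewrite /zrange !big_map doubleS.
have E k : iota 0 k = index_iota 0 k by rewrite /index_iota subn0.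
rewrite !E big_nat_recl// big_nat_recr//= sub0r addrA; congr (_ + _ + g _).
  by apply: eq_bigr => i _; congr g; lia.
by lia.
Qed.

Lemma zrange0 (V : zmodType) (g : int -> V) : \sum_(m <- zrange 0) g m = g 0.
Proof. by rewrite /zrange /= big_seq1. Qed.

Lemma zrange_opp (V : zmodType) (g : int -> V) N :
  \sum_(m <- zrange N) g (- m) = \sum_(m <- zrange N) g m.
Proof.
elim: N => [|N IH]; first by rewrite !zrange0 oppr0.
by rewrite !zrangeS IH opprK addrAC (addrC (g (N.+1)%:Z)) addrAC.
Qed.

Lemma zrange_telescope (g : int -> R[i]) N :
  \sum_(m <- zrange N) g (m - 1) - \sum_(m <- zrange N) g m = g (- (N.+1)%:Z) - g N%:Z.
Proof.
elim: N => [|N IH]; first by rewrite !zrange0 sub0r.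
rewrite !zrangeS.
have -> : - (N.+1)%:Z - 1 = - (N.+2)%:Z by lia.
have -> : (N.+1)%:Z - 1 = N%:Z by lia.
rewrite -(subrK (\sum_(m <- zrange N) g m) (\sum_(m <- zrange N) g (m - 1))) IH.
ring.
Qed.

Lemma mem_zrange N m : (m \in zrange N) = (`|m| <= N%:Z).
Proof.
apply/mapP/idP => [[j]|mN].
  by rewrite mem_iota => + ->; lia.
by exists (absz (m + N%:Z)); rewrite ?mem_iota; lia.
Qed.

Lemma zrange_le (g : int -> R) (B : R) N : (forall m, `|m| <= N%:Z -> g m <= B) ->
  \sum_(m <- zrange N) g m <= (N.*2.+1)%:R * B.
Proof.
move=> gB; apply: le_trans (_ : \sum_(m <- zrange N) B <= _).
  rewrite !big_seq; apply: ler_sum => m; rewrite mem_zrange; exact: gB.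
by rewrite big_const_seq count_predT size_map size_iota iter_addr_0 mulr_natl.
Qed.

(** For a real sequence, 1 / (n + 1)^2 <= 2 / (n + 1) - 2 / (n + 2) makes [r n - 2 * B / (n + 1)]
    nondecreasing and [r n + 2 * B / (n + 1)] nonincreasing; the supremum of the former is the
    limit. The two components together give the factor 4. *)
Lemma quadratic_limit (v : nat -> R[i]) (B : R) :
  (forall n : nat, nc (v n.+1 - v n) <= B / n.+1%:R ^+ 2) ->
  exists L, forall n : nat, nc (v n - L) <= 4 * B / n.+1%:R.
Proof.
move=> hv; have B0 : 0 <= B.
  by have := le_trans (nc_ge0 _) (hv 0%N); rewrite expr1n divr1.
have key (r : nat -> R) : (forall n : nat, `|r n.+1 - r n| <= B / n.+1%:R ^+ 2) ->
    exists L, forall n : nat, `|r n - L| <= 2 * B / n.+1%:R.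
  move=> hr.
  pose a (n : nat) := r n - 2 * B / n.+1%:R; pose b (n : nat) := r n + 2 * B / n.+1%:R.
  have step (n : nat) : `|r n.+1 - r n| <= 2 * B / n.+1%:R - 2 * B / n.+2%:R.
    apply: le_trans (hr n) _.
    have n1 : (0 : R) < n.+1%:R by [].
    have n2 : (n.+2%:R : R) = n.+1%:R + 1 by rewrite -natr1.
    rewrite n2 -subr_ge0.
    have -> : 2 * B / n.+1%:R - 2 * B / (n.+1%:R + 1) - B / n.+1%:R ^+ 2 =
        B * (n.+1%:R - 1) / (n.+1%:R ^+ 2 * (n.+1%:R + 1)).
      field; rewrite gt_eqF// ?gt_eqF// ?addr_gt0//.
    have n3 : (0 : R) <= n.+1%:R - 1 by rewrite subr_ge0 ler1n.
    apply: divr_ge0; first exact: mulr_ge0.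
    by apply: mulr_ge0; [exact: exprn_ge0|exact: addr_ge0].
  have aS (n : nat) : a n <= a n.+1.
    have := step n; rewrite /a ler_norml => /andP[+ _].
    by move: (2 * B / _) (2 * B / _) => x y; lra.
  have bS (n : nat) : b n.+1 <= b n.
    have := step n; rewrite /b ler_norml => /andP[_ +].
    by move: (2 * B / _) (2 * B / _) => x y; lra.
  have ab (n : nat) : a n <= b n.
    by rewrite /a /b lerD2l ge0_cp// divr_ge0// mulr_ge0.
  have ah : {homo a : i j / (i <= j)%N >-> i <= j}.
    by apply: homo_leq => //; exact: le_trans.
  have bh : {homo b : i j / (i <= j)%N >-> j <= i}.
    by apply: homo_leq => // x y z; exact: ge_trans.
  have aub i j : a i <= b j.
    have := ah _ _ (leq_maxl i j); have := bh _ _ (leq_maxr i j).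
    by have := ab (maxn i j); lra.
  exists (sup (range a)) => n; rewrite ler_distl.
  have na : range a !=set0 by exists (a 0%N), 0%N.
  have h1 : a n <= sup (range a).
    by apply: ub_le_sup; [exists (b 0%N) => _ [j _ <-]|exists n].
  have h2 : sup (range a) <= b n by apply: ge_sup => // _ [j _ <-].
  by move: h1 h2; rewrite /a /b; move: (2 * B / _) => x; lra.
have [L1 h1] : exists L, forall n : nat, `|re (v n) - L| <= 2 * B / n.+1%:R.
  by apply: key => n; apply: le_trans (hv n); rewrite -reN -reD nc_re.
have [L2 h2] : exists L, forall n : nat, `|im (v n) - L| <= 2 * B / n.+1%:R.
  by apply: key => n; apply: le_trans (hv n); rewrite -imN -imD nc_im.
exists (L1 +i* L2) => n; apply: le_trans (nc_le_reim _) _.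
rewrite !(reD,imD,reN,imN) /=; have := h1 n; have := h2 n.
have -> : 4 * B / n.+1%:R = 2 * B / n.+1%:R + 2 * B / n.+1%:R by field.
by move: (2 * B / _) => x; lra.
Qed.

End BoxSums.

Section LatticeSums.
Context {R : realType}.
Variable tau : R[i].
Hypothesis tau_gt0 : 0 < im tau.
Implicit Types (z w v : R[i]) (F G : R[i] -> R[i]) (m n : int) (N : nat).

Local Notation lat := (lat tau).

Lemma latN m n : - lat m n = lat (- m) (- n).
Proof. by rewrite /lat !rmorphN /=; ring. Qed.

(** The imaginary part of a lattice point is [n * im tau], which bounds [n]; then [m] is bounded
    through [m = lat m n - n * tau]. *)
Lemma lat_lower : exists2 c : R, 0 < c & forall m n,
  c * `|m|%:~R <= nc (lat m n) /\ c * `|n|%:~R <= nc (lat m n).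
Proof.
pose b := im tau; pose t := nc tau.
have t0 : 0 <= t by exact: nc_ge0.
have k0 : 0 < 1 + t / b by rewrite ltr_wpDr// divr_ge0// ltW.
exists (Num.min b (1 + t / b)^-1); first by rewrite lt_min tau_gt0 invr_gt0.
move=> m n; have hn : b * `|n|%:~R <= nc (lat m n).
  apply: le_trans (nc_im _).
  have -> : im (lat m n) = b * n%:~R.
    rewrite /lat imD imM.
    have -> : (m%:~R : R[i]) = (m%:~R : R)%:C by rewrite rmorph_int.
    have -> : (n%:~R : R[i]) = (n%:~R : R)%:C by rewrite rmorph_int.
    by rewrite /= mul0r addr0 add0r mulrC.
  by rewrite normrM (gtr0_norm tau_gt0) intr_norm.
have hm : `|m|%:~R <= nc (lat m n) * (1 + t / b).
  have -> : `|m|%:~R = nc (lat m n - n%:~R * tau) :> R by rewrite /lat addrK nc_int.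
  apply: le_trans (ncB _ _) _; rewrite mulrDr mulr1 lerD2l ncM nc_int.
  rewrite -/t (mulrC t) mulrA ler_wpM2r//.
  by rewrite ler_pdivlMr// mulrC.
split.
  apply: le_trans (_ : (1 + t / b)^-1 * `|m|%:~R <= _).
    by rewrite ler_wpM2r ?ler0z// ge_min lexx orbT.
  by rewrite mulrC ler_pdivrMr.
apply: le_trans hn; by rewrite ler_wpM2r ?ler0z// ge_min lexx.
Qed.

Definition lat_const : R := projT1 (cid2 lat_lower).
Local Notation c := lat_const.

Lemma lat_const_gt0 : 0 < c.
Proof. by rewrite /c; case: cid2. Qed.

Lemma lat_ge m n : c * `|m|%:~R <= nc (lat m n) /\ c * `|n|%:~R <= nc (lat m n).
Proof. by rewrite /c; case: cid2 => /= ? _; apply. Qed.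

Lemma lat_ge_const m n : nonzero m n -> c <= nc (lat m n).
Proof.
have [h1 h2] := lat_ge m n => /orP[m0|n0].
  by apply: le_trans h1; rewrite ler_peMr ?(ltW lat_const_gt0)// -[1]/(1%:~R) ler_int; lia.
by apply: le_trans h2; rewrite ler_peMr ?(ltW lat_const_gt0)// -[1]/(1%:~R) ler_int; lia.
Qed.

Lemma lat_neq0 m n : nonzero m n -> lat m n != 0.
Proof. by move=> /lat_ge_const h; rewrite -nc_gt0 (lt_le_trans lat_const_gt0). Qed.

(** Cubic decay on the nonzero lattice points makes the N-th square shell contribute O(N^-2), so
    that the box sums converge with rate O(1 / N). *)
Definition decays (A : R) F := forall m n, nonzero m n ->
  nc (F (lat m n)) * nc (lat m n) ^+ 3 <= A.

Lemma decays_ge0 A F : decays A F -> 0 <= A.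
Proof.
move=> /(_ 1 1 isT) h; apply: le_trans h.
by rewrite mulr_ge0 ?exprn_ge0 ?nc_ge0.
Qed.

(** The shell between consecutive boxes has exactly 8 (N + 1) points, each of modulus at least
    [c * (N + 1)]. The two full rows contain the corners, so the columns range over [zrange N]
    only. *)
Lemma box_sumS F A N : decays A F ->
  nc (box_sum tau F N.+1 - box_sum tau F N) <= (8 * A / c ^+ 3) / N.+1%:R ^+ 2.
Proof.
move=> hF; have c0 := lat_const_gt0.
pose G m n := if nonzero m n then F (lat m n) else 0.
have bE M : box_sum tau F M = \sum_(m <- zrange M) \sum_(n <- zrange M) G m n.
  by rewrite /box_sum; apply: eq_bigr => m _; rewrite big_mkcond.
pose B := A / c ^+ 3 / N.+1%:R ^+ 3.
have hG m n : (`|m| == (N.+1)%:Z) || (`|n| == (N.+1)%:Z) -> nc (G m n) <= B.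
  move=> mn; rewrite /G; have nz : nonzero m n by rewrite /nonzero; lia.
  rewrite nz /B -mulrA -invfM -exprMn ler_pdivlMr; last by rewrite exprn_gt0// mulr_gt0.
  apply: le_trans (hF _ _ nz); rewrite ler_wpM2l ?nc_ge0// lerXn2r ?nnegrE ?nc_ge0//.
    by rewrite mulr_ge0// ltW.
  have [h1 h2] := lat_ge m n.
  by case/orP: mn => /eqP E; [move: h1|move: h2]; rewrite E.
have rows m : (`|m| == (N.+1)%:Z) -> nc (\sum_(n <- zrange N.+1) G m n) <= (N.+1.*2.+1)%:R * B.
  move=> hm; apply: le_trans (nc_sum _ _ _) _; apply: zrange_le => n _.
  by apply: hG; rewrite hm.
have cols n : (`|n| == (N.+1)%:Z) -> nc (\sum_(m <- zrange N) G m n) <= (N.*2.+1)%:R * B.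
  move=> hn; apply: le_trans (nc_sum _ _ _) _; apply: zrange_le => m _.
  by apply: hG; rewrite hn orbT.
have mid : \sum_(m <- zrange N) \sum_(n <- zrange N.+1) G m n =
    \sum_(m <- zrange N) G m (- (N.+1)%:Z) + \sum_(m <- zrange N) \sum_(n <- zrange N) G m n
    + \sum_(m <- zrange N) G m (N.+1)%:Z.
  by rewrite -!big_split; apply: eq_bigr => m _; exact: zrangeS.
rewrite !bE zrangeS mid.
set r1 := \sum_(n <- _) G (- _) n; set r2 := \sum_(n <- _) G (Posz _) n.
set c1 := \sum_(m <- zrange N) G m (- _); set c2 := \sum_(m <- zrange N) G m (Posz _).
set S := \sum_(m <- _) \sum_(n <- _) _.
have -> : r1 + (c1 + S + c2) + r2 - S = (r1 + r2) + (c1 + c2) by ring.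
have N1 : `|- (N.+1)%:Z| == (N.+1)%:Z by lia.
have N2 : `|(N.+1)%:Z| == (N.+1)%:Z by lia.
apply: le_trans (ncD _ _) _; apply: le_trans (lerD (ncD _ _) (ncD _ _)) _.
apply: le_trans (lerD (lerD (rows _ N1) (rows _ N2)) (lerD (cols _ N1) (cols _ N2))) _.
rewrite -!mulrDl -!natrD.
have -> : 8 * A / c ^+ 3 / N.+1%:R ^+ 2 = (8 * N.+1%:R) * B.
  have n1 : (N.+1%:R : R) != 0 by rewrite pnatr_eq0.
  by rewrite /B; move: (N.+1%:R) n1 => x x0; field; rewrite x0 gt_eqF.
rewrite -natrM; have -> : (N.+1.*2.+1 + N.+1.*2.+1 + (N.*2.+1 + N.*2.+1) = 8 * N.+1)%N by lia.
by [].
Qed.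

Lemma box_sum0 F : box_sum tau F 0 = 0.
Proof. by rewrite /box_sum zrange0 /zrange /= big_cons big_nil. Qed.

Lemma lattice_sum_rate F A : decays A F ->
  forall N, nc (box_sum tau F N - lattice_sum tau F) <= (32 * A / c ^+ 3) / N.+1%:R.
Proof.
move=> hF; have [L hL] := quadratic_limit (fun N => box_sumS N hF).
suff -> : lattice_sum tau F = L.
  by move=> N; apply: le_trans (hL N) _; rewrite !mulrA -natrM.
apply: lim_nc => e e0.
set K := 4 * _ in hL; have K0 : 0 <= K.
  rewrite /K mulr_ge0// divr_ge0 ?mulr_ge0 ?exprn_ge0 ?(decays_ge0 hF)//;
    exact: ltW lat_const_gt0.
have [N hN] := archi_nat (K / e); exists N => n hn; apply: le_lt_trans (hL n) _.
rewrite ltr_pdivrMr// mulrC -ltr_pdivrMr//; apply: lt_trans (hN n hn) _.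
by rewrite ltr_nat.
Qed.

Lemma box_sum_cvg F A (e : R) : decays A F -> 0 < e ->
  exists N : nat, forall n : nat, (N <= n)%N -> nc (box_sum tau F n - lattice_sum tau F) < e.
Proof.
move=> hF e0; set K := 32 * A / c ^+ 3; have K0 : 0 <= K.
  rewrite /K divr_ge0 ?mulr_ge0 ?exprn_ge0 ?(decays_ge0 hF)//;
    exact: ltW lat_const_gt0.
have [N hN] := archi_nat (K / e); exists N => n hn.
apply: le_lt_trans (lattice_sum_rate hF n) _.
rewrite -/K ltr_pdivrMr// mulrC -ltr_pdivrMr//; apply: lt_trans (hN n hn) _.
by rewrite ltr_nat.
Qed.

Lemma lattice_sum_unique F A L : decays A F ->
  (forall e : R, 0 < e -> exists N : nat, forall n : nat, (N <= n)%N -> nc (box_sum tau F n - L) < e) ->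
  lattice_sum tau F = L.
Proof. by move=> hF hL; exact: lim_nc. Qed.

Definition sum_const : R := 32 / c ^+ 3.

(** This is the rate of convergence at [N = 0], where the box sum is empty. *)
Lemma lattice_sum_le F A : decays A F -> nc (lattice_sum tau F) <= sum_const * A.
Proof.
move=> hF; have := lattice_sum_rate hF 0; rewrite box_sum0 sub0r ncN divr1.
by rewrite mulrAC.
Qed.

Lemma decaysD A B F G : decays A F -> decays B G -> decays (A + B) (fun w => F w + G w).
Proof.
move=> hF hG m n mn; apply: le_trans (lerD (hF m n mn) (hG m n mn)).
by rewrite -mulrDl ler_wpM2r ?ncD// exprn_ge0 ?nc_ge0.
Qed.

Lemma decaysZ A a F : decays A F -> decays (nc a * A) (fun w => a * F w).
Proof.
by move=> hF m n mn; rewrite ncM -mulrA ler_wpM2l ?nc_ge0//; exact: hF.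
Qed.

Lemma lattice_sumD A B F G : decays A F -> decays B G ->
  lattice_sum tau (fun w => F w + G w) = lattice_sum tau F + lattice_sum tau G.
Proof.
move=> hF hG; apply: (lattice_sum_unique (decaysD hF hG)) => e e0.
have e2 : 0 < e / 2 by rewrite divr_gt0.
have [N1 h1] := box_sum_cvg hF e2; have [N2 h2] := box_sum_cvg hG e2.
exists (maxn N1 N2) => n; rewrite geq_max => /andP[n1 n2].
have -> : box_sum tau (fun w => F w + G w) n = box_sum tau F n + box_sum tau G n.
  by rewrite /box_sum -big_split; apply: eq_bigr => m _; rewrite -big_split.
rewrite opprD addrACA; apply: le_lt_trans (ncD _ _) _.
by rewrite (splitr e) ltrD ?h1 ?h2.
Qed.

Lemma lattice_sumZ A a F : decays A F ->
  lattice_sum tau (fun w => a * F w) = a * lattice_sum tau F.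
Proof.
move=> hF; apply: (lattice_sum_unique (decaysZ a hF)) => e e0.
have k0 : 0 < nc a + 1 by rewrite ltr_wpDl// nc_ge0.
have e2 : 0 < e / (nc a + 1) by rewrite divr_gt0.
have [N h] := box_sum_cvg hF e2.
exists N => n /h hn.
have -> : box_sum tau (fun w => a * F w) n = a * box_sum tau F n.
  by rewrite /box_sum mulr_sumr; apply: eq_bigr => m _; rewrite mulr_sumr.
rewrite -mulrBr ncM; apply: le_lt_trans (_ : (nc a + 1) * nc (box_sum tau F n - lattice_sum tau F) < _).
  by rewrite ler_wpM2r ?nc_ge0// lerDl.
by rewrite mulrC -ltr_pdivlMr.
Qed.

Lemma lattice_sumB A B F G : decays A F -> decays B G ->
  lattice_sum tau (fun w => F w - G w) = lattice_sum tau F - lattice_sum tau G.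
Proof.
move=> hF hG; have := lattice_sumD hF (decaysZ (-1) hG).
rewrite (lattice_sumZ (-1) hG) mulN1r => <-; congr lattice_sum.
by apply/funext => w; rewrite mulN1r.
Qed.

Lemma decaysB A B F G : decays A F -> decays B G -> decays (A + B) (fun w => F w - G w).
Proof.
move=> hF hG; have := decaysD hF (decaysZ (-1) hG).
rewrite ncN nc1 mul1r => h m n mn; have := h m n mn.
by rewrite mulN1r.
Qed.

Lemma decays_opp A F : decays A F -> decays A (fun w => F (- w)).
Proof.
move=> hF m n mn; rewrite latN -[nc (lat m n)]ncN latN; apply: hF.
by move: mn; rewrite /nonzero !oppr_eq0.
Qed.

Lemma lattice_sum_opp F : lattice_sum tau (fun w => F (- w)) = lattice_sum tau F.
Proof.
congr (lim (_ @ \oo)); apply/funext => N.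
rewrite -(zrange_opp _ N); apply: eq_bigr => m _; rewrite big_mkcond [RHS]big_mkcond.
rewrite -(zrange_opp _ N); apply: eq_bigr => n _; rewrite !oppr_eq0.
by rewrite -[_ + _ * tau]/(lat (- m) (- n)) latN !opprK.
Qed.

(* The two box sums differ by O(N) boundary terms of size O(N^-2). *)
Lemma box_shift G (A M : R) v : v = 1 \/ v = tau ->
  (forall m n, M <= nc (lat m n) -> nc (G (lat m n)) * nc (lat m n) ^+ 2 <= A) ->
  forall e : R, 0 < e -> exists N0, forall N, (N0 <= N)%N ->
  nc (\sum_(m <- zrange N) \sum_(n <- zrange N) G (lat m n - v) -
      \sum_(m <- zrange N) \sum_(n <- zrange N) G (lat m n)) < e.
Proof.
move=> hv hG e e0; have c0 := lat_const_gt0.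
pose A' := Num.max A 0; have A'0 : 0 <= A' by rewrite le_max lexx orbT.
have bnd N m n : (0 < N)%N -> M <= c * N%:R ->
    (N%:Z <= `|m|) || (N%:Z <= `|n|) -> nc (G (lat m n)) <= A' / (c * N%:R) ^+ 2.
  move=> N0 MN mn.
  have cN : 0 < c * N%:R by rewrite mulr_gt0// ltr0n.
  have wN : c * N%:R <= nc (lat m n).
    have [h1 h2] := lat_ge m n.
    case/orP: mn => E; [apply: le_trans h1|apply: le_trans h2];
      by rewrite ler_pM2l// -[N%:R]/(N%:Z%:~R) ler_int.
  rewrite ler_pdivlMr ?exprn_gt0//.
  apply: le_trans (_ : nc (G (lat m n)) * nc (lat m n) ^+ 2 <= _).
    by rewrite ler_wpM2l ?nc_ge0// lerXn2r ?nnegrE ?nc_ge0// ltW.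
  by rewrite le_max hG// (le_trans MN).
pose K := 6 * A' / c ^+ 2.
have [N1 hN1] := archi_nat (K / e); have [N2 hN2] := archi_nat (M / c).
exists (maxn (maxn N1 N2) 1) => N.
rewrite !geq_max => /andP[/andP[h1 h2] N0].
have MN : M <= c * N%:R.
  by rewrite mulrC -ler_pdivrMr// ltW// hN2.
have KN : K / N%:R < e.
  by rewrite ltr_pdivrMr ?ltr0n// mulrC -ltr_pdivrMr// hN1.
apply: le_lt_trans KN.
have fin (g : int -> R[i]) : (forall n, nc (g n) <= A' / (c * N%:R) ^+ 2 * 2) ->
    nc (\sum_(n <- zrange N) g n) <= K / N%:R.
  move=> hg; apply: le_trans (nc_sum _ _ _) _.
  apply: le_trans (zrange_le (B := A' / (c * N%:R) ^+ 2 * 2) (fun n _ => hg n)) _.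
  have -> : K / N%:R = (3 * N%:R) * (A' / (c * N%:R) ^+ 2 * 2).
    have n1 : (N%:R : R) != 0 by rewrite pnatr_eq0 -lt0n.
    by rewrite /K; move: (N%:R) n1 => x x0; field; rewrite x0 gt_eqF.
  rewrite ler_wpM2r ?mulr_ge0 ?invr_ge0 ?exprn_ge0 ?mulr_ge0//; first exact: ltW.
  by rewrite -natrM ler_nat; lia.
have two x y : nc x <= A' / (c * N%:R) ^+ 2 -> nc y <= A' / (c * N%:R) ^+ 2 ->
    nc (x - y) <= A' / (c * N%:R) ^+ 2 * 2.
  by move=> hx hy; apply: le_trans (ncB _ _) _; rewrite mulr_natr mulr2n lerD.
case: hv => ->.
  (* For the period 1 the sum over [m] has to be innermost; there the difference telescopes to two
     end terms. *)
  rewrite exchange_big [X in _ - X]exchange_big -sumrB; apply: fin => n.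
  have E m : lat m n - 1 = lat (m - 1) n by rewrite /lat rmorphB /=; ring.
  under eq_bigr do rewrite E.
  rewrite (zrange_telescope (fun m => G (lat m n))).
  by apply: two; apply: bnd => //; lia.
rewrite -sumrB; apply: fin => m.
have E n : lat m n - tau = lat m (n - 1) by rewrite /lat rmorphB /=; ring.
under eq_bigr do rewrite E.
rewrite (zrange_telescope (fun n => G (lat m n))).
by apply: two; apply: bnd => //; lia.
Qed.

End LatticeSums.

(** Holomorphy as a second-order estimate, uniform in the base point [x] near [z]. It passes to
    lattice sums term by term, is stable under products, bounds the derivative locally and leads
    directly to the mean value property. *)
Definition hol {R : realType} (D : set R[i]) (F F' : R[i] -> R[i]) :=
  forall z, D z -> exists C del : R, 0 < del /\
    forall x h, nc (x - z) < del -> nc h < del ->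
      nc (F (x + h) - F x - F' x * h) <= C * nc h ^+ 2.

(** * Eisenstein series and their differentiation term by term *)

Section EisensteinSeries.
Context {R : realType}.
Variable tau : R[i].
Hypothesis tau_gt0 : 0 < im tau.
Implicit Types (z w v h p : R[i]) (F G : R[i] -> R[i]) (m n : int) (N k : nat).

Local Notation lat := (lat tau).
Local Notation c := (lat_const tau_gt0).
Local Notation decays := (decays tau).
Local Notation K := (sum_const tau_gt0).

(** The constant depends on [k] only: for [p = x - w] the remainders decay like |w|^-(k+2) and can
    be summed over the lattice. *)
Lemma inv_power_remainder k : exists2 C : R, 0 <= C & forall p h,
  p != 0 -> 2 * nc h <= nc p ->
  nc ((p + h) ^- k - p ^- k + k%:R * h * p ^- k.+1) * nc p ^+ k.+2 <= C * nc h ^+ 2.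
Proof.
have base p h : p != 0 -> 2 * nc h <= nc p -> p + h != 0 /\ nc (p + h)^-1 <= 2 / nc p.
  move=> p0 hp; have a0 : 0 < nc p by rewrite nc_gt0.
  have hph : nc p / 2 <= nc (p + h).
    by have := ncBl p (- h); rewrite opprK ncN; lra.
  have ph0 : 0 < nc (p + h) by apply: lt_le_trans hph; rewrite divr_gt0.
  split; first by rewrite -nc_gt0.
  by rewrite ncV -[2 / _]invf_div lef_pV2 ?posrE ?divr_gt0.
elim: k => [|k [C C0 IH]].
  by exists 0 => // p h _ _; rewrite !expr0 !mul0r addr0 invr1 subrr nc0 !mul0r.
exists (C * 2 + 2 + k%:R * 2); first by rewrite !addr_ge0// mulr_ge0.
move=> p h p0 hp; have [ph0 hq] := base p h p0 hp.
have a0 : 0 < nc p by rewrite nc_gt0.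
have {}IH := IH p h p0 hp.
(* The remainder of order [k] is multiplied by [(p + h)^-1]; this factor is expanded to second order
   against [p ^- k] and to first order against the linear term. *)
have -> : (p + h) ^- k.+1 - p ^- k.+1 + k.+1%:R * h * p ^- k.+2 =
    ((p + h) ^- k - p ^- k + k%:R * h * p ^- k.+1) * (p + h)^-1 +
    p ^- k * (h ^+ 2 * p ^- 2 * (p + h)^-1) + k%:R * h * p ^- k.+1 * (h * p^-1 * (p + h)^-1).
  have pk0 : p ^+ k != 0 by rewrite expf_neq0.
  have phk0 : (p + h) ^+ k != 0 by rewrite expf_neq0.
  rewrite -[k.+1%:R]natr1 !exprS; move: (p ^+ k) ((p + h) ^+ k) pk0 phk0 => P Q P0 Q0.
  by field; rewrite P0 Q0 p0 ph0.
set a := nc p in a0 hq IH *; set b := nc h in IH *.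
set R1 := nc _ in IH.
have q0 : 0 <= nc (p + h)^-1 by exact: nc_ge0.
have b0 : 0 <= b by exact: nc_ge0.
apply: le_trans (_ : (R1 * (2 / a) + a ^- k * (b ^+ 2 * a ^- 2 * (2 / a)) +
   k%:R * b * a ^- k.+1 * (b * a^-1 * (2 / a))) * a ^+ k.+3 <= _).
  rewrite ler_wpM2r ?exprn_ge0 ?(ltW a0)//.
  apply: le_trans (ncD _ _) _; apply: lerD.
    apply: le_trans (ncD _ _) _; apply: lerD.
      by rewrite ncM ler_wpM2l ?nc_ge0.
    rewrite !(ncM, ncV, ncX) -/a -/b -ncV.
    by rewrite !ler_wpM2l ?mulr_ge0 ?invr_ge0 ?exprn_ge0 ?(ltW a0).
  rewrite !(ncM, ncV, ncX) nc_nat -/a -/b -ncV.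
  by rewrite !ler_wpM2l ?mulr_ge0 ?invr_ge0 ?exprn_ge0 ?(ltW a0).
have -> : (R1 * (2 / a) + a ^- k * (b ^+ 2 * a ^- 2 * (2 / a)) +
   k%:R * b * a ^- k.+1 * (b * a^-1 * (2 / a))) * a ^+ k.+3 =
   2 * (R1 * a ^+ k.+2) + 2 * b ^+ 2 + k%:R * 2 * b ^+ 2.
  have ak0 : a ^+ k != 0 by rewrite expf_neq0// gt_eqF.
  rewrite !exprS; move: (a ^+ k) ak0 => P P0.
  by field; rewrite P0 gt_eqF.
have -> : (C * 2 + 2 + k%:R * 2) * b ^+ 2 = 2 * (C * b ^+ 2) + 2 * b ^+ 2 + k%:R * 2 * b ^+ 2.
  by ring.
by rewrite !lerD2r ler_pM2l.
Qed.

Lemma inv_power_bound p (B : R) k : 0 < B -> B <= nc p -> nc (p ^- k) <= B ^- k.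
Proof.
move=> B0 Bp; rewrite ncV ncX lef_pV2 ?posrE ?exprn_gt0//; last exact: lt_le_trans Bp.
by rewrite lerXn2r// nnegrE ?nc_ge0// ltW.
Qed.

Lemma finite_lower_bound (T : eqType) (s : seq T) (g : T -> R) :
  (forall x, x \in s -> 0 < g x) -> exists2 d, 0 < d & forall x, x \in s -> d <= g x.
Proof.
elim: s => [|x s IH] h; first by exists 1.
have [|d d0 hd] := IH; first by move=> y ys; apply: h; rewrite inE ys orbT.
exists (Num.min d (g x)); first by rewrite lt_min d0 h// mem_head.
move=> y; rewrite inE => /orP[/eqP->|/hd]; first by rewrite ge_min lexx orbT.
by apply: le_trans; rewrite ge_min lexx.
Qed.

(** Lattice points with |w| >= 2 |z| lie at distance at least |w| / 2 from [z]; the finitely many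
    others are handled by a minimum. Measuring the distance relative to |w| turns powers of [z - w]
    into powers of [w]. *)
Lemma far_from_lattice z : (forall m n, nonzero m n -> z != lat m n) ->
  exists2 d : R, 0 < d & forall m n, nonzero m n -> d * nc (lat m n) <= nc (z - lat m n).
Proof.
move=> hz; have c0 := lat_const_gt0 tau_gt0.
have [N hN] := archi_nat (2 * nc z / c).
pose s := [seq p <- [seq (m, n) | m <- zrange N, n <- zrange N] | nonzero p.1 p.2].
pose g (p : int * int) := nc (z - lat p.1 p.2) / nc (lat p.1 p.2).
have [p|d d0 hd] := @finite_lower_bound _ s g.
  rewrite mem_filter => /andP[nz _]; rewrite divr_gt0// nc_gt0 ?subr_eq0 ?hz//.
  exact: (lat_neq0 tau_gt0).
exists (Num.min d (1/2)); first by rewrite lt_min d0 divr_gt0.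
move=> m n nz; have w0 : 0 < nc (lat m n) by rewrite nc_gt0 (lat_neq0 tau_gt0).
have [big|small] := leP (2 * nc z) (nc (lat m n)).
  have := ncBl (lat m n) z; rewrite (ncBC z) => h.
  apply: le_trans (_ : 1/2 * nc (lat m n) <= _); last by lra.
  by rewrite ler_wpM2r ?nc_ge0// ge_min lexx orbT.
rewrite -ler_pdivlMr//; apply: le_trans (_ : d <= _); first by rewrite ge_min lexx.
apply: (hd (m, n)); rewrite mem_filter nz andTb.
have NN x : c * `|x|%:~R <= nc (lat m n) -> x \in zrange N.
  move=> hx; rewrite mem_zrange -(ler_int R) -[N%:~R]/(N%:R) ltW//.
  apply: le_lt_trans (hN _ (leqnn _)); rewrite ler_pdivlMr// mulrC.
  by apply: le_trans hx _; exact: ltW.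
have [h1 h2] := lat_ge tau_gt0 m n.
by apply: allpairs_f; apply: NN.
Qed.

(** The convergence-producing corrections in the definitions of zeta and [wp]; from exponent 3 on
    the sums converge as they stand. *)
Definition corr k z w : R[i] :=
  match k with 1 => w^-1 + z / w ^+ 2 | 2 => - w ^- 2 | _ => 0 end.

Definition esum_term k z w := (z - w) ^- k + corr k z w.

Definition Esum k z := lattice_sum tau (esum_term k z).

(** [E 1] is zeta, [E 2] is wp, [E 3] is - wp' / 2 and [E 4] is wp'' / 6. In this normalisation the
    derivative of [E k] is always [- k * E (k + 1)]. *)
Definition E k z : R[i] := z ^- k + Esum k z.

Lemma esum_term_decays k z (d : R) : (0 < k)%N -> 0 < d ->
  (forall m n, nonzero m n -> d * nc (lat m n) <= nc (z - lat m n)) ->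
  exists A, decays A (esum_term k z).
Proof.
move=> k0 d0 hd; have c0 := lat_const_gt0 tau_gt0.
case: k k0 => [//|[|[|k]]] _.
- exists (nc z ^+ 2 / d) => m n nz.
  have w0 := lat_neq0 tau_gt0 nz; have zw := hd m n nz; set w := lat m n in w0 zw *.
  have a0 : 0 < nc w by rewrite nc_gt0.
  have zw0 : z - w != 0 by rewrite -nc_gt0; apply: lt_le_trans zw; rewrite mulr_gt0.
  have -> : esum_term 1 z w = z ^+ 2 * w ^- 2 / (z - w).
    by rewrite /esum_term /= expr1; field; rewrite w0 zw0.
  rewrite !(ncM, ncV, ncX).
  have -> : nc z ^+ 2 / nc w ^+ 2 / nc (z - w) * nc w ^+ 3 = nc z ^+ 2 * (nc w / nc (z - w)).
    by field; rewrite !gt_eqF// nc_gt0.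
  rewrite ler_wpM2l ?exprn_ge0 ?nc_ge0// ler_pdivrMr ?nc_gt0// mulrC ler_pdivlMr//.
  by rewrite mulrC.
- exists (nc z * (2 + nc z / c) / d ^+ 2) => m n nz.
  have w0 := lat_neq0 tau_gt0 nz; have zw := hd m n nz.
  have cw := lat_ge_const tau_gt0 nz; set w := lat m n in w0 zw cw *.
  have a0 : 0 < nc w by rewrite nc_gt0.
  have zw0 : z - w != 0 by rewrite -nc_gt0; apply: lt_le_trans zw; rewrite mulr_gt0.
  have -> : esum_term 2 z w = z * (2 * w - z) / (w ^+ 2 * (z - w) ^+ 2).
    by rewrite /esum_term /=; field; rewrite w0 zw0.
  rewrite !(ncM, ncV, ncX).
  apply: le_trans (_ : nc z * (nc w * (2 + nc z / c)) / (nc w ^+ 2 * (d * nc w) ^+ 2) * nc w ^+ 3 <= _).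
    rewrite ler_wpM2r ?exprn_ge0 ?nc_ge0//; apply: ler_pM.
    + by rewrite mulr_ge0 ?nc_ge0.
    + by rewrite invr_ge0 mulr_ge0 ?exprn_ge0 ?nc_ge0.
    + rewrite ler_wpM2l ?nc_ge0//; apply: le_trans (ncB _ _) _.
      rewrite ncM nc_nat mulrDr mulrC lerD2l mulrCA ler_peMr ?nc_ge0//.
      by rewrite ler_pdivlMr// mul1r.
    + rewrite lef_pV2 ?posrE ?mulr_gt0 ?exprn_gt0 ?mulr_gt0 ?nc_gt0//.
      rewrite ler_wpM2l ?exprn_ge0 ?nc_ge0// lerXn2r// nnegrE ?nc_ge0//.
      by rewrite mulr_ge0 ?(ltW d0)// ltW.
  rewrite le_eqVlt; apply/orP; left; apply/eqP; field.
  by rewrite !gt_eqF.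
- exists (d ^- 3 * (d * c) ^- k) => m n nz.
  have w0 := lat_neq0 tau_gt0 nz; have zw := hd m n nz.
  have cw := lat_ge_const tau_gt0 nz; set w := lat m n in w0 zw cw *.
  have a0 : 0 < nc w by rewrite nc_gt0.
  rewrite /esum_term /= addr0 -addn3 exprD invfM ncM -mulrA.
  rewrite [leRHS]mulrC; apply: ler_pM; rewrite ?mulr_ge0 ?exprn_ge0 ?nc_ge0//.
    apply: inv_power_bound; first exact: mulr_gt0.
    by apply: le_trans zw; rewrite ler_wpM2l// ltW.
  have := inv_power_bound 3 (mulr_gt0 d0 a0) zw.
  rewrite exprMn (invfM (d ^+ 3)) => h; apply: le_trans (ler_wpM2r _ h) _.
    by rewrite exprn_ge0 ?nc_ge0.
  by rewrite divfK// expf_neq0// gt_eqF.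
Qed.

(** The second-order remainders of the terms are |h|^2 times summable quantities, uniformly for base
    points near [z]; hence the sum may be differentiated term by term. *)
Lemma lattice_hol k : (0 < k)%N -> hol (~` lattice tau) (E k) (fun z => - k%:R * E k.+1 z).
Proof.
move=> k0 z zL; have c0 := lat_const_gt0 tau_gt0.
have zL' m n : z != lat m n by apply/eqP => zE; apply: zL; exists m, n.
have z0 : 0 < nc z.
  rewrite nc_gt0; have := zL' 0 0; by rewrite /lat mul0r addr0.
have [|d d0 hd] := far_from_lattice (z := z); first by move=> m n _.
have [C C0 hC] := inv_power_remainder k.
have dc : 0 < d * c by rewrite mulr_gt0.
(* Within [2 * del] of [z] half of the relative distance to the lattice survives, and |h| < [del]
   ensures 2 |h| <= |x| and 2 |h| <= |x - w|. *)
pose del := Num.min (d * c / 8) (nc z / 8).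
have del0 : 0 < del by rewrite lt_min !divr_gt0.
pose B := d / 2.
have B0 : 0 < B by rewrite divr_gt0.
pose A := C * (B ^- 3 * (B * c) ^- k.-1).
exists (C * (nc z / 2) ^- k.+2 + K * A), del; split=> // x h xz hh.
have xnear y : nc (y - z) < del *+ 2 -> forall m n, nonzero m n ->
    B * nc (lat m n) <= nc (y - lat m n).
  move=> yz m n nz; have -> : B * nc (lat m n) = d * nc (lat m n) / 2 by rewrite /B mulrAC.
  have := hd m n nz; have := lat_ge_const tau_gt0 nz => cw.
  have : nc (z - lat m n) <= nc (y - z) + nc (y - lat m n).
    rewrite (ncBC y); apply: le_trans (ncD _ _).
    by rewrite (_ : z - y + _ = z - lat m n)//; ring.
  have : del <= d * c / 8 by rewrite ge_min lexx.
  move: yz; rewrite mulr2n.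
  have : d * c <= d * nc (lat m n) by rewrite ler_pM2l.
  by move: (d * c) (d * nc _) => dc' dw; lra.
have [|A1 hA1] := esum_term_decays (k := k) (z := x + h) k0 B0.
  apply: xnear; rewrite addrAC mulr2n; apply: le_lt_trans (ncD _ _) _; exact: ltrD.
have [|A2 hA2] := esum_term_decays (k := k) (z := x) k0 B0.
  by apply: xnear; apply: lt_trans xz _; rewrite mulr2n ltrDl.
have [||A3 hA3] := esum_term_decays (k := k.+1) (z := x) _ B0 => //.
  by apply: xnear; apply: lt_trans xz _; rewrite mulr2n ltrDl.
have -> : E k (x + h) - E k x - - k%:R * E k.+1 x * h =
    ((x + h) ^- k - x ^- k + k%:R * h * x ^- k.+1) +
    (Esum k (x + h) - Esum k x + k%:R * h * Esum k.+1 x).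
  by rewrite /E; ring.
apply: le_trans (ncD _ _) _; rewrite mulrDl; apply: lerD.
  have x0 : nc z / 2 <= nc x.
    have : nc z <= nc (x - z) + nc x.
      by rewrite (ncBC x); apply: le_trans (ncD _ _); rewrite subrK.
    have : del <= nc z / 8 by rewrite ge_min lexx orbT.
    lra.
  have xp : 0 < nc x by apply: lt_le_trans x0; rewrite divr_gt0.
  have h1 : 2 * nc h <= nc x.
    have : del <= nc z / 8 by rewrite ge_min lexx orbT.
    lra.
  have xn : x != 0 by rewrite -nc_gt0.
  have := hC x h xn h1.
  rewrite -ler_pdivlMr ?exprn_gt0// => /le_trans; apply.
  rewrite [leLHS]mulrAC ler_wpM2r ?exprn_ge0 ?nc_ge0// ler_wpM2l//.
  rewrite lef_pV2 ?posrE ?exprn_gt0 ?divr_gt0// lerXn2r// nnegrE ?nc_ge0//.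
  by rewrite ltW// divr_gt0.
have hB := decaysB hA1 hA2.
have hZ := decaysZ (k%:R * h) hA3.
rewrite /Esum -(lattice_sumB tau_gt0 hA1 hA2) -(lattice_sumZ tau_gt0 _ hA3).
rewrite -(lattice_sumD tau_gt0 hB hZ) -mulrA; apply: lattice_sum_le => m n nz.
have w0 := lat_neq0 tau_gt0 nz; have xw := xnear x; set w := lat m n in w0 *.
have {}xw : B * nc w <= nc (x - w).
  by apply: xw => //; apply: lt_trans xz _; rewrite mulr2n ltrDl.
have cw : c <= nc w by exact: (lat_ge_const tau_gt0 nz).
have Bw : B * c <= B * nc w by rewrite ler_pM2l.
have BwP : 0 < B * nc w by rewrite mulr_gt0// nc_gt0.
(* The corrections cancel: [corr 1] is affine in [z] with slope [w ^- 2], which is opposite to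
   [corr 2], and for larger [k] the correction does not depend on [z]. *)
have -> : esum_term k (x + h) w - esum_term k x w + k%:R * h * esum_term k.+1 x w =
    (x - w + h) ^- k - (x - w) ^- k + k%:R * h * (x - w) ^- k.+1.
  rewrite /esum_term (_ : x - w + h = x + h - w); last by ring.
  case: k k0 {hC hA1 hA2 hA3 hB hZ A} => [//|[|[|k]]] _ /=.
  - by ring.
  - by ring.
  - by ring.
have xw0 : x - w != 0 by rewrite -nc_gt0 (lt_le_trans BwP).
have hxw : 2 * nc h <= nc (x - w).
  have : del <= d * c / 8 by rewrite ge_min lexx.
  have Bc : B * c = d * c / 2 by rewrite /B mulrAC.
  by move: Bw; rewrite Bc; move: (d * c) (B * nc w) xw => dc' Bw'; lra.
have := hC _ _ xw0 hxw; set r := nc (_ - _ + _).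
have xwp : 0 < nc (x - w) by rewrite nc_gt0.
rewrite -ler_pdivlMr ?exprn_gt0// => hr.
apply: le_trans (ler_wpM2r _ hr) _; first by rewrite exprn_ge0 ?nc_ge0.
rewrite /A [leLHS](_ : _ = C * nc h ^+ 2 * (nc w ^+ 3 / nc (x - w) ^+ k.+2)); last by ring.
rewrite [leRHS](_ : _ = C * nc h ^+ 2 * (B ^- 3 * (B * c) ^- k.-1)); last by ring.
rewrite ler_wpM2l ?mulr_ge0 ?exprn_ge0 ?nc_ge0//.
have -> : k.+2 = (3 + k.-1)%N by rewrite -[in LHS](prednK k0).
rewrite exprD (invfM (nc (x - w) ^+ 3)) mulrA; apply: ler_pM.
- by rewrite mulr_ge0 ?invr_ge0 ?exprn_ge0 ?nc_ge0.
- by rewrite invr_ge0 exprn_ge0 ?nc_ge0.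
- rewrite ler_pdivrMr ?exprn_gt0// mulrC ler_pdivlMr ?exprn_gt0//.
  by rewrite mulrC -exprMn lerXn2r ?nnegrE ?nc_ge0// ltW.
- rewrite lef_pV2 ?posrE ?exprn_gt0 ?mulr_gt0//.
  rewrite lerXn2r ?nnegrE ?nc_ge0 ?(ltW (mulr_gt0 B0 c0))//.
  exact: le_trans xw.
Qed.

End EisensteinSeries.

(** * Periods of the Eisenstein series and the increment of zeta *)

Section EisensteinPeriods.
Context {R : realType}.
Variable tau : R[i].
Hypothesis tau_gt0 : 0 < im tau.
Implicit Types (z w v h p : R[i]) (F G : R[i] -> R[i]) (m n : int) (N k : nat).

Local Notation lat := (lat tau).
Local Notation c := (lat_const tau_gt0).
Local Notation decays := (decays tau).
Local Notation K := (sum_const tau_gt0).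
Local Notation Esum := (Esum tau).
Local Notation E := (E tau).

Definition full_box G N : R[i] := \sum_(m <- zrange N) \sum_(n <- zrange N) G (lat m n).

Lemma full_boxE G N : full_box G N = G 0 + box_sum tau G N.
Proof.
have delta (a : R[i]) : \sum_(m <- zrange N) (if m == 0 then a else 0) = a.
  elim: N => [|N IH]; first by rewrite zrange0.
  by rewrite zrangeS IH add0r addr0.
rewrite -[G 0 in RHS]delta /box_sum /full_box -big_split /=; apply: eq_bigr => m _.
rewrite [in RHS]big_mkcond /=.
have -> : (if m == 0 then G 0 else 0) =
    \sum_(n <- zrange N) (if n == 0 then (if m == 0 then G 0 else 0) else 0).
  by rewrite delta.
rewrite -big_split /=; apply: eq_bigr => n _; rewrite /nonzero.
have [->|m0] := eqVneq m 0; have [->|n0] := eqVneq n 0; rewrite /= ?add0r ?addr0//.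
by rewrite /lat mul0r addr0.
Qed.

Lemma box_sumB F G N : box_sum tau (fun w => F w - G w) N = box_sum tau F N - box_sum tau G N.
Proof. by rewrite /box_sum -sumrB; apply: eq_bigr => m _; rewrite -sumrB. Qed.

Lemma box_sumD F G N : box_sum tau (fun w => F w + G w) N = box_sum tau F N + box_sum tau G N.
Proof. by rewrite /box_sum -big_split; apply: eq_bigr => m _; rewrite -big_split. Qed.

(** On a finite box the corrections can be split off. What remains is the sum of [(z - w) ^- k] over
    the full box, where [w = 0] supplies the principal part, and this can be compared with its
    translates. *)
Lemma E_approx k z : (0 < k)%N -> ~ lattice tau z -> forall e : R, 0 < e ->
  exists N0, forall N, (N0 <= N)%N ->
    nc (full_box (fun w => (z - w) ^- k) N + box_sum tau (corr k z) N - E k z) < e.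
Proof.
move=> k0 zL e e0.
have [|d d0 hd] := far_from_lattice tau_gt0 (z := z).
  by move=> m n _; apply/eqP => zE; apply: zL; exists m, n.
have [A hA] := esum_term_decays tau_gt0 k0 d0 hd.
have [N0 hN0] := box_sum_cvg tau_gt0 hA e0.
exists N0 => N /hN0; congr (nc _ < e).
by rewrite full_boxE subr0 /E /Esum /esum_term box_sumD; ring.
Qed.

Lemma not_latticeD z m n : ~ lattice tau z -> ~ lattice tau (z + lat m n).
Proof.
move=> zL [m' [n' zE]]; apply: zL; exists (m' - m), (n' - n).
by rewrite -[z](addrK (lat m n)) zE -!/(lat _ _) /lat !rmorphB /=; ring.
Qed.

Lemma period_lat v : v = 1 \/ v = tau -> exists m n, v = lat m n.
Proof.
case=> ->; first by exists 1, 0; rewrite /lat mul0r addr0.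
by exists 0, 1; rewrite /lat mul1r add0r.
Qed.

Lemma small_eq0 z : (forall e : R, 0 < e -> nc z < e) -> z = 0.
Proof.
move=> h; apply/eqP; rewrite -nc_eq0; have [//|z0] := eqVneq (nc z) 0.
have zp : 0 < nc z by rewrite lt_neqAle eq_sym z0 nc_ge0.
by have := h _ zp; rewrite ltxx.
Qed.

Lemma nc_sub_large z w : 2 * nc z <= nc w -> nc w / 2 <= nc (z - w).
Proof. by have := ncBl w z; rewrite (ncBC z); lra. Qed.

(** For [k > 1] the correction does not depend on [z], and the terms are O(|w|^-2), the decay
    required for shifting the box by a period. *)
Lemma E_period k z v : (1 < k)%N -> v = 1 \/ v = tau -> ~ lattice tau z ->
  E k (z + v) = E k z.
Proof.
move=> k1 hv zL; have k0 : (0 < k)%N by exact: ltnW.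
have zvL : ~ lattice tau (z + v).
  by have [m [n ->]] := period_lat hv; exact: not_latticeD.
apply/eqP; rewrite -subr_eq0; apply/eqP; apply: small_eq0 => e e0.
have e3 : 0 < e / 3 by rewrite divr_gt0.
have [N1 h1] := E_approx k0 zL e3; have [N2 h2] := E_approx k0 zvL e3.
pose G w := (z - w) ^- k.
have hG m n : Num.max 1 (2 * nc z) <= nc (lat m n) ->
    nc (G (lat m n)) * nc (lat m n) ^+ 2 <= 2 ^+ k.
  rewrite ge_max => /andP[w1 wz]; set w := lat m n in w1 wz *.
  have w0 : 0 < nc w by exact: lt_le_trans w1.
  have := inv_power_bound k (divr_gt0 w0 (ltr0Sn R 1)) (nc_sub_large wz).
  move=> h; apply: le_trans (ler_wpM2r _ h) _; first by rewrite exprn_ge0 ?nc_ge0.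
  rewrite expr_div_n invf_div -mulrA ler_piMr ?exprn_ge0//.
  rewrite mulrC ler_pdivrMr ?exprn_gt0// mul1r; exact: ler_weXn2l.
have [N3 h3] := box_shift tau_gt0 hv hG e3.
pose N := maxn (maxn N1 N2) N3.
have {}h1 := h1 N; have {}h2 := h2 N; have {}h3 := h3 N.
have {h1} h1 := h1 (leq_trans (leq_maxl _ _) (leq_maxl _ _)).
have {h2} h2 := h2 (leq_trans (leq_maxr _ _) (leq_maxl _ _)).
have {h3} h3 := h3 (leq_maxr _ _).
have cE : box_sum tau (corr k (z + v)) N = box_sum tau (corr k z) N.
  by case: k k1 {h1 h2 h3 G hG k0} => [//|[//|[|k]]].
have sE : full_box (fun w => (z + v - w) ^- k) N =
    \sum_(m <- zrange N) \sum_(n <- zrange N) G (lat m n - v).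
  apply: eq_bigr => m _; apply: eq_bigr => n _; rewrite /G.
  by congr (_ ^- k); ring.
move: h1 h2 h3; rewrite cE sE -[X in _ -> _ -> nc (_ - X) < _ -> _]/(full_box G N).
set T := full_box _ N; set S := \sum_(m <- _) _; set B := box_sum _ _ _ => h1 h2 h3.
rewrite (_ : E k (z + v) - E k z = (T + B - E k z) - (S + B - E k (z + v)) + (S - T)); last by ring.
have := ncD ((T + B - E k z) - (S + B - E k (z + v))) (S - T).
have := ncB (T + B - E k z) (S + B - E k (z + v)).
by lra.
Qed.

(** The single terms [1 / (z - w)] decay too slowly for shifting the box. Their differences at two
    points decay quadratically, which shows that the increment over a period is the same at both. *)
Lemma zeta_increment z z' : ~ lattice tau z -> ~ lattice tau z' ->
  E 1 (z + 1) - E 1 z = E 1 (z' + 1) - E 1 z'.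
Proof.
move=> zL zL'; have hv : (1 : R[i]) = 1 \/ (1 : R[i]) = tau by left.
have shiftL x : ~ lattice tau x -> ~ lattice tau (x + 1).
  by have [m [n ->]] := period_lat hv; exact: not_latticeD.
apply/eqP; rewrite -subr_eq0; apply/eqP; apply: small_eq0 => e e0.
have e5 : 0 < e / 5 by rewrite divr_gt0.
have [N1 h1] := E_approx (ltnSn 0) zL e5.
have [N2 h2] := E_approx (ltnSn 0) (shiftL _ zL) e5.
have [N3 h3] := E_approx (ltnSn 0) zL' e5.
have [N4 h4] := E_approx (ltnSn 0) (shiftL _ zL') e5.
pose G w := (z - w) ^- 1 - (z' - w) ^- 1.
have hG m n : Num.max 1 (Num.max (2 * nc z) (2 * nc z')) <= nc (lat m n) ->
    nc (G (lat m n)) * nc (lat m n) ^+ 2 <= 4 * nc (z' - z).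
  rewrite !ge_max => /and3P[w1 wz wz']; set w := lat m n in w1 wz wz' *.
  have w0 : 0 < nc w by exact: lt_le_trans w1.
  have w20 : 0 < nc w / 2 by rewrite divr_gt0.
  have p1 := nc_sub_large wz; have p2 := nc_sub_large wz'.
  have q1 : 0 < nc (z - w) by exact: lt_le_trans p1.
  have q2 : 0 < nc (z' - w) by exact: lt_le_trans p2.
  have -> : G w = (z' - z) / ((z - w) * (z' - w)).
    by rewrite /G !expr1; field; rewrite -!nc_gt0 q1 q2.
  rewrite ncM ncV ncM mulrAC ler_pdivrMr ?mulr_gt0//.
  rewrite [leRHS](_ : _ = nc (z' - z) * ((2 * nc (z - w)) * (2 * nc (z' - w)))); last by ring.
  rewrite ler_wpM2l ?nc_ge0// expr2.
  by apply: ler_pM; rewrite ?nc_ge0//; lra.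
have [N5 h5] := box_shift tau_gt0 hv hG e5.
pose N := maxn (maxn (maxn N1 N2) (maxn N3 N4)) N5.
have {}h1 := h1 N _; have {}h2 := h2 N _; have {}h3 := h3 N _.
have {}h4 := h4 N _; have {}h5 := h5 N _.
move: (h1 (ltac:(rewrite !leq_max leqnn ?orbT//))) => {}h1.
move: (h2 (ltac:(rewrite !leq_max leqnn ?orbT//))) => {}h2.
move: (h3 (ltac:(rewrite !leq_max leqnn ?orbT//))) => {}h3.
move: (h4 (ltac:(rewrite !leq_max leqnn ?orbT//))) => {}h4.
move: (h5 (ltac:(rewrite !leq_max leqnn ?orbT//))) => {}h5.
have sE x : full_box (fun w => (x + 1 - w) ^- 1) N =
    \sum_(m <- zrange N) \sum_(n <- zrange N) (x - (lat m n - 1)) ^- 1.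
  by apply: eq_bigr => m _; apply: eq_bigr => n _; congr (_ ^- 1); ring.
have GE : \sum_(m <- zrange N) \sum_(n <- zrange N) G (lat m n - 1) -
    \sum_(m <- zrange N) \sum_(n <- zrange N) G (lat m n) =
    (full_box (fun w => (z + 1 - w) ^- 1) N - full_box (fun w => (z - w) ^- 1) N) -
    (full_box (fun w => (z' + 1 - w) ^- 1) N - full_box (fun w => (z' - w) ^- 1) N).
  have GS f : \sum_(m <- zrange N) \sum_(n <- zrange N) G (f m n) =
    \sum_(m <- zrange N) \sum_(n <- zrange N) (z - f m n) ^- 1 -
    \sum_(m <- zrange N) \sum_(n <- zrange N) (z' - f m n) ^- 1.
    by rewrite -sumrB; apply: eq_bigr => m _; rewrite -sumrB.
  by rewrite !sE !GS /full_box; ring.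
have cE x : box_sum tau (corr 1 (x + 1)) N - box_sum tau (corr 1 x) N =
    box_sum tau (fun w => 1 / w ^+ 2) N.
  rewrite -box_sumB; apply: eq_bigr => m _; apply: eq_bigr => n _ /=.
  by rewrite !mulrDl; ring.
have {}cE := etrans (cE z) (esym (cE z')).
move: h1 h2 h3 h4 h5; rewrite GE.
set F1 := full_box _ N; set F2 := full_box _ N; set F3 := full_box _ N; set F4 := full_box _ N.
move: cE; set B1 := box_sum _ _ _; set B2 := box_sum _ _ _.
set B3 := box_sum _ _ _; set B4 := box_sum _ _ _ => cE h1 h2 h3 h4 h5.
rewrite (_ : E 1 (z + 1) - E 1 z - (E 1 (z' + 1) - E 1 z') =
  (((F1 + B2 - E 1 z) - (F2 + B1 - E 1 (z + 1))) -
   ((F3 + B4 - E 1 z') - (F4 + B3 - E 1 (z' + 1)))) + ((F2 - F1) - (F4 - F3))); last first.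
  by rewrite -[B1](subrK B2) cE; ring.
have := ncB (F1 + B2 - E 1 z) (F2 + B1 - E 1 (z + 1)).
have := ncB (F3 + B4 - E 1 z') (F4 + B3 - E 1 (z' + 1)).
have := ncB ((F1 + B2 - E 1 z) - (F2 + B1 - E 1 (z + 1)))
  ((F3 + B4 - E 1 z') - (F4 + B3 - E 1 (z' + 1))).
have := ncD (((F1 + B2 - E 1 z) - (F2 + B1 - E 1 (z + 1))) -
   ((F3 + B4 - E 1 z') - (F4 + B3 - E 1 (z' + 1)))) ((F2 - F1) - (F4 - F3)).
by lra.
Qed.

End EisensteinPeriods.

Lemma exprVNn (F : fieldType) (x : F) k : (- x) ^- k = (-1) ^+ k * x ^- k.
Proof. by rewrite (exprNn x) invfM invr_sign. Qed.

(** * Laurent expansions at the origin *)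

Section EisensteinExpansions.
Context {R : realType}.
Variable tau : R[i].
Hypothesis tau_gt0 : 0 < im tau.
Implicit Types (z w v h p : R[i]) (F G : R[i] -> R[i]) (m n : int) (N k : nat).

Local Notation lat := (lat tau).
Local Notation c := (lat_const tau_gt0).
Local Notation decays := (decays tau).
Local Notation K := (sum_const tau_gt0).
Local Notation Esum := (Esum tau).
Local Notation E := (E tau).

Lemma wpE z : wp tau z = E 2 z. Proof. by []. Qed.

Lemma wzetaE z : wzeta tau z = E 1 z.
Proof.
rewrite /wzeta /E /Esum expr1; congr (_ + lattice_sum tau _).
by apply/funext => w; rewrite /esum_term /= expr1 addrA.
Qed.

Lemma E_opp k z : (0 < k)%N -> ~ lattice tau z -> E k (- z) = (-1) ^+ k * E k z.
Proof.
move=> k0 zL; have [|d d0 hd] := far_from_lattice tau_gt0 (z := z).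
  by move=> m n _; apply/eqP => zE; apply: zL; exists m, n.
have [A hA] := esum_term_decays tau_gt0 k0 d0 hd.
rewrite /E mulrDr exprVNn; congr (_ + _); rewrite /Esum -(lattice_sum_opp tau (esum_term k z)).
rewrite -(lattice_sumZ tau_gt0 _ (decays_opp hA)); congr lattice_sum.
apply/funext => w; rewrite /esum_term (_ : - z - w = - (z - - w)); last by ring.
rewrite exprVNn mulrDr; congr (_ + _); case: k k0 {hA} => [//|[|[|k]]] _ /=.
- by rewrite expr1 sqrrN invrN; ring.
- by rewrite !sqrrN expr1n mul1r.
- by rewrite mulr0.
Qed.

Definition inv_power k w : R[i] := w ^- k.

Lemma inv_power_decays k : (2 < k)%N -> decays (c ^- (k - 3)) (inv_power k).
Proof.
move=> k3 m n nz; have cw := lat_ge_const tau_gt0 nz; set w := lat m n in cw *.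
have w0 : 0 < nc w by apply: lt_le_trans cw; exact: lat_const_gt0.
rewrite /inv_power -[in w ^- k](subnK k3) exprD invfM ncM.
rewrite [nc (w ^- 3)]ncV ncX mulfVK ?expf_neq0 ?gt_eqF//.
exact: inv_power_bound (lat_const_gt0 _) cw.
Qed.

(** The sum is invariant under the reflection of the lattice, and each term changes sign. *)
Lemma odd_sum0 k : (2 < k)%N -> odd k -> lattice_sum tau (inv_power k) = 0.
Proof.
move=> k3 ko; have hP := inv_power_decays k3.
have : lattice_sum tau (inv_power k) = - lattice_sum tau (inv_power k).
  rewrite -[LHS]lattice_sum_opp -mulN1r -(lattice_sumZ tau_gt0 _ hP).
  congr lattice_sum; apply/funext => w.
  by rewrite /inv_power exprVNn -signr_odd ko expr1.
by move/eqP; rewrite -addr_eq0 -mulr2n mulrn_eq0 /= => /eqP.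
Qed.

Lemma small_decays k z : (0 < k)%N -> 2 * nc z <= c -> exists A, decays A (esum_term k z).
Proof.
move=> k0 zc; apply: (esum_term_decays tau_gt0 k0 (d := 1 / 2)); first by rewrite divr_gt0.
move=> m n nz; rewrite mul1r mulrC; apply: nc_sub_large.
exact: le_trans zc (lat_ge_const tau_gt0 nz).
Qed.

(** A common estimate for the Taylor remainders below: each is a fraction with numerator O(|z|^l
    |w|^j), and 2 |z| <= [c] allows |z - w| to be replaced by |w| / 2. Surplus powers of |w| are
    absorbed by the lower bound [c]. *)
Lemma fraction_bound (B : R) (j a b l : nat) z (r : R[i] -> R[i]) :
  (j + 3 <= a + b)%N -> 0 <= B -> 2 * nc z <= c ->
  (forall w, c <= nc w -> nc (r w) <= B * nc z ^+ l * nc w ^+ j) ->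
  forall m n, nonzero m n ->
   nc (r (lat m n) / (lat m n ^+ a * (z - lat m n) ^+ b)) * nc (lat m n) ^+ 3 <=
   B * 2 ^+ b * c ^- (a + b - (j + 3)) * nc z ^+ l.
Proof.
move=> jab B0 zc hr m n nz; have cw := lat_ge_const tau_gt0 nz.
set w := lat m n in cw *; have c0 := lat_const_gt0 tau_gt0.
have w0 : 0 < nc w by apply: lt_le_trans cw.
have zw := nc_sub_large (le_trans zc cw).
have h1 := inv_power_bound b (divr_gt0 w0 (ltr0Sn R 1)) zw.
have h2 : nc ((w ^+ a * (z - w) ^+ b)^-1) <= 2 ^+ b * nc w ^- (a + b).
  rewrite invfM ncM ncV ncX exprD invfM mulrCA ler_wpM2l ?invr_ge0 ?exprn_ge0 ?nc_ge0//.
  by apply: le_trans h1 _; rewrite expr_div_n invf_div.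
have h3 : nc w ^- (a + b - (j + 3)) <= c ^- (a + b - (j + 3)).
  by rewrite lef_pV2 ?posrE ?exprn_gt0// lerXn2r// nnegrE ?nc_ge0// ltW.
rewrite ncM.
apply: le_trans (_ : (B * nc z ^+ l * nc w ^+ j) * (2 ^+ b * nc w ^- (a + b)) * nc w ^+ 3 <= _).
  rewrite ler_wpM2r ?exprn_ge0 ?nc_ge0//; apply: ler_pM; rewrite ?nc_ge0//.
  exact: hr.
rewrite -[in X in nc w ^- X](subnK jab) exprD invfM exprD.
rewrite [leLHS](_ : _ = B * 2 ^+ b * nc w ^- (a + b - (j + 3)) * nc z ^+ l); last first.
  have : nc w ^+ j != 0 by rewrite expf_neq0// gt_eqF.
  have : nc w ^+ 3 != 0 by rewrite expf_neq0// gt_eqF.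
  move: (nc w ^+ j) (nc w ^+ 3) => x y y0 x0.
  have : nc w ^+ (a + b - (j + 3)) != 0 by rewrite expf_neq0// gt_eqF.
  move: (nc w ^+ (a + b - _)) => t t0.
  by field; rewrite x0 y0 t0.
by rewrite ler_wpM2r ?exprn_ge0 ?nc_ge0// ler_wpM2l// mulr_ge0// exprn_ge0.
Qed.

Lemma g2E : g2 tau = 60 * lattice_sum tau (inv_power 4). Proof. by []. Qed.
Lemma g3E : g3 tau = 140 * lattice_sum tau (inv_power 6). Proof. by []. Qed.

(** The orders of this and of the next two expansions suffice to cancel the poles and the constant
    terms in the differential equations of [wp]. *)
Lemma Esum4_expansion : exists C : R, forall z, 2 * nc z <= c ->
  nc (Esum 4 z - g2 tau / 60) <= C * nc z.
Proof.
have c0 := lat_const_gt0 tau_gt0.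
exists (K * (9 * 2 ^+ 4 * c ^- (4 + 4 - (3 + 3)))) => z zc.
have [A hA] := small_decays (k := 4) isT zc.
have -> : Esum 4 z - g2 tau / 60 =
    lattice_sum tau (fun w => esum_term 4 z w - inv_power 4 w).
  by rewrite (lattice_sumB tau_gt0 hA (inv_power_decays _))// g2E /Esum; field.
rewrite -mulrA; apply: lattice_sum_le => m n nz.
pose r w := z * (4 * w ^+ 3 - 6 * z * w ^+ 2 + 4 * z ^+ 2 * w - z ^+ 3).
have w0 := lat_neq0 tau_gt0 nz; have cw := lat_ge_const tau_gt0 nz.
have zw : z - lat m n != 0.
  rewrite -nc_gt0; apply: lt_le_trans (nc_sub_large (le_trans zc cw)).
  by rewrite divr_gt0// nc_gt0.
have -> : esum_term 4 z (lat m n) - inv_power 4 (lat m n) =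
    r (lat m n) / (lat m n ^+ 4 * (z - lat m n) ^+ 4).
  by rewrite /r /esum_term /inv_power /=; field; rewrite w0 zw.
rewrite -[nc z]expr1; apply: fraction_bound => // w {}cw.
rewrite /r ncM expr1 [leRHS](_ : _ = nc z * (9 * nc w ^+ 3)); last by ring.
rewrite ler_wpM2l ?nc_ge0//.
have h : 2 * nc z <= nc w by exact: le_trans cw.
apply: le_trans (ncB _ _) _; apply: le_trans (lerD (ncD _ _) (lexx _)) _.
apply: le_trans (lerD (lerD (ncB _ _) (lexx _)) (lexx _)) _.
rewrite !(ncM, ncX, nc_nat).
have a0 := nc_ge0 z; have b0 := nc_ge0 w; move: (nc z) (nc w) h a0 b0 => a b h a0 b0.
have b2 : 0 <= b ^+ 2 by exact: sqr_ge0.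
have p1 : 2 * (a * b ^+ 2) <= b * b ^+ 2 by rewrite mulrA ler_wpM2r.
have p2 : 2 * (a ^+ 2 * b) <= a * b ^+ 2.
  by rewrite expr2 expr2 !mulrA -!mulrA mulrCA ler_wpM2l// mulrA ler_wpM2r.
have p3 : 2 * a ^+ 3 <= a ^+ 2 * b.
  by rewrite exprSr mulrCA ler_wpM2l// exprn_ge0.
rewrite (_ : 4 * b ^+ 3 = 4 * (b * b ^+ 2)); last by ring.
rewrite (_ : b ^+ 3 = b * b ^+ 2); last by ring.
rewrite (_ : 6 * a * b ^+ 2 = 6 * (a * b ^+ 2)); last by ring.
rewrite (_ : 4 * a ^+ 2 * b = 4 * (a ^+ 2 * b)); last by ring.
have : 0 <= b * b ^+ 2 by rewrite mulr_ge0.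
by move: (b * b ^+ 2) (a * b ^+ 2) (a ^+ 2 * b) (a ^+ 3) p1 p2 p3 => x y t u; lra.
Qed.

Lemma Esum3_expansion : exists C : R, forall z, 2 * nc z <= c ->
  nc (Esum 3 z + g2 tau / 20 * z + g3 tau / 14 * z ^+ 3) <= C * nc z ^+ 4.
Proof.
have c0 := lat_const_gt0 tau_gt0.
(* The summand is a fraction with [a = 6], [b = 3] and a numerator of degree [j = 2] in [w]; 30
   exceeds 15 + 24 / 2 + 10 / 4. *)
exists (K * (30 * 2 ^+ 3 * c ^- (6 + 3 - (2 + 3)))) => z zc.
have [A hA] := small_decays (k := 3) isT zc.
have d3 := inv_power_decays (k := 3) isT; have d4 := decaysZ (3 * z) (inv_power_decays (k := 4) isT).
have d5 := decaysZ (6 * z ^+ 2) (inv_power_decays (k := 5) isT).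
have d6 := decaysZ (10 * z ^+ 3) (inv_power_decays (k := 6) isT).
have -> : Esum 3 z + g2 tau / 20 * z + g3 tau / 14 * z ^+ 3 =
    lattice_sum tau (fun w => esum_term 3 z w + (inv_power 3 w + (3 * z * inv_power 4 w +
       (6 * z ^+ 2 * inv_power 5 w + 10 * z ^+ 3 * inv_power 6 w)))).
  have e4 := decaysD d5 d6; have e3 := decaysD d4 e4; have e2 := decaysD d3 e3.
  rewrite (lattice_sumD tau_gt0 hA e2) (lattice_sumD tau_gt0 d3 e3).
  rewrite (lattice_sumD tau_gt0 d4 e4) (lattice_sumD tau_gt0 d5 d6).
  rewrite !(lattice_sumZ tau_gt0 _ (inv_power_decays _))//.
  (* The odd power sums vanish, and those of [w ^- 4] and [w ^- 6] are [g2 / 60] and [g3 / 140]. *)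
  by rewrite (odd_sum0 (k := 3))// (odd_sum0 (k := 5))// g2E g3E /Esum; field.
rewrite -mulrA; apply: lattice_sum_le => m n nz.
pose r w := z ^+ 4 * (15 * w ^+ 2 - 24 * z * w + 10 * z ^+ 2).
have w0 := lat_neq0 tau_gt0 nz; have cw := lat_ge_const tau_gt0 nz.
have zw : z - lat m n != 0.
  rewrite -nc_gt0; apply: lt_le_trans (nc_sub_large (le_trans zc cw)).
  by rewrite divr_gt0// nc_gt0.
rewrite (_ : esum_term 3 z _ + _ = r (lat m n) / (lat m n ^+ 6 * (z - lat m n) ^+ 3)); last first.
  by rewrite /r /esum_term /inv_power /=; field; rewrite w0 zw.
apply: fraction_bound => // w {}cw.
rewrite /r ncM ncX [leRHS](_ : _ = nc z ^+ 4 * (30 * nc w ^+ 2)); last by ring.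
rewrite ler_wpM2l ?exprn_ge0 ?nc_ge0//.
have h : 2 * nc z <= nc w by exact: le_trans cw.
apply: le_trans (ncD _ _) _; apply: le_trans (lerD (ncB _ _) (lexx _)) _.
rewrite !(ncM, ncX, nc_nat).
have a0 := nc_ge0 z; have b0 := nc_ge0 w; move: (nc z) (nc w) h a0 b0 => a b h a0 b0.
have p1 : 2 * (a * b) <= b ^+ 2 by rewrite mulrA expr2 ler_wpM2r.
have p2 : 2 * a ^+ 2 <= a * b by rewrite expr2 mulrCA ler_wpM2l.
rewrite -mulrA; have := sqr_ge0 b.
by move: (b ^+ 2) (a * b) (a ^+ 2) p1 p2 => x y t; lra.
Qed.

Lemma Esum2_expansion : exists C : R, forall z, 2 * nc z <= c ->
  nc (Esum 2 z - g2 tau / 20 * z ^+ 2 - g3 tau / 28 * z ^+ 4) <= C * nc z ^+ 5.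
Proof.
have c0 := lat_const_gt0 tau_gt0.
exists (K * (9 * 2 ^+ 2 * c ^- (6 + 2 - (1 + 3)))) => z zc.
have [A hA] := small_decays (k := 2) isT zc.
have d3 := decaysZ (2 * z) (inv_power_decays (k := 3) isT).
have d4 := decaysZ (3 * z ^+ 2) (inv_power_decays (k := 4) isT).
have d5 := decaysZ (4 * z ^+ 3) (inv_power_decays (k := 5) isT).
have d6 := decaysZ (5 * z ^+ 4) (inv_power_decays (k := 6) isT).
have -> : Esum 2 z - g2 tau / 20 * z ^+ 2 - g3 tau / 28 * z ^+ 4 =
    lattice_sum tau (fun w => esum_term 2 z w - (2 * z * inv_power 3 w + (3 * z ^+ 2 * inv_power 4 w +
       (4 * z ^+ 3 * inv_power 5 w + 5 * z ^+ 4 * inv_power 6 w)))).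
  have e4 := decaysD d5 d6; have e3 := decaysD d4 e4; have e2 := decaysD d3 e3.
  rewrite (lattice_sumB tau_gt0 hA e2) (lattice_sumD tau_gt0 d3 e3).
  rewrite (lattice_sumD tau_gt0 d4 e4) (lattice_sumD tau_gt0 d5 d6).
  rewrite !(lattice_sumZ tau_gt0 _ (inv_power_decays _))//.
  by rewrite (odd_sum0 (k := 3))// (odd_sum0 (k := 5))// g2E g3E /Esum; field.
rewrite -mulrA; apply: lattice_sum_le => m n nz.
pose r w := z ^+ 5 * (6 * w - 5 * z).
have w0 := lat_neq0 tau_gt0 nz; have cw := lat_ge_const tau_gt0 nz.
have zw : z - lat m n != 0.
  rewrite -nc_gt0; apply: lt_le_trans (nc_sub_large (le_trans zc cw)).
  by rewrite divr_gt0// nc_gt0.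
rewrite (_ : esum_term 2 z _ - _ = r (lat m n) / (lat m n ^+ 6 * (z - lat m n) ^+ 2)); last first.
  by rewrite /r /esum_term /inv_power /=; field; rewrite w0 zw.
apply: fraction_bound => // w {}cw.
rewrite /r ncM ncX expr1 [leRHS](_ : _ = nc z ^+ 5 * (9 * nc w)); last by ring.
rewrite ler_wpM2l ?exprn_ge0 ?nc_ge0//.
have h : 2 * nc z <= nc w by exact: le_trans cw.
apply: le_trans (ncB _ _) _; by rewrite !(ncM, nc_nat); lra.
Qed.

End EisensteinExpansions.

(** * Antiderivatives of continuous functions *)

Section Antiderivative.
Context {R : realType}.
Implicit Types (f g P : R -> R[i]) (t x y : R).

Local Notation mu := (@lebesgue_measure R).

Definition ccont f := (continuous (fun x => re (f x)) /\ continuous (fun x => im (f x)))%type.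

Lemma cder_ccont f (f' : R -> R[i]) : (forall t, cder f (f' t) t) -> ccont f.
Proof. by move=> h; split => t; have [h1 h2] := h t; exact: is_derive_cont. Qed.

(** The integral from a base point is differentiated only to the right of it, so the base point
    [- |x| - 1] moves with [x]. The increment from 0 does not depend on it, as two such integrals
    differ by a constant. *)
Lemma real_antiderivative (g : R -> R) : continuous g ->
  exists P : R -> R, P 0 = 0 /\ forall t, is_derive t (1 : R) P (g t).
Proof.
move=> gc; pose G (a x : R) := (\int[mu]_(t in `[a, x]) g t)%R.
have dG a x : a < x -> is_derive x (1 : R) (G a) (g x).
  move=> ax; have x1 : x < x + 1 by rewrite ltrDl.
  have [|d v] := @continuous_FTC1_closed R g a x (x + 1) x1 _ ax (gc x).
  - apply: continuous_compact_integrable; first exact: segment_compact.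
    exact: continuous_subspaceT.
  - by split; [exact: d|rewrite -derive1E; exact: v].
pose P x := G (- `|x| - 1) x - G (- `|x| - 1) 0.
have PG a x : a < 0 -> a < x -> P x = G a x - G a 0.
  move=> a0 ax; pose m := Num.max a (- `|x| - 1).
  have m0 : m < 0 by rewrite gt_max a0 -opprD oppr_lt0 ltr_wpDl.
  have mx : m < x.
    rewrite gt_max ax /=; have := ler_norm (- x); rewrite normrN; lra.
  have key (b b' y z : R) : b <= b' -> b' < y -> y <= z -> G b z - G b y = G b' z - G b' y.
    move=> bb by_ yz.
    have dd s : y <= s <= z -> is_derive s (1 : R) (G b - G b') 0.
      move=> /andP[ys _]; rewrite -(subrr (g s)).
      by apply: is_deriveB; apply: dG; lra.
    have le1 := le_derive yz dd (fun s _ => is_derive_cst (0 : R) s (1 : R)) (fun s _ => lexx 0).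
    have le2 := le_derive yz (fun s _ => is_derive_cst (0 : R) s (1 : R)) dd (fun s _ => lexx 0).
    move: le1 le2; rewrite !fctE.
    by move: (G b z) (G b y) (G b' z) (G b' y) => ? ? ? ?; lra.
  have two b : b <= m -> G b x - G b 0 = G m x - G m 0.
    move=> bm; have [x0|/ltW x0] := leP 0 x; first exact: key.
    have := key b m x 0 bm mx x0; lra.
  by rewrite /P !two// le_max lexx ?orbT.
exists P; split; first by rewrite /P subrr.
move=> t; pose a := - `|t| - 2.
have a0 : a < 0 by rewrite /a; have := normr_ge0 t; lra.
have at_ : a < t by rewrite /a; have := ler_norm (- t); rewrite normrN; lra.
apply/is_deriveP => e e0.
have /is_deriveP := dG a t at_ => /(_ e e0)[d d0 hd].
exists (Num.min d 1); first by rewrite lt_min d0 ltr01.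
move=> s; rewrite lt_min => /andP[sd s1].
rewrite !(PG a)//; last first.
  by rewrite /a; move: s1; have := ler_norm (- t); have := ler_norm (- s); rewrite !normrN; lra.
by have := hd s sd; congr (`|_| <= _); ring.
Qed.

Lemma antiderivative f : ccont f ->
  exists P, P 0 = 0 /\ forall t, cder P (f t) t.
Proof.
move=> [f1 f2]; have [P1 [p1 d1]] := real_antiderivative f1.
have [P2 [p2 d2]] := real_antiderivative f2.
exists (fun t => P1 t +i* P2 t); split; first by rewrite p1 p2.
by move=> t; split; [exact: d1|exact: d2].
Qed.

Lemma Rintegral_antiderivative (g P : R -> R) (a b : R) : a <= b -> continuous g ->
  (forall t, is_derive t (1 : R) P (g t)) -> (\int[mu]_(x in `[a, b]) g x)%R = P b - P a.
Proof.
move=> ab gc dP; have [<-|nab] := eqVneq a b.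
  by rewrite set_itv1 Rintegral_set1 subrr.
have {}ab : a < b by rewrite lt_neqAle nab.
have Pc : continuous P by move=> t; apply: is_derive_cont (dP t).
rewrite /Rintegral (continuous_FTC2 (F := P))//=.
- exact: continuous_subspaceT.
- split=> [x _||]; first by have [] := dP x.
  + exact: cvg_at_right_filter (Pc a).
  + exact: cvg_at_left_filter (Pc b).
- by move=> x _; rewrite derive1E; have [] := dP x.
Qed.

Lemma cRintegral_antiderivative f P (a b : R) : a <= b -> ccont f ->
  (forall t, cder P (f t) t) -> cRintegral a b f = P b - P a.
Proof.
move=> ab [f1 f2] dP; rewrite /cRintegral.
rewrite (Rintegral_antiderivative ab f1 (fun t => (dP t).1)).
rewrite (Rintegral_antiderivative ab f2 (fun t => (dP t).2)).
by apply: complexP; rewrite !(reD, imD, reN, imN).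
Qed.

End Antiderivative.

Section Prim.
Context {R : realType}.
Implicit Types (f : R -> R[i]).

(** A total choice of the antiderivative that vanishes at 0; for a discontinuous integrand it is the
    zero function by default. *)
Definition prim f : R -> R[i] :=
  if pselect (ccont f) is left fc then projT1 (cid (antiderivative fc)) else fun=> 0.

Lemma prim0 f : prim f 0 = 0.
Proof. by rewrite /prim; case: pselect => // fc; case: cid => P []. Qed.

Lemma primP f t : ccont f -> cder (prim f) (f t) t.
Proof. by rewrite /prim; case: pselect => // fc _; case: cid => P []. Qed.

Definition expi (t : R) : R[i] := cos t +i* sin t.

Lemma nc_expi t : nc (expi t) = 1.
Proof. by rewrite nc_sqrtE /= cos2Dsin2 sqrtr1. Qed.

Lemma cder_expi t : cder expi ('i%C * expi t) t.
Proof.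
split => /=.
  by apply: is_derive_ext (is_derive_cos t) _ _ => //; rewrite mul0r mul1r sub0r.
by apply: is_derive_ext (is_derive_sin t) _ _ => //; rewrite mul0r mul1r add0r.
Qed.

Lemma expi2pi : expi (pi *+ 2) = expi 0.
Proof. by rewrite /expi cos2pi sin2pi cos0 sin0. Qed.

Lemma expi0 : expi 0 = 1.
Proof. by rewrite /expi cos0 sin0. Qed.

Lemma expipi : expi pi = -1.
Proof. by rewrite /expi cospi sinpi; apply: complexP; rewrite /= ?oppr0. Qed.

End Prim.

(** * Holomorphic functions and Liouville's theorem *)
Section Holomorphic.
Context {R : realType}.
Implicit Types (F G : R[i] -> R[i]) (D : set R[i]) (z a u : R[i]).

Lemma hol_bounded D F F' z : hol D F F' -> D z ->
  exists M d : R, 0 < d /\ forall x, nc (x - z) < d -> nc (F x) <= M /\ nc (F' x) <= M.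
Proof.
move=> hF Dz; have [C [d [d0 hd]]] := hF z Dz.
have C0 : 0 <= C * d ^+ 2 / 4.
  have := hd z (d / 2)%:C; rewrite subrr nc0 d0 nc_real ger0_norm; last by lra.
  rewrite expr_div_n -natrX mulrA => /(_ isT) h; apply: le_trans (nc_ge0 _) (h _).
  by lra.
pose M1 := nc (F z) + nc (F' z) * d + C * d ^+ 2 / 4 *+ 4.
have C1 : 0 <= C.
  by move: C0; rewrite -mulrA pmulr_lge0// divr_gt0// exprn_gt0.
have F1 x : nc (x - z) < d -> nc (F x) <= M1.
  move=> xz; have := hd z (x - z); rewrite subrr nc0 d0 xz (addrC z) subrK => /(_ isT isT) h.
  rewrite (_ : F x = (F x - F z - F' z * (x - z)) + (F z + F' z * (x - z))); last by ring.
  apply: le_trans (ncD _ _) _; rewrite addrC; apply: lerD.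
    apply: le_trans (ncD _ _) _; rewrite lerD2l ncM ler_wpM2l ?nc_ge0//; exact: ltW.
  apply: le_trans h _; rewrite -mulr_natr divfK ?pnatr_eq0// ler_wpM2l//.
  by rewrite lerXn2r ?nnegrE ?nc_ge0 ?ltW.
(* The bound on [F'] comes from a difference quotient with the fixed real step [d / 4]. *)
pose k := (d / 4)%:C : R[i].
have k0 : nc k = d / 4 by rewrite nc_real ger0_norm// divr_ge0// ltW.
pose M2 := (M1 + M1 + C * d ^+ 2) / (d / 4).
exists (Num.max M1 M2), (d / 2); split; first by rewrite divr_gt0.
move=> x xz; have xd : nc (x - z) < d by lra.
have := F1 x xd => Fx; split; first by rewrite le_max Fx.
rewrite le_max; apply/orP; right; rewrite ler_pdivlMr ?divr_gt0// -k0 -ncM.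
have kd : nc k < d by rewrite k0; lra.
have := hd x k xd kd => h.
have Fxk : nc (F (x + k)) <= M1.
  apply: F1; rewrite addrAC; apply: le_lt_trans (ncD _ _) _; rewrite k0; lra.
rewrite (_ : F' x * k = (F (x + k) - F x) - (F (x + k) - F x - F' x * k)); last by ring.
apply: le_trans (ncB _ _) _; apply: lerD.
  by apply: le_trans (ncB _ _) _; exact: lerD.
apply: le_trans h _; rewrite ler_wpM2l// lerXn2r ?nnegrE ?nc_ge0 ?ltW//.
Qed.

Lemma hol_cst D a : hol D (fun=> a) (fun=> 0).
Proof.
move=> z _; exists 0, 1; split=> // x h _ _.
by rewrite subrr mul0r subr0 nc0 mul0r.
Qed.

Lemma holD D F F' G G' : hol D F F' -> hol D G G' ->
  hol D (fun z => F z + G z) (fun z => F' z + G' z).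
Proof.
move=> hF hG z Dz; have [C1 [d1 [d10 h1]]] := hF z Dz; have [C2 [d2 [d20 h2]]] := hG z Dz.
exists (C1 + C2), (Num.min d1 d2); rewrite lt_min d10 d20; split=> // x h.
rewrite !lt_min => /andP[x1 x2] /andP[k1 k2].
rewrite (_ : _ - _ - _ = (F (x + h) - F x - F' x * h) + (G (x + h) - G x - G' x * h)); last by ring.
by apply: le_trans (ncD _ _) _; rewrite mulrDl lerD ?h1 ?h2.
Qed.

Lemma holM D F F' G G' : hol D F F' -> hol D G G' ->
  hol D (fun z => F z * G z) (fun z => F' z * G z + F z * G' z).
Proof.
move=> hF hG z Dz; have [C1 [d1 [d10 h1]]] := hF z Dz; have [C2 [d2 [d20 h2]]] := hG z Dz.
have [M1 [d3 [d30 h3]]] := hol_bounded hF Dz; have [M2 [d4 [d40 h4]]] := hol_bounded hG Dz.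
pose d := Num.min (Num.min d1 d2) (Num.min d3 d4) / 2.
have dd1 : d * 2 <= d1 by rewrite divfK// !ge_min lexx.
have dd2 : d * 2 <= d2 by rewrite divfK// !ge_min lexx orbT.
have dd3 : d * 2 <= d3 by rewrite divfK// !ge_min lexx !orbT.
have dd4 : d * 2 <= d4 by rewrite divfK// !ge_min lexx !orbT.
have d0 : 0 < d by rewrite divr_gt0// !lt_min d10 d20 d30 d40.
have M10 : 0 <= M1 by have [] := h3 z (ltac:(by rewrite subrr nc0)); move: (nc_ge0 (F z)); lra.
have M20 : 0 <= M2 by have [] := h4 z (ltac:(by rewrite subrr nc0)); move: (nc_ge0 (G z)); lra.
have C10 : 0 <= C1 * (d / 2) ^+ 2.
  have := h1 z (d / 2)%:C; rewrite subrr nc0 nc_real ger0_norm; last by lra.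
  move=> h; apply: le_trans (nc_ge0 _) (h _ _); lra.
have {}C10 : 0 <= C1 by move: C10; rewrite pmulr_lge0// exprn_gt0// divr_gt0.
have C20 : 0 <= C2.
  have C20 : 0 <= C2 * (d / 2) ^+ 2.
    have := h2 z (d / 2)%:C; rewrite subrr nc0 nc_real ger0_norm; last by lra.
    move=> h; apply: le_trans (nc_ge0 _) (h _ _); lra.
  by move: C20; rewrite pmulr_lge0// exprn_gt0// divr_gt0.
exists (C1 * M2 + M1 * C2 + M1 * (M2 + C2 * d)), d; split=> // x h xz hd.
have k1 := h1 x h (ltac:(lra)) (ltac:(lra)).
have k2 := h2 x h (ltac:(lra)) (ltac:(lra)).
have [Fx F'x] := h3 x (ltac:(lra)); have [Gx G'x] := h4 x (ltac:(lra)).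
have [Gxh _] : nc (G (x + h)) <= M2 /\ nc (G' (x + h)) <= M2.
  by apply: h4; rewrite addrAC; apply: le_lt_trans (ncD _ _) _; lra.
rewrite (_ : _ - _ - _ = (F (x + h) - F x - F' x * h) * G (x + h) +
  F x * (G (x + h) - G x - G' x * h) + F' x * h * (G (x + h) - G x)); last by ring.
have hh := nc_ge0 h.
rewrite [leRHS](_ : _ = C1 * M2 * nc h ^+ 2 + M1 * C2 * nc h ^+ 2 +
  M1 * (M2 + C2 * d) * nc h ^+ 2); last by ring.
apply: le_trans (ncD _ _) _; apply: lerD.
  apply: le_trans (ncD _ _) _; apply: lerD.
    by rewrite ncM mulrAC; apply: ler_pM; rewrite ?nc_ge0.
  by rewrite ncM -mulrA; apply: ler_pM; rewrite ?nc_ge0.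
have k3 : nc (G (x + h) - G x) <= (M2 + C2 * d) * nc h.
  rewrite (_ : _ - _ = (G (x + h) - G x - G' x * h) + G' x * h); last by ring.
  apply: le_trans (ncD _ _) _; rewrite addrC mulrDl; apply: lerD.
    by rewrite ncM ler_wpM2r.
  apply: le_trans k2 _; rewrite expr2 mulrA ler_wpM2r// ler_wpM2l//; exact: ltW.
rewrite !ncM expr2 [leRHS](_ : _ = (M1 * nc h) * ((M2 + C2 * d) * nc h)); last by ring.
apply: ler_pM; rewrite ?mulr_ge0 ?nc_ge0//.
by rewrite ler_wpM2r.
Qed.

Lemma holZ D a F F' : hol D F F' -> hol D (fun z => a * F z) (fun z => a * F' z).
Proof.
move=> hF z Dz; have [C [d [d0 hd]]] := hF z Dz.
exists (nc a * C), d; split=> // x h xz hh.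
rewrite (_ : _ - _ - _ = a * (F (x + h) - F x - F' x * h)); last by ring.
by rewrite ncM -mulrA ler_wpM2l ?nc_ge0// hd.
Qed.

Lemma hol_eq D F F' G G' : hol D F F' -> F =1 G -> F' =1 G' -> hol D G G'.
Proof. by move=> h /funext <- /funext <-. Qed.

Lemma hol_shift D F F' a : hol D F F' ->
  hol [set z | D (z + a)] (fun z => F (z + a)) (fun z => F' (z + a)).
Proof.
move=> hF z /= Dz; have [C [d [d0 hd]]] := hF _ Dz; exists C, d; split=> // x h xz hh.
by have := hd (x + a) h; rewrite opprD addrACA subrr addr0 (addrAC x a) => /(_ xz hh).
Qed.

Lemma holS D D' F F' : D' `<=` D -> hol D F F' -> hol D' F F'.
Proof. by move=> DD hF z /DD; exact: hF. Qed.

Lemma hol_near D F F' G : open D -> hol D F F' -> (forall z, D z -> F z = G z) -> hol D G F'.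
Proof.
move=> /open_nc oD hF FG z Dz; have [C [d [d0 hd]]] := hF z Dz.
have [r r0 hr] := oD z Dz.
exists C, (Num.min d (r / 2)); rewrite lt_min d0 divr_gt0//; split=> // x h.
rewrite !lt_min => /andP[x1 x2] /andP[k1 k2].
rewrite -!FG; first exact: hd.
  by apply: hr; rewrite ncBC; lra.
apply: hr; rewrite ncBC addrAC; apply: le_lt_trans (ncD _ _) _; lra.
Qed.

Lemma hol_cont D F F' z : hol D F F' -> D z -> forall e : R, 0 < e ->
  exists2 d : R, 0 < d & forall x, nc (x - z) < d -> nc (F x - F z) < e.
Proof.
move=> hF Dz e e0; have [C [d [d0 hd]]] := hF z Dz.
pose M := nc (F' z) + `|C| * d + 1; have M0 : 0 < M.
  by rewrite ltr_wpDl// addr_ge0 ?nc_ge0// mulr_ge0// ltW.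
exists (Num.min d (e / M)); first by rewrite lt_min d0 divr_gt0.
move=> x; rewrite lt_min => /andP[xd xe].
have := hd z (x - z); rewrite subrr nc0 d0 xd (addrC z) subrK => /(_ isT isT) h.
apply: le_lt_trans (_ : M * nc (x - z) < _); last by rewrite mulrC -ltr_pdivlMr.
rewrite (_ : F x - F z = F x - F z - F' z * (x - z) + F' z * (x - z)); last by ring.
rewrite [leRHS](_ : _ = (`|C| * d * nc (x - z) + nc (x - z)) + nc (F' z) * nc (x - z)); last first.
  by rewrite /M; ring.
apply: le_trans (ncD _ _) _; rewrite ncM; apply: lerD => //.
apply: le_trans h _; apply: ler_wpDr; first exact: nc_ge0.
rewrite expr2 mulrA ler_wpM2r ?nc_ge0//; apply: le_trans (_ : `|C| * nc (x - z) <= _).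
  by rewrite ler_wpM2r ?nc_ge0// ler_norm.
by rewrite ler_wpM2l// ltW.
Qed.

Lemma hol_curve D F F' (g : R -> R[i]) (g' : R[i]) (t : R) :
  hol D F F' -> D (g t) -> cder g g' t -> cder (fun s => F (g s)) (F' (g t) * g') t.
Proof.
move=> hF Dg /cderP dg; have [C [d [d0 hd]]] := hF _ Dg.
apply/cderP => e e0.
pose L := nc g' + 1; have L0 : 0 < L by rewrite ltr_wpDl// nc_ge0.
have [d1 d10 h1] := dg 1 ltr01.
pose A := nc (F' (g t)) + 1; have A0 : 0 < A by rewrite ltr_wpDl// nc_ge0.
have eA : 0 < e / 2 / A by rewrite !divr_gt0.
have [d2 d20 h2] := dg _ eA.
pose B := `|C| * L ^+ 2 + 1.
have B0 : 0 < B by rewrite ltr_wpDl// mulr_ge0// sqr_ge0.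
exists (Num.min (Num.min d1 d2) (Num.min (d / L) (e / 2 / B))).
  by rewrite !lt_min d10 d20 !divr_gt0.
move=> s; rewrite !lt_min => /andP[/andP[s1 s2] /andP[s3 s4]].
have gL : nc (g (t + s) - g t) <= L * `|s|.
  rewrite (_ : g (t + s) - g t = (g (t + s) - g t - g' * s%:C) + g' * s%:C); last by ring.
  apply: le_trans (ncD _ _) _; rewrite addrC /L mulrDl ncM nc_real lerD2l; exact: h1.
have gd : nc (g (t + s) - g t) < d.
  by apply: le_lt_trans gL _; rewrite mulrC -ltr_pdivlMr.
have := hd (g t) (g (t + s) - g t); rewrite subrr nc0 d0 (addrC (g t)) subrK => /(_ isT gd) h.
rewrite (_ : F (g (t + s)) - F (g t) - F' (g t) * g' * s%:C =
  (F (g (t + s)) - F (g t) - F' (g t) * (g (t + s) - g t)) +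
  F' (g t) * (g (t + s) - g t - g' * s%:C)); last by ring.
apply: le_trans (ncD _ _) _; rewrite (splitr e) mulrDl; apply: lerD.
  apply: le_trans h _; apply: le_trans (_ : B * `|s| * `|s| <= _); last first.
    rewrite ler_wpM2r// mulrC -ler_pdivlMr//; exact: ltW.
  apply: le_trans (_ : `|C| * (L * `|s|) ^+ 2 <= _).
    apply: le_trans (_ : `|C| * nc (g (t + s) - g t) ^+ 2 <= _).
      by rewrite ler_wpM2r ?sqr_ge0// ler_norm.
    rewrite ler_wpM2l// lerXn2r ?nnegrE ?nc_ge0// mulr_ge0// ltW//.
  rewrite exprMn /B !mulrDl mul1r mulrA expr2 -!mulrA lerDl mulr_ge0//.
rewrite ncM; apply: le_trans (_ : A * (e / 2 / A * `|s|) <= _).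
  apply: ler_pM; rewrite ?nc_ge0 ?lerDl//; exact: h2.
by rewrite mulrA mulrCA divff ?gt_eqF// mulr1.
Qed.

Lemma cder_line z u (t : R) : cder (fun s : R => z + s%:C * u) u t.
Proof.
apply/cderP => e e0; exists 1 => // s _.
by rewrite (_ : _ - _ - _ = 0) ?nc0 ?mulr_ge0 ?(ltW e0)// rmorphD /=; ring.
Qed.

Lemma hol_line D F F' z u (t : R) : hol D F F' -> D (z + t%:C * u) ->
  cder (fun s : R => F (z + s%:C * u)) (F' (z + t%:C * u) * u) t.
Proof. by move=> hF Dz; apply: hol_curve hF Dz (cder_line z u t). Qed.

End Holomorphic.

(** * Mean value property and maximum modulus *)

Section MeanValue.
Context {R : realType}.
Implicit Types (F G : R[i] -> R[i]) (D : set R[i]) (z a u : R[i]).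

Lemma hol_ball D F F' a : hol D F F' -> D a ->
  exists2 d : R, 0 < d & hol [set z | nc (z - a) < d] F F'.
Proof.
move=> hF Da; have [C [d [d0 hd]]] := hF a Da; exists d => // z /= zd.
exists C, (Num.min d (d - nc (z - a))); rewrite lt_min d0 subr_gt0 zd; split=> // x h.
rewrite !lt_min => /andP[_ xz] /andP[hh _]; apply: hd => //.
rewrite (_ : x - a = (x - z) + (z - a)); last by ring.
by apply: le_lt_trans (ncD _ _) _; rewrite -ltrBrDr.
Qed.

(** On the circle of radius [r] the radial derivative of [F] is the angular one divided by [i r],
    and the latter integrates to 0 over a full turn. The mean is therefore constant in [r] and
    equals its limit at radius 0. The direction [u] fixes where the parametrisation starts. *)
Lemma mean_value D F F' a u : hol D F F' -> D a -> nc u = 1 ->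
  exists2 d : R, 0 < d & forall r, 0 < r < d ->
    ccont (fun t => F (a + r%:C * (u * expi t))) /\
    prim (fun t => F (a + r%:C * (u * expi t))) (pi *+ 2) = (pi *+ 2)%:C * F a.
Proof.
move=> hF Da u1; have [d1 d10 hb] := hol_ball hF Da.
have [C [d2 [d20 hd]]] := hF a Da.
pose d := Num.min d1 d2; have d0 : 0 < d by rewrite lt_min d10.
have dd1 : d <= d1 by rewrite ge_min lexx.
have dd2 : d <= d2 by rewrite ge_min lexx orbT.
clearbody d; pose g (r t : R) := a + r%:C * (u * expi t).
have gr r t : 0 < r -> nc (g r t - a) = r.
  by move=> r0; rewrite /g addrAC subrr add0r !ncM u1 nc_expi nc_real gtr0_norm// !mulr1.
pose f (r t : R) := F (g r t).
have dg r t : cder (g r) (r%:C * (u * ('i%C * expi t))) t.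
  apply: cder_eq; first exact: cderD (cder_cst a t) (cderZ _ (cderZ _ (cder_expi t))).
  by rewrite add0r.
have df r t : 0 < r < d -> cder (f r) (F' (g r t) * (r%:C * (u * ('i%C * expi t)))) t.
  move=> /andP[r0 rd]; apply: hol_curve hb _ (dg r t).
  by rewrite /= gr// (lt_le_trans rd).
have fc r : 0 < r < d -> ccont (f r).
  by move=> rd; apply: cder_ccont => t; exact: df.
pose p2 : R := pi *+ 2; have p20 : 0 <= p2 by rewrite mulrn_wge0// pi_ge0.
pose phi r := prim (f r) p2.
have C0 : 0 <= C.
  have : 0 <= C * (d2 / 2) ^+ 2.
    have := hd a (d2 / 2)%:C; rewrite subrr nc0 nc_real ger0_norm; last by lra.
    by move=> h; apply: le_trans (nc_ge0 _) (h _ _); lra.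
  by rewrite pmulr_lge0// exprn_gt0// divr_gt0.
have step r s : 0 < r < d -> 0 < r + s < d -> `|s| < d ->
    nc (phi (r + s) - phi r) <= 2 * (C * `|s| ^+ 2) * p2.
  move=> rd rsd sd; have r0 : 0 < r by case/andP: rd.
  have rn0 : (r%:C : R[i]) != 0 by rewrite -nc_gt0 nc_real normr_gt0 gt_eqF.
  have i0 : ('i%C : R[i]) != 0.
    by rewrite -nc_gt0 nc_sqrtE /= expr0n expr1n add0r sqrtr1.
  (* The last term takes the same value at 0 and 2 pi, so [H] measures the change of the mean, while
     its derivative is the second-order remainder of [F]. *)
  pose H t := prim (f (r + s)) t - prim (f r) t - (s%:C / (r%:C * 'i%C)) * f r t.
  have dH t : cder H (f (r + s) t - f r t - F' (g r t) * (s%:C * (u * expi t))) t.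
    apply: cder_eq.
      exact: cderB (cderB (primP t (fc _ rsd)) (primP t (fc _ rd))) (cderZ _ (df r t rd)).
    by congr (_ - _); field; rewrite rn0 i0.
  have := cder_bound (K := C * `|s| ^+ 2) p20 (fun t _ => dH t).
  rewrite subr0 /H !prim0 /f /g /p2 expi2pi -/(g _ _).
  rewrite -/(f _ _) -/p2 -/(phi _) -/(phi _).
  rewrite (_ : _ - _ - _ - _ = phi (r + s) - phi r); last by rewrite /phi /f /g; ring.
  apply => t _; have := hd (g r t) (s%:C * (u * expi t)).
  rewrite gr// !ncM u1 nc_expi nc_real !mulr1.
  have -> : g r t + s%:C * (u * expi t) = g (r + s) t by rewrite /g rmorphD /=; ring.
  apply; last exact: lt_le_trans sd dd2.
  by case/andP: rd => _ rd; exact: lt_le_trans dd2.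
have phi_cst r r' : 0 < r -> r <= r' -> r' < d -> phi r' = phi r.
  move=> r0 rr rd; apply: cder0_cst => // t /andP[t1 t2].
  have t0 : 0 < t by exact: lt_le_trans t1.
  have td : t < d by exact: le_lt_trans rd.
  apply/cderP => e e0; pose B := 2 * C * p2 + 1.
  have B0 : 0 < B by rewrite ltr_wpDl// !mulr_ge0.
  exists (Num.min (Num.min d (e / B)) (Num.min t (d - t))).
    by rewrite !lt_min d0 divr_gt0// t0 subr_gt0 td.
  move=> s; rewrite !lt_min => /andP[/andP[s1 s2] /andP[s3 s4]].
  rewrite mul0r subr0; apply: le_trans (step t s _ _ _) _ => //.
  - by rewrite t0.
  - by apply/andP; split; [have := ler_norm (- s); rewrite normrN|have := ler_norm s]; lra.
  - rewrite ltr_pdivlMr// in s2.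
    rewrite expr2 (_ : _ * p2 = (2 * C * p2) * `|s| * `|s|); last by ring.
    rewrite ler_wpM2r//; apply/ltW; apply: le_lt_trans s2.
    by rewrite mulrC ler_wpM2l// lerDl.
exists d => // r /andP[r0 rd]; split; first by apply: fc; rewrite r0.
rewrite -/(f r) -/p2 -/(phi r); apply/eqP; rewrite -subr_eq0; apply/eqP.
apply: small_eq0 => e e0; pose e' := e / (2 * p2 + 1).
have q0 : 0 < 2 * p2 + 1 by rewrite ltr_wpDl// mulr_ge0.
have e'0 : 0 < e' by rewrite divr_gt0.
have [d3 d30 h3] := hol_cont hF Da e'0.
pose s := Num.min r d3 / 2.
have s0 : 0 < s by rewrite divr_gt0// lt_min r0.
have sr : s <= r.
  have : Num.min r d3 <= r by rewrite ge_min lexx.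
  by rewrite /s; lra.
have s3 : s < d3.
  have : Num.min r d3 <= d3 by rewrite ge_min lexx orbT.
  by rewrite /s; lra.
rewrite (phi_cst s r)//.
have sd : 0 < s < d by rewrite s0 (le_lt_trans sr).
have dH t : cder (fun t => prim (f s) t - t%:C * F a) (f s t - F a) t.
  apply: cderB (primP t (fc _ sd)) _; apply: cder_eq.
    exact: cderM (cder_real (is_derive_id t (1 : R))) (cder_cst _ t).
  by rewrite mulr0 addr0 mul1r.
have := cder_bound (K := e') p20 (fun t _ => dH t).
rewrite prim0 mul0r !subr0 => h; apply: le_lt_trans (h _) _.
  by move=> t _; apply/ltW/h3; rewrite gr.
rewrite (_ : _ * p2 = e * (2 * p2 / (2 * p2 + 1))); last by rewrite /e'; ring.
by rewrite gtr_pMr// ltr_pdivrMr// mul1r ltrDl.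
Qed.

(** With [u] pointing away from the origin, the angle pi on the circle is the point of the ray
    through [a] that is closer to 0. By the mean value property the real part of conj(F a) F attains
    its upper bound |F a|^2 on the whole circle. *)
Lemma max_modulus_ray D F F' a : hol D F F' -> D a -> a != 0 ->
  (forall z, nc (F z) <= nc (F a)) ->
  exists2 s : R, 0 < s < 1 & nc (F ((1 - s)%:C * a)) = nc (F a).
Proof.
move=> hF Da a0 hmax; have na : 0 < nc a by rewrite nc_gt0.
pose u := a / (nc a)%:C.
have u1 : nc u = 1.
  by rewrite ncM ncV nc_real ger0_norm ?nc_ge0// divff// gt_eqF.
have [d d0 hd] := mean_value hF Da u1.
pose r := Num.min d (nc a) / 2.
have r0 : 0 < r by rewrite divr_gt0// lt_min d0.
have rd : r < d.
  have : Num.min d (nc a) <= d by rewrite ge_min lexx.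
  by move: r0; rewrite /r; lra.
have ra : r < nc a.
  have : Num.min d (nc a) <= nc a by rewrite ge_min lexx orbT.
  by move: r0; rewrite /r; lra.
clearbody r; have [|fc P2] := hd r; first by rewrite r0.
set f := (fun t => _) in fc P2; set M := nc (F a).
exists (r / nc a); first by rewrite divr_gt0//= ltr_pdivrMr// mul1r.
have fpi : f pi = F ((1 - r / nc a)%:C * a).
  rewrite /f expipi; congr F; rewrite rmorphB rmorphM fmorphV /= /u.
  by field; rewrite -nc_gt0 nc_real normr_gt0 gt_eqF.
rewrite -fpi; apply/eqP; rewrite eq_le hmax /=.
pose G t := re ((F a)^*%C * prim f t).
have dG t : is_derive t (1 : R) G (re ((F a)^*%C * f t)).
  by have [] := cderZ (F a)^*%C (primP t fc).
(* [H] is nondecreasing and vanishes at 0 and at 2 pi, hence in between; so its derivative at pi is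
   0. *)
pose H t := t * M ^+ 2 - G t.
have dH t : is_derive t (1 : R) H (M ^+ 2 - re ((F a)^*%C * f t)).
  apply: is_deriveB; apply: is_derive_ext (is_deriveM (is_derive_id t (1 : R)) (is_derive_cst (M ^+ 2) t (1 : R))) _ _ => //=.
  by rewrite /GRing.scale /= mulr0 add0r mulr1.
have ncJ (x : R[i]) : nc x^*%C = nc x by rewrite !nc_sqrtE re_conj im_conj sqrrN.
have reM2 t : re ((F a)^*%C * f t) <= M ^+ 2.
  apply: le_trans (ler_norm _) _; apply: le_trans (nc_re _) _.
  by rewrite ncM ncJ expr2 ler_wpM2l ?nc_ge0// hmax.
have mono x y : x <= y -> H x <= H y.
  move=> xy; rewrite -subr_ge0 -(subrr (0 : R)).
  apply: (le_derive xy (fun t _ => is_derive_cst (0 : R) t (1 : R)) (fun t _ => dH t)).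
  by move=> t _; rewrite subr_ge0.
have H0 : H 0 = 0 by rewrite /H /G prim0 mulr0 mul0r subrr.
have H2 : H (pi *+ 2) = 0.
  rewrite /H /G P2.
  have -> : (F a)^*%C * ((pi *+ 2)%:C * F a) = (pi *+ 2 * M ^+ 2)%:C.
    by rewrite mulrCA (mulrC (F a)^*%C) mul_conj -rmorphM.
  by rewrite /= subrr.
have Hz t : 0 <= t <= pi *+ 2 -> H t = 0.
  move=> /andP[t0 t2]; apply/eqP; rewrite eq_le -{1}H2 -{1}H0 !mono//.
have : M ^+ 2 - re ((F a)^*%C * f pi) = 0.
  have /is_deriveP hp := dH pi.
  set v := _ - _ in hp *; apply/eqP; rewrite -normr_le0; apply/ler_addgt0Pr => e e0; rewrite add0r.
  have [del del0 hdel] := hp e e0.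
  pose s := Num.min del pi / 2.
  have p0 : 0 < pi :> R by exact: pi_gt0.
  have s0 : 0 < s by rewrite divr_gt0// lt_min del0.
  have sdel : s < del.
    have : Num.min del pi <= del by rewrite ge_min lexx.
    by move: s0; rewrite /s; lra.
  have sp : s < pi.
    have : Num.min del pi <= pi by rewrite ge_min lexx orbT.
    by move: s0; rewrite /s; lra.
  clearbody s; have := hdel s; rewrite gtr0_norm// => /(_ sdel).
  rewrite !Hz ?pi_ge0//; last 2 first.
    by rewrite mulr2n lerDl ltW.
    by rewrite mulr2n lerD2l !ltW// addr_gt0.
  by rewrite subrr sub0r normrN normrM (gtr0_norm s0) ler_pM2r.
move=> /eqP; rewrite subr_eq0 => /eqP hM.
have : M * M <= M * nc (f pi).
  rewrite -expr2 hM; apply: le_trans (ler_norm _) _; apply: le_trans (nc_re _) _.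
  by rewrite ncM ncJ.
have [M0|M0] := eqVneq M 0; first by rewrite M0 nc_ge0.
by rewrite ler_pM2l// lt_neqAle eq_sym M0 nc_ge0.
Qed.

End MeanValue.

Section Liouville.
Context {R : realType}.
Variable tau : R[i].
Hypothesis tau_gt0 : 0 < im tau.

Lemma periodic_int (F : R[i] -> R[i]) v : (forall z, F (z + v) = F z) ->
  forall z (n : int), F (z + n%:~R * v) = F z.
Proof.
move=> hF z [n|n].
  elim: n z => [|n IH] z; first by rewrite mul0r addr0.
  rewrite -[RHS](IH z) -[RHS]hF; congr F.
  by rewrite -addn1 PoszD intrD /=; ring.
rewrite NegzE; elim: n z => [|n IH] z; first by rewrite -[LHS]hF; congr F; ring.
rewrite -[RHS](IH z) -[LHS](hF); congr F.
by rewrite -[n.+2]addn1 PoszD opprD intrD /=; ring.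
Qed.

Definition coord (p : R * R) : R[i] := p.1%:C + p.2%:C * tau.

Lemma coord_onto z : exists p, z = coord p.
Proof.
exists (re z - im z / im tau * re tau, im z / im tau); rewrite /coord.
apply: complexP; rewrite !(reD, imD, reM, imM) /= ?mul0r ?subr0 ?addr0 ?add0r.
  by rewrite subrK.
by rewrite divfK// gt_eqF.
Qed.

Lemma continuous_coord (F : R[i] -> R[i]) :
  (forall z (e : R), 0 < e -> exists2 d : R, 0 < d & forall x, nc (x - z) < d -> nc (F x - F z) < e) ->
  continuous (fun p => nc (F (coord p)) : R).
Proof.
move=> Fc p; apply/cvgrPdist_lt => e e0.
have [d d0 hd] := Fc (coord p) e e0.
have k0 : 0 < 1 + nc tau by rewrite ltr_pwDl// nc_ge0.
have r0 : 0 < d / (1 + nc tau) by rewrite divr_gt0.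
apply: filterS (nbhsx_ballx p _ r0) => q [/= q1 q2]; rewrite /ball /= in q1 q2.
have : nc (F (coord q) - F (coord p)) < e.
  apply: hd; rewrite (_ : _ - _ = (q.1 - p.1)%:C + (q.2 - p.2)%:C * tau); last first.
    by rewrite /coord !rmorphB /=; ring.
  apply: le_lt_trans (ncD _ _) _; rewrite ncM !nc_real (distrC q.1) (distrC q.2).
  have q2' : `|p.2 - q.2| * nc tau <= d / (1 + nc tau) * nc tau.
    by rewrite ler_wpM2r ?nc_ge0// ltW.
  rewrite (_ : d = d / (1 + nc tau) + d / (1 + nc tau) * nc tau); first exact: ltr_leD.
  by field; rewrite gt_eqF.
apply: le_lt_trans; rewrite ler_norml; apply/andP; split.
  by rewrite lerNl opprB; exact: ncBl.
by rewrite ncBC; exact: ncBl.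
Qed.

(** Among the maximum points of |F| in a compact parallelogram, one closest to 0 is chosen. If the
    maximum is positive, this point lies in [D] and differs from 0, and by [max_modulus_ray] the
    maximum is attained again strictly closer to 0. *)
Lemma liouville (D : set R[i]) (F F' : R[i] -> R[i]) :
  (forall z, F (z + 1) = F z) -> (forall z, F (z + tau) = F z) ->
  hol D F F' -> (forall z, ~ D z -> F z = 0) ->
  (forall z, ~ D z -> forall e : R, 0 < e -> exists2 d : R, 0 < d &
     forall x, nc (x - z) < d -> nc (F x) < e) ->
  ~ D 0 -> forall z, F z = 0.
Proof.
move=> F1 Ft hF F0 Fc D0.
have Fcont z (e : R) : 0 < e ->
    exists2 d : R, 0 < d & forall x, nc (x - z) < d -> nc (F x - F z) < e.
  move=> e0; have [Dz|Dz] := pselect (D z); first exact: hol_cont hF Dz e e0.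
  by have [d d0 hd] := Fc z Dz e e0; exists d => // x /hd; rewrite (F0 z)// subr0.
have gc := continuous_coord Fcont.
set g := (fun p => _) in gc.
(* This square of coordinates contains a full cell and is star-shaped about 0, so that moving
   towards 0 does not leave it. *)
pose K : set (R * R) := `[(-1 : R), 1] `*` `[(-1 : R), 1].
have cK : compact K by apply: compact_setX; exact: segment_compact.
have K0 : K !=set0 by exists (0, 0); split => /=; rewrite in_itv /= lerN10 ler01.
have [p /[!inE] pK pmax] := compact_EVT_max K0 cK (continuous_subspaceT gc).
have Fmax z : nc (F z) <= g p.
  have [q ->] := coord_onto z.
  pose q' : R * R := (q.1 - (Num.floor q.1)%:~R, q.2 - (Num.floor q.2)%:~R).
  have q'K : K q'.
    split; rewrite /= in_itv /=.
      have := floor_itv q.1 (R := R); rewrite intrD => /andP[]; lra.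
    have := floor_itv q.2 (R := R); rewrite intrD => /andP[]; lra.
  have := pmax q'; rewrite inE => /(_ q'K); congr (nc _ <= _).
  rewrite -[RHS](periodic_int F1 _ (- Num.floor q.1)) -[RHS](periodic_int Ft _ (- Num.floor q.2)).
  congr F; rewrite /coord /q' /= !rmorphB /= !rmorphN /=.
  have ri (n : int) : ((n%:~R : R)%:C : R[i]) = n%:~R by rewrite rmorph_int.
  by rewrite !ri; ring.
move=> z; apply/eqP; rewrite -nc_eq0 eq_le nc_ge0 andbT; apply: le_trans (Fmax z) _.
have [//|M0] := leP (g p) 0; exfalso.
pose A := K `&` g @^-1` [set g p].
have cA : compact A.
  apply: compact_closedI => //; apply: closed_comp; first by move=> x _; exact: gc.
  exact: closed_eq.
have A0 : A !=set0 by exists p.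
have hc : continuous (fun q => nc (coord q) : R).
  apply: (@continuous_coord id) => x e e0; by exists e.
have [a /[!inE] -[aK aM] amin] := compact_EVT_min A0 cA (continuous_subspaceT hc).
have Fa : nc (F (coord a)) = g p by exact: aM.
have Da : D (coord a).
  by apply: contrapT => /F0 E; move: M0; rewrite -Fa E nc0 ltxx.
have a0 : coord a != 0 by apply/eqP => E; rewrite E in Da.
have [|s /andP[s0 s1] Es] := max_modulus_ray hF Da a0; first by move=> x; rewrite Fa.
pose b : R * R := ((1 - s) * a.1, (1 - s) * a.2).
have bE : coord b = (1 - s)%:C * coord a by rewrite /coord /b /= !rmorphM /=; ring.
have bA : A b.
  split; last by rewrite /preimage /= /g bE Es.
  have sc x : -1 <= x <= 1 -> -1 <= (1 - s) * x <= 1.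
    move=> x1; rewrite -ler_norml normrM; rewrite -ler_norml in x1.
    by rewrite mulr_ile1// ger0_norm; lra.
  by case: aK => /=; rewrite !in_itv /= => a1 a2; split; rewrite /= in_itv /= sc.
have := amin b; rewrite inE => /(_ bA); rewrite bE ncM nc_real ger0_norm; last by lra.
by rewrite leNgt gtr_pMl ?nc_gt0// => /negP; apply; lra.
Qed.

End Liouville.

(** * The Weierstrass function *)
Section WeierstrassEquations.
Context {R : realType}.
Variable tau : R[i].
Hypothesis tau_gt0 : 0 < im tau.
Implicit Types (z w h : R[i]) (F G B : R[i] -> R[i]) (L : set R[i]).

Local Notation lat := (lat tau).
Local Notation c := (lat_const tau_gt0).
Local Notation Esum := (Esum tau).
Local Notation E := (E tau).
Local Notation Lam := (lattice tau).

(** The point 0 is excluded here and in [bnd0], since the value of [E k] at its pole carries no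
    meaning. *)
Definition tends0 F := forall e : R, 0 < e ->
  exists2 d : R, 0 < d & forall z, z != 0 -> nc z < d -> nc (F z) < e.

Definition bnd0 B := exists M d : R, 0 < d /\ forall z, z != 0 -> nc z < d -> nc (B z) <= M.

Lemma bnd0_cst a : bnd0 (fun=> a).
Proof. by exists (nc a), 1. Qed.

Lemma bnd0_id : bnd0 id.
Proof. by exists 1, 1; split=> // z _ /ltW. Qed.

Lemma bnd0D B1 B2 : bnd0 B1 -> bnd0 B2 -> bnd0 (fun z => B1 z + B2 z).
Proof.
move=> [M1 [d1 [d10 h1]]] [M2 [d2 [d20 h2]]]; exists (M1 + M2), (Num.min d1 d2).
rewrite lt_min d10; split=> // z z0; rewrite lt_min => /andP[z1 z2].
by apply: le_trans (ncD _ _) _; rewrite lerD ?h1 ?h2.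
Qed.

Lemma bnd0M B1 B2 : bnd0 B1 -> bnd0 B2 -> bnd0 (fun z => B1 z * B2 z).
Proof.
move=> [M1 [d1 [d10 h1]]] [M2 [d2 [d20 h2]]]; exists (M1 * M2), (Num.min d1 d2).
rewrite lt_min d10; split=> // z z0; rewrite lt_min => /andP[z1 z2].
by rewrite ncM; apply: ler_pM; rewrite ?nc_ge0 ?h1 ?h2.
Qed.

Lemma bnd0N B : bnd0 B -> bnd0 (fun z => - B z).
Proof. by move=> [M [d [d0 h]]]; exists M, d; split=> // z z0 zd; rewrite ncN h. Qed.

Lemma bnd0X B n : bnd0 B -> bnd0 (fun z => B z ^+ n).
Proof.
move=> hB; elim: n => [|n IH].
  by have := bnd0_cst 1; congr bnd0; apply/funext => z; rewrite expr0.
by have := bnd0M hB IH; congr bnd0; apply/funext => z; rewrite exprS.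
Qed.

Lemma tends0M F B (d0 : R) : 0 < d0 -> bnd0 B ->
  (forall z, z != 0 -> nc z < d0 -> F z = z * B z) -> tends0 F.
Proof.
move=> d00 [M [d [dp hB]]] hF e e0; pose M' := `|M| + 1.
have M0 : 0 < M' by rewrite ltr_wpDl.
exists (Num.min (Num.min d d0) (e / M')); first by rewrite !lt_min dp d00 divr_gt0.
move=> z z0; rewrite !lt_min => /andP[/andP[z1 z2] z3].
rewrite hF// ncM; rewrite ltr_pdivlMr// in z3; apply: le_lt_trans z3.
rewrite ler_wpM2l ?nc_ge0//; apply: le_trans (hB z z0 z1) _.
by apply: le_trans (ler_norm _) _; rewrite lerDl.
Qed.

(** Normalised Taylor remainders. With them [E 2], [E 3] and [E 4] have exact expressions near 0,
    and the cancellation of poles becomes an identity of rational functions. *)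
Definition rem2 z := (Esum 2 z - g2 tau / 20 * z ^+ 2 - g3 tau / 28 * z ^+ 4) / z ^+ 5.
Definition rem3 z := (Esum 3 z + g2 tau / 20 * z + g3 tau / 14 * z ^+ 3) / z ^+ 4.
Definition rem4 z := (Esum 4 z - g2 tau / 60) / z.

Lemma quotient_bnd0 F n (C : R) : (forall z, 2 * nc z <= c -> nc (F z) <= C * nc z ^+ n) ->
  bnd0 (fun z => F z / z ^+ n).
Proof.
move=> h; have c0 := lat_const_gt0 tau_gt0; exists C, (c / 2); split; first by rewrite divr_gt0.
move=> z z0 zc; rewrite ncM ncV ncX ler_pdivrMr ?exprn_gt0 ?nc_gt0//; apply: h.
by rewrite mulrC -ler_pdivlMr// ltW.
Qed.

Lemma rem2_bnd0 : bnd0 rem2.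
Proof. by have [C h] := Esum2_expansion tau_gt0; exact: quotient_bnd0 h. Qed.
Lemma rem3_bnd0 : bnd0 rem3.
Proof. by have [C h] := Esum3_expansion tau_gt0; exact: quotient_bnd0 h. Qed.
Lemma rem4_bnd0 : bnd0 rem4.
Proof.
have [C h] := Esum4_expansion tau_gt0.
have h' z : 2 * nc z <= c -> nc (Esum 4 z - g2 tau / 60) <= C * nc z ^+ 1.
  by rewrite expr1; exact: h.
by have := quotient_bnd0 h'; congr bnd0; apply/funext => z; rewrite expr1.
Qed.

Lemma E2_near0 z : z != 0 ->
  E 2 z = z ^- 2 + g2 tau / 20 * z ^+ 2 + g3 tau / 28 * z ^+ 4 + z ^+ 5 * rem2 z.
Proof. by move=> z0; rewrite /E /rem2; field. Qed.
Lemma E3_near0 z : z != 0 ->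
  E 3 z = z ^- 3 - g2 tau / 20 * z - g3 tau / 14 * z ^+ 3 + z ^+ 4 * rem3 z.
Proof. by move=> z0; rewrite /E /rem3; field. Qed.
Lemma E4_near0 z : z != 0 -> E 4 z = z ^- 4 + g2 tau / 60 + z * rem4 z.
Proof. by move=> z0; rewrite /E /rem4; field. Qed.

Lemma open_lattice_compl : open (~` Lam).
Proof.
apply/open_nc => z zL; have c0 := lat_const_gt0 tau_gt0.
have zL' m n : z != lat m n by apply/eqP => zE; apply: zL; exists m, n.
have [|d d0 hd] := far_from_lattice tau_gt0 (z := z); first by move=> m n _.
have z0 : 0 < nc z.
  by rewrite nc_gt0; have := zL' 0 0; rewrite /lat mul0r addr0.
exists (Num.min (nc z) (d * c)); first by rewrite lt_min z0 mulr_gt0.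
move=> x; rewrite lt_min => /andP[x1 x2] [m [n xE]].
rewrite -[_ + _]/(lat m n) in xE.
have [nz|] := boolP (nonzero m n); last first.
  rewrite /nonzero negb_or !negbK => /andP[/eqP m0 /eqP n0].
  by move: x1; rewrite xE m0 n0 /lat mul0r addr0 subr0 ltxx.
have := hd m n nz; rewrite -xE leNgt => /negP; apply; apply: lt_le_trans x2 _.
by rewrite ler_pM2l// xE lat_ge_const.
Qed.

Lemma lattice_sub z w : Lam z -> Lam w -> Lam (z - w).
Proof.
move=> [m [n ->]] [m' [n' ->]]; exists (m - m'), (n - n').
by rewrite !rmorphB /=; ring.
Qed.

Lemma lattice0 : Lam 0. Proof. by exists 0, 0; rewrite mul0r addr0. Qed.
Lemma lattice1 : Lam 1. Proof. by exists 1, 0; rewrite mul0r addr0. Qed.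
Lemma lattice_tau : Lam tau. Proof. by exists 0, 1; rewrite mul1r add0r. Qed.
Lemma lattice_opp z : Lam z -> Lam (- z).
Proof. by move=> h; rewrite -sub0r; exact: lattice_sub lattice0 h. Qed.
Lemma lattice_add z w : Lam z -> Lam w -> Lam (z + w).
Proof. by move=> hz /lattice_opp hw; rewrite -[w]opprK; exact: lattice_sub. Qed.

Lemma E_lattice k z w : (1 < k)%N -> ~ Lam z -> Lam w -> E k (z + w) = E k z.
Proof.
move=> k1 zL [m [n ->]].
pose F x := if pselect (Lam x) then 0 else E k x.
have FE x : ~ Lam x -> F x = E k x by rewrite /F; case: pselect.
have per v : v = 1 \/ v = tau -> forall x, F (x + v) = F x.
  move=> hv x; have vL : Lam v by case: hv => ->; [exact: lattice1|exact: lattice_tau].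
  rewrite /F; case: pselect => h1; case: pselect => h2 //.
  - by case: h2; rewrite -(addrK v x); exact: lattice_sub.
  - by case: h1; exact: lattice_add.
  - exact: E_period.
have wL : Lam (m%:~R + n%:~R * tau) by exists m, n.
rewrite -!FE//; last by move=> h; apply: zL; rewrite -(addrK (m%:~R + n%:~R * tau) z); exact: lattice_sub.
rewrite addrA (periodic_int (per tau (or_intror erefl))).
by rewrite -[X in F (z + X)]mulr1 (periodic_int (per 1 (or_introl erefl))).
Qed.

(** [G] is extended by 0 to [L], where [tends0] provides continuity, and Liouville's theorem
    applies. [L] may be larger than the lattice; this is used for the product formula at a
    half-period. *)
Lemma elliptic_zero L G G' : L 0 -> L 1 -> L tau ->
  (forall z w, L z -> L w -> L (z - w)) -> open (~` L) -> hol (~` L) G G' ->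
  (forall z w, ~ L z -> L w -> G (z + w) = G z) -> tends0 G ->
  forall z, ~ L z -> G z = 0.
Proof.
move=> L0 L1 Lt Lsub oL hG Gper G0.
have Ladd z w : L z -> L w -> L (z + w).
  by move=> hz hw; rewrite -[w]opprK -[- w]sub0r; apply: (Lsub _ _ hz); exact: Lsub.
pose F x := if pselect (L x) then 0 else G x.
have FE x : ~ L x -> F x = G x by rewrite /F; case: pselect.
have F0 x : L x -> F x = 0 by rewrite /F; case: pselect.
have per w : L w -> forall x, F (x + w) = F x.
  move=> Lw x; rewrite /F; case: pselect => h1; case: pselect => h2 //.
  - by case: h2; rewrite -(addrK w x); exact: Lsub.
  - by case: h1; exact: Ladd.
  - exact: Gper.
suff H z : F z = 0 by move=> z zL; rewrite -FE.
apply: (liouville tau_gt0 (D := ~` L) (F' := G')); try exact: per.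
- by apply: hol_near oL hG _ => x /FE.
- by move=> x /contrapT; exact: F0.
- move=> x /contrapT Lx e e0; have [d d0 hd] := G0 e e0; exists d => // y yx.
  have [Ly|Ly] := pselect (L y); first by rewrite F0// nc0.
  rewrite -[y](subrK x) per// FE; last by move=> h; apply: Ly; rewrite -(subrK x y); exact: Ladd.
  apply: hd => //; apply/eqP => E0; apply: Ly.
  by move/eqP: E0; rewrite subr_eq0 => /eqP ->.
- by apply.
Qed.

Lemma E_hol k : (0 < k)%N -> hol (~` Lam) (E k) (fun z => - k%:R * E k.+1 z).
Proof. exact: lattice_hol. Qed.

(** This is wp'' = 6 wp^2 - g2 / 2: the difference of the two sides is elliptic, and near 0 it is
    [z] times a bounded function. *)
Lemma wp_second z : ~ Lam z -> 6 * E 4 z = 6 * E 2 z ^+ 2 - g2 tau / 2.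
Proof.
pose G z := 6 * E 4 z - 6 * (E 2 z * E 2 z) + g2 tau / 2.
move=> zL; apply/eqP; rewrite -subr_eq0; apply/eqP.
rewrite (_ : _ - _ = G z); last by rewrite /G; ring.
have [G' hG] : exists G', hol (~` Lam) G G'.
  have e2 := E_hol (k := 2) isT; have e4 := E_hol (k := 4) isT.
  eexists; apply: hol_eq; first exact: (holD (holD (holZ 6 e4) (holZ (-6) (holM e2 e2))) (@hol_cst _ _ (g2 tau / 2))).
    by move=> x; rewrite /G; ring.
  by [].
apply: (elliptic_zero lattice0 lattice1 lattice_tau lattice_sub open_lattice_compl hG) => //.
- by move=> x w xL wL; rewrite /G !E_lattice.
- pose s2 z := g2 tau / 20 + g3 tau / 28 * z ^+ 2 + z ^+ 3 * rem2 z.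
  (* The quotient of [G] by [z]. The poles have cancelled, and so have the constants, since g2
     occurs with the coefficient 6 / 60 - 12 / 20 + 1 / 2 = 0. *)
  pose B z := 6 * rem4 z - 12 * z * (g3 tau / 28 + z * rem2 z) - 6 * z ^+ 3 * s2 z ^+ 2.
  have bs2 : bnd0 s2.
    apply: bnd0D; first apply: bnd0D; first exact: bnd0_cst.
      by apply: bnd0M; [exact: bnd0_cst|exact: bnd0X bnd0_id].
    by apply: bnd0M; [exact: bnd0X bnd0_id|exact: rem2_bnd0].
  apply: (@tends0M G B 1 ltr01).
    apply: bnd0D; first apply: bnd0D.
    + by apply: bnd0M; [exact: bnd0_cst|exact: rem4_bnd0].
    + apply: bnd0N; apply: bnd0M; first by apply: bnd0M; [exact: bnd0_cst|exact: bnd0_id].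
      apply: bnd0D; first exact: bnd0_cst.
      by apply: bnd0M; [exact: bnd0_id|exact: rem2_bnd0].
    + apply: bnd0N; apply: bnd0M; last exact: bnd0X.
      by apply: bnd0M; [exact: bnd0_cst|exact: bnd0X bnd0_id].
  move=> x x0 _; rewrite /G /B /s2 E2_near0// E4_near0//; field; exact: x0.
Qed.

(** This is wp'^2 = 4 wp^3 - g2 wp - g3, by the same comparison at the origin. *)
Lemma wp_first z : ~ Lam z ->
  (-2 * E 3 z) ^+ 2 = 4 * E 2 z ^+ 3 - g2 tau * E 2 z - g3 tau.
Proof.
pose G z := 4 * (E 3 z * E 3 z) - 4 * (E 2 z * (E 2 z * E 2 z)) + g2 tau * E 2 z + g3 tau.
move=> zL; apply/eqP; rewrite -subr_eq0; apply/eqP.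
rewrite (_ : _ - _ = G z); last by rewrite /G; ring.
have [G' hG] : exists G', hol (~` Lam) G G'.
  have e2 := E_hol (k := 2) isT; have e3 := E_hol (k := 3) isT.
  eexists; apply: hol_eq; first exact: (holD (holD (holD (holZ 4 (holM e3 e3)) (holZ (-4) (holM e2 (holM e2 e2)))) (holZ (g2 tau) e2)) (@hol_cst _ _ (g3 tau))).
    by move=> x; rewrite /G; ring.
  by [].
apply: (elliptic_zero lattice0 lattice1 lattice_tau lattice_sub open_lattice_compl hG) => //.
- by move=> x w xL wL; rewrite /G !E_lattice.
- pose s2 z := g2 tau / 20 + g3 tau / 28 * z ^+ 2 + z ^+ 3 * rem2 z.
  pose s3 z := - (g2 tau / 20) - g3 tau / 14 * z ^+ 2 + z ^+ 3 * rem3 z.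
  pose B z := 8 * rem3 z - 12 * rem2 z + 4 * z * s3 z ^+ 2 - 12 * z * s2 z ^+ 2
     - 4 * z ^+ 5 * s2 z ^+ 3 + g2 tau * z * s2 z.
  have bs2 : bnd0 s2.
    apply: bnd0D; first apply: bnd0D; first exact: bnd0_cst.
      by apply: bnd0M; [exact: bnd0_cst|exact: bnd0X bnd0_id].
    by apply: bnd0M; [exact: bnd0X bnd0_id|exact: rem2_bnd0].
  have bs3 : bnd0 s3.
    apply: bnd0D; first apply: bnd0D; first exact: bnd0_cst.
      by apply: bnd0N; apply: bnd0M; [exact: bnd0_cst|exact: bnd0X bnd0_id].
    by apply: bnd0M; [exact: bnd0X bnd0_id|exact: rem3_bnd0].
  have mon a n : bnd0 (fun z => a * z ^+ n).
    by apply: bnd0M; [exact: bnd0_cst|exact: bnd0X bnd0_id].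
  apply: (@tends0M G B 1 ltr01).
    do 4?apply: bnd0D.
    + apply: bnd0D; first by apply: bnd0M; [exact: bnd0_cst|exact: rem3_bnd0].
      by apply: bnd0N; apply: bnd0M; [exact: bnd0_cst|exact: rem2_bnd0].
    + by apply: bnd0M; [exact: (mon _ 1)|exact: bnd0X].
    + by apply: bnd0N; apply: bnd0M; [exact: (mon _ 1)|exact: bnd0X].
    + by apply: bnd0N; apply: bnd0M; [exact: mon|exact: bnd0X].
    + by apply: bnd0M; [exact: (mon _ 1)|].
  move=> x x0 _; rewrite /G /B /s2 /s3 E2_near0// E3_near0//; field; exact: x0.
Qed.

End WeierstrassEquations.

(** * Linear differential equations *)
Section LinearODE.
Context {R : realType}.
Implicit Types (f q y F : R -> R[i]) (x t : R).

Lemma ccont_cst (a : R[i]) : ccont (fun _ : R => a).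
Proof. by split => t; exact: cvg_cst. Qed.

Lemma ccontD f y : ccont f -> ccont y -> ccont (fun t => f t + y t).
Proof.
move=> [f1 f2] [y1 y2]; split => t.
  have -> : (fun t => re (f t + y t)) = (fun t => re (f t) + re (y t)) by apply/funext => s; rewrite reD.
  by apply: cvgD; [exact: f1|exact: y1].
have -> : (fun t => im (f t + y t)) = (fun t => im (f t) + im (y t)) by apply/funext => s; rewrite imD.
by apply: cvgD; [exact: f2|exact: y2].
Qed.

Lemma ccontN f : ccont f -> ccont (fun t => - f t).
Proof.
move=> [f1 f2]; split => t.
  have -> : (fun t => re (- f t)) = (fun t => - re (f t)) by apply/funext => s; rewrite reN.
  by apply: cvgN; exact: f1.
have -> : (fun t => im (- f t)) = (fun t => - im (f t)) by apply/funext => s; rewrite imN.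
by apply: cvgN; exact: f2.
Qed.

Lemma ccontM f y : ccont f -> ccont y -> ccont (fun t => f t * y t).
Proof.
move=> [f1 f2] [y1 y2]; split => t.
  have -> : (fun t => re (f t * y t)) = (fun t => re (f t) * re (y t) - im (f t) * im (y t)).
    by apply/funext => s; rewrite reM.
  by apply: cvgB; apply: cvgM; [exact: f1|exact: y1|exact: f2|exact: y2].
have -> : (fun t => im (f t * y t)) = (fun t => re (f t) * im (y t) + im (f t) * re (y t)).
  by apply/funext => s; rewrite imM.
by apply: cvgD; apply: cvgM; [exact: f1|exact: y2|exact: f2|exact: y1].
Qed.

Lemma ccontP f : ccont f <-> forall t (e : R), 0 < e ->
  exists2 d : R, 0 < d & forall s, `|s - t| < d -> nc (f s - f t) < e.
Proof.
split=> [[f1 f2] t e e0|h].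
  have e2 : 0 < e / 2 by rewrite divr_gt0.
  have /cvgrPdist_lt/(_ _ e2)/nbhs_ballP[d1 /= d10 h1] := f1 t.
  have /cvgrPdist_lt/(_ _ e2)/nbhs_ballP[d2 /= d20 h2] := f2 t.
  exists (Num.min d1 d2); first by rewrite lt_min d10.
  move=> s; rewrite lt_min distrC => /andP[s1 s2].
  apply: le_lt_trans (nc_le_reim _) _; rewrite !(reD, imD, reN, imN).
  by rewrite (splitr e) ltrD// distrC; [exact: h1|exact: h2].
split=> t; apply/cvgrPdist_lt => e e0; have [d d0 hd] := h t e e0;
  (apply/nbhs_ballP; exists d => // s; rewrite /ball /= distrC => /hd; apply: le_lt_trans).
  by rewrite ncBC -reN -reD nc_re.
by rewrite ncBC -imN -imD nc_im.
Qed.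

Lemma is_derive_exp_scaled (M t : R) : is_derive t (1 : R) (fun s => expR (M * s)) (M * expR (M * t)).
Proof.
have h := is_derive_expR (M * t).
have k : is_derive t (1 : R) (fun s : R => M * s) M.
  apply: is_derive_ext (is_deriveM (is_derive_cst M t (1 : R)) (is_derive_id t (1 : R))) _ _ => //=.
  by rewrite /GRing.scale /= mulr0 addr0 mulr1.
by apply: is_derive_ext (is_derive1_comp h k) _ _ => //; rewrite /GRing.scale /= mulrC.
Qed.

(** In the norm weighted by [expR (M * |t|)], integration from 0 gains a factor [2 / M]; the Picard
    iteration thus contracts on the whole line at once. *)
Lemma antiderivative_exp_bound f F (B M : R) : 0 < M -> F 0 = 0 ->
  (forall t, cder F (f t) t) -> (forall t, nc (f t) <= B * expR (M * `|t|)) ->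
  forall x, nc (F x) <= 2 * B / M * expR (M * `|x|).
Proof.
move=> M0 F0 dF hB.
have B0 : 0 <= B.
  by have := le_trans (nc_ge0 _) (hB 0); rewrite normr0 mulr0 expR0 mulr1.
have pos (f' F' : R -> R[i]) : F' 0 = 0 -> (forall t, cder F' (f' t) t) ->
    (forall t, nc (f' t) <= B * expR (M * `|t|)) ->
    forall x, 0 <= x -> nc (F' x) <= 2 * B / M * expR (M * `|x|).
  move=> F'0 dF' hB' x x0.
  have := @cder_dom R F' f' (fun t => B / M * expR (M * t)) (fun t => B * expR (M * t)) 0 x x0.
  rewrite F'0 subr0 => h; apply: le_trans (h _ _ _) _.
  - by move=> t _; exact: dF'.
  - move=> t _.
    apply: is_derive_ext (is_deriveM (is_derive_cst (B / M) t (1 : R)) (is_derive_exp_scaled M t)) _ _ => //=.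
    by rewrite /GRing.scale /= mulr0 addr0 mulrA divfK// gt_eqF.
  - by move=> t /andP[t0 _]; have := hB' t; rewrite (ger0_norm t0).
  rewrite (ger0_norm x0) -!mulrA ler_pM2l// mulr0 expR0 mulr1 mulrA gerBl.
  by rewrite divr_ge0// ltW.
move=> x; have [x0|x0] := leP 0 x; first exact: (pos f F).
rewrite -[x]opprK normrN; apply: (pos (fun t => - f (- t)) (fun t => F (- t))).
- by rewrite oppr0.
- by move=> t; apply: cder_opp.
- by move=> t; rewrite ncN; have := hB (- t); rewrite normrN.
- by rewrite oppr_ge0 ltW.
Qed.

(** It converts the geometric convergence of the Picard iteration into the rate required by
    [quadratic_limit]. *)
Lemma pow2_quadratic n : ((n.+1) ^ 2 <= 4 * 2 ^ n)%N.
Proof.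
elim: n => // -[//|[//|n IH]]; apply: (@leq_trans (2 * n.+3 ^ 2)).
  by rewrite -!mulnn; nia.
by rewrite (expnS 2 n.+2) mulnCA leq_mul2l.
Qed.

Lemma picard q (K : R) (a b : R[i]) : ccont q -> (forall t, nc (q t) <= K) ->
  exists y y1 : R -> R[i], [/\ y 0 = a, y1 0 = b, forall t, cder y (y1 t) t &
    forall t, cder y1 (q t * y t) t].
Proof.
move=> qc qK.
have K0 : 0 <= K by exact: le_trans (nc_ge0 _) (qK 0).
(* Two integrations and one multiplication by [q] cost [4 * K / M ^+ 2], which is at most 1 / 2 for
   this [M]. *)
pose M := 8 * K + 1.
have M1 : 1 <= M by rewrite /M; lra.
have M0 : 0 < M by rewrite /M; lra.
pose u0 (x : R) := a + x%:C * b.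
have du0 x : cder u0 b x.
  apply: cder_eq; first exact: cderD (cder_cst a x) (cderM (cder_real (is_derive_id x (1 : R))) (cder_cst b x)).
  by rewrite /=; ring.
have cu0 : ccont u0 by apply: cder_ccont du0.
pose T y := fun x => u0 x + prim (prim (fun t => q t * y t)) x.
have cT y : ccont y -> ccont (prim (fun t => q t * y t)).
  by move=> cy; apply: cder_ccont (fun t => primP t (ccontM qc cy)).
have dT y x : ccont y -> cder (T y) (b + prim (fun t => q t * y t) x) x.
  by move=> cy; apply: cderD (du0 x) (primP x (cT y cy)).
have ccT y : ccont y -> ccont (T y) by move=> cy; apply: cder_ccont (fun t => dT y t cy).
have Tbound y z (B : R) : ccont y -> ccont z ->
    (forall t, nc (y t - z t) <= B * expR (M * `|t|)) ->
    forall t, nc (T y t - T z t) <= B / 2 * expR (M * `|t|).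
  move=> cy cz h.
  have h1 t : nc (q t * y t - q t * z t) <= (K * B) * expR (M * `|t|).
    by rewrite -mulrBr ncM -mulrA; apply: ler_pM; rewrite ?nc_ge0.
  have h2 := antiderivative_exp_bound (F := fun x => prim (fun t => q t * y t) x - prim (fun t => q t * z t) x)
    M0 _ (fun t => cderB (primP t (ccontM qc cy)) (primP t (ccontM qc cz))) h1.
  have {}h2 := h2 (ltac:(by rewrite !prim0 subrr)).
  have h3 := antiderivative_exp_bound (F := fun x => prim (prim (fun t => q t * y t)) x - prim (prim (fun t => q t * z t)) x)
    M0 _ (fun t => cderB (primP t (cT y cy)) (primP t (cT z cz))) h2.
  have {}h3 := h3 (ltac:(by rewrite !prim0 subrr)).
  move=> t; rewrite /T (_ : _ - _ = prim (prim (fun t => q t * y t)) t - prim (prim (fun t => q t * z t)) t); last by ring.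
  apply: le_trans (h3 t) _; rewrite ler_wpM2r ?expR_ge0//.
  have B0 : 0 <= B.
    by have := le_trans (nc_ge0 _) (h 0); rewrite normr0 mulr0 expR0 mulr1.
  rewrite (_ : 2 * (2 * (K * B) / M) / M = B * (4 * K / M ^+ 2)); last by field; rewrite gt_eqF.
  rewrite ler_wpM2l// ler_pdivrMr ?exprn_gt0//.
  apply: le_trans (_ : 2^-1 * M <= _); first by rewrite /M; lra.
  by rewrite ler_pM2l ?invr_gt0// expr2 ler_pMl.
pose S n := iter n T u0.
have cS n : ccont (S n) by elim: n => [//|n IH]; exact: ccT.
pose A := (nc a + nc b) * (2 * K + 1).
have u0b t : nc (u0 t) <= (nc a + nc b) * expR (M * `|t|).
  apply: le_trans (ncD _ _) _; rewrite ncM nc_real mulrDl.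
  have e1 : 1 + M * `|t| <= expR (M * `|t|) by exact: expR_ge1Dx.
  have t1 : `|t| <= M * `|t| by rewrite ler_peMl.
  apply: lerD; first by rewrite ler_peMr ?nc_ge0//; have := normr_ge0 t; lra.
  by rewrite mulrC ler_wpM2l ?nc_ge0//; lra.
have step0 t : nc (S 1%N t - S 0%N t) <= A * expR (M * `|t|).
  rewrite /S /= /T (_ : _ - _ = prim (prim (fun t => q t * u0 t)) t); last by ring.
  have h1 s : nc (q s * u0 s) <= K * (nc a + nc b) * expR (M * `|s|).
    by rewrite ncM -mulrA; apply: ler_pM; rewrite ?nc_ge0.
  have h2 := antiderivative_exp_bound M0 (prim0 _) (fun t => primP t (ccontM qc cu0)) h1.
  have h3 := antiderivative_exp_bound M0 (prim0 _) (fun t => primP t (cT _ cu0)) h2.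
  apply: le_trans (h3 t) _; rewrite ler_wpM2r ?expR_ge0// /A.
  rewrite (_ : 2 * (2 * (K * (nc a + nc b)) / M) / M = (nc a + nc b) * (4 * K / M ^+ 2)); last by field; rewrite gt_eqF.
  rewrite ler_wpM2l ?addr_ge0 ?nc_ge0// ler_pdivrMr ?exprn_gt0//.
  apply: le_trans (_ : 1 * M <= _); first by rewrite /M; lra.
  apply: ler_pM => //; first exact: ltW.
    by rewrite lerDr mulr_ge0.
  by rewrite expr2 ler_pMl.
have A0 : 0 <= A by rewrite /A mulr_ge0 ?addr_ge0 ?nc_ge0 ?mulr_ge0.
clearbody A.
have stepn n t : nc (S n.+1 t - S n t) <= A / 2 ^+ n * expR (M * `|t|).
  elim: n t => [|n IH] t; first by rewrite expr0 divr1.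
  rewrite (_ : A / 2 ^+ n.+1 = A / 2 ^+ n / 2); last by rewrite exprS invfM; ring.
  exact: (Tbound _ _ _ (cS n.+1) (cS n) IH).
have lim x : exists L, forall n : nat, nc (S n x - L) <= 16 * A * expR (M * `|x|) / n.+1%:R.
  have [|L hL] := @quadratic_limit R (fun n => S n x) (4 * A * expR (M * `|x|)).
    move=> n; apply: le_trans (stepn n x) _.
    rewrite ler_pdivlMr ?exprn_gt0// [leLHS](_ : _ = A * expR (M * `|x|) * (n.+1%:R ^+ 2 / 2 ^+ n)); last by ring.
    rewrite [leRHS](_ : _ = A * expR (M * `|x|) * 4); last by ring.
    rewrite ler_wpM2l ?mulr_ge0 ?expR_ge0// ler_pdivrMr ?exprn_gt0//.
    by rewrite -!natrX -natrM ler_nat pow2_quadratic.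
  exists L => n; apply: le_trans (hL n) _.
  by rewrite (_ : 4 * (4 * A * _) = 16 * A * expR (M * `|x|))//; ring.
pose Y x := projT1 (cid (lim x)).
have hY n x : nc (S n x - Y x) <= 16 * A / n.+1%:R * expR (M * `|x|).
  by rewrite mulrAC /Y; case: cid.
have tail (k : R) : 0 <= k -> forall e : R, 0 < e -> exists n : nat, k / n.+1%:R < e.
  move=> k0 e e0; have [N hN] := archi_nat (k / e); exists N.
  rewrite ltr_pdivrMr// mulrC -ltr_pdivrMr//; apply: lt_trans (hN N (leqnn _)) _.
  by rewrite ltr_nat.
have cY : ccont Y.
  apply/ccontP => t e e0; have e3 : 0 < e / 3 by rewrite divr_gt0.
  have k0 : 0 <= 16 * A * expR (M * (`|t| + 1)) by rewrite !mulr_ge0 ?expR_ge0.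
  have [n hn] := tail _ k0 _ e3.
  have /ccontP/(_ t _ e3)[d d0 hd] := cS n.
  exists (Num.min d 1); first by rewrite lt_min d0 ltr01.
  move=> s; rewrite lt_min => /andP[sd s1].
  have near x : `|x| <= `|t| + 1 -> nc (S n x - Y x) < e / 3.
    move=> xt; apply: le_lt_trans (hY n x) _; apply: le_lt_trans hn.
    by rewrite [leRHS]mulrAC ler_wpM2l ?divr_ge0 ?mulr_ge0// ler_expR ler_pM2l.
  have h1 : nc (S n t - Y t) < e / 3 by apply: near; rewrite lerDl.
  have h2 : nc (S n s - Y s) < e / 3.
    apply: near; have := ler_normD t (s - t); rewrite addrC subrK; lra.
  rewrite (_ : Y s - Y t = (S n s - S n t) - (S n s - Y s) + (S n t - Y t)); last by ring.
  have := hd s sd; have := ncD ((S n s - S n t) - (S n s - Y s)) (S n t - Y t).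
  have := ncB (S n s - S n t) (S n s - Y s); lra.
have fix_ x : Y x = T Y x.
  apply/eqP; rewrite -subr_eq0; apply/eqP; apply: small_eq0 => e e0.
  have e2 : 0 < e / 2 by rewrite divr_gt0.
  have k0 : 0 <= 16 * A * expR (M * `|x|) by rewrite !mulr_ge0 ?expR_ge0.
  have [n hn] := tail _ k0 _ e2.
  have h1 := hY n.+1 x; have h2 := Tbound _ _ _ (cS n) cY (hY n) x.
  rewrite (_ : Y x - T Y x = (S n.+1 x - T Y x) - (S n.+1 x - Y x)); last by ring.
  apply: le_lt_trans (ncB _ _) _; rewrite (splitr e); apply: ltr_leD.
    apply: le_lt_trans h2 _; apply: le_lt_trans hn; rewrite [leRHS]mulrAC.
    rewrite ler_wpM2r ?expR_ge0//; have : 0 <= 16 * A / n.+1%:R by rewrite divr_ge0// mulr_ge0.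
    move: (16 * A / _) => k.
    lra.
  apply: le_trans h1 _; apply: le_trans (ltW hn); rewrite [leRHS]mulrAC.
  rewrite ler_wpM2r ?expR_ge0// ler_wpM2l ?mulr_ge0// lef_pV2 ?posrE//.
  by rewrite ler_nat.
have YT : Y = T Y by apply/funext => x; exact: fix_.
exists Y, (fun x => b + prim (fun t => q t * Y t) x); split.
- by rewrite YT /T /u0 prim0 mul0r !addr0.
- by rewrite prim0 addr0.
- by move=> t; have := dT Y t cY; rewrite -YT.
- move=> t; apply: cder_eq; first exact: cderD (cder_cst b t) (primP t (ccontM qc cY)).
  by rewrite add0r.
Qed.

End LinearODE.

(** * Gronwall's inequality and uniqueness for second-order equations *)

Section Gronwall.
Context {R : realType}.
Implicit Types (D p r : R -> R[i]) (t T : R).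

Lemma dot_le (x y : R[i]) : re x * re y + im x * im y <= nc x * nc y.
Proof.
have -> : re x * re y + im x * im y = re (x^*%C * y).
  by rewrite reM re_conj im_conj mulNr opprK.
apply: le_trans (ler_norm _) _; apply: le_trans (nc_re _) _.
by rewrite ncM !nc_sqrtE re_conj im_conj sqrrN.
Qed.

Lemma is_derive_nc2 D (d : R[i]) t : cder D d t ->
  is_derive t (1 : R) (fun s => nc (D s) ^+ 2) (2 * (re (D t) * re d + im (D t) * im d)).
Proof.
move=> [h1 h2].
apply: is_derive_ext (is_deriveD (is_deriveM h1 h1) (is_deriveM h2 h2)) _ _.
  by move=> s; rewrite nc_sqr !expr2.
by rewrite /GRing.scale /=; ring.
Qed.

(** The energy |D|^2 + |D1|^2 grows at most at the rate [(2 + K) * E + e ^+ 2], by Cauchy-Schwarz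
    and 2ab <= a^2 + b^2. Multiplication by the integrating factor and integration give the
    bound. *)
Lemma gronwall D (D1 : R -> R[i]) p r (K e T : R) : 0 <= T -> 0 <= e ->
  (forall t, 0 <= t <= T -> cder D (D1 t) t) ->
  (forall t, 0 <= t <= T -> cder D1 (p t * D t + r t) t) ->
  (forall t, 0 <= t <= T -> nc (p t) <= K) ->
  (forall t, 0 <= t <= T -> nc (r t) <= e) ->
  forall t, 0 <= t <= T -> nc (D t) ^+ 2 + nc (D1 t) ^+ 2 <=
    (nc (D 0) ^+ 2 + nc (D1 0) ^+ 2 + e ^+ 2 * T) * expR ((2 + K) * T).
Proof.
move=> T0 e0 dD dD1 pK re_ t /andP[t0 tT].
have K0 : 0 <= K by apply: le_trans (nc_ge0 _) (pK 0 _); rewrite lexx.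
pose L := 2 + K; have L0 : 0 <= L by rewrite addr_ge0.
pose E s := nc (D s) ^+ 2 + nc (D1 s) ^+ 2.
pose E' s := 2 * (re (D s) * re (D1 s) + im (D s) * im (D1 s)) +
  2 * (re (D1 s) * re (p s * D s + r s) + im (D1 s) * im (p s * D s + r s)).
have dE s : 0 <= s <= T -> is_derive s (1 : R) E (E' s).
  by move=> sT; apply: is_deriveD (is_derive_nc2 (dD s sT)) (is_derive_nc2 (dD1 s sT)).
have E'le s : 0 <= s <= T -> E' s <= L * E s + e ^+ 2.
  move=> sT; have h1 := dot_le (D s) (D1 s); have h2 := dot_le (D1 s) (p s * D s + r s).
  have h3 : nc (p s * D s + r s) <= K * nc (D s) + e.
    apply: le_trans (ncD _ _) _; rewrite ncM lerD ?re_// ler_wpM2r ?nc_ge0 ?pK//.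
  have h4 := ler_wpM2l (nc_ge0 (D1 s)) h3.
  move: h1 h2; rewrite /E' /E /L; have := nc_ge0 (D s); have := nc_ge0 (D1 s).
  move: (nc (D s)) (nc (D1 s)) (re _ * _ + _) (re _ * _ + _) h4 => a b x y h4 b0 a0 h1 h2.
  have : 2 * (a * b) <= a ^+ 2 + b ^+ 2 by have := sqr_ge0 (a - b); rewrite sqrrB; lra.
  have : 2 * (b * e) <= b ^+ 2 + e ^+ 2 by have := sqr_ge0 (b - e); rewrite sqrrB; lra.
  move=> k1 k2; have k3 := ler_wpM2l K0 k2.
  rewrite mulrDr in h4.
  have hb := ler_wpM2l K0 (sqr_ge0 a); nra.
have dexp s : is_derive s (1 : R) (fun x => expR (- L * x)) (- L * expR (- L * s)).
  exact: is_derive_exp_scaled.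
have := @le_derive R (fun s => E s * expR (- L * s)) (fun s => e ^+ 2 * s)
  (fun s => (E' s - L * E s) * expR (- L * s)) (fun=> e ^+ 2) 0 t t0.
rewrite !mulr0 expR0 mulr1 subr0 => h.
have {}h : E t * expR (- L * t) - E 0 <= e ^+ 2 * t.
  apply: h => s /andP[s0 st].
  - have sT : 0 <= s <= T by rewrite s0 (le_trans st).
    apply: is_derive_ext (is_deriveM (dE s sT) (dexp s)) _ _ => //.
    by rewrite /GRing.scale /=; ring.
  - apply: is_derive_ext (is_deriveM (is_derive_cst (e ^+ 2) s (1 : R)) (is_derive_id s (1 : R))) _ _ => //=.
    by rewrite /GRing.scale /= mulr0 addr0 mulr1.
  - have sT : 0 <= s <= T by rewrite s0 (le_trans st).
    have h1 := E'le s sT.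
    have h2 : expR (- L * s) <= 1 by rewrite -expR0 ler_expR mulNr oppr_le0 mulr_ge0.
    apply: le_trans (_ : e ^+ 2 * expR (- L * s) <= _).
      by rewrite ler_wpM2r ?expR_ge0//; lra.
    by rewrite ler_piMr ?sqr_ge0.
have -> : nc (D t) ^+ 2 + nc (D1 t) ^+ 2 = E t * expR (- L * t) * expR (L * t).
  by rewrite -mulrA -expRD mulNr addNr expR0 mulr1.
apply: ler_pM; rewrite ?expR_ge0//.
- by rewrite mulr_ge0 ?expR_ge0// addr_ge0 ?sqr_ge0.
- rewrite -lerBlDl; apply: le_trans h _; rewrite ler_wpM2l ?sqr_ge0//.
- by rewrite ler_expR ler_wpM2l.
Qed.

Lemma ode_unique D (D1 : R -> R[i]) p (K T : R) : 0 <= T ->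
  (forall t, 0 <= t <= T -> cder D (D1 t) t) ->
  (forall t, 0 <= t <= T -> cder D1 (p t * D t) t) ->
  (forall t, 0 <= t <= T -> nc (p t) <= K) ->
  D 0 = 0 -> D1 0 = 0 -> forall t, 0 <= t <= T -> D t = 0 /\ D1 t = 0.
Proof.
move=> T0 dD dD1 pK D0 D10 t tT.
have := @gronwall D D1 p (fun=> 0) K 0 T T0 (lexx 0) dD _ pK _ t tT.
rewrite D0 D10 nc0 expr0n /= !add0r !mul0r => h.
have {}h : nc (D t) ^+ 2 + nc (D1 t) ^+ 2 <= 0.
  by apply: h => s sT; rewrite ?nc0// addr0; exact: dD1.
have h1 := sqr_ge0 (nc (D t)); have h2 := sqr_ge0 (nc (D1 t)).
by split; apply/eqP; rewrite -nc_eq0 -sqrf_eq0; apply/eqP; lra.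
Qed.

End Gronwall.

(** * Half-periods *)
Lemma not_int (R : realType) (x : R) (m : int) : 0 < x < 1 -> x <> m%:~R.
Proof.
by move=> + xm; rewrite xm ltr0z ltrz1 => /andP[]; lia.
Qed.

Section HalfPeriods.
Context {R : realType}.
Variable tau : R[i].
Hypothesis tau_gt0 : 0 < im tau.
Implicit Types (z w h : R[i]).

Local Notation c := (lat_const tau_gt0).
Local Notation E := (E tau).
Local Notation Lam := (lattice tau).

Lemma lattice_coord (s t : R) : Lam (s%:C + t%:C * tau) ->
  exists m n : int, s = m%:~R /\ t = n%:~R.
Proof.
move=> [m [n]].
have -> : (m%:~R : R[i]) = (m%:~R : R)%:C by rewrite rmorph_int.
have -> : (n%:~R : R[i]) = (n%:~R : R)%:C by rewrite rmorph_int.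
move=> eq; exists m, n.
have h2 : t = n%:~R.
  have := congr1 (@im R) eq; rewrite !(imD, imM) /= !mul0r !add0r !addr0.
  by apply: mulIf; rewrite gt_eqF.
split => //; have := congr1 (@re R) eq; rewrite h2 !(reD, reM) /=.
exact: addIr.
Qed.

Lemma E2_blowup (M : R) : exists2 d : R, 0 < d & forall z, z != 0 -> nc z < d -> M < nc (E 2 z).
Proof.
have [C [d [d0 hd]]] : bnd0 (fun z => g2 tau / 20 * z ^+ 2 + g3 tau / 28 * z ^+ 4 + z ^+ 5 * rem2 tau z).
  apply: bnd0D; last by apply: bnd0M; [exact: bnd0X (@bnd0_id R)|exact: rem2_bnd0].
  by apply: bnd0D; apply: bnd0M; [exact: bnd0_cst|exact: bnd0X (@bnd0_id R)|exact: bnd0_cst|exact: bnd0X (@bnd0_id R)].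
pose N := `|M| + `|C| + 1; have N0 : 0 < N by rewrite ltr_wpDl// addr_ge0.
have N1 : 1 <= N by rewrite lerDr addr_ge0.
exists (Num.min d N^-1); first by rewrite lt_min d0 invr_gt0.
move=> z z0; rewrite lt_min => /andP[zd zN].
have zp : 0 < nc z by rewrite nc_gt0.
have hB := hd z z0 zd; set B := _ + _ in hB.
rewrite (_ : E 2 z = z ^- 2 + B); last by rewrite E2_near0// /B; ring.
have h1 : N < nc (z ^- 2).
  have Nz : N < (nc z)^-1 by rewrite -[N]invrK ltf_pV2 ?posrE ?invr_gt0.
  rewrite ncV ncX -exprVn; apply: lt_le_trans Nz _.
  by rewrite expr2 ler_peMl ?invr_ge0 ?nc_ge0//; apply: le_trans N1 (ltW _); rewrite -[N]invrK ltf_pV2 ?posrE ?invr_gt0.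
have := ncBl (z ^- 2) (- B); rewrite opprK ncN => h2.
have := ler_norm M; have := ler_norm C; rewrite /N in h1; lra.
Qed.

Definition half_period h := Lam (h + h) /\ ~ Lam h.

Lemma lattice_oppE z : Lam (- z) <-> Lam z.
Proof. by split=> [/lattice_opp|]; rewrite ?opprK//; exact: lattice_opp. Qed.

(** [E 3] is odd, and [- h] differs from [h] by a lattice point. *)
Lemma E3_half h : half_period h -> E 3 h = 0.
Proof.
move=> [h2 hL]; have hL' : ~ Lam (- h) by rewrite lattice_oppE.
have : E 3 h = - E 3 h.
  rewrite -[LHS](E_lattice tau_gt0 (k := 3) _ hL (lattice_opp h2))//.
  rewrite (_ : h - (h + h) = - h); last by ring.
  by rewrite E_opp// -signr_odd expr1 mulN1r.
by move/eqP; rewrite -addr_eq0 -mulr2n mulrn_eq0 /= => /eqP.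
Qed.

Lemma half_E4 h : half_period h -> 6 * E 4 h = 6 * E 2 h ^+ 2 - g2 tau / 2.
Proof. by move=> [_ hL]; exact: wp_second. Qed.

Lemma hol_at k z : (0 < k)%N -> ~ Lam z -> exists C d : R, [/\ 0 < d, 0 <= C &
  forall x, nc x < d -> nc (E k (z + x) - E k z + k%:R * E k.+1 z * x) <= C * nc x ^+ 2].
Proof.
move=> k0 zL; have [C [d [d0 hd]]] := E_hol tau_gt0 k0 zL.
exists `|C|, d; split=> // x xd; have := hd z x; rewrite subrr nc0 => /(_ d0 xd).
rewrite mulNr mulNr opprK => /le_trans; apply.
by rewrite ler_wpM2r ?sqr_ge0// ler_norm.
Qed.

Lemma near_not_lattice z : ~ Lam z -> exists2 d : R, 0 < d & forall x, nc x < d -> ~ Lam (z + x).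
Proof.
move=> zL; have /open_nc oL := open_lattice_compl tau_gt0.
have [d d0 hd] := oL z zL; exists d => // x xd; apply: hd.
by rewrite opprD addNKr ncN.
Qed.

(** The linear term is absent because [E 3] vanishes at a half-period; the cubic error comes from
    integrating the second-order remainder of [E 3] along the segment. *)
Lemma half_taylor h : half_period h -> exists C d : R, 0 < d /\ forall z, nc z < d ->
  nc (E 2 (z + h) - E 2 h - 3 * E 4 h * z ^+ 2) <= C * nc z ^+ 3.
Proof.
move=> hh; have [h2 hL] := hh; have [C [d [d0 C0 hd]]] := hol_at (k := 3) isT hL.
have [d1 d10 hd1] := near_not_lattice hL.
exists (4 * C), (Num.min d d1); rewrite lt_min d0; split=> // z.
rewrite lt_min => /andP[zd zd1].
pose psi (t : R) := E 2 (h + t%:C * z) - 3 * E 4 h * z ^+ 2 * (t%:C) ^+ 2.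
have dpsi (t : R) : 0 <= t <= 1 ->
    cder psi (- 2 * z * (E 3 (h + t%:C * z) - E 3 h + 3%:R * E 4 h * (t%:C * z))) t.
  move=> /andP[t0 t1].
  have tz : nc (t%:C * z) < d1.
    rewrite ncM nc_real ger0_norm//; apply: le_lt_trans zd1.
    by rewrite ler_piMl ?nc_ge0.
  have k1 := hol_line (E_hol tau_gt0 (k := 2) isT) (hd1 _ tz).
  have k2 := cderZ (3 * E 4 h * z ^+ 2) (cderX 2 (cder_real (is_derive_id t (1 : R)))).
  apply: cder_eq (cderB k1 k2) _.
  by rewrite (E3_half hh) /= expr1 rmorph1; ring.
have := cder_bound (K := 2 * C * nc z ^+ 3) (@ler01 R) dpsi.
rewrite (_ : psi 1 - psi 0 = E 2 (z + h) - E 2 h - 3 * E 4 h * z ^+ 2); last first.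
  by rewrite /psi rmorph1 rmorph0 mul1r mul0r addr0 expr1n expr0n /= mulr0 mulr1 (addrC h); ring.
move=> H; apply: le_trans (H _) _.
  move=> t /andP[t0 t1]; have tz : nc (t%:C * z) <= nc z.
    by rewrite ncM nc_real ger0_norm// ler_piMl ?nc_ge0.
  have := hd (t%:C * z) (le_lt_trans tz zd) => h3.
  rewrite !ncM ncN nc_nat (_ : 2 * C * nc z ^+ 3 = 2 * nc z * (C * nc z ^+ 2)); last by ring.
  apply: ler_wpM2l; first by rewrite mulr_ge0 ?nc_ge0.
  apply: le_trans h3 _; rewrite ler_wpM2l// lerXn2r ?nnegrE ?nc_ge0//.
by rewrite subr0 mulr1 mulrA; apply: ler_wpM2r; rewrite ?exprn_ge0 ?nc_ge0//; lra.
Qed.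

(** The right-hand side is wp''(h) / 2. Translation by [h] exchanges the two factors, so the product
    is elliptic for the lattice enlarged by [h]; at 0 the double pole of the first factor meets the
    zero of order two of the second, and the product tends to the stated constant. *)
Lemma product_identity h z : half_period h -> ~ Lam z -> ~ Lam (z + h) ->
  (E 2 z - E 2 h) * (E 2 (z + h) - E 2 h) = 3 * E 4 h.
Proof.
move=> hh zL zhL; have [h2 hL] := hh.
pose L : set R[i] := [set x | Lam x \/ Lam (x + h)].
have hE x : Lam (x + h) <-> Lam (x - h).
  split=> k; first by rewrite (_ : x - h = x + h - (h + h)); [exact: lattice_sub|ring].
  by rewrite (_ : x + h = x - h + (h + h)); [exact: lattice_add|ring].
have Lsub x w : L x -> L w -> L (x - w).
  move=> [hx|hx] [hw|hw].
  - by left; exact: lattice_sub.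
  - by right; apply/hE; rewrite -addrA -opprD; exact: lattice_sub.
  - by right; rewrite addrAC; exact: lattice_sub.
  - by left; rewrite (_ : x - w = (x + h) - (w + h)); [exact: lattice_sub|ring].
have oL : open (~` L).
  apply/open_nc => x xL.
  have x1 : ~ Lam x by move=> k; apply: xL; left.
  have x2 : ~ Lam (x + h) by move=> k; apply: xL; right.
  have [d1 d10 k1] := near_not_lattice x1; have [d2 d20 k2] := near_not_lattice x2.
  exists (Num.min d1 d2); first by rewrite lt_min d10.
  move=> y; rewrite lt_min ncBC => /andP[y1 y2] [yL|yL].
    by apply: k1 y1 _; rewrite addrC subrK.
  by apply: k2 y2 _; rewrite addrAC (addrC x) subrK.
pose G z := (E 2 z - E 2 h) * (E 2 (z + h) - E 2 h) - 3 * E 4 h.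
have [G' hG] : exists G', hol (~` L) G G'.
  have s1 : ~` L `<=` ~` Lam by move=> x xL k; apply: xL; left.
  have s2 : ~` L `<=` [set x | (~` Lam) (x + h)] by move=> x xL k; apply: xL; right.
  have e1 := holS s1 (E_hol tau_gt0 (k := 2) isT).
  have e2 := holS s2 (hol_shift (E_hol tau_gt0 (k := 2) isT)).
  eexists; exact: (holD (holM (holD e1 (@hol_cst _ _ (- E 2 h))) (holD e2 (@hol_cst _ _ (- E 2 h)))) (@hol_cst _ _ (- (3 * E 4 h)))).
apply/eqP; rewrite -subr_eq0; apply/eqP; rewrite -[LHS]/(G z).
apply: (@elliptic_zero _ _ tau_gt0 L G G') => //.
- by left; exact: lattice0.
- by left; exact: lattice1.
- by left; exact: lattice_tau.
- move=> x w xL wL; rewrite /G.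
  have x1 : ~ Lam x by move=> k; apply: xL; left.
  have x2 : ~ Lam (x + h) by move=> k; apply: xL; right.
  case: wL => wL.
    rewrite (E_lattice tau_gt0 (k := 2) (w := w))//.
    by rewrite (addrAC x) (E_lattice tau_gt0 (k := 2) (z := x + h) (w := w)).
  rewrite (_ : x + w = x + h + (w - h)); last by ring.
  rewrite (_ : x + h + (w - h) + h = x + (w + h)); last by ring.
  rewrite (E_lattice tau_gt0 (k := 2) (z := x + h) (w := w - h))//; last by apply/hE.
  by rewrite (E_lattice tau_gt0 (k := 2) (z := x) (w := w + h))// mulrC.
- have [C [d [d0 hd]]] := half_taylor hh.
  pose rho x := (E 2 (x + h) - E 2 h - 3 * E 4 h * x ^+ 2) / x ^+ 3.
  have brho : bnd0 rho.
    exists C, d; split=> // x x0 xd; rewrite ncM ncV ncX ler_pdivrMr ?exprn_gt0 ?nc_gt0//.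
    exact: hd.
  pose s x := g2 tau / 20 * x ^+ 2 + g3 tau / 28 * x ^+ 4 + x ^+ 5 * rem2 tau x.
  have bX n : bnd0 (fun x : R[i] => x ^+ n) by exact: bnd0X (@bnd0_id R).
  have bs : bnd0 s.
    apply: bnd0D; last by apply: bnd0M; [exact: bX|exact: rem2_bnd0].
    by apply: bnd0D; apply: bnd0M; [exact: bnd0_cst|exact: bX|exact: bnd0_cst|exact: bX].
  apply: (@tends0M R G (fun x => rho x + (s x - E 2 h) * (3 * E 4 h * x + x ^+ 2 * rho x)) 1 ltr01).
    apply: bnd0D => //; apply: bnd0M; first by apply: bnd0D => //; exact: bnd0_cst.
    apply: bnd0D; first by apply: bnd0M; [exact: bnd0_cst|exact: (bX 1)].
    by apply: bnd0M.
  move=> x x0 _; rewrite /G (_ : E 2 x = x ^- 2 + s x); last by rewrite E2_near0// /s; ring.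
  rewrite (_ : E 2 (x + h) = E 2 h + 3 * E 4 h * x ^+ 2 + x ^+ 3 * rho x); last first.
    by rewrite /rho; field.
  by field.
- by case.
Qed.

(** The condition on [ep] says that wp'' vanishes where wp = [ep]. Then wp - [ep] solves a linear
    second-order equation along the segment with zero initial data, and so vanishes identically. *)
Lemma wp_leg p v (ep : R[i]) : (forall t : R, 0 <= t <= 1 -> ~ Lam (p + t%:C * v)) ->
  6 * ep ^+ 2 = g2 tau / 2 -> E 2 p = ep -> E 3 p = 0 ->
  forall t : R, 0 <= t <= 1 -> E 2 (p + t%:C * v) = ep /\ E 3 (p + t%:C * v) = 0.
Proof.
move=> pL hep E2p E3p.
have [->|v0] := eqVneq v 0; first by move=> t _; rewrite mulr0 addr0.
pose y (t : R) := E 2 (p + t%:C * v) - ep.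
pose y1 (t : R) := - 2 * E 3 (p + t%:C * v) * v.
have dy t : 0 <= t <= 1 -> cder y (y1 t) t.
  move=> t1; have k1 := hol_line (E_hol tau_gt0 (k := 2) isT) (pL t t1).
  by apply: cder_eq (cderB k1 (cder_cst ep t)) _; rewrite subr0.
have dy1 t : 0 <= t <= 1 -> cder y1 (6 * v ^+ 2 * (y t + 2 * ep) * y t) t.
  move=> t1; have k1 := hol_line (E_hol tau_gt0 (k := 3) isT) (pL t t1).
  apply: cder_eq; first apply: cder_ext (cderZ (-2 * v) k1).
    by move=> s; rewrite /y1; ring.
  have := wp_second tau_gt0 (pL t t1); rewrite -hep => k2.
  rewrite (_ : -2 * v * (-3%:R * E 4 (p + t%:C * v) * v) = v ^+ 2 * (6 * E 4 (p + t%:C * v))); last by ring.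
  by rewrite k2 /y; ring.
have [K hK] : exists K : R, forall t, 0 <= t <= 1 -> nc (6 * v ^+ 2 * (y t + 2 * ep)) <= K.
  have cy : {within `[(0 : R), 1], continuous (fun t => nc (y t) ^+ 2)}.
    apply: continuous_in_subspaceT => t; rewrite inE /= in_itv /= => t1.
    exact: is_derive_cont (is_derive_nc2 (dy t t1)).
  have [t0 _ hmax] := EVT_max (@ler01 R) cy.
  exists (nc (6 * v ^+ 2) * (nc (y t0) ^+ 2 + 1 + nc (2 * ep))) => t t1.
  rewrite ncM ler_wpM2l ?nc_ge0//; apply: le_trans (ncD _ _) _; rewrite lerD2r.
  have := hmax t; rewrite in_itv /= => /(_ t1).
  have := sqr_ge0 (nc (y t) - 1); rewrite sqrrB; have := nc_ge0 (y t); have := sqr_ge0 (nc (y t)).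
  lra.
move=> t t1; have [||h1 h2] := ode_unique (@ler01 R) dy dy1 hK _ _ t1.
- by rewrite /y mul0r addr0 E2p subrr.
- by rewrite /y1 mul0r addr0 E3p mulr0 mul0r.
split; first by apply/eqP; rewrite -subr_eq0; apply/eqP.
move/eqP: h2; rewrite /y1 !mulf_eq0 (negbTE v0) orbF oppr_eq0 pnatr_eq0 /=.
by move/eqP.
Qed.

End HalfPeriods.

(** * Distinctness and symmetric functions of the values e_k *)

Section HalfPeriodValues.
Context {R : realType}.
Variable tau : R[i].
Hypothesis tau_gt0 : 0 < im tau.
Implicit Types (z w h : R[i]).

Local Notation E := (E tau).
Local Notation Lam := (lattice tau).

Lemma coord_not_lattice (s t : R) : (0 < s < 1) || (0 < t < 1) -> ~ Lam (s%:C + t%:C * tau).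
Proof.
move=> st /(lattice_coord tau_gt0)[m [n [sm tn]]].
by case/orP: st => st; [exact: (not_int st sm)|exact: (not_int st tn)].
Qed.

(** If wp'' vanished at the half-period, wp would be constant along a path with legs parallel to 1
    and to [tau] that avoids the lattice and ends as close to it as desired, where wp blows up. *)
Lemma half_coord (s t : R) : (s = 2^-1 /\ t = 0) \/ (0 <= s <= 1 /\ t = 2^-1) ->
  half_period tau (s%:C + t%:C * tau) -> E 4 (s%:C + t%:C * tau) != 0.
Proof.
move=> st; set h := _ + _ => hh; apply/eqP => E40.
have E3h := E3_half tau_gt0 hh; have hep := half_E4 tau_gt0 hh.
rewrite E40 mulr0 in hep; move/esym/eqP: hep; rewrite subr_eq0 => /eqP hep.
have half01 : 0 < (2^-1 : R) < 1 by rewrite invr_gt0 ltr0n invf_lt1 ?ltr1n.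
have i1 : 0 <= (1 : R) <= 1 by rewrite ler01 lexx.
(* Up to a period the path ends at [x * v]: from [1 / 2] it goes to [1 / 2 + x * tau] and then to
   [1 + x * tau]; in the other case it goes to [x + tau / 2] and then to [x + tau]. *)
pose v : R[i] := if t == 0 then tau else 1.
have val (x : R) : 0 < x < 1 -> E 2 (x%:C * v) = E 2 h.
  move=> x01; case: st => [[sE tE]|[/andP[s0 s1] tE]].
    rewrite /v tE eqxx.
    have L1 (t' : R) : 0 <= t' <= 1 -> ~ Lam (h + t'%:C * (x%:C * tau)).
      move=> _; rewrite /h tE rmorph0 mul0r addr0 sE mulrA -rmorphM.
      by apply: coord_not_lattice; rewrite half01.
    have [e1 e2] := wp_leg tau_gt0 L1 hep erefl E3h i1.
    have hE : h + 1%:C * (x%:C * tau) = (2^-1)%:C + x%:C * tau.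
      by rewrite /h tE sE rmorph0 rmorph1; ring.
    rewrite hE in e1 e2.
    have L2 (t' : R) : 0 <= t' <= 1 -> ~ Lam ((2^-1)%:C + x%:C * tau + t'%:C * (2^-1)%:C).
      move=> _; rewrite addrAC -rmorphM -rmorphD.
      by apply: coord_not_lattice; rewrite x01 orbT.
    have [e3 _] := wp_leg tau_gt0 L2 hep e1 e2 i1.
    rewrite -e3 rmorph1 mul1r addrAC -rmorphD /= -[2^-1]mul1r -splitr rmorph1 addrC.
    rewrite (E_lattice tau_gt0)//; last exact: lattice1.
    by have := coord_not_lattice (s := 0) (t := x); rewrite x01 orbT rmorph0 add0r; apply.
  have v1 : v = 1.
    by rewrite /v tE; case: eqP => // k; move: half01; rewrite k ltxx.
  rewrite v1 mulr1.
  have L1 (t' : R) : 0 <= t' <= 1 -> ~ Lam (h + t'%:C * (x - s)%:C).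
    move=> _; rewrite /h addrAC -rmorphM -rmorphD tE.
    by apply: coord_not_lattice; rewrite half01 orbT.
  have [e1 e2] := wp_leg tau_gt0 L1 hep erefl E3h i1.
  have hE : h + 1%:C * (x - s)%:C = x%:C + (2^-1)%:C * tau.
    by rewrite /h tE rmorph1 rmorphB /=; ring.
  rewrite hE in e1 e2.
  have L2 (t' : R) : 0 <= t' <= 1 -> ~ Lam (x%:C + (2^-1)%:C * tau + t'%:C * ((2^-1)%:C * tau)).
    move=> _; rewrite mulrA -rmorphM -addrA -mulrDl -rmorphD.
    by apply: coord_not_lattice; rewrite x01.
  have [e3 _] := wp_leg tau_gt0 L2 hep e1 e2 i1.
  rewrite -e3 rmorph1 mul1r -addrA -mulrDl -rmorphD /= -[2^-1]mul1r -splitr rmorph1 mul1r.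
  rewrite (E_lattice tau_gt0)//; last exact: lattice_tau.
  by have := coord_not_lattice (s := x) (t := 0); rewrite x01 rmorph0 mul0r addr0; apply.
have v0 : v != 0.
  rewrite /v; case: (t == 0); last by rewrite -nc_gt0 nc1.
  by apply/eqP => t0; move: tau_gt0; rewrite t0 ltxx.
have [d d0 hd] := E2_blowup tau_gt0 (nc (E 2 h)).
have vp : 0 < nc v by rewrite nc_gt0.
pose x := Num.min (2^-1) (d / nc v / 2).
have x0 : 0 < x by rewrite lt_min !divr_gt0// invr_gt0 ltr0n.
have x1 : x < 1.
  by apply: le_lt_trans (_ : 2^-1 < 1); [rewrite ge_min lexx|case/andP: half01].
have xd : x < d / nc v.
  apply: le_lt_trans (_ : d / nc v / 2 < _); first by rewrite ge_min lexx orbT.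
  by rewrite gtr_pMr ?divr_gt0//; case/andP: half01.
have := hd (x%:C * v); rewrite val ?x0// ltxx => k.
have : false by apply: k; [rewrite mulf_neq0// -nc_gt0 nc_real normr_gt0 gt_eqF|rewrite ncM nc_real gtr0_norm// -ltr_pdivlMr].
by [].
Qed.

(** If the values agreed, the product identities for [h] and [h'] would give wp(z + h) = wp(z + h').
    Near [z = - h] the left side blows up, whereas the right side is bounded. *)
Lemma half_values_neq h h' : half_period tau h -> half_period tau h' ->
  ~ Lam (h - h') -> E 4 h != 0 -> E 2 h != E 2 h'.
Proof.
move=> hh hh' hhL E4h; apply/eqP => eqE.
have [h2 hL] := hh; have [h2' hL'] := hh'.
have hNL : ~ Lam (- h) by rewrite lattice_oppE.
have hhL' : ~ Lam (- h - h').
  move=> k; apply: hhL; rewrite (_ : h - h' = - h - h' + (h + h)); last by ring.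
  exact: lattice_add.
have hhL2 : ~ Lam (h' - h) by rewrite -opprB lattice_oppE.
have [d1 d10 k1] := near_not_lattice tau_gt0 hNL.
have [d2 d20 k2] := near_not_lattice tau_gt0 hhL2.
have [d3 d30 k3] := hol_cont (E_hol tau_gt0 (k := 2) isT) hhL2 (@ltr01 R).
have [d4 d40 k4] := E2_blowup tau_gt0 (nc (E 2 (h' - h)) + 1).
have [d5 [C [d50 k5]]] : exists d C : R, 0 < d /\ forall z, z != 0 -> nc z < d -> ~ Lam z.
  have c0 := lat_const_gt0 tau_gt0; exists (lat_const tau_gt0), 0; split=> // z z0 zd [m [n zE]].
  rewrite -[_ + _]/(lat tau m n) in zE.
  have [nz|] := boolP (nonzero m n).
    by have := lat_ge_const tau_gt0 nz; rewrite -zE leNgt zd.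
  rewrite /nonzero negb_or !negbK => /andP[/eqP m0 /eqP n0].
  by move: z0; rewrite zE m0 n0 /lat mul0r addr0 eqxx.
pose d := Num.min (Num.min (Num.min d1 d2) (Num.min d3 d4)) d5.
have d0 : 0 < d by rewrite !lt_min d10 d20 d30 d40 d50.
pose z : R[i] := (d / 2)%:C.
have zd : nc z < d by rewrite nc_real gtr0_norm ?divr_gt0// gtr_pMr// invf_lt1 ?ltr1n.
have z0 : z != 0 by rewrite -nc_gt0 nc_real normr_gt0 gt_eqF ?divr_gt0.
move: zd; rewrite !lt_min => /andP[/andP[/andP[z1 z2] /andP[z3 z4]] z5].
have zL := k5 z z0 z5.
have p1 := product_identity tau_gt0 (z := - h + z) hh (k1 z z1).
have p2 := product_identity tau_gt0 (z := - h + z) hh' (k1 z z1).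
have {}p1 := p1 (ltac:(by rewrite addrAC addNr add0r)).
have {}p2 := p2 (ltac:(by rewrite addrAC (addrC (- h)); exact: k2)).
have E44 : E 4 h' = E 4 h.
  have n6 : (6 : R[i]) != 0 by rewrite pnatr_eq0.
  by apply: (mulfI n6); rewrite (half_E4 tau_gt0 hh) (half_E4 tau_gt0 hh') eqE.
rewrite (_ : - h + z + h = z) in p1; last by ring.
rewrite (_ : - h + z + h' = h' - h + z) in p2; last by ring.
rewrite E44 -p1 -eqE in p2.
have nz : E 2 (- h + z) - E 2 h != 0.
  apply/eqP => k; move: p1; rewrite k mul0r => /esym/eqP.
  by rewrite mulf_eq0 pnatr_eq0 /= (negbTE E4h).
move/(mulfI nz)/addIr: p2 => p2.
have := k4 z z0 z4; rewrite -p2.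
have := k3 (h' - h + z); rewrite addrAC subrr add0r => /(_ z3) k.
have := ncD (E 2 (h' - h + z) - E 2 (h' - h)) (E 2 (h' - h)); rewrite subrK; lra.
Qed.

Lemma omega_half (k : 'I_3) : exists s t : R, [/\ omega tau k / 2 = s%:C + t%:C * tau,
  (s = 2^-1 /\ t = 0) \/ (0 <= s <= 1 /\ t = 2^-1),
  s *+ 2 = (k != 1%N :> nat)%:R & t *+ 2 = (k != 0%N :> nat)%:R].
Proof.
have h2 : (2^-1 : R) *+ 2 = 1 by rewrite mulr2n -[2^-1]mul1r -splitr.
have hC : (2^-1 : R)%:C = 2^-1 :> R[i] by rewrite fmorphV rmorph_nat.
have le1 : 0 <= (2^-1 : R) <= 1 by rewrite invr_ge0 ler0n invf_le1 ?ler1n ?ltr0n.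
case: k => [[|[|[|//]]] hk]; rewrite /omega /=.
- exists 2^-1, 0; split=> //; [by rewrite mul1r hC rmorph0 mul0r addr0|by left|by rewrite mul0rn].
- exists 0, 2^-1; split=> //; [by rewrite hC rmorph0 add0r mulrC|by right; rewrite lexx ler01|by rewrite mul0rn].
- exists 2^-1, 2^-1; split=> //; [by rewrite hC; ring|by right].
Qed.

Lemma omega_half_period (k : 'I_3) : half_period tau (omega tau k / 2).
Proof.
split.
  rewrite -splitr.
  case: k => [[|[|[|//]]] hk]; rewrite /omega /=.
  - exact: lattice1.
  - exact: lattice_tau.
  - by apply: lattice_add; [exact: lattice1|exact: lattice_tau].
have [s [t [-> st _ _]]] := omega_half k.
have half01 : 0 < (2^-1 : R) < 1 by rewrite invr_gt0 ltr0n invf_lt1 ?ltr1n.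
by apply: coord_not_lattice; case: st => [[-> _]|[_ ->]]; rewrite half01 ?orbT.
Qed.

Lemma e_root (k : 'I_3) : 4 * e tau k ^+ 3 - g2 tau * e tau k - g3 tau = 0.
Proof.
have [_ hL] := omega_half_period k.
have := wp_first tau_gt0 hL; rewrite (E3_half tau_gt0 (omega_half_period k)) mulr0 expr0n /=.
by move=> <-.
Qed.

Lemma e_distinct (j k : 'I_3) : j != k -> e tau j != e tau k.
Proof.
move=> jk; have hj := omega_half_period j; have hk := omega_half_period k.
have [s [t [jE st s2 t2]]] := omega_half j; have [s' [t' [kE st' s2' t2']]] := omega_half k.
apply: (half_values_neq hj hk); last by rewrite jE; apply: half_coord => //; rewrite -jE.
rewrite jE kE (_ : _ - _ = (s - s')%:C + (t - t')%:C * tau); last by rewrite !rmorphB /=; ring.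
move=> /(lattice_coord tau_gt0)[m [n [sm tn]]].
(* Doubling turns the coordinates 0 and 1 / 2 into booleans. Half-periods congruent modulo the
   lattice have the same booleans, and these determine the index. *)
have double (x y : R) (p : int) (a b : bool) : x *+ 2 = a%:R -> y *+ 2 = b%:R ->
    x - y = p%:~R -> a = b.
  move=> xa yb xyp; have : (p *+ 2)%:~R = (a%:Z - b%:Z)%:~R :> R.
    by rewrite rmorphMn rmorphB /= -xyp mulrnBl xa yb.
  by move/intr_inj; case: a {xa}; case: b {yb} => //; lia.
have h1 := double _ _ _ _ _ s2 s2' sm; have h2 := double _ _ _ _ _ t2 t2' tn.
move/eqP: jk; apply; apply: val_inj.
by case: j h1 h2 {jE hj s2 t2} => [[|[|[|//]]] ?]; case: k {kE hk s2' t2'} => [[|[|[|//]]] ?].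
Qed.

(** Vieta's formulas for three distinct roots of 4 x^3 - g2 x - g3, obtained by dividing differences
    of the root equations by differences of the roots. *)
Lemma e_symmetric : let e1 := e tau (@Ordinal 3 0 isT) in
  let e2 := e tau (@Ordinal 3 1 isT) in let e3 := e tau (@Ordinal 3 2 isT) in
  [/\ e3 = - (e1 + e2), g2 tau = 4 * (e1 ^+ 2 + e1 * e2 + e2 ^+ 2) &
   g3 tau = - 4 * e1 * e2 * (e1 + e2)].
Proof.
set i1 := @Ordinal 3 0 isT; set i2 := @Ordinal 3 1 isT; set i3 := @Ordinal 3 2 isT.
move=> e1 e2 e3.
have r1 := e_root i1; have r2 := e_root i2; have r3 := e_root i3.
have d12 : e1 - e2 != 0 by rewrite subr_eq0; exact: e_distinct.
have d13 : e1 - e3 != 0 by rewrite subr_eq0; exact: e_distinct.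
have d23 : e2 - e3 != 0 by rewrite subr_eq0; exact: e_distinct.
rewrite -/e1 -/e2 -/e3 in r1 r2 r3.
move: e1 e2 e3 r1 r2 r3 d12 d13 d23 => a b c r1 r2 r3 dab dac dbc.
have cubic x y : x - y != 0 -> 4 * x ^+ 3 - g2 tau * x - g3 tau = 0 ->
    4 * y ^+ 3 - g2 tau * y - g3 tau = 0 -> g2 tau = 4 * (x ^+ 2 + x * y + y ^+ 2).
  move=> xy rx ry; apply: (mulIf xy); apply/eqP; rewrite -subr_eq0; apply/eqP.
  rewrite (_ : _ - _ = (4 * y ^+ 3 - g2 tau * y - g3 tau) - (4 * x ^+ 3 - g2 tau * x - g3 tau)).
    by rewrite rx ry subrr.
  by ring.
have g2E := cubic a b dab r1 r2; have g2E' := cubic a c dac r1 r3.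
have cE : c = - (a + b).
  apply/eqP; rewrite -addr_eq0; apply/eqP; apply: (mulIf dbc).
  have n4 : (4 : R[i]) != 0 by rewrite pnatr_eq0.
  rewrite mul0r; apply: (mulfI n4); rewrite mulr0.
  rewrite (_ : 4 * _ = 4 * (a ^+ 2 + a * b + b ^+ 2) - 4 * (a ^+ 2 + a * c + c ^+ 2)).
    by rewrite -g2E -g2E' subrr.
  by ring.
split=> //; apply/eqP; rewrite -subr_eq0; apply/eqP.
by rewrite -[RHS]oppr0 -r1 g2E; ring.
Qed.

End HalfPeriodValues.

(** * Floquet solutions of the Lamé equation *)
Section LameEquation.
Context {R : realType}.
Variables (tau z0 : R[i]).
Hypothesis tau_gt0 : 0 < im tau.
Hypothesis z0_regular : forall x : R, ~ lattice tau (x%:C + z0).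
Implicit Types (x t : R) (l w : R[i]) (y u : R -> R[i]).

Local Notation E := (E tau).
Local Notation g2 := (g2 tau).
Local Notation g3 := (g3 tau).

Definition pot x : R[i] := E 2 (x%:C + z0).
Definition dpot x : R[i] := - 2 * E 3 (x%:C + z0).

Lemma E_line k x : (0 < k)%N ->
  cder (fun t => E k (t%:C + z0)) (- k%:R * E k.+1 (x%:C + z0)) x.
Proof.
move=> k0; have h : ~ lattice tau (z0 + x%:C * 1).
  by rewrite mulr1 addrC; exact: z0_regular.
have := hol_line (E_hol tau_gt0 k0) h; rewrite !mulr1 (addrC z0) => d.
by apply: cder_ext d => t; rewrite mulr1 addrC.
Qed.

Lemma cder_pot x : cder pot (dpot x) x.
Proof. exact: E_line. Qed.

Lemma cder_dpot x : cder dpot (6 * pot x ^+ 2 - g2 / 2) x.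
Proof.
apply: cder_eq (cderZ (- 2) (@E_line 3 x isT)) _.
by rewrite -(wp_second tau_gt0 (@z0_regular x)); ring.
Qed.

Lemma dpot2 x : dpot x ^+ 2 = 4 * pot x ^+ 3 - g2 * pot x - g3.
Proof. exact: wp_first. Qed.

Lemma E_line_period k x : (1 < k)%N -> E k ((x + 1)%:C + z0) = E k (x%:C + z0).
Proof.
move=> k1; rewrite rmorphD /= rmorph1 addrAC.
by rewrite (E_period tau_gt0 k1 (or_introl erefl) (@z0_regular x)).
Qed.

Lemma pot_period x : pot (x + 1) = pot x. Proof. exact: E_line_period. Qed.
Lemma dpot_period x : dpot (x + 1) = dpot x. Proof. by rewrite /dpot E_line_period. Qed.

(** The degree 3 is forced: in the third-order equation wp^k produces the leading coefficient 2 (2 k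
    + 1) (k - 3) (k + 4), which vanishes only for k = 3. Comparison of the lower powers then
    determines the other coefficients of a monic solution. *)
Definition Phi l x := pot x ^+ 3 - l / 5 * pot x ^+ 2 + (2 * l ^+ 2 / 75 - g2 / 4) * pot x +
  (l * g2 / 15 - g3 / 4 - l ^+ 3 / 225).
Definition dPhi l x := (3 * pot x ^+ 2 - 2 * l / 5 * pot x + (2 * l ^+ 2 / 75 - g2 / 4)) * dpot x.
(** Here wp'^2 and wp'' have been replaced by polynomials in wp. *)
Definition ddPhi l x := (6 * pot x - 2 * l / 5) * (4 * pot x ^+ 3 - g2 * pot x - g3) +
  (3 * pot x ^+ 2 - 2 * l / 5 * pot x + (2 * l ^+ 2 / 75 - g2 / 4)) * (6 * pot x ^+ 2 - g2 / 2).

Lemma cder_Phi l x : cder (Phi l) (dPhi l x) x.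
Proof.
have d := cder_pot x.
apply: cder_eq.
  exact: (cderD (cderD (cderD (cderX 3 d) (cderN (cderZ (l / 5) (cderX 2 d)))) (cderZ _ d)) (cder_cst _ x)).
by rewrite /dPhi /= expr1; field.
Qed.

Lemma cder_dPhi l x : cder (dPhi l) (ddPhi l x) x.
Proof.
have d := cder_pot x; have d1 := cder_dpot x.
apply: cder_eq.
  exact: (cderM (cderD (cderB (cderZ 3 (cderX 2 d)) (cderZ (2 * l / 5) d)) (cder_cst (2 * l ^+ 2 / 75 - g2 / 4) x)) d1).
rewrite /ddPhi /= expr1 -[in RHS]dpot2; ring.
Qed.

(* The function Phi solves the third-order equation satisfied by products of solutions. *)
Lemma cder_ddPhi l x :
  cder (ddPhi l) (4 * (12 * pot x + l) * dPhi l x + 24 * dpot x * Phi l x) x.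
Proof.
have d := cder_pot x.
apply: cder_eq.
  apply: cderD.
    apply: (cderM (cderB (cderZ 6 d) (cder_cst (2 * l / 5) x))).
    exact: (cderB (cderB (cderZ 4 (cderX 3 d)) (cderZ g2 d)) (cder_cst g3 x)).
  apply: cderM; first exact: (cderD (cderB (cderZ 3 (cderX 2 d)) (cderZ (2 * l / 5) d)) (cder_cst (2 * l ^+ 2 / 75 - g2 / 4) x)).
  exact: (cderB (cderZ 6 (cderX 2 d)) (cder_cst (g2 / 2) x)).
by rewrite /Phi /dPhi /= !expr1; field.
Qed.

(** The constant is the leading coefficient in [l]: [Phi] behaves like [- l ^+ 3 / 225], hence
    [4 * l * Phi ^+ 2] like [(2 / 225) ^+ 2 * l ^+ 7]. *)
Definition w2 l : R[i] := (2 / 225) ^+ 2 * spectral_poly tau l.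

Lemma spectral_polyE l : let e1 := e tau (@Ordinal 3 0 isT) in let e2 := e tau (@Ordinal 3 1 isT) in
  let e3 := e tau (@Ordinal 3 2 isT) in let F e := l ^+ 2 - 6 * e * l + 15 * (3 * e ^+ 2 - g2) in
  spectral_poly tau l = l * (F e1 * F e2 * F e3).
Proof.
move=> e1 e2 e3 F; rewrite /spectral_poly !big_ord_recl big_ord0 mulr1.
have -> : ord0 = @Ordinal 3 0 isT by apply: val_inj.
have -> : lift (@Ordinal 3 0 isT) ord0 = @Ordinal 3 1 isT by apply: val_inj.
have -> : lift (@Ordinal 3 0 isT) (lift ord0 ord0) = @Ordinal 3 2 isT by apply: val_inj.
by rewrite -(mulrA (F e1)).
Qed.

(** A polynomial identity in wp, [l] and two of the values e_k, once wp'^2, g2, g3 and the third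
    value are expressed by them. *)
Lemma w2E l x :
  dPhi l x ^+ 2 - 2 * Phi l x * ddPhi l x + 4 * (12 * pot x + l) * Phi l x ^+ 2 = w2 l.
Proof.
rewrite /w2 spectral_polyE; have [-> h2 h3] := e_symmetric tau_gt0.
rewrite /dPhi exprMn dpot2 /Phi /ddPhi h2 h3.
move: (e tau _) (e tau _) (pot x) => a b p; by field.
Qed.

Definition sol l y (y1 : R -> R[i]) :=
  (forall x, cder y (y1 x) x) /\ (forall x, cder y1 ((12 * pot x + l) * y x) x).

Lemma cder0_const (f : R -> R[i]) : (forall t, cder f 0 t) -> forall x x', f x = f x'.
Proof.
by move=> h x x'; have [xx|/ltW xx] := leP x x'; [apply/esym|]; apply: cder0_cst => // t _.
Qed.

Lemma wronskian_const l y y1 u u1 : sol l y y1 -> sol l u u1 ->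
  forall x x', y1 x * u x - y x * u1 x = y1 x' * u x' - y x' * u1 x'.
Proof.
move=> [dy dy1] [du du1]; apply: cder0_const => t.
apply: cder_eq (cderB (cderM (dy1 t) (du t)) (cderM (dy t) (du1 t))) _.
by ring.
Qed.

Lemma solD l (a b : R[i]) y y1 u u1 : sol l y y1 -> sol l u u1 ->
  sol l (fun x => a * y x + b * u x) (fun x => a * y1 x + b * u1 x).
Proof.
move=> [dy dy1] [du du1]; split=> x.
  exact: cderD (cderZ a (dy x)) (cderZ b (du x)).
by apply: cder_eq (cderD (cderZ a (dy1 x)) (cderZ b (du1 x))) _; ring.
Qed.

Lemma sol_shift l y y1 : sol l y y1 -> sol l (fun x => y (x + 1)) (fun x => y1 (x + 1)).
Proof.
move=> [dy dy1]; split=> x; first exact: cder_shift.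
by have := cder_shift (dy1 (x + 1)); rewrite pot_period.
Qed.

Lemma pot_bounded : exists K : R, forall x, nc (pot x) <= K.
Proof.
have cp : continuous (fun x => nc (pot x) ^+ 2).
  by move=> x; exact: is_derive_cont (is_derive_nc2 (cder_pot x)).
have [t0 _ hmax] := EVT_max (@ler01 R) (continuous_subspaceT cp).
exists (nc (pot t0) ^+ 2 + 1) => x.
have per (m : int) s : pot (s + m%:~R) = pot s.
  have nat_ (n : nat) s' : pot (s' + n%:R) = pot s'.
    by elim: n => [|n IH]; rewrite ?addr0// -natr1 addrA pot_period.
  by case: m => n; [exact: nat_|rewrite NegzE -[LHS](nat_ n.+1) mulrNz subrK].
pose s := x - (Num.floor x)%:~R.
have -> : pot x = pot s by rewrite -(per (Num.floor x) s) subrK.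
have := hmax s; rewrite in_itv /= /s => h.
have /andP[f1 f2] := floor_itv x; rewrite intrD in f2.
have {}h := h (ltac:(lra)); move: h; rewrite -/s.
have := sqr_ge0 (nc (pot s) - 1); rewrite sqrrB; have := sqr_ge0 (nc (pot s)).
by move: (nc (pot s)) => a; lra.
Qed.

Lemma ccont_pot l : ccont (fun x => 12 * pot x + l).
Proof.
by apply: cder_ccont => x; exact: cderD (cderZ 12 (cder_pot x)) (cder_cst l x).
Qed.

Lemma sol_exists l (a b : R[i]) : exists yy : (R -> R[i]) * (R -> R[i]),
  [/\ sol l yy.1 yy.2, yy.1 0 = a & yy.2 0 = b].
Proof.
have [K hK] := pot_bounded.
have [|y [y1 [ya yb dy dy1]]] := @picard R (fun x => 12 * pot x + l) (12 * K + nc l) a b (ccont_pot l).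
  by move=> t; apply: le_trans (ncD _ _) _; rewrite lerD2r ncM nc_nat ler_wpM2l.
by exists (y, y1); split.
Qed.

Definition fund l (a b : R[i]) := projT1 (cid (sol_exists l a b)).

Lemma fundP l a b : [/\ sol l (fund l a b).1 (fund l a b).2, (fund l a b).1 0 = a &
  (fund l a b).2 0 = b].
Proof. by rewrite /fund; case: cid. Qed.

(** The Wronskians of [y] with two fundamental solutions are constant, hence 0. Since the Wronskian
    of the latter is -1, both [y] and [y1] vanish. *)
Lemma sol_unique l y y1 : sol l y y1 -> y 0 = 0 -> y1 0 = 0 -> forall x, y x = 0 /\ y1 x = 0.
Proof.
move=> hy y0 y10 x; have [hc c0 c10] := fundP l 1 0; have [hs s0 s10] := fundP l 0 1.
set c := (fund l 1 0).1 in hc c0; set c1 := (fund l 1 0).2 in hc c10.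
set s := (fund l 0 1).1 in hs s0; set s1 := (fund l 0 1).2 in hs s10.
have k1 := wronskian_const hy hc x 0; have k2 := wronskian_const hy hs x 0.
have k3 := wronskian_const hc hs x 0.
rewrite y0 y10 !mul0r subrr in k1 k2; rewrite c0 c10 s0 s10 mul0r mul1r sub0r in k3.
move/eqP: k1; rewrite subr_eq0 => /eqP k1; move/eqP: k2; rewrite subr_eq0 => /eqP k2.
split.
  rewrite -[y x]mulr1 -[1]opprK -k3.
  by rewrite (_ : y x * - _ = (y x * s1 x) * c x - (y x * c1 x) * s x); [rewrite -k1 -k2; ring|ring].
rewrite -[y1 x]mulr1 -[1]opprK -k3.
by rewrite (_ : y1 x * - _ = (y1 x * c x) * s1 x - (y1 x * s x) * c1 x); [rewrite k1 k2; ring|ring].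
Qed.

Definition Kop l y (y1 : R -> R[i]) x := Phi l x * y1 x - dPhi l x / 2 * y x.
(** The derivative of [Kop], with the second derivative of [y] eliminated by the equation. *)
Definition Kop1 l y (y1 : R -> R[i]) x :=
  dPhi l x / 2 * y1 x + (Phi l x * (12 * pot x + l) - ddPhi l x / 2) * y x.

Lemma Kop_sol l y y1 : sol l y y1 -> sol l (Kop l y y1) (Kop1 l y y1).
Proof.
move=> [dy dy1]; split=> x.
  apply: cder_eq.
    apply: cder_ext (cderB (cderM (cder_Phi l x) (dy1 x)) (cderM (cderZ (1 / 2) (cder_dPhi l x)) (dy x))).
    by move=> t; rewrite /Kop; ring.
  by rewrite /Kop1; field.
apply: cder_eq.
  apply: cder_ext (cderD (cderM (cderZ (1 / 2) (cder_dPhi l x)) (dy1 x))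
    (cderM (cderB (cderM (cder_Phi l x) (cderD (cderZ 12 (cder_pot x)) (cder_cst l x)))
      (cderZ (1 / 2) (cder_ddPhi l x))) (dy x))).
  by move=> t; rewrite /Kop1; ring.
by rewrite /Kop; field.
Qed.

Lemma Kop_sqr l y y1 x : Kop l (Kop l y y1) (Kop1 l y y1) x = w2 l / 4 * y x.
Proof. by rewrite -(w2E l x) /Kop /Kop1; field. Qed.

Definition eigen l w y y1 := sol l y y1 /\ forall x, Kop l y y1 x = w / 2 * y x.

Lemma eigen_Kop1 l w y y1 : eigen l w y y1 -> forall x, Kop1 l y y1 x = w / 2 * y1 x.
Proof.
move=> [hy hK] x; have [d1 _] := Kop_sol hy; have [dy _] := hy.
have h1 := d1 x; have h2 := cderZ (w / 2) (dy x).
have h3 : cder (Kop l y y1) (w / 2 * y1 x) x by apply: cder_ext h2 => t; rewrite hK.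
case: h1 => [[_ a1] [_ a2]]; case: h3 => [[_ b1] [_ b2]].
by apply: complexP; [rewrite -a1 b1|rewrite -a2 b2].
Qed.

(** As the square of [Kop] is [w ^+ 2 / 4], this is, up to the factor [w], the projection onto the
    eigenspace of [w / 2]. *)
Definition eigproj l w y (y1 : R -> R[i]) x := Kop l y y1 x + w / 2 * y x.
Definition eigproj1 l w y (y1 : R -> R[i]) x := Kop1 l y y1 x + w / 2 * y1 x.

Lemma eigproj_eigen l w y y1 : w ^+ 2 = w2 l -> sol l y y1 ->
  eigen l w (eigproj l w y y1) (eigproj1 l w y y1).
Proof.
move=> ww hy; split.
  have := solD 1 (w / 2) (Kop_sol hy) hy.
  rewrite (_ : (fun x => 1 * Kop l y y1 x + _) = eigproj l w y y1); last first.
    by apply/funext => x; rewrite mul1r.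
  by rewrite (_ : (fun x => 1 * Kop1 l y y1 x + _) = eigproj1 l w y y1)//; apply/funext => x; rewrite mul1r.
move=> x; rewrite /eigproj /eigproj1.
rewrite (_ : Kop l _ _ x = Kop l (Kop l y y1) (Kop1 l y y1) x + w / 2 * Kop l y y1 x).
  by rewrite Kop_sqr -ww; field.
by rewrite /Kop; ring.
Qed.

Lemma Phi_period l x : Phi l (x + 1) = Phi l x.
Proof. by rewrite /Phi pot_period. Qed.

Lemma dPhi_period l x : dPhi l (x + 1) = dPhi l x.
Proof. by rewrite /dPhi pot_period dpot_period. Qed.

Lemma eigen_shift l w y y1 : eigen l w y y1 ->
  eigen l w (fun x => y (x + 1)) (fun x => y1 (x + 1)).
Proof.
move=> [hy hK]; split; first exact: sol_shift.
by move=> x; have := hK (x + 1); rewrite /Kop Phi_period dPhi_period.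
Qed.

(** For [w' = w] it makes eigenfunctions dependent as soon as [Phi] is nonzero somewhere; for
    [w' = - w] it expresses [Phi] by the product of the two Floquet solutions. *)
Lemma eigen_wronskian l w w' y y1 u u1 : eigen l w y y1 -> eigen l w' u u1 ->
  forall x, Phi l x * (y1 x * u x - y x * u1 x) = (w - w') / 2 * (y x * u x).
Proof.
move=> [_ hy] [_ hu] x.
rewrite (_ : _ * _ = Kop l y y1 x * u x - Kop l u u1 x * y x); last by rewrite /Kop; ring.
by rewrite hy hu; field.
Qed.

Lemma Phi_neq0 l : w2 l != 0 -> exists x, Phi l x != 0.
Proof.
move=> w0; apply: contrapT => h.
have P0 x : Phi l x = 0 by apply/eqP/negPn/negP => k; apply: h; exists x.
have d0 x : dPhi l x = 0.
  have h1 : cder (Phi l) 0 x by apply: cder_ext (cder_cst 0 x) => t; rewrite P0.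
  have := cder_Phi l x; case: h1 => [[_ a1] [_ a2]] [[_ b1] [_ b2]].
  by apply: complexP; [rewrite -b1 a1|rewrite -b2 a2].
by move/negP: w0; apply; rewrite -(w2E l 0) P0 d0 expr0n !(mulr0, mul0r) subr0 addr0.
Qed.

Lemma eigen_dependent l w y y1 u u1 : w2 l != 0 -> eigen l w y y1 -> eigen l w u u1 ->
  forall x, y1 x * u x = y x * u1 x.
Proof.
move=> w0 hy hu x; have [x0 P0] := Phi_neq0 w0.
have := eigen_wronskian hy hu x0; rewrite subrr mul0r mul0r => /eqP.
rewrite mulf_eq0 (negbTE P0) /= => /eqP h0.
apply/eqP; rewrite -subr_eq0; apply/eqP.
by rewrite -h0; exact: wronskian_const hy.1 hu.1 x x0.
Qed.

(** The shift by the period preserves the eigenspace, which has dimension one by [eigen_dependent];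
    the factor is read off from whichever initial value is nonzero. *)
Lemma eigen_multiplier l w y y1 : w2 l != 0 -> eigen l w y y1 ->
  (y 0 != 0) || (y1 0 != 0) -> exists rho, [/\ rho != 0,
  forall x, y (x + 1) = rho * y x & forall x, y1 (x + 1) = rho * y1 x].
Proof.
move=> w0 hy y0; have hu := eigen_shift hy.
have dep := eigen_dependent w0 hy hu 0; rewrite add0r in dep.
have [rho [r1 r2]] : exists rho, y 1 = rho * y 0 /\ y1 1 = rho * y1 0.
  have [e0|e0] := eqVneq (y 0) 0.
    rewrite e0 eqxx /= in y0; exists (y1 1 / y1 0); rewrite divfK//; split=> //.
    rewrite e0 mulr0; move/eqP: dep; rewrite e0 mul0r mulf_eq0 (negbTE y0) /=.
    by move/eqP.
  exists (y 1 / y 0); rewrite divfK//; split=> //.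
  by apply: (mulfI e0); rewrite -dep; field.
have z x : y (x + 1) - rho * y x = 0 /\ y1 (x + 1) - rho * y1 x = 0.
  have hs := solD 1 (- rho) hu.1 hy.1.
  have [||k1 k2] := sol_unique hs _ _ x.
  - by rewrite add0r r1; ring.
  - by rewrite add0r r2; ring.
  - by move: k1 k2; rewrite !mul1r !mulNr.
exists rho; split.
- apply/eqP => r0; move: y0.
  have [k1 k2] := z (-1); rewrite addNr r0 !mul0r !subr0 in k1 k2.
  by rewrite k1 k2 eqxx.
- by move=> x; apply/eqP; rewrite -subr_eq0; apply/eqP; have [] := z x.
- by move=> x; apply/eqP; rewrite -subr_eq0; apply/eqP; have [] := z x.
Qed.

(** A vanishing Wronskian gives [y * u = 0] at 0, and the same computation with [Kop1] gives
    [y1 * u1 = 0]. For nonzero data, one function then has only a value and the other only a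
    derivative at 0, and their Wronskian cannot vanish. *)
Lemma eigen_independent l w y y1 u u1 : w2 l != 0 -> w != 0 ->
  eigen l w y y1 -> eigen l (- w) u u1 ->
  (y 0 != 0) || (y1 0 != 0) -> (u 0 != 0) || (u1 0 != 0) ->
  y1 0 * u 0 - y 0 * u1 0 != 0.
Proof.
move=> w20 w0 hy hu y0 u0; apply/eqP => W0.
have E1 := eigen_Kop1 hy 0; have E2 := eigen_Kop1 hu 0.
have F1 := hy.2 0; have F2 := hu.2 0.
have w2n : w / 2 != 0 by rewrite mulf_neq0// invr_eq0 pnatr_eq0.
have key a b : w / 2 * a = b -> - w / 2 * a = b -> a = 0.
  move=> h1 h2; apply: (mulfI w2n); rewrite mulr0.
  have /eqP : w / 2 * a = - (w / 2 * a) by rewrite {1}h1 -h2; ring.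
  by rewrite -addr_eq0 -mulr2n mulrn_eq0 /= => /eqP.
have : u 0 * y 0 = 0.
  apply: (mulfI w2n); rewrite mulr0.
  have := eigen_wronskian hy hu 0; rewrite W0 mulr0 => /esym.
  rewrite (_ : (w - - w) / 2 * _ = 2 * (w / 2 * (u 0 * y 0))); last by field.
  by move/eqP; rewrite mulf_eq0 pnatr_eq0 /= => /eqP.
have P10 : u1 0 * y1 0 = 0.
  have k1 : Kop1 l y y1 0 * u 0 - Kop1 l u u1 0 * y 0 =
      dPhi l 0 / 2 * (y1 0 * u 0 - y 0 * u1 0) by rewrite /Kop1; ring.
  have k2 : Kop1 l y y1 0 * u1 0 - Kop1 l u u1 0 * y1 0 =
      - (Phi l 0 * (12 * pot 0 + l) - ddPhi l 0 / 2) * (y1 0 * u 0 - y 0 * u1 0) by rewrite /Kop1; ring.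
  rewrite W0 mulr0 E1 E2 in k2; apply: (mulfI w2n); rewrite mulr0.
  have /eqP : 2 * (w / 2 * (u1 0 * y1 0)) = 0 by rewrite -k2; field.
  by rewrite mulf_eq0 pnatr_eq0 /= => /eqP.
move/eqP; rewrite mulf_eq0 => /orP[/eqP ua|/eqP ya].
  move: u0; rewrite ua eqxx /= => u10.
  move/eqP: P10; rewrite mulf_eq0 (negbTE u10) /= => /eqP y10.
  move: y0; rewrite y10 eqxx orbF => y0.
  by move/eqP: W0; rewrite ua y10 mulr0 sub0r oppr_eq0 mulf_eq0 (negbTE y0) (negbTE u10).
move: y0; rewrite ya eqxx /= => y10.
move/eqP: P10; rewrite mulf_eq0 (negbTE y10) orbF => /eqP u10.
move: u0; rewrite u10 eqxx orbF => u0.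
by move/eqP: W0; rewrite ya u10 mul0r subr0 mulf_eq0 (negbTE y10) (negbTE u0).
Qed.

(** For the data (1, 0) the value at 0 is [(w - dPhi) / 2], and for (0, 1) the derivative at 0 is
    [(w + dPhi) / 2]. Their sum is [w], so they do not both vanish. *)
Lemma eigproj_nonzero l w : w != 0 -> exists ab : R[i] * R[i],
  (eigproj l w (fund l ab.1 ab.2).1 (fund l ab.1 ab.2).2 0 != 0) ||
  (eigproj1 l w (fund l ab.1 ab.2).1 (fund l ab.1 ab.2).2 0 != 0).
Proof.
move=> w0; have [_ c0 c10] := fundP l 1 0; have [_ s0 s10] := fundP l 0 1.
have [h|h] := eqVneq (w - dPhi l 0) 0; last first.
  exists (1, 0); rewrite /eigproj /Kop /= c0 c10.
  rewrite (_ : _ + _ = (w - dPhi l 0) / 2); last by field.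
  by rewrite mulf_neq0// invr_eq0 pnatr_eq0.
exists (0, 1); apply/orP; right; rewrite /eigproj1 /Kop1 /= s0 s10.
rewrite (_ : _ + _ = w - (w - dPhi l 0) / 2); last by field.
by rewrite h mul0r subr0.
Qed.

End LameEquation.

(** * The integral of [Phi] over a period *)

Section LameIntegral.
Context {R : realType}.
Variables (tau z0 : R[i]).
Hypothesis tau_gt0 : 0 < im tau.
Hypothesis z0_regular : forall x : R, ~ lattice tau (x%:C + z0).

Local Notation E := (E tau).

(** The increment of zeta does not depend on the point and is computed at - 1 / 2, where oddness
    gives 2 zeta(1/2). *)
Lemma eta1_increment : E 1 (1%:C + z0) - E 1 (0%:C + z0) = eta1 tau.
Proof.
have hL : ~ lattice tau (- (1 / 2)).
  rewrite lattice_oppE.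
  have := @coord_not_lattice R tau tau_gt0 (2^-1) 0.
  rewrite rmorph0 mul0r addr0 fmorphV rmorph_nat mul1r; apply.
  by rewrite invr_gt0 ltr0n invf_lt1 ?ltr1n.
have zL := @z0_regular 0.
rewrite (_ : 1%:C + z0 = 0%:C + z0 + 1); last by rewrite rmorph1 rmorph0; ring.
rewrite (zeta_increment tau_gt0 zL hL) /eta1 wzetaE.
rewrite (_ : - (1 / 2) + 1 = 1 / 2); last by field.
rewrite E_opp ?expr1//; last by rewrite -lattice_oppE.
by ring.
Qed.

Lemma Phi_integral l : exists P : R -> R[i], (forall x, cder P (Phi tau z0 l x) x) /\
  P 1 - P 0 = - (4 / 15 * l ^+ 3 + 8 / 5 * eta1 tau * l ^+ 2
    - 3 * g2 tau * l + 9 * g3 tau - 6 * eta1 tau * g2 tau) / 60.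
Proof.
pose c := l * g2 tau / 15 - g3 tau / 4 - l ^+ 3 / 225.
pose b := 2 * l ^+ 2 / 75 - g2 tau / 4.
(* The powers wp^3 and wp^2 are reduced by (wp wp')' = 10 wp^3 - 3 g2 wp / 2 - g3 and wp'' = 6 wp^2
   - g2 / 2, while wp integrates to - zeta. The resulting coefficients of wp and of 1 are [k] and
   [k']. *)
pose k := 3 * g2 tau / 20 + b.
pose k' := g3 tau / 10 - l * g2 tau / 60 + c.
pose P x := 1 / 10 * (pot tau z0 x * dpot tau z0 x) - l / 30 * dpot tau z0 x
  - k * E 1 (x%:C + z0) + k' * x%:C.
exists P; split=> [x|].
  have d := cder_pot tau_gt0 z0_regular x; have d1 := cder_dpot tau_gt0 z0_regular x.
  have d2 := E_line tau_gt0 z0_regular x (k := 1) isT.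
  have d3 := cder_real (is_derive_id x (1 : R)).
  apply: cder_eq.
    exact: (cderD (cderB (cderB (cderZ (1 / 10) (cderM d d1)) (cderZ (l / 30) d1)) (cderZ k d2)) (cderZ k' d3)).
  rewrite -/(pot tau z0 x) -expr2 dpot2// /Phi /k /k' /b /c rmorph1; by field.
(* The terms with wp' are periodic, so only zeta and the linear term contribute. *)
have p1 := pot_period tau_gt0 z0_regular 0; have p2 := dpot_period tau_gt0 z0_regular 0.
rewrite add0r in p1 p2; rewrite /P p1 p2.
rewrite (_ : _ - _ = - k * (E 1 (1%:C + z0) - E 1 (0%:C + z0)) + k'); last first.
  by rewrite rmorph1 rmorph0; ring.
by rewrite eta1_increment /k /k' /b /c; field.
Qed.

End LameIntegral.

(** * Dependence on the spectral parameter *)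
Section SpectralParameter.
Context {R : realType}.
Variables (tau z0 : R[i]).
Hypothesis tau_gt0 : 0 < im tau.
Hypothesis z0_regular : forall x : R, ~ lattice tau (x%:C + z0).
Implicit Types (x t : R) (l w a b : R[i]) (y u : R -> R[i]).

Local Notation fund := (fund tau_gt0 z0_regular).
Local Notation sol := (sol tau z0).
Local Notation w2 := (w2 tau).
Local Notation Phi := (Phi tau z0).
Local Notation eigen := (eigen tau z0).

Lemma sol_fund l y y1 : sol l y y1 -> forall x,
  (fund l (y 0) (y1 0)).1 x = y x /\ (fund l (y 0) (y1 0)).2 x = y1 x.
Proof.
move=> hy x; have [hf f0 f10] := fundP tau_gt0 z0_regular l (y 0) (y1 0).
have hs := solD 1 (-1) hf hy.
have [||k1 k2] := sol_unique tau_gt0 z0_regular hs _ _ x.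
- by rewrite f0 mul1r mulN1r subrr.
- by rewrite f10 mul1r mulN1r subrr.
by rewrite !mul1r !mulN1r in k1 k2; split; apply/eqP; rewrite -subr_eq0; apply/eqP.
Qed.

Lemma fund_bounded l a b : exists M : R, forall x, 0 <= x <= 1 ->
  nc ((fund l a b).1 x) <= M /\ nc ((fund l a b).2 x) <= M.
Proof.
have [[d d1] _ _] := fundP tau_gt0 z0_regular l a b.
have bound (y y1 : R -> R[i]) : (forall x, cder y (y1 x) x) ->
    exists M : R, forall x, 0 <= x <= 1 -> nc (y x) <= M.
  move=> dy; have cy : continuous (fun x => nc (y x) ^+ 2).
    by move=> x; exact: is_derive_cont (is_derive_nc2 (dy x)).
  have [t0 _ hmax] := EVT_max (@ler01 R) (continuous_subspaceT cy).
  exists (nc (y t0) ^+ 2 + 1) => x x01.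
  have := hmax x; rewrite in_itv /= => /(_ x01).
  have := sqr_ge0 (nc (y x) - 1); rewrite sqrrB; have := sqr_ge0 (nc (y x)).
  by move: (nc (y x)) => c; lra.
have [M1 h1] := bound _ _ d; have [M2 h2] := bound _ _ d1.
exists (Num.max M1 M2) => x x01.
by split; rewrite le_max ?h1 ?h2// orbT.
Qed.

(** The difference of two solutions solves the equation at [l'] with forcing term [(l' - l) * y],
    where [y] is the solution at [l], and [gronwall] applies. *)
Lemma fund_cont l a b (e : R) : 0 < e -> exists2 d : R, 0 < d & forall l' a' b',
  nc (l' - l) < d -> nc (a' - a) < d -> nc (b' - b) < d -> forall x, 0 <= x <= 1 ->
  nc ((fund l' a' b').1 x - (fund l a b).1 x) < e /\
  nc ((fund l' a' b').2 x - (fund l a b).2 x) < e.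
Proof.
move=> e0; have [K hK] := pot_bounded tau_gt0 z0_regular.
have [M hM] := fund_bounded l a b.
have M0 : 0 <= M.
  by have [] := hM 0; [rewrite lexx ler01|move=> h _; exact: le_trans (nc_ge0 _) h].
have K0 : 0 <= K by exact: le_trans (nc_ge0 _) (hK 0).
pose L := 12 * K + nc l + 1.
pose X := expR ((2 + L) * 1); have X0 : 0 < X by exact: expR_gt0.
pose B := (1 + 1 + M ^+ 2) * X; have B0 : 0 < B.
  by rewrite mulr_gt0// ltr_wpDr ?sqr_ge0.
pose d := Num.min 1 (e / (B + 1)).
have d0 : 0 < d by rewrite lt_min ltr01 divr_gt0// ltr_wpDr// ltW.
exists d => // l' a' b' dl da db x x01.
have [[df df1] f0 f10] := fundP tau_gt0 z0_regular l a b.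
have [[dg dg1] g0 g10] := fundP tau_gt0 z0_regular l' a' b'.
have d1 : d <= 1 by rewrite ge_min lexx.
have := @gronwall R (fun t => (fund l' a' b').1 t - (fund l a b).1 t)
  (fun t => (fund l' a' b').2 t - (fund l a b).2 t) (fun t => 12 * pot tau z0 t + l')
  (fun t => (l' - l) * (fund l a b).1 t) L (d * M) 1 ler01 (mulr_ge0 (ltW d0) M0).
move=> h; have {}h := h _ _ _ _ x x01.
have {h} h : nc ((fund l' a' b').1 x - (fund l a b).1 x) ^+ 2 +
    nc ((fund l' a' b').2 x - (fund l a b).2 x) ^+ 2 <= d ^+ 2 * B.
  apply: le_trans (h _ _ _ _) _.
  - by move=> t _; exact: cderB (dg t) (df t).
  - by move=> t _; apply: cder_eq (cderB (dg1 t) (df1 t)) _; ring.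
  - move=> t _; apply: le_trans (ncD _ _) _; rewrite /L -addrA; apply: lerD.
      by rewrite ncM nc_nat ler_wpM2l.
    by have := ncD (l' - l) l; rewrite subrK; move: dl d1; lra.
  - move=> t t01; rewrite ncM; apply: ler_pM; rewrite ?nc_ge0 ?(ltW dl)//.
    by have [] := hM t t01.
  rewrite f0 f10 g0 g10 -/X /B mulrA ler_wpM2r ?(ltW X0)//.
  rewrite !mulrDr !mulr1 exprMn; apply: lerD => //; apply: lerD.
    by rewrite lerXn2r ?nnegrE ?nc_ge0 ?ltW.
  by rewrite lerXn2r ?nnegrE ?nc_ge0 ?ltW.
have lt : d ^+ 2 * B < e ^+ 2.
  have de : d * (B + 1) <= e.
    by rewrite -ler_pdivlMr ?ltr_wpDr ?(ltW B0)// ge_min lexx orbT.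
  apply: lt_le_trans (_ : (d * (B + 1)) ^+ 2 <= _); last first.
    by rewrite lerXn2r ?nnegrE ?(ltW e0)// mulr_ge0 ?(ltW d0)// addr_ge0// ltW.
  rewrite exprMn ltr_pM2l ?exprn_gt0// sqrrD mulr1 expr1n.
  by have := sqr_ge0 B; lra.
have s1 := sqr_ge0 (nc ((fund l' a' b').1 x - (fund l a b).1 x)).
have s2 := sqr_ge0 (nc ((fund l' a' b').2 x - (fund l a b).2 x)).
by split; rewrite -(ltr_pXn2r (n := 2)) ?nnegrE ?nc_ge0 ?(ltW e0)//; lra.
Qed.

Definition cont_at (F : R[i] -> R[i]) l := forall e : R, 0 < e ->
  exists2 d : R, 0 < d & forall l', nc (l' - l) < d -> nc (F l' - F l) < e.

Lemma hol_id (D : set R[i]) : hol D id (fun=> 1).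
Proof.
move=> z _; exists 0, 1; split=> // x h _ _.
by rewrite (_ : _ - _ - _ = 0) ?nc0 ?mul0r//=; ring.
Qed.

Definition entire (F : R[i] -> R[i]) := exists F', hol setT F F'.

Lemma entire_cst a : entire (fun=> a).
Proof. by exists (fun=> 0); exact: hol_cst. Qed.
Lemma entire_id : entire id.
Proof. by exists (fun=> 1); exact: hol_id. Qed.
Lemma entireD F G : entire F -> entire G -> entire (fun l => F l + G l).
Proof. by move=> [F' hF] [G' hG]; eexists; exact: holD hF hG. Qed.
Lemma entireM F G : entire F -> entire G -> entire (fun l => F l * G l).
Proof. by move=> [F' hF] [G' hG]; eexists; exact: holM hF hG. Qed.
Lemma entireN F : entire F -> entire (fun l => - F l).
Proof.
move=> [F' hF]; exists (fun l => -1 * F' l); apply: hol_eq (holZ (-1) hF) _ _ => // l.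
by rewrite mulN1r.
Qed.
Lemma entireX F n : entire F -> entire (fun l => F l ^+ n).
Proof.
move=> hF; elim: n => [|n IH]; first exact: entire_cst.
have [G' hG] := entireM hF IH; exists G'; apply: hol_eq hG _ _ => // l.
by rewrite exprS.
Qed.

Lemma entire_cont F l : entire F -> cont_at F l.
Proof. by move=> [F' hF] e e0; exact: (@hol_cont _ _ _ _ l hF I e e0). Qed.

Lemma cont_atD F G l : cont_at F l -> cont_at G l -> cont_at (fun l' => F l' + G l') l.
Proof.
move=> hF hG e e0; have e2 : 0 < e / 2 by rewrite divr_gt0.
have [d1 d10 h1] := hF _ e2; have [d2 d20 h2] := hG _ e2.
exists (Num.min d1 d2); first by rewrite lt_min d10.
move=> x; rewrite lt_min => /andP[x1 x2]; rewrite opprD addrACA.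
apply: le_lt_trans (ncD _ _) _; rewrite (splitr e); apply: ltrD; [exact: h1|exact: h2].
Qed.

Lemma cont_atZ c F l : cont_at F l -> cont_at (fun l' => c * F l') l.
Proof.
move=> hF e e0; have k0 : 0 < nc c + 1 by rewrite ltr_wpDl// nc_ge0.
have [d d0 hd] := hF _ (divr_gt0 e0 k0); exists d => // x /hd h.
rewrite -mulrBr ncM; apply: le_lt_trans (_ : (nc c + 1) * nc (F x - F l) < _).
  by rewrite ler_wpM2r ?nc_ge0// lerDl.
by rewrite mulrC -ltr_pdivlMr.
Qed.

Lemma entire_Phi x : entire (Phi ^~ x).
Proof.
pose p := pot tau z0 x.
exact: (entireD (entireD (entireD (entire_cst (p ^+ 3))
    (entireN (entireM (entireM entire_id (entire_cst 5^-1)) (entire_cst (p ^+ 2)))))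
  (entireM (entireD (entireM (entireM (entire_cst 2) (entireX 2 entire_id)) (entire_cst 75^-1))
    (entire_cst (- (g2 tau / 4)))) (entire_cst p)))
  (entireD (entireD (entireM (entireM entire_id (entire_cst (g2 tau))) (entire_cst 15^-1))
    (entire_cst (- (g3 tau / 4)))) (entireN (entireM (entireX 3 entire_id) (entire_cst 225^-1))))).
Qed.

Lemma entire_dPhi_coef x :
  entire (fun l => 3 * pot tau z0 x ^+ 2 - 2 * l / 5 * pot tau z0 x + (2 * l ^+ 2 / 75 - g2 tau / 4)).
Proof.
pose p := pot tau z0 x.
exact: (entireD (entireD (entire_cst (3 * p ^+ 2))
    (entireN (entireM (entireM (entireM (entire_cst 2) entire_id) (entire_cst 5^-1)) (entire_cst p))))
  (entireD (entireM (entireM (entire_cst 2) (entireX 2 entire_id)) (entire_cst 75^-1))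
    (entire_cst (- (g2 tau / 4))))).
Qed.

Lemma entire_dPhi x : entire (dPhi tau z0 ^~ x).
Proof. exact: (entireM (entire_dPhi_coef x) (entire_cst (dpot tau z0 x))). Qed.

Lemma entire_ddPhi x : entire (ddPhi tau z0 ^~ x).
Proof.
pose p := pot tau z0 x.
exact: (entireD (entireM (entireD (entire_cst (6 * p))
    (entireN (entireM (entireM (entire_cst 2) entire_id) (entire_cst 5^-1))))
    (entire_cst (4 * p ^+ 3 - g2 tau * p - g3 tau)))
  (entireM (entire_dPhi_coef x) (entire_cst (6 * p ^+ 2 - g2 tau / 2)))).
Qed.

Lemma entire_w2 : entire w2.
Proof.
have H : entire (fun l => dPhi tau z0 l 0 ^+ 2 + - (2 * Phi l 0 * ddPhi tau z0 l 0) +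
    4 * (12 * pot tau z0 0 + l) * Phi l 0 ^+ 2).
  exact: (entireD (entireD (entireX 2 (entire_dPhi 0))
      (entireN (entireM (entireM (entire_cst 2) (entire_Phi 0)) (entire_ddPhi 0))))
    (entireM (entireM (entire_cst 4) (entireD (entire_cst (12 * pot tau z0 0)) entire_id))
      (entireX 2 (entire_Phi 0)))).
case: H => F' hF; exists F'; apply: hol_eq hF _ _ => // l.
exact: w2E.
Qed.

(** The root nearer to [w0] is taken, since [sqrtc] may jump. Two values of the branch near [w0]
    have a sum of modulus at least |w0|, and the difference of their squares factors through it;
    this gives continuity. *)
Lemma sqrt_branch (F : R[i] -> R[i]) l0 : (forall l, cont_at F l) -> F l0 != 0 ->
  exists (d : R) (W : R[i] -> R[i]), 0 < d /\ forall l, nc (l - l0) < d ->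
    [/\ F l != 0, W l ^+ 2 = F l & cont_at W l].
Proof.
move=> cF F0; pose w0 := sqrtc (F l0).
have w02 : w0 ^+ 2 = F l0 by exact: sqr_sqrtc.
have w00 : w0 != 0 by apply: contraNneq F0 => h; rewrite -w02 h expr0n.
have n0 : 0 < nc w0 by rewrite nc_gt0.
pose W l := if nc (sqrtc (F l) - w0) <= nc (sqrtc (F l) + w0) then sqrtc (F l) else - sqrtc (F l).
have W2 l : W l ^+ 2 = F l.
  by rewrite /W; case: ifP => _; rewrite ?sqrrN sqr_sqrtc.
have Wclose l : nc (W l - w0) <= nc (W l + w0).
  rewrite /W; case: ifPn => // h; rewrite -ltNge in h.
  by rewrite -ncN opprB opprK addrC -[leRHS]ncN opprD opprK ltW.
have e0 : 0 < nc w0 ^+ 2 / 16 by rewrite divr_gt0// exprn_gt0.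
have [d d0 hd] := cF l0 _ e0.
have near l : nc (l - l0) < d -> nc (W l - w0) < nc w0 / 4.
  move=> /hd h; rewrite -(ltr_pXn2r (n := 2)) ?nnegrE ?nc_ge0 ?divr_ge0 ?nc_ge0//.
  rewrite expr_div_n (_ : 4 ^+ 2 = 16 :> R); last by ring.
  apply: le_lt_trans h; rewrite -W2 -w02 subr_sqr ncM expr2 ler_wpM2l ?nc_ge0//.
exists d, W; split=> // l ld; have Wl := near l ld.
have Fl0 : F l != 0.
  rewrite -W2 expf_neq0// -nc_gt0.
  have := ncBl w0 (w0 - W l); rewrite subKr (ncBC w0); lra.
split => // e ep.
have k0 : 0 < e * nc w0 by rewrite mulr_gt0.
have [d1 d10 h1] := cF l _ k0.
exists (Num.min d1 (d - nc (l - l0))); first by rewrite lt_min d10 subr_gt0.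
move=> l'; rewrite lt_min => /andP[l1 l2].
have Wl' : nc (W l' - w0) < nc w0 / 4.
  apply: near; rewrite (_ : l' - l0 = (l' - l) + (l - l0)); last by ring.
  by apply: le_lt_trans (ncD _ _) _; lra.
have big : nc w0 <= nc (W l' + W l).
  have := ncBl (2 * w0) (2 * w0 - (W l' + W l)); rewrite subKr ncM nc_nat.
  rewrite (_ : 2 * w0 - _ = - ((W l' - w0) + (W l - w0))); last by ring.
  by rewrite ncN; have := ncD (W l' - w0) (W l - w0); lra.
have := h1 l' l1; rewrite -!W2 subr_sqr ncM => h.
rewrite -(ltr_pM2r n0); apply: le_lt_trans h.
by rewrite ler_wpM2l ?nc_ge0.
Qed.

(* [rho l] is the multiplier of [yp l], and [W] a branch of the square root of [w2]. *)
Definition floquet_family l0 (d : R) (yp yp1 ym ym1 : R[i] -> R -> R[i]) (rho W : R[i] -> R[i]) :=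
  forall l, nc (l - l0) < d ->
  [/\ [/\ W l ^+ 2 = w2 l, W l != 0, sol l (yp l) (yp1 l) & sol l (ym l) (ym1 l)],
      [/\ rho l != 0, forall x, yp l (x + 1) = rho l * yp l x, forall x, yp1 l (x + 1) = rho l * yp1 l x,
        forall x, ym l (x + 1) = (rho l)^-1 * ym l x & forall x, ym1 l (x + 1) = (rho l)^-1 * ym1 l x],
      yp1 l 0 * ym l 0 - yp l 0 * ym1 l 0 != 0,
      forall x, Phi l x * (yp1 l 0 * ym l 0 - yp l 0 * ym1 l 0) = W l * (yp l x * ym l x) &
      forall e : R, 0 < e -> exists2 r : R, 0 < r & forall l', nc (l' - l) < r -> forall x, 0 <= x <= 1 ->
        nc (yp l' x - yp l x) < e /\ nc (yp1 l' x - yp1 l x) < e].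

Lemma floquet_exists l0 : w2 l0 != 0 -> exists d yp yp1 ym ym1 rho W,
  [/\ 0 < d, floquet_family l0 d yp yp1 ym ym1 rho W & cont_at W l0].
Proof.
move=> w20.
have [d [W [d0 hW]]] := sqrt_branch (fun l => entire_cont l entire_w2) w20.
have [_ W2 cW0] : [/\ w2 l0 != 0, W l0 ^+ 2 = w2 l0 & cont_at W l0].
  by apply: hW; rewrite subrr nc0.
have W0 : W l0 != 0 by apply: contraNneq w20 => h; rewrite -W2 h expr0n.
have WN0 : - W l0 != 0 by rewrite oppr_eq0.
have [ab hp] := eigproj_nonzero tau_gt0 z0_regular l0 W0.
have [cd hm] := eigproj_nonzero tau_gt0 z0_regular l0 WN0.
(* [A] and [B] are the initial data of the eigenfunction projected from the solution with data [p],
   for the eigenvalue [s * W l / 2] with [s = 1] or [s = - 1]. Near [l0] they are continuous in [l],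
   as combinations of entire functions and [W]. *)
pose A (s : R[i]) (p : R[i] * R[i]) l := (Phi l 0 * p.2 - dPhi tau z0 l 0 / 2 * p.1) + s * p.1 / 2 * W l.
pose B (s : R[i]) (p : R[i] * R[i]) l := (dPhi tau z0 l 0 / 2 * p.2 +
  (Phi l 0 * (12 * pot tau z0 0 + l) - ddPhi tau z0 l 0 / 2) * p.1) + s * p.2 / 2 * W l.
have cA s p l : nc (l - l0) < d -> cont_at (A s p) l.
  move=> ld; have [_ _ cW] := hW l ld; apply: cont_atD; last exact: cont_atZ.
  apply: entire_cont.
  exact: (entireD (entireM (entire_Phi 0) (entire_cst p.2))
    (entireN (entireM (entireM (entire_dPhi 0) (entire_cst 2^-1)) (entire_cst p.1)))).
have cB s p l : nc (l - l0) < d -> cont_at (B s p) l.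
  move=> ld; have [_ _ cW] := hW l ld; apply: cont_atD; last exact: cont_atZ.
  apply: entire_cont.
  exact: (entireD (entireM (entireM (entire_dPhi 0) (entire_cst 2^-1)) (entire_cst p.2))
    (entireM (entireD (entireM (entire_Phi 0) (entireD (entire_cst (12 * pot tau z0 0)) entire_id))
      (entireN (entireM (entire_ddPhi 0) (entire_cst 2^-1)))) (entire_cst p.1))).
have eig s p l : s ^+ 2 = 1 -> nc (l - l0) < d ->
    eigen l (s * W l) (fund l (A s p l) (B s p l)).1 (fund l (A s p l) (B s p l)).2.
  move=> s1 ld; have [_ Wl2 _] := hW l ld.
  have [hf f0 f10] := fundP tau_gt0 z0_regular l p.1 p.2.
  have sW : (s * W l) ^+ 2 = w2 l by rewrite exprMn s1 mul1r.
  have hp' := eigproj_eigen tau_gt0 z0_regular sW hf.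
  set f := (fund l p.1 p.2).1 in hf f0 hp'; set f1 := (fund l p.1 p.2).2 in hf f10 hp'.
  have eA : eigproj tau z0 l (s * W l) f f1 0 = A s p l.
    by rewrite /eigproj /Kop f0 f10 /A; field.
  have eB : eigproj1 tau z0 l (s * W l) f f1 0 = B s p l.
    by rewrite /eigproj1 /Kop1 f0 f10 /B; field.
  have hs := sol_fund hp'.1; rewrite eA eB in hs.
  have [k1 k2] : (fund l (A s p l) (B s p l)).1 = eigproj tau z0 l (s * W l) f f1 /\
      (fund l (A s p l) (B s p l)).2 = eigproj1 tau z0 l (s * W l) f f1.
    by split; apply/funext => x; have [] := hs x.
  by rewrite k1 k2.
have at0 s p : (eigproj tau z0 l0 (s * W l0) (fund l0 p.1 p.2).1 (fund l0 p.1 p.2).2 0 != 0) ||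
    (eigproj1 tau z0 l0 (s * W l0) (fund l0 p.1 p.2).1 (fund l0 p.1 p.2).2 0 != 0) ->
    (A s p l0 != 0) || (B s p l0 != 0).
  have [_ f0 f10] := fundP tau_gt0 z0_regular l0 p.1 p.2.
  rewrite /eigproj /eigproj1 /Kop /Kop1 f0 f10.
  rewrite (_ : _ - _ + _ = A s p l0); last by rewrite /A; field.
  by rewrite (_ : _ * _ + _ * _ + _ = B s p l0)//; rewrite /B; field.
have nz s p : (A s p l0 != 0) || (B s p l0 != 0) -> exists2 r : R, 0 < r & forall l, nc (l - l0) < r ->
    (A s p l != 0) || (B s p l != 0).
  have l0d : nc (l0 - l0) < d by rewrite subrr nc0.
  have one (F : R[i] -> R[i]) : cont_at F l0 -> F l0 != 0 ->
      exists2 r : R, 0 < r & forall l, nc (l - l0) < r -> F l != 0.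
    move=> cF F0; have n0 : 0 < nc (F l0) by rewrite nc_gt0.
    have [r r0 hr] := cF _ n0; exists r => // l /hr; rewrite ncBC => h.
    by apply/eqP => k; rewrite k subr0 ltxx in h.
  case/orP=> h.
    by have [r r0 hr] := one _ (cA s p l0 l0d) h; exists r => // l /hr ->.
  by have [r r0 hr] := one _ (cB s p l0 l0d) h; exists r => // l /hr ->; rewrite orbT.
have [r1 r10 n1] := nz 1 ab (at0 1 ab (ltac:(by rewrite mul1r))).
have [r2 r20 n2] := nz (-1) cd (at0 (-1) cd (ltac:(by rewrite mulN1r))).
pose yp l := (fund l (A 1 ab l) (B 1 ab l)).1; pose yp1 l := (fund l (A 1 ab l) (B 1 ab l)).2.
pose ym l := (fund l (A (-1) cd l) (B (-1) cd l)).1; pose ym1 l := (fund l (A (-1) cd l) (B (-1) cd l)).2.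
have p0 l : yp l 0 = A 1 ab l /\ yp1 l 0 = B 1 ab l.
  by have [_ k1 k2] := fundP tau_gt0 z0_regular l (A 1 ab l) (B 1 ab l).
have m0 l : ym l 0 = A (-1) cd l /\ ym1 l 0 = B (-1) cd l.
  by have [_ k1 k2] := fundP tau_gt0 z0_regular l (A (-1) cd l) (B (-1) cd l).
(* At least one of the two initial values is nonzero near [l0], and its ratio gives the
   multiplier. *)
pose rho l := if yp l 0 == 0 then yp1 l 1 / yp1 l 0 else yp l 1 / yp l 0.
pose D := Num.min d (Num.min r1 r2).
have D0 : 0 < D by rewrite !lt_min d0 r10.
exists D, yp, yp1, ym, ym1, rho, W; split; [exact: D0| |exact: cW0].
move=> l; rewrite !lt_min => /andP[ld /andP[l1 l2]].
have [w2l Wl2 cW] := hW l ld.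
have Wl0 : W l != 0 by apply: contraNneq w2l => h; rewrite -Wl2 h expr0n.
have hyp : eigen l (W l) (yp l) (yp1 l).
  by have := eig 1 ab l (ltac:(by rewrite expr1n)) ld; rewrite mul1r.
have hym : eigen l (- W l) (ym l) (ym1 l).
  by have := eig (-1) cd l (ltac:(by rewrite sqrrN expr1n)) ld; rewrite mulN1r.
have yp0 : (yp l 0 != 0) || (yp1 l 0 != 0) by have [-> ->] := p0 l; exact: n1.
have ym0 : (ym l 0 != 0) || (ym1 l 0 != 0) by have [-> ->] := m0 l; exact: n2.
have [rp [rp0 rp1 rp2]] := eigen_multiplier tau_gt0 z0_regular w2l hyp yp0.
have [rm [rm0 rm1 rm2]] := eigen_multiplier tau_gt0 z0_regular w2l hym ym0.
have Wr := eigen_independent tau_gt0 z0_regular w2l Wl0 hyp hym yp0 ym0.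
have rhoE : rho l = rp.
  have k1 := rp1 0; have k2 := rp2 0; rewrite add0r in k1 k2.
  rewrite /rho; case: ifPn => [/eqP h|h]; last by rewrite k1 mulfK.
  by move: yp0; rewrite h eqxx /= => h1; rewrite k2 mulfK.
(* The Wronskian is constant and is multiplied by [rp * rm] over a period, so the two multipliers
   are reciprocal. *)
have rmE : rm = (rho l)^-1.
  have := wronskian_const hyp.1 hym.1 1 0.
  have := rp1 0; have := rp2 0; have := rm1 0; have := rm2 0; rewrite add0r => -> -> -> ->.
  rewrite (_ : _ - _ = rp * rm * (yp1 l 0 * ym l 0 - yp l 0 * ym1 l 0)); last by ring.
  rewrite -[RHS]mul1r => /(mulIf Wr) h; rewrite rhoE.
  by apply: (mulfI rp0); rewrite h mulfV.
split.
- by split; [exact: Wl2|exact: Wl0|exact: hyp.1|exact: hym.1].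
- by rewrite -rmE rhoE; split.
- exact: Wr.
- move=> x; have := eigen_wronskian hyp hym x.
  rewrite (wronskian_const hyp.1 hym.1 x 0) => ->.
  by field.
- move=> e e0; have [r r0 hr] := fund_cont l (A 1 ab l) (B 1 ab l) e0.
  have [s1 s10 k1] := cA 1 ab l ld r r0; have [s2 s20 k2] := cB 1 ab l ld r r0.
  exists (Num.min r (Num.min s1 s2)); first by rewrite !lt_min r0 s10.
  move=> l'; rewrite !lt_min => /andP[q1 /andP[q2 q3]] x x01.
  by apply: hr => //; [exact: k1|exact: k2].
Qed.

End SpectralParameter.

(** Complex differentiability at the single point [l], which is what continuity of the Floquet
    solutions in the parameter provides for the multiplier. *)
Definition cdiff {R : realType} (F : R[i] -> R[i]) (a l : R[i]) := forall e : R, 0 < e ->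
  exists2 r : R, 0 < r & forall h, nc h < r -> nc (F (l + h) - F l - a * h) <= e * nc h.

(** * The logarithmic derivative of the multiplier *)

Section MultiplierDerivative.
Context {R : realType}.
Variables (tau z0 : R[i]).
Hypothesis tau_gt0 : 0 < im tau.
Hypothesis z0_regular : forall x : R, ~ lattice tau (x%:C + z0).

Lemma bounded01 (y y1 : R -> R[i]) : (forall x, cder y (y1 x) x) ->
  exists2 M : R, 0 <= M & forall x : R, 0 <= x <= 1 -> nc (y x) <= M.
Proof.
move=> dy; have cy : continuous (fun x => nc (y x) ^+ 2).
  by move=> x; exact: is_derive_cont (is_derive_nc2 (dy x)).
have [t0 _ hmax] := EVT_max (@ler01 R) (continuous_subspaceT cy).
exists (nc (y t0) ^+ 2 + 1) => [|x x01]; first by rewrite addr_ge0// sqr_ge0.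
have := hmax x; rewrite in_itv /= => /(_ x01).
have := sqr_ge0 (nc (y x) - 1); rewrite sqrrB; have := sqr_ge0 (nc (y x)).
by move: (nc (y x)) => c; lra.
Qed.

Lemma rho_derivative l0 d yp yp1 ym ym1 rho W :
  floquet_family tau z0 l0 d yp yp1 ym ym1 rho W ->
  forall l, nc (l - l0) < d -> forall P, (forall x : R, cder P (Phi tau z0 l x) x) ->
  cdiff rho (rho l * ((P 1 - P 0) / W l)) l.
Proof.
move=> hF l ld P dP.
have [[Wl2 Wl0 [dyp dyp1] [dym dym1]] [r0 rp rp1 rm rm1] Wr0 hPhi hcont] := hF l ld.
set Wr := yp1 l 0 * ym l 0 - yp l 0 * ym1 l 0 in Wr0 hPhi.
set q := (P 1 - P 0) / W l.
have cpm : ccont (fun x => yp l x * ym l x).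
  by apply: ccontM; [exact: cder_ccont dyp|exact: cder_ccont dym].
set pp := prim (fun x => yp l x * ym l x).
(* Integrating the relation between [Phi] and the product of the Floquet solutions converts the
   integral of [yp * ym] into that of [Phi]. *)
have ppE : pp 1 = Wr * q.
  have h : Wr * P 1 - W l * pp 1 = Wr * P 0 - W l * pp 0.
    apply: (@cder0_const _ (fun x => Wr * P x - W l * pp x)) => t.
    apply: cder_eq (cderB (cderZ Wr (dP t)) (cderZ (W l) (primP t cpm))) _.
    by rewrite mulrC hPhi subrr.
  rewrite /pp prim0 -/pp mulr0 subr0 in h; apply: (mulfI Wl0).
  rewrite (_ : W l * pp 1 = Wr * (P 1 - P 0)); last by rewrite mulrBr -h; ring.
  by rewrite /q; field.
have [M M0 hM] := bounded01 dym.
pose M' := nc (ym l 0) + nc (ym1 l 0).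
have M'0 : 0 <= M' by rewrite addr_ge0 ?nc_ge0.
have nW : 0 < nc Wr by rewrite nc_gt0.
have nr : 0 < nc (rho l) by rewrite nc_gt0.
pose C := 2 / nc Wr * (nc (rho l) * (2 * M) + nc (rho l * q) * M').
have C0 : 0 <= C by rewrite mulr_ge0 ?divr_ge0 ?addr_ge0 ?mulr_ge0 ?nc_ge0.
move=> e e0.
(* The second bound keeps the mixed Wronskian at 0 above half of |Wr|; the first one yields the
   final error. *)
pose e' := Num.min (e / (C + 1)) (nc Wr / (2 * (M' + 1))).
have C1 : 0 < C + 1 by rewrite ltr_wpDl.
have M'1 : 0 < 2 * (M' + 1) by rewrite mulr_gt0// ltr_wpDl.
have e'0 : 0 < e' by rewrite lt_min !divr_gt0.
have [r r_gt0 hr] := hcont _ e'0.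
exists (Num.min r (d - nc (l - l0))); first by rewrite lt_min r_gt0 subr_gt0.
move=> h; rewrite lt_min => /andP[h1 h2]; set l' := l + h.
have ll' : l' - l = h by rewrite /l' addrAC subrr add0r.
have ld' : nc (l' - l0) < d.
  by rewrite (_ : l' - l0 = h + (l - l0)); [apply: le_lt_trans (ncD _ _) _; lra|rewrite /l'; ring].
have [[_ _ [dyp' dyp1'] _] [r0' rp' rp1' _ _] _ _ _] := hF l' ld'.
have close x : 0 <= x <= 1 -> nc (yp l' x - yp l x) < e' /\ nc (yp1 l' x - yp1 l x) < e'.
  by move=> x01; apply: hr => //; rewrite ll'.
(* The Wronskian of [yp] at the nearby parameter [l'] with [ym] at [l]. Its derivative carries the
   explicit factor [h], so that continuity of [yp] in the parameter already determines the
   first-order change of [rho]. *)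
pose J (x : R) := yp1 l' x * ym l x - yp l' x * ym1 l x.
have dJ x : cder J (h * (yp l' x * ym l x)) x.
  apply: cder_eq (cderB (cderM (dyp1' x) (dym x)) (cderM (dyp' x) (dym1 x))) _.
  by rewrite -ll'; ring.
have J1 : J 1 = rho l' / rho l * J 0.
  rewrite /J -[1]add0r rp' rp1' rm rm1; ring.
have err : nc (J 1 - J 0 - h * pp 1) <= 2 * (nc h * (e' * M)).
  have := @cder_bound R (fun x => J x - h * pp x) (fun x => h * ((yp l' x - yp l x) * ym l x))
    (nc h * (e' * M)) 0 1 ler01.
  rewrite /pp prim0 -/pp mulr0 !subr0 mulr1 addrAC; apply.
    move=> t _; apply: cder_eq (cderB (dJ t) (cderZ h (primP t cpm))) _; ring.
  move=> t t01; rewrite !ncM ler_wpM2l ?nc_ge0//; apply: ler_pM; rewrite ?nc_ge0//.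
    by apply/ltW; have [] := close t t01.
  exact: hM.
have J0W : nc (J 0 - Wr) <= e' * M'.
  have z01 : 0 <= (0 : R) <= 1 by rewrite lexx ler01.
  have [c1 c2] := close 0 z01.
  rewrite (_ : J 0 - Wr = (yp1 l' 0 - yp1 l 0) * ym l 0 - (yp l' 0 - yp l 0) * ym1 l 0); last first.
    by rewrite /J /Wr; ring.
  apply: le_trans (ncB _ _) _; rewrite !ncM /M' mulrDr; apply: lerD; rewrite ler_wpM2r ?nc_ge0//; exact: ltW.
have J0big : nc Wr / 2 <= nc (J 0).
  have := ncBl Wr (Wr - J 0); rewrite subKr (ncBC Wr) => k.
  have : e' * M' <= nc Wr / 2.
    apply: le_trans (_ : nc Wr / (2 * (M' + 1)) * M' <= _).
      by rewrite ler_wpM2r// ge_min lexx orbT.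
    rewrite invfM mulrA -mulrA ler_piMr ?divr_ge0 ?nc_ge0// mulrC ler_pdivrMr ?ltr_wpDl// mul1r.
    by rewrite lerDl.
  lra.
have J0p : 0 < nc (J 0) by apply: lt_le_trans J0big; rewrite divr_gt0.
have J0n : J 0 != 0 by rewrite -nc_gt0.
have eq : rho l' - rho l - rho l * q * h =
    (rho l * (J 1 - J 0 - h * pp 1) - h * (rho l * q) * (J 0 - Wr)) / J 0.
  by rewrite J1 ppE; field; rewrite J0n r0.
rewrite -/q eq ncM ncV ler_pdivrMr//.
have k1 : nc (rho l * (J 1 - J 0 - h * pp 1) - h * (rho l * q) * (J 0 - Wr)) <=
    nc h * e' * (nc (rho l) * (2 * M) + nc (rho l * q) * M').
  apply: le_trans (ncB _ _) _; rewrite [leRHS]mulrDr; apply: lerD.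
    rewrite ncM [leRHS](_ : _ = nc (rho l) * (2 * (nc h * (e' * M)))); last by ring.
    by rewrite ler_wpM2l ?nc_ge0.
  rewrite (ncM (h * (rho l * q))) (ncM h) [leRHS](_ : _ = nc h * nc (rho l * q) * (e' * M')); last by ring.
  by rewrite ler_wpM2l ?mulr_ge0 ?nc_ge0.
apply: le_trans k1 _.
have k2 : (nc (rho l) * (2 * M) + nc (rho l * q) * M') = C * (nc Wr / 2).
  by rewrite /C; field; rewrite gt_eqF.
have eC : e' <= e / (C + 1) by rewrite ge_min lexx.
rewrite k2; clearbody C e'; rewrite mulrA.
apply: ler_pM; [by rewrite !mulr_ge0 ?nc_ge0 ?(ltW e'0)|by rewrite divr_ge0 ?nc_ge0| |exact: J0big].
rewrite -mulrA mulrC ler_wpM2r ?nc_ge0//.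
apply: le_trans (_ : e / (C + 1) * (C + 1) <= _); last by rewrite divfK// gt_eqF.
apply: ler_pM => //; first exact: ltW.
by rewrite lerDl.
Qed.

End MultiplierDerivative.

(** * Square-integrable functions *)

Section SquareIntegrable.
Context {R : realType}.
Implicit Types (f g y : R -> R[i]).
Local Notation mu := (@lebesgue_measure R).

Definition cmeas f := (measurable_fun setT (fun x => re (f x)) /\
  measurable_fun setT (fun x => im (f x)))%type.

Definition sqint f : \bar R := (\int[mu]_x ((nc (f x)) ^+ 2)%:E)%E.

Lemma ccont_cmeas f : ccont f -> cmeas f.
Proof. by move=> [f1 f2]; split; exact: continuous_measurable_fun. Qed.

Lemma cmeasD f g : cmeas f -> cmeas g -> cmeas (fun x => f x + g x).
Proof.
move=> [f1 f2] [g1 g2]; split.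
  rewrite (_ : (fun _ => _) = (fun x => re (f x) + re (g x))); last by apply/funext => x; rewrite reD.
  exact: measurable_funD.
rewrite (_ : (fun _ => _) = (fun x => im (f x) + im (g x))); last by apply/funext => x; rewrite imD.
exact: measurable_funD.
Qed.

Lemma cmeasM f g : cmeas f -> cmeas g -> cmeas (fun x => f x * g x).
Proof.
move=> [f1 f2] [g1 g2]; split.
  rewrite (_ : (fun _ => _) = (fun x => re (f x) * re (g x) - im (f x) * im (g x))); last by apply/funext => x; rewrite reM.
  by apply: measurable_funB; exact: measurable_funM.
rewrite (_ : (fun _ => _) = (fun x => re (f x) * im (g x) + im (f x) * re (g x))); last by apply/funext => x; rewrite imM.
by apply: measurable_funD; exact: measurable_funM.
Qed.

Lemma cmeas_cst (a : R[i]) : cmeas (fun=> a).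
Proof. exact/ccont_cmeas/ccont_cst. Qed.

Lemma cmeas_nc2 f : cmeas f -> measurable_fun setT (fun x => nc (f x) ^+ 2).
Proof.
move=> [f1 f2].
rewrite (_ : (fun _ => _) = (fun x => re (f x) ^+ 2 + im (f x) ^+ 2)); last by apply/funext => x; rewrite nc_sqr.
by apply: measurable_funD; exact: measurable_funX.
Qed.

Lemma cmeas_nc f : cmeas f -> measurable_fun setT (fun x => nc (f x)).
Proof.
move=> /cmeas_nc2 h.
rewrite (_ : (fun _ => _) = (fun x => Num.sqrt (nc (f x) ^+ 2))); last first.
  by apply/funext => x; rewrite sqrtr_sqr ger0_norm// nc_ge0.
by apply: measurableT_comp h; apply: continuous_measurable_fun; exact: sqrt_continuous.
Qed.

Lemma sqintE f : (L2norm f `^ 2)%E = sqint f.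
Proof.
rewrite /L2norm poweR_Lnorm ?pnatr_eq0//; apply: eq_integral => x _ /=.
by rewrite (ger0_norm (nc_ge0 _)) powR_mulrn ?nc_ge0.
Qed.

Lemma sqint_ge0 f : (0 <= sqint f)%E.
Proof. by apply: integral_ge0 => x _; rewrite lee_fin sqr_ge0. Qed.

Lemma L2normE f : L2norm f = (sqint f `^ 2^-1)%E.
Proof. by rewrite -sqintE -poweRrM divff ?pnatr_eq0// poweRe1// Lnorm_ge0. Qed.

Lemma L2P f : L2 f <-> cmeas f /\ (sqint f < +oo)%E.
Proof.
split=> [[f1 f2 ff]|[[f1 f2] ff]].
  split; first by split.
  by rewrite -sqintE poweR_lty.
by split=> //; rewrite L2normE poweR_lty.
Qed.

Lemma L2norm_le f g (M : R) : 0 <= M -> (sqint f <= (M ^+ 2)%:E * sqint g)%E ->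
  (L2norm f <= M%:E * L2norm g)%E.
Proof.
move=> M0 h; rewrite !L2normE.
have -> : M%:E = ((M ^+ 2)%:E `^ 2^-1)%E.
  by rewrite poweR_EFin powR12_sqrt ?sqr_ge0// sqrtr_sqr ger0_norm.
rewrite -poweRM ?lee_fin ?sqr_ge0 ?sqint_ge0//.
apply: gt0_ler_poweR => //; rewrite ?in_itv/= ?leey ?andbT ?sqint_ge0 ?mule_ge0 ?lee_fin ?sqr_ge0//; exact: sqint_ge0.
Qed.

End SquareIntegrable.

(** * Complex Lebesgue integrals and primitives *)

Section ComplexIntegral.
Context {R : realType}.
Implicit Types (f g h y : R -> R[i]) (D : set R).
Local Notation mu := (@lebesgue_measure R).
Local Notation meas := (@measurable _ (measurableTypeR R)).

(** Measurability is imposed on the whole line, so that only integrability has to be checked when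
    the domain changes. *)
Definition cint D f := cmeas f /\ mu.-integrable D (fun x => (nc (f x))%:E).
Definition cI D f : R[i] := (\int[mu]_(x in D) re (f x)) +i* (\int[mu]_(x in D) im (f x)).
Definition lint f := forall a b : R, cint `[a, b] f.

Lemma integrableZ D (c : R) (F : R -> R) : meas D -> mu.-integrable D (EFin \o F) ->
  mu.-integrable D (EFin \o (fun x => c * F x)).
Proof.
move=> mD IF; rewrite (_ : EFin \o _ = (fun x => c%:E * (EFin \o F) x)%E); last by apply/funext => x; rewrite /= EFinM.
exact: integrableZl.
Qed.

Lemma integrable_add D (F G : R -> R) : meas D -> mu.-integrable D (EFin \o F) ->
  mu.-integrable D (EFin \o G) -> mu.-integrable D (EFin \o (fun x => F x + G x)).
Proof.
move=> mD IF IG; rewrite (_ : EFin \o _ = (EFin \o F) \+ (EFin \o G))%E; last by apply/funext.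
exact: integrableD.
Qed.

Lemma cint_dom D f (F : R -> R) : meas D -> cmeas f -> mu.-integrable D (EFin \o F) ->
  (forall x, D x -> nc (f x) <= F x) -> cint D f.
Proof.
move=> mD mf iF fF; split=> //; apply: le_integrable iF => //.
  by apply/measurable_EFinP/measurable_funTS; exact: cmeas_nc.
move=> x Dx /=; rewrite lee_fin ger0_norm ?nc_ge0//; apply: le_trans (fF x Dx) _.
exact: ler_norm.
Qed.

Lemma cint_re D f : meas D -> cint D f -> mu.-integrable D (EFin \o (fun x => re (f x))).
Proof.
move=> mD [[f1 f2] h]; apply: le_integrable h => //.
  by apply/measurable_EFinP/measurable_funTS.
by move=> x Dx /=; rewrite lee_fin (ger0_norm (nc_ge0 _)) nc_re.
Qed.

Lemma cint_im D f : meas D -> cint D f -> mu.-integrable D (EFin \o (fun x => im (f x))).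
Proof.
move=> mD [[f1 f2] h]; apply: le_integrable h => //.
  by apply/measurable_EFinP/measurable_funTS.
by move=> x Dx /=; rewrite lee_fin (ger0_norm (nc_ge0 _)) nc_im.
Qed.

Lemma cID D f g : meas D -> cint D f -> cint D g ->
  cI D (fun x => f x + g x) = cI D f + cI D g.
Proof.
move=> mD If Ig; apply: complexP; rewrite ?(reD, imD) /=.
  under eq_Rintegral do rewrite reD.
  by rewrite RintegralD//; exact: cint_re.
under eq_Rintegral do rewrite imD.
by rewrite RintegralD//; exact: cint_im.
Qed.

Lemma cIZ D (a : R[i]) f : meas D -> cint D f -> cI D (fun x => a * f x) = a * cI D f.
Proof.
move=> mD If; have [i1 i2] := (cint_re mD If, cint_im mD If).
have Z (c : R) (F : R -> R) := @integrableZ D c F mD.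
apply: complexP; rewrite ?(reM, imM) /=.
  under eq_Rintegral do rewrite reM.
  by rewrite RintegralB ?RintegralZl//; exact: Z.
under eq_Rintegral do rewrite imM.
by rewrite RintegralD ?RintegralZl//; exact: Z.
Qed.

Lemma cintD D f g : meas D -> cint D f -> cint D g -> cint D (fun x => f x + g x).
Proof.
move=> mD [mf If] [mg Ig]; apply: (cint_dom mD (cmeasD mf mg)) (integrable_add mD If Ig) _ => x _.
exact: ncD.
Qed.

Lemma cintM D (K : R) f g : meas D -> cmeas g -> (forall x, D x -> nc (g x) <= K) -> cint D f ->
  cint D (fun x => g x * f x).
Proof.
move=> mD mg gK [mf If].
apply: (cint_dom mD (cmeasM mg mf)) (integrableZ K mD If) _ => x Dx /=.
by rewrite ncM ler_wpM2r ?nc_ge0 ?gK.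
Qed.

Lemma nc_cI D f (F : R -> R) : meas D -> cint D f -> mu.-integrable D (EFin \o F) ->
  (forall x, D x -> nc (f x) <= F x) -> nc (cI D f) <= 2 * \int[mu]_(x in D) F x.
Proof.
move=> mD If IF fF; apply: le_trans (nc_le_reim _) _ => /=.
rewrite (_ : 2 * _ = \int[mu]_(x in D) F x + \int[mu]_(x in D) F x); last by ring.
have [i1 i2] := (cint_re mD If, cint_im mD If).
have le (G : R -> R) : mu.-integrable D (EFin \o G) -> (forall x, `|G x| <= nc (f x)) ->
    `|\int[mu]_(x in D) G x| <= \int[mu]_(x in D) F x.
  move=> iG Gf; apply: le_trans (le_normr_Rintegral mD iG) _.
  apply: le_Rintegral => //; first exact: (integrable_norm iG).
  by move=> x Dx; exact: le_trans (Gf x) (fF _ Dx).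
by apply: lerD; apply: le => // x; [exact: nc_re|exact: nc_im].
Qed.

Lemma cI_ae D f g : meas D -> cmeas f -> cmeas g -> {ae mu, forall x, f x = g x} -> cI D f = cI D g.
Proof.
move=> mD [f1 f2] [g1 g2] fg.
have [N [mN N0 sub]] := fg.
apply: complexP => /=; rewrite /Rintegral; congr fine; apply: ae_eq_integral => //.
- by apply/measurable_EFinP/measurable_funTS.
- by apply/measurable_EFinP/measurable_funTS.
- by exists N; split=> // x /= h; apply: sub => /= E; apply: h => _; rewrite E.
- by apply/measurable_EFinP/measurable_funTS.
- by apply/measurable_EFinP/measurable_funTS.
- by exists N; split=> // x /= h; apply: sub => /= E; apply: h => _; rewrite E.
Qed.

Lemma cI_itvD (a : itv_bound R) (x b : R) f : (a <= BRight x)%O -> x <= b ->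
  cint [set` Interval a (BRight b)] f ->
  cI [set` Interval a (BRight b)] f = cI [set` Interval a (BRight x)] f + cI `[x, b] f.
Proof.
move=> ax xb If.
have step F : mu.-integrable [set` Interval a (BRight b)] (EFin \o F) ->
    \int[mu]_(t in [set` Interval a (BRight b)]) F t =
    \int[mu]_(t in [set` Interval a (BRight x)]) F t + \int[mu]_(t in `[x, b]) F t.
  move=> iF; apply/eqP; rewrite addrC -subr_eq Rintegral_itvB// Rintegral_itv_obnd_cbnd//.
  by apply: integrableS iF => //; apply: subset_itvr.
apply: complexP; rewrite ?(reD, imD) /=; apply: step; [exact: cint_re|exact: cint_im].
Qed.

Lemma cI_itvD2 (x b : R) (c : itv_bound R) f : x <= b -> (BRight b <= c)%O ->
  cint [set` Interval (BLeft x) c] f ->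
  cI [set` Interval (BLeft x) c] f = cI `[x, b] f + cI [set` Interval (BLeft b) c] f.
Proof.
move=> xb bc If.
have step F : mu.-integrable [set` Interval (BLeft x) c] (EFin \o F) ->
    \int[mu]_(t in [set` Interval (BLeft x) c]) F t =
    \int[mu]_(t in `[x, b]) F t + \int[mu]_(t in [set` Interval (BLeft b) c]) F t.
  move=> iF; apply/eqP; rewrite addrC -subr_eq Rintegral_itvB// Rintegral_itv_obnd_cbnd//.
  by apply: integrableS iF => //; apply: subset_itvr; rewrite bnd_simp.
apply: complexP; rewrite ?(reD, imD) /=; apply: step; [exact: cint_re|exact: cint_im].
Qed.

Lemma ccont_bounded f (a b : R) : ccont f -> exists2 K : R, 0 <= K & forall x, `[a, b]%classic x -> nc (f x) <= K.
Proof.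
move=> [f1 f2]; have [ab|ba] := leP a b; last first.
  by exists 0 => // x /=; rewrite in_itv/= => /andP[]; lra.
have [c1 _ h1] := EVT_max ab (continuous_subspaceT f1); have [c2 _ h2] := EVT_min ab (continuous_subspaceT f1).
have [c3 _ h3] := EVT_max ab (continuous_subspaceT f2); have [c4 _ h4] := EVT_min ab (continuous_subspaceT f2).
exists (`|re (f c1)| + `|re (f c2)| + (`|im (f c3)| + `|im (f c4)|)); first by rewrite !addr_ge0.
move=> x xab; apply: le_trans (nc_le_reim _) _; apply: lerD; rewrite ler_norml.
  have := h1 x xab; have := h2 x xab; have := ler_norm (re (f c1)); have := ler_norm (- re (f c2)).
  by rewrite normrN; have := normr_ge0 (re (f c1)); have := normr_ge0 (re (f c2)); lra.
have := h3 x xab; have := h4 x xab; have := ler_norm (im (f c3)); have := ler_norm (- im (f c4)).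
by rewrite normrN; have := normr_ge0 (im (f c3)); have := normr_ge0 (im (f c4)); lra.
Qed.

Lemma integrable_cst_itv (a b k : R) : mu.-integrable `[a, b] (EFin \o (fun=> k)).
Proof. by apply: continuous_compact_integrable; [exact: segment_compact|exact: cst_continuous]. Qed.

Lemma Rintegral_cst_itv (a b k : R) : a <= b -> \int[mu]_(x in `[a, b]) k = k * (b - a).
Proof.
move=> ab; rewrite Rintegral_cst//; congr (k * _).
transitivity (fine (lebesgue_measure (`[a, b]%classic : set R))); first by [].
by rewrite lebesgue_measure_itv/= lte_fin; case: ltgtP ab => //= -> _; rewrite subrr.
Qed.

Lemma ccont_lint f : ccont f -> lint f.
Proof.
move=> cf a b; have [K K0 fK] := ccont_bounded a b cf.
by apply: (cint_dom _ (ccont_cmeas cf) (integrable_cst_itv a b K)).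
Qed.

Lemma lintM v f : ccont v -> lint f -> lint (fun x => v x * f x).
Proof.
move=> cv lf a b; have [K K0 vK] := ccont_bounded a b cv.
exact: (cintM _ (ccont_cmeas cv) vK).
Qed.

Lemma lintD f g : lint f -> lint g -> lint (fun x => f x + g x).
Proof. by move=> lf lg a b; exact: cintD. Qed.

Lemma primitiveD f y g h : lint f -> lint g -> primitive_of f y -> primitive_of g h ->
  primitive_of (fun x => f x + g x) (fun x => y x + h x).
Proof.
move=> lf lg pf pg a b ab; have := cID (measurable_itv _) (lf a b) (lg a b).
rewrite /cI -/(cRintegral a b (fun x => f x + g x)) => ->; rewrite -/(cRintegral a b f) -/(cRintegral a b g).
by rewrite -pf// -pg//; ring.
Qed.

Lemma primitiveZ (c : R[i]) f y : lint f -> primitive_of f y ->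
  primitive_of (fun x => c * f x) (fun x => c * y x).
Proof.
move=> lf pf a b ab; have := cIZ c (measurable_itv _) (lf a b).
by rewrite /cI -/(cRintegral a b (fun x => c * f x)) => ->; rewrite -/(cRintegral a b f) -pf//; ring.
Qed.

Lemma primitive_ae f g y : cmeas f -> cmeas g -> {ae mu, forall x, f x = g x} ->
  primitive_of f y -> primitive_of g y.
Proof. by move=> mf mg fg pf a b ab; rewrite pf//; exact: cI_ae. Qed.

(** A continuous integrand has a classical antiderivative, from which [y] differs by a constant. *)
Lemma primitive_cder f y : ccont f -> primitive_of f y -> forall x, cder y (f x) x.
Proof.
move=> cf py x; have [P [_ dP]] := antiderivative cf.
apply: cder_ext (_ : cder (fun t => P t + (y 0 - P 0)) (f x) x) => [t|].
  have [t0|/ltW t0] := leP 0 t; have := py _ _ t0; rewrite (cRintegral_antiderivative t0 cf dP) => h.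
    by rewrite (_ : P t = y t - y 0 + P 0); [ring|rewrite h; ring].
  by rewrite (_ : P t = P 0 - (y 0 - y t)); [ring|rewrite h; ring].
by apply: cder_eq (cderD (dP x) (cder_cst _ _)) _; rewrite addr0.
Qed.

(* The increment of [u A - ∫ (u' A + u g)] over [s, t] is O((t - s) ∫_s^t |g|), so that halving the
   interval repeatedly shows that it vanishes. *)
Lemma primitive_by_parts (u u1 A g : R -> R[i]) : (forall x, cder u (u1 x) x) -> ccont u1 ->
  lint g -> primitive_of g A -> ccont A ->
  primitive_of (fun x => u1 x * A x + u x * g x) (fun x => u x * A x).
Proof.
move=> du cu1 lg pA cA; have cu : ccont u := cder_ccont du.
have lh : lint (fun x => u1 x * A x + u x * g x).
  by apply: lintD; apply: lintM => //; exact: ccont_lint.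
set h := fun x => _ in lh *.
pose D (x y : R) := u y * A y - u x * A x - cRintegral x y h.
have Dadd (x m y : R) : x <= m -> m <= y -> D x y = D x m + D m y.
  move=> xm my; rewrite /D.
  have -> : cRintegral x y h = cRintegral x m h + cRintegral m y h.
    by apply: (@cI_itvD (BLeft x) m y h) => //; rewrite bnd_simp.
  by ring.
move=> a b ab; apply/eqP; rewrite -subr_eq0 -/h -/(D a b); apply/eqP.
have [K K0 u1K] := ccont_bounded a b cu1.
pose G (x y : R) := \int[mu]_(t in `[x, y]) nc (g t).
have ig (x y : R) : mu.-integrable `[x, y] (EFin \o (fun t => nc (g t))) by have [_] := lg x y.
have Gadd (x m y : R) : x <= m -> m <= y -> G x y = G x m + G m y.
  move=> xm my; apply/eqP; rewrite addrC -subr_eq Rintegral_itvB ?bnd_simp// Rintegral_itv_obnd_cbnd//.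
  by apply: integrableS (ig x y) => //; apply: subset_itv; rewrite bnd_simp.
have G0 (x y : R) : 0 <= G x y by apply: Rintegral_ge0 => t _; exact: nc_ge0.
have Dle (x y : R) : a <= x -> x <= y -> y <= b -> nc (D x y) <= 8 * K * (y - x) * G x y.
  move=> ax xy yb.
  have sub : `[x, y] `<=` `[a, b] by apply: subset_itv; rewrite bnd_simp.
  have m : meas `[x, y] by [].
  have uK (t : R) : `[x, y]%classic t -> nc (u y - u t) <= 2 * K * (y - x).
    rewrite /= in_itv/= => /andP[xt ty].
    apply: le_trans (cder_bound ty (fun s _ => du s) _) _ => [s sty|].
      apply: u1K; rewrite /= in_itv/=; lra.
    by have := mulr_ge0 K0 (_ : 0 <= t - x); nra.
  have l1 : lint (fun t => u1 t * (A t - A x)).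
    by apply: lintM => //; apply: ccont_lint; apply: ccontD => //; exact: ccont_cst.
  have l2 : lint (fun t => (u y - u t) * g t).
    by apply: lintM => //; apply: ccontD; [exact: ccont_cst|exact: ccontN].
  have l3 : lint (fun t => A x * u1 t) by apply: ccont_lint; apply: ccontM => //; exact: ccont_cst.
  have l4 : lint (fun t => u y * g t) by apply: lintM => //; exact: ccont_cst.
  (* Subtracting the exact increments with constant factors [A x] and [u y] leaves integrands
     containing [A t - A x] and [u y - u t], both small on a short interval. *)
  have DE : D x y = cI `[x, y] (fun t => (u y - u t) * g t) - cI `[x, y] (fun t => u1 t * (A t - A x)).
    have e1 : cRintegral x y h + cI `[x, y] (fun t => (u y - u t) * g t) =
        cI `[x, y] (fun t => u1 t * (A t - A x)) + A x * (u y - u x) + u y * (A y - A x).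
      rewrite -(cRintegral_antiderivative xy cu1 du) pA// -!cIZ//; last exact: ccont_lint.
      rewrite -!cID//; last exact: cintD.
      by congr cI; apply/funext => t; rewrite /h; ring.
    by rewrite /D -[X in _ - X](addrK (cI `[x, y] (fun t => (u y - u t) * g t))) e1; ring.
  rewrite DE; apply: le_trans (ncB _ _) _.
  rewrite (_ : 8 * K * _ * _ = 2 * (2 * K * (y - x) * G x y) + 2 * (K * (2 * G x y) * (y - x))); last by ring.
  apply: lerD.
    apply: le_trans (nc_cI m (l2 x y) (integrableZ (2 * K * (y - x)) m (ig x y)) _) _.
      by move=> t tx /=; rewrite ncM ler_wpM2r ?nc_ge0 ?uK.
    by rewrite ler_wpM2l// RintegralZl.
  apply: le_trans (nc_cI m (l1 x y) (integrable_cst_itv x y (K * (2 * G x y))) _) _.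
    move=> t txy; rewrite ncM; apply: ler_pM; rewrite ?nc_ge0//.
      by apply: u1K; exact: sub.
    move: txy; rewrite /= in_itv/= => /andP[xt ty]; rewrite pA//.
    apply: le_trans (nc_cI (measurable_itv _) (lg x t) (ig x t) _) _ => //.
    by rewrite ler_wpM2l// (Gadd x t y)// lerDl.
  by rewrite ler_wpM2l// Rintegral_cst_itv.
have bis n : forall x y : R, a <= x -> x <= y -> y <= b -> nc (D x y) <= 8 * K * (y - x) * G x y / 2 ^+ n.
  elim: n => [|n IH] x y ax xy yb; first by rewrite expr0 divr1; exact: Dle.
  pose m := (x + y) / 2.
  have xm : x <= m by rewrite /m; lra.
  have my : m <= y by rewrite /m; lra.
  rewrite (Dadd x m y xm my); apply: le_trans (ncD _ _) _.
  apply: le_trans (lerD (IH x m ax xm (le_trans my yb)) (IH m y (le_trans ax xm) my yb)) _.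
  rewrite (Gadd x m y xm my) exprS le_eqVlt; apply/orP; left; apply/eqP.
  have : (2 ^+ n : R) != 0 by rewrite expf_neq0.
  by rewrite /m; move: (2 ^+ n) => c c0; field.
apply: small_eq0 => e e0; pose C := 8 * K * (b - a) * G a b.
have C0 : 0 <= C by rewrite !mulr_ge0// subr_ge0.
have [N hN] := archi_nat (C / e); have := hN N (leqnn _); rewrite ltr_pdivrMr// => hNe.
apply: le_lt_trans (bis N a b (lexx _) ab (lexx _)) _.
rewrite ltr_pdivrMr ?exprn_gt0// -/C; apply: lt_le_trans hNe _.
by rewrite mulrC ler_wpM2l ?(ltW e0)// -natrX ler_nat ltnW// ltn_expl.
Qed.

End ComplexIntegral.

(** * Square-integrable functions with square-integrable derivatives *)

Section SobolevFunctions.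
Context {R : realType}.
Implicit Types (f g h y v : R -> R[i]) (D : set R).
Local Notation mu := (@lebesgue_measure R).
Local Notation meas := (@measurable _ (measurableTypeR R)).

Lemma L2_integrable f : L2 f <-> cmeas f /\ mu.-integrable setT (EFin \o (fun x => nc (f x) ^+ 2)).
Proof.
rewrite L2P; split=> -[mf h]; split=> //.
  apply/integrableP; split; first by apply/measurable_EFinP; exact: cmeas_nc2.
  rewrite (_ : integral _ _ _ = sqint f)//; apply: eq_integral => x _.
  by rewrite /= ger0_norm// sqr_ge0.
by apply: integrable_lty h.
Qed.

Lemma L2_dom f (F : R -> R) : cmeas f -> mu.-integrable setT (EFin \o F) ->
  (forall x, nc (f x) ^+ 2 <= F x) -> L2 f.
Proof.
move=> mf iF fF; apply/L2_integrable; split=> //; apply: le_integrable iF => //.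
  by apply/measurable_EFinP; exact: cmeas_nc2.
by move=> x _ /=; rewrite lee_fin ger0_norm ?sqr_ge0//; apply: le_trans (fF x) (ler_norm _).
Qed.

Lemma L2_sum_integrable f g (a b : R) : L2 f -> L2 g ->
  mu.-integrable setT (EFin \o (fun x => a * nc (f x) ^+ 2 + b * nc (g x) ^+ 2)).
Proof. by move=> /L2_integrable[_ hf] /L2_integrable[_ hg]; apply: integrable_add => //; exact: integrableZ. Qed.

Lemma L2D f g : L2 f -> L2 g -> L2 (fun x => f x + g x).
Proof.
move=> lf lg; have [mf _] := (L2_integrable f).1 lf; have [mg _] := (L2_integrable g).1 lg.
apply: L2_dom (cmeasD mf mg) (L2_sum_integrable 2 2 lf lg) _ => x.
apply: le_trans (_ : (nc (f x) + nc (g x)) ^+ 2 <= _).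
  by rewrite ler_sqr ?nnegrE ?addr_ge0 ?nc_ge0// ncD.
by have := sqr_ge0 (nc (f x) - nc (g x)); move: (nc _) (nc _) => s t; nra.
Qed.

Lemma L2M v f (K : R) : cmeas v -> (forall x, nc (v x) <= K) -> L2 f -> L2 (fun x => v x * f x).
Proof.
move=> mv vK lf; have [mf _] := (L2_integrable f).1 lf.
apply: L2_dom (cmeasM mv mf) (L2_sum_integrable (K ^+ 2) 0 lf lf) _ => x.
by rewrite mul0r addr0 ncM exprMn ler_wpM2r ?sqr_ge0// ler_sqr ?nnegrE ?nc_ge0//; apply: le_trans (vK x); exact: nc_ge0.
Qed.

Lemma Rintegral_subset D (F : R -> R) : meas D -> mu.-integrable setT (EFin \o F) -> (forall x, 0 <= F x) ->
  \int[mu]_(x in D) F x <= \int[mu]_(x in setT) F x.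
Proof.
move=> mD iF F0; have iD : mu.-integrable D (EFin \o F) by exact: integrableS iF.
rewrite /Rintegral fine_le//; try exact: integrable_fin_num.
apply: ge0_subset_integral => //; first exact: (measurable_int _ iF).
by move=> x _; rewrite lee_fin.
Qed.

Lemma L2_integrableS f D : meas D -> L2 f -> mu.-integrable D (EFin \o (fun x => nc (f x) ^+ 2)).
Proof. by move=> mD /L2_integrable[_ h]; exact: integrableS h. Qed.

(** A weighted form of 2ab <= a^2 + b^2, which takes the place of the Cauchy-Schwarz inequality when
    an integral of |f| is bounded by one of |f|^2. *)
Lemma le_sqr_inv (a e : R) : 0 < e -> a <= e * a ^+ 2 + e^-1.
Proof.
move=> e0; have -> : e * a ^+ 2 + e^-1 = ((e * a - 1) ^+ 2 + 2 * (e * a)) / e by field; rewrite gt_eqF.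
rewrite ler_pdivlMr// mulrC; have := sqr_ge0 (e * a - 1); have := sqr_ge0 (e * a).
by move: (e * a) => t; nra.
Qed.

Lemma L2_lint f : L2 f -> lint f.
Proof.
move=> lf a b; have [mf _] := (L2_integrable f).1 lf.
apply: (cint_dom (F := fun x => 1 * nc (f x) ^+ 2 + 1^-1)) => //.
  apply: integrable_add; [by []| |exact: integrable_cst_itv].
  by apply: integrableZ => //; exact: L2_integrableS.
by move=> x _; exact: le_sqr_inv.
Qed.

(** An increment over an interval of length [s] is at most a constant times [eps * S + s / eps],
    with [S] the integral of |f|^2; first [eps] and then the length is chosen small. *)
Lemma primitive_ccont v f y : ccont v -> L2 f -> primitive_of (fun x => v x * f x) y -> ccont y.
Proof.
move=> cv lf py; apply/ccontP => t e0 he0.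
have [K K0 vK] := ccont_bounded (t - 1) (t + 1) cv.
have [mf i2] := (L2_integrable f).1 lf.
pose S := \int[mu]_(x in setT) nc (f x) ^+ 2.
have S0 : 0 <= S by apply: Rintegral_ge0 => x _; exact: sqr_ge0.
have key (eps x x' : R) : 0 < eps -> t - 1 <= x -> x <= x' -> x' <= t + 1 ->
    nc (y x' - y x) <= 2 * (K * (eps * S + eps^-1 * (x' - x))).
  move=> eps0 tx xx x't; rewrite py//.
  have m : meas `[x, x'] by [].
  have iE : mu.-integrable `[x, x'] (EFin \o (fun s => eps * nc (f s) ^+ 2 + eps^-1)).
    apply: integrable_add; [by []| |exact: integrable_cst_itv].
    by apply: integrableZ => //; exact: L2_integrableS.
  apply: le_trans (nc_cI m (lintM cv (L2_lint lf) x x') (integrableZ K m iE) _) _.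
    move=> s sxx; rewrite ncM; apply: ler_pM; rewrite ?nc_ge0//; last exact: le_sqr_inv.
    by apply: vK; move: sxx; rewrite /= !in_itv/=; lra.
  rewrite ler_wpM2l// RintegralZl// ler_wpM2l// RintegralD//; last 2 first.
  - by apply: integrableZ => //; exact: L2_integrableS.
  - exact: integrable_cst_itv.
  rewrite Rintegral_cst_itv// lerD2r RintegralZl//; last exact: L2_integrableS.
  by rewrite ler_wpM2l ?(ltW eps0)//; apply: Rintegral_subset => // s; exact: sqr_ge0.
have K1 : 0 < K + 1 by rewrite ltr_wpDl.
have S1 : 0 < S + 1 by rewrite ltr_wpDl.
have K8 : 0 < 8 * (K + 1) by rewrite mulr_gt0.
pose eps := e0 / (8 * (K + 1) * (S + 1)).
have eps0 : 0 < eps by rewrite divr_gt0// mulr_gt0.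
pose r := Num.min 1 (e0 * eps / (8 * (K + 1))).
have r0 : 0 < r by rewrite lt_min ltr01 divr_gt0// mulr_gt0.
have fin (s : R) : 0 <= s -> s < r -> 2 * (K * (eps * S + eps^-1 * s)) < e0.
  move=> s0; rewrite lt_min => /andP[_]; rewrite ltr_pdivlMr//.
  move=> hs; have h1 : 8 * (K + 1) * (eps * (S + 1)) = e0.
    by rewrite /eps; field; rewrite (lt0r_neq0 K1) (lt0r_neq0 S1).
  have h2 : eps^-1 * s * (8 * (K + 1)) < e0.
    by rewrite -mulrA mulrC ltr_pdivrMr.
  clearbody eps; have p1 : 0 <= eps^-1 * s by rewrite mulr_ge0// invr_ge0 ltW.
  have p2 : 0 <= eps * S by rewrite mulr_ge0// ltW.
  have p3 : 0 <= K * (eps * S) by exact: mulr_ge0.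
  have p4 : 0 <= K * (eps^-1 * s) by exact: mulr_ge0.
  have p5 : 0 <= K * eps by rewrite mulr_ge0// ltW.
  by move: (eps^-1 * s) p1 p4 h2 => w p1 p4 h2; nra.
exists r => // s ts; have r1 : r <= 1 by rewrite ge_min lexx.
clearbody r eps.
have [hts|hst] := leP t s.
  have ts0 : 0 <= s - t by rewrite subr_ge0.
  rewrite ger0_norm// in ts.
  by apply: le_lt_trans (key eps _ _ eps0 _ hts _) (fin _ ts0 ts); lra.
have ts0 : 0 <= t - s by rewrite subr_ge0 ltW.
rewrite distrC ger0_norm// in ts; rewrite ncBC.
by apply: le_lt_trans (key eps _ _ eps0 _ (ltW hst) _) (fin _ ts0 ts); lra.
Qed.

(** On an interval of length [n], the quantity |c|^2 n is at most a fixed multiple of the integral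
    of |y|^2 + |dy|^2, which is finite. The position of the interval is free, so that control of [v]
    on one half-line is enough. *)
Lemma L2_const_wronskian y dy v v1 (c : R[i]) (M : R) : L2 y -> L2 dy ->
  (forall n : nat, exists a : R, forall x, a <= x <= a + n%:R ->
     [/\ dy x * v x - y x * v1 x = c, nc (v x) <= M & nc (v1 x) <= M]) -> c = 0.
Proof.
move=> ly ldy h; pose F x := 2 * M ^+ 2 * nc (y x) ^+ 2 + 2 * M ^+ 2 * nc (dy x) ^+ 2.
have iF := L2_sum_integrable (2 * M ^+ 2) (2 * M ^+ 2) ly ldy.
have F0 x : 0 <= F x.
  by apply: addr_ge0; (apply: mulr_ge0; last exact: sqr_ge0); apply: mulr_ge0 => //; exact: sqr_ge0.
pose T := \int[mu]_(x in setT) F x.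
have bnd (n : nat) : nc c ^+ 2 * n%:R <= T.
  have [a ha] := h n; have an : a <= a + n%:R by rewrite lerDl.
  have -> : nc c ^+ 2 * n%:R = \int[mu]_(x in `[a, a + n%:R]) (nc c ^+ 2).
    by rewrite Rintegral_cst_itv// addrAC subrr add0r.
  apply: le_trans (_ : \int[mu]_(x in `[a, a + n%:R]) F x <= _); last exact: Rintegral_subset.
  apply: le_Rintegral => //; first exact: integrable_cst_itv.
    exact: integrableS iF.
  move=> x /=; rewrite in_itv/= => /ha[<- vM v1M].
  have := nc_ge0 (v x); have := nc_ge0 (v1 x) => v10 v0.
  apply: le_trans (_ : (M * nc (dy x) + M * nc (y x)) ^+ 2 <= _).
    rewrite ler_sqr ?nnegrE ?addr_ge0 ?mulr_ge0 ?nc_ge0//; try by apply: le_trans v0 vM.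
    apply: le_trans (ncB _ _) _; rewrite !ncM.
    by apply: lerD; rewrite mulrC ler_wpM2r ?nc_ge0.
  rewrite /F; have := sqr_ge0 (M * nc (dy x) - M * nc (y x)).
  by move: (nc (y x)) (nc (dy x)) => p q; nra.
apply/eqP; rewrite -nc_eq0 eq_le nc_ge0 andbT leNgt; apply/negP => c0.
have [N hN] := archi_nat (T / nc c ^+ 2); have := hN N (leqnn _).
by rewrite ltr_pdivrMr ?exprn_gt0// ltNge mulrC bnd.
Qed.

End SobolevFunctions.

(** * The spectrum and the Floquet multiplier *)

Section Classical.
Context {R : realType}.
Variables (tau z0 : R[i]).
Hypothesis tau_gt0 : 0 < im tau.
Hypothesis z0_regular : forall x : R, ~ lattice tau (x%:C + z0).
Implicit Types (f y : R -> R[i]) (l : R[i]).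
Local Notation mu := (@lebesgue_measure R).
Local Notation pot := (pot tau z0).
Local Notation sol := (sol tau z0).

(** Primitives of square-integrable functions are continuous. Hence [d2y] agrees almost everywhere
    with a continuous function, and [y] is a classical solution. *)
Lemma lame_classical l y f : ccont f -> lame tau z0 y (fun x => l * y x + f x) ->
  exists dy, [/\ L2 y, L2 dy, forall x, cder y (dy x) x &
    forall x, cder dy ((12 * pot x + l) * y x + f x) x].
Proof.
move=> cf [d2y [dy [ly ldy ld2y py pdy]] ae]; exists dy.
have cont (g h : R -> R[i]) : L2 g -> primitive_of g h -> ccont h.
  move=> lg pg; apply: (primitive_ccont (v := fun=> 1) (ccont_cst _) lg).
  by rewrite (_ : (fun x => _) = g)//; apply/funext => x; rewrite mul1r.
have [cy cdy] := (cont _ _ ldy py, cont _ _ ld2y pdy).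
have cG : ccont (fun x => (12 * pot x + l) * y x + f x).
  by apply: ccontD => //; apply: ccontM => //; exact: ccont_pot.
have mG := ccont_cmeas cG; have [md2y _] := (L2_integrable d2y).1 ld2y.
split; [exact: ly|exact: ldy|exact: primitive_cder cdy py|].
apply: primitive_cder cG _; apply: primitive_ae md2y mG _ pdy.
have [N [mN N0 sub]] := ae; exists N; split; [exact: mN|exact: N0|] => x /= h.
apply: sub => /= E; apply: h; have wpE : wp tau (x%:C + z0) = pot x by [].
by rewrite wpE in E; rewrite -[d2y x](subrK (12 * pot x * y x)) -E; ring.
Qed.

Lemma lame_sub l y y' f : lame tau z0 y (fun x => l * y x + f x) -> lame tau z0 y' (fun x => l * y' x + f x) ->
  lame tau z0 (fun x => y x + -1 * y' x) (fun x => l * (y x + -1 * y' x) + 0).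
Proof.
move=> [d2y [dy [ly ldy ld2y py pdy]] ae] [d2y' [dy' [ly' ldy' ld2y' py' pdy']] ae'].
exists (fun x => d2y x + -1 * d2y' x).
  have L2Z f' : L2 f' -> L2 (fun x => -1 * f' x) by apply: (L2M (K := nc (-1))) => //; exact: cmeas_cst.
  have lint1 f' : L2 f' -> lint (fun x => -1 * f' x) by move=> /L2Z/L2_lint.
  exists (fun x => dy x + -1 * dy' x).
  split; [exact: L2D ly (L2Z _ ly')|exact: L2D ldy (L2Z _ ldy')|exact: L2D ld2y (L2Z _ ld2y')| |].
    by apply: primitiveD => //; [exact: L2_lint|exact: lint1|apply: primitiveZ => //; exact: L2_lint].
  by apply: primitiveD => //; [exact: L2_lint|exact: lint1|apply: primitiveZ => //; exact: L2_lint].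
apply: negligibleS (negligibleU ae ae') => x /= h.
apply/not_andP => -[E E']; apply: h.
rewrite -[d2y x](subrK (12 * wp tau (x%:C + z0) * y x)) -E.
by rewrite -[d2y' x](subrK (12 * wp tau (x%:C + z0) * y' x)) -E'; ring.
Qed.

Lemma periodic_bound (N : R -> R) (K : R) : (forall x, N (x + 1) = N x) ->
  (forall x : R, 0 <= x <= 1 -> N x <= K) -> forall x, N x <= K.
Proof.
move=> N1 NK x; have per (m : int) s : N (s + m%:~R) = N s.
  have nat_ (n : nat) s' : N (s' + n%:R) = N s'.
    by elim: n => [|n IH]; rewrite ?addr0// -natr1 addrA N1.
  by case: m => n; [exact: nat_|rewrite NegzE -[LHS](nat_ n.+1) mulrNz subrK].
rewrite -(subrK (Num.floor x)%:~R x) per; apply: NK.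
by have /andP[f1 f2] := floor_itv x; rewrite intrD in f2; lra.
Qed.

(** The product of |y x| and [expR (- (k * x))] is periodic, hence bounded by its values on
    [0, 1]. *)
Lemma multiplier_bound y (r : R[i]) (k : R) : ccont y -> (forall x, y (x + 1) = r * y x) ->
  nc r = expR k -> exists2 M : R, 0 <= M & forall x, nc (y x) <= M * expR (k * x).
Proof.
move=> cy per rk; have [K K0 yK] := ccont_bounded 0 1 cy.
exists (K * expR `|k|) => [|x]; first by rewrite mulr_ge0// expR_ge0.
suff h : nc (y x) * expR (- (k * x)) <= K * expR `|k|.
  rewrite -[nc (y x)]mulr1 -(expRxMexpNx_1 (k * x)) [expR _ * _]mulrC mulrA.
  by rewrite ler_wpM2r ?expR_ge0.
apply: (@periodic_bound (fun x => nc (y x) * expR (- (k * x)))) => [s|s s01].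
  rewrite per ncM rk mulrDr mulr1 opprD expRD mulrACA mulrA.
  by rewrite -[RHS]mulr1 -(expRxMexpNx_1 k); ring.
apply: ler_pM; rewrite ?nc_ge0 ?expR_ge0//; first by apply: yK; rewrite /= in_itv.
rewrite ler_expR; apply: le_trans (ler_norm _) _; rewrite normrN normrM.
by rewrite ler_piMr// ger0_norm; case/andP: s01.
Qed.

Lemma cder_flat y (a : R[i]) (t d : R) : 0 < d -> cder y a t -> (forall s, `|s - t| < d -> y s = y t) -> a = 0.
Proof.
move=> d0 /cderP dy flat; apply: small_eq0 => e0 he.
have [del del0 h] := dy (e0 / 2) (divr_gt0 he (ltr0Sn _ 1)).
pose s := Num.min d del / 2; have m0 : 0 < Num.min d del by rewrite lt_min d0.
have s0 : 0 < s by rewrite divr_gt0.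
have [sd sdel] : s < d /\ s < del.
  by have := lexx (Num.min d del); rewrite {2}/Order.min /s; case: ifP => *; split; lra.
clearbody s; have := h s; rewrite gtr0_norm// => /(_ sdel).
have -> : y (t + s) = y t by apply: flat; rewrite (_ : t + s - t = s) ?gtr0_norm//; ring.
rewrite subrr sub0r ncN ncM nc_real (gtr0_norm s0) ler_pM2r// => h2.
by apply: le_lt_trans h2 _; rewrite ltr_pdivrMr// ltr_pMr// ltr1n.
Qed.

Section Floquet.
Variables (l : R[i]) (yp yp1 ym ym1 : R -> R[i]) (r : R[i]).
Hypothesis solp : sol l yp yp1.
Hypothesis solm : sol l ym ym1.
Hypothesis r0 : r != 0.
Hypothesis yp_mul : forall x, yp (x + 1) = r * yp x.
Hypothesis yp1_mul : forall x, yp1 (x + 1) = r * yp1 x.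
Hypothesis W0 : yp1 0 * ym 0 - yp 0 * ym1 0 != 0.

(** If [y] solved the equation with right-hand side [f], its Wronskian with [yp] would be constant
    on either side of [0, 1], and 0 there, because [yp] is bounded and [y] is square-integrable. Its
    derivative is b |yp|^2 >= 0, so [yp] would vanish on (0, 1). *)
Lemma unimodular_spectrum : nc r = 1 -> spectrum (lame tau z0) l.
Proof.
move=> r1 [M0 res].
have r1' : nc r = expR 0 by rewrite expR0.
have cyp : ccont yp := cder_ccont solp.1.
have cyp1 : ccont yp1 := cder_ccont solp.2.
have [K1 K10 yK1] := multiplier_bound cyp yp_mul r1'.
have [K2 K20 yK2] := multiplier_bound cyp1 yp1_mul r1'.
pose K := K1 + K2.
have yK x : nc (yp x) <= K.
  by have := yK1 x; rewrite mul0r expR0 mulr1 => h; apply: le_trans h _; rewrite lerDl.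
have y1K x : nc (yp1 x) <= K.
  by have := yK2 x; rewrite mul0r expR0 mulr1 => h; apply: le_trans h _; rewrite lerDr.
(* The bump is 2 x (1 - x) on [0, 1] and 0 elsewhere. *)
pose b (x : R) := `|x * (1 - x)| + x * (1 - x).
have b0 x : 0 <= b x by rewrite /b; have := ler_norm (- (x * (1 - x))); rewrite normrN; lra.
have bout x : ~~ (0 < x < 1) -> b x = 0.
  by move=> h; rewrite /b ler0_norm ?addNr//; move: h; rewrite negb_and -!leNgt => /orP[]; nra.
have bin x : 0 < x < 1 -> 0 < b x.
  by move=> /andP[x0 x1]; rewrite /b addr_gt0// ?normr_gt0 ?mulf_neq0 ?mulr_gt0; lra.
have cb : continuous b.
  move=> x; apply: cvgD; last apply: cvgM => //.
    by apply: cvg_norm; apply: cvgM => //; apply: cvgB => //; exact: cvg_cst.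
  by apply: cvgB => //; exact: cvg_cst.
pose f x := (b x)%:C * (yp x)^*%C.
have cf : ccont f.
  apply: ccontM; first by split=> //= x; exact: cvg_cst.
  split; [rewrite (_ : (fun _ => _) = (fun x => re (yp x)))|rewrite (_ : (fun _ => _) = (fun x => - im (yp x)))].
  - exact: cyp.1.
  - by apply/funext => x; rewrite re_conj.
  - by move=> x; apply: cvgN; exact: cyp.2.
  - by apply/funext => x; rewrite im_conj.
have nc_conj (z : R[i]) : nc z^*%C = nc z.
  by rewrite !nc_sqrtE re_conj im_conj sqrrN.
have lf : L2 f.
  have iI : mu.-integrable setT (EFin \o (fun x => K ^+ 2 * \1_`[0%R, 1%R] x)).
    by apply: integrableZ => //; exact: integrable_indic_itv.
  apply: L2_dom (ccont_cmeas cf) iI _ => x.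
  have [x01|x01] := boolP (0 < x < 1); last first.
    by rewrite /f bout// mul0r nc0 expr0n/= mulr_ge0 ?sqr_ge0// indicE.
  rewrite indicE mem_set/= ?in_itv/= ?mulr1; last by lra.
  rewrite ler_sqr ?nnegrE ?nc_ge0 ?addr_ge0// /f ncM nc_real nc_conj ger0_norm//.
  apply: le_trans (yK x); rewrite ler_piMl ?nc_ge0// /b ger0_norm; nra.
have [y [ly _ _]] := res f lf.
have [dy [l2y l2dy dy_ ddy]] := lame_classical cf ly.
pose W x := dy x * yp x - y x * yp1 x.
have dW x : cder W (b x * nc (yp x) ^+ 2)%:C x.
  apply: cder_eq (cderB (cderM (ddy x) (solp.1 x)) (cderM (dy_ x) (solp.2 x))) _.
  by rewrite rmorphM /= -mul_conj /f; ring.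
have Wl x : x <= 0 -> W x = W 0.
  move=> x0; apply/esym; apply: cder0_cst => // t /andP[_ t0].
  by apply: cder_eq (dW t) _; rewrite bout ?mul0r// negb_and -!leNgt t0.
have Wr x : 1 <= x -> W x = W 1.
  move=> x0; apply: cder0_cst => // t /andP[t0 _].
  by apply: cder_eq (dW t) _; rewrite bout ?mul0r// negb_and -!leNgt t0 orbT.
have W00 : W 0 = 0.
  apply: (L2_const_wronskian (M := K) l2y l2dy (v := yp) (v1 := yp1)) => n.
  by exists (- n%:R) => x; rewrite addNr => /andP[_ x0]; split=> //; exact: Wl.
have W10 : W 1 = 0.
  apply: (L2_const_wronskian (M := K) l2y l2dy (v := yp) (v1 := yp1)) => n.
  by exists 1 => x /andP[x0 _]; split=> //; exact: Wr.
have mono (s t : R) : s <= t -> re (W s) <= re (W t).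
  move=> st; rewrite -subr_ge0; rewrite -[leLHS](subrr (0 : R)).
  apply: (@le_derive R (fun=> 0) (fun x => re (W x)) (fun=> 0) (fun x => b x * nc (yp x) ^+ 2)) => // x _.
  - exact: (dW x).1.
  - by rewrite mulr_ge0 ?sqr_ge0.
have W_0 (s : R) : 0 <= s <= 1 -> re (W s) = 0.
  move=> /andP[s0 s1]; have := mono _ _ s0; have := mono _ _ s1.
  by rewrite W00 W10 /=; lra.
have yp_0 (s : R) : 0 < s < 1 -> yp s = 0.
  move=> /[dup] s01 /andP[s0 s1]; have m0 : 0 < Num.min s (1 - s) by rewrite lt_min s0 subr_gt0.
  have := cder_flat m0 (cder_real (dW s).1) _ => /(_ _)/(congr1 (@re R)) /= h.
  have {h} : b s * nc (yp s) ^+ 2 = 0.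
    apply: h => t; rewrite lt_min !ltr_norml => /andP[/andP[t1 t2] /andP[t3 t4]].
    by rewrite !W_0//; lra.
  by move/eqP; rewrite mulf_eq0 gt_eqF ?bin//= expf_eq0/= nc_eq0 => /eqP.
have yp1_0 : yp1 (1 / 2) = 0.
  apply: (cder_flat (d := 1 / 4) _ (solp.1 (1 / 2))) => [|s]; first by lra.
  by rewrite ltr_norml => /andP[s1 s2]; rewrite !yp_0//; lra.
move: W0; rewrite (wronskian_const solp solm 0 (1 / 2)) yp1_0 yp_0 ?mul0r ?subrr ?eqxx//.
by lra.
Qed.

End Floquet.
End Classical.

(** * A convolution estimate in L^2 *)

Section Convolution.
Context {R : realType}.
Implicit Types (f y : R -> R[i]).
Local Notation mu := (@lebesgue_measure R).
Local Notation meas := (@measurable _ (measurableTypeR R)).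
Variable d : R.
Hypothesis d0 : 0 < d.

(** Four times this kernel dominates [expR (- (d * |s|))], and its primitive, an arctangent divided
    by [d], bounds its integral by [pi / d]. *)
Definition ker (s : R) : R := (1 + (d * s) ^+ 2)^-1.

Lemma ker_gt0 s : 0 < ker s.
Proof. by rewrite invr_gt0 ltr_pwDl// sqr_ge0. Qed.

Lemma ker_le1 s : ker s <= 1.
Proof. by rewrite invf_le1 ?ltr_pwDl ?sqr_ge0// lerDl sqr_ge0. Qed.

Lemma ker_sub s t : ker (s - t) = ker (t - s).
Proof. by rewrite /ker -[s - t]opprB mulrN sqrrN. Qed.

Lemma expR_le_ker s : expR (- (d * `|s|)) <= 4 * ker s.
Proof.
have u0 : 0 <= d * `|s| by rewrite mulr_ge0// ltW.
have -> : ker s = (1 + (d * `|s|) ^+ 2)^-1 by rewrite /ker !exprMn real_normK ?num_real.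
rewrite expRN; move: (d * `|s|) u0 => u u0; have p : 0 < 1 + u ^+ 2 by rewrite ltr_pwDl// sqr_ge0.
rewrite ler_pdivlMr// mulrC ler_pdivrMr ?expR_gt0//.
(* The exponential is at least (1 + u / 2)^2, and four times this is (2 + u)^2 >= 1 + u^2. *)
have := expR_ge1Dx (u / 2); have -> : expR u = expR (u / 2) ^+ 2 by rewrite expr2 -expRD -splitr.
by move: (expR (u / 2)) => w hw; nra.
Qed.

Lemma continuous_ker : continuous ker.
Proof.
move=> s; apply: cvgV; first by rewrite gt_eqF// ltr_pwDl// sqr_ge0.
apply: cvgD; first exact: cvg_cst.
by apply: cvgM; apply: cvgM => //; exact: cvg_cst.
Qed.

Lemma continuous_ker_sub x : continuous (fun t => ker (x - t)).
Proof.
move=> t; apply: (@continuous_comp R R R (fun t => x - t) ker); last exact: continuous_ker.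
by apply: cvgB => //; exact: cvg_cst.
Qed.

Lemma measurable_ker_sub x : measurable_fun (setT : set (measurableTypeR R)) (fun t => ker (x - t)).
Proof. by apply: (@continuous_measurable_fun R); exact: (@continuous_ker_sub x). Qed.

Lemma Rintegral_ker x (n : R) : 0 <= n -> \int[mu]_(t in `[x - n, x + n]) ker (x - t) <= pi / d.
Proof.
move=> n0; have xn : x - n <= x + n by lra.
have dP (t : R) : is_derive t (1 : R) (fun t => - (atan (d * (x - t)) / d)) (ker (x - t)).
  have dl : is_derive t (1 : R) (fun t => d * (x - t)) (- d).
    apply/is_deriveP => e0 he; exists 1 => // s _.
    by rewrite (_ : _ - _ - _ = 0) ?normr0 ?mulr_ge0 ?(ltW he)//; ring.
  have da := @is_derive1_comp R atan (fun t => d * (x - t)) t _ _ (is_derive1_atan (d * (x - t))) dl.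
  have := cder_real da => /(cderZ (- (d^-1)%:C))[+ _] => h.
  apply: is_derive_ext h _ _ => [s|]; first by rewrite reM /= oppr0 mul0r subr0 mulNr mulrC.
  by rewrite reM /= oppr0 mul0r subr0 /ker /GRing.scale /=; field; rewrite !gt_eqF// ltr_pwDl// sqr_ge0.
rewrite (Rintegral_antiderivative xn (@continuous_ker_sub x) dP).
have := atan_gtNpi2 (d * (x - (x + n))); have := atan_ltpi2 (d * (x - (x - n))).
move: (atan _) (atan _) => a b ha hb; rewrite opprK addrC -mulrBl ler_pM2r ?invr_gt0//; lra.
Qed.

Lemma ker_integral x : (\int[mu]_t (ker (x - t))%:E <= (pi / d)%:E)%E.
Proof.
pose F (n : nat) : set R := `[x - n%:R, x + n%:R]%classic.
have FT : \bigcup_n F n = setT.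
  rewrite -subTset => t _; have [N hN] := archi_nat `|x - t|; exists N => //=.
  by have := hN N (leqnn _); rewrite /F /= in_itv/= ltr_norml => /andP[]; lra.
have mk : measurable_fun (setT : set (measurableTypeR R)) (fun t => (ker (x - t))%:E).
  by apply/measurable_EFinP; exact: measurable_ker_sub.
have cv : (\int[mu]_(t in F n) (ker (x - t))%:E @[n --> \oo] --> \int[mu]_(t in \bigcup_n F n) (ker (x - t))%:E)%E.
  apply: ge0_nondecreasing_set_cvg_integral => //.
  - move=> m n mn; apply/subsetPset; apply: subset_itv; rewrite bnd_simp.
      by rewrite lerD2l lerN2 ler_nat.
    by rewrite lerD2l ler_nat.
  - by move=> n; exact: measurable_itv.
  - by move=> n; exact: measurable_funTS.
  - by move=> n t _; rewrite lee_fin ltW// ker_gt0.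
rewrite FT in cv; apply: cvge_to_le cv _; apply: nearW => n.
have iF : mu.-integrable (F n) (EFin \o (fun t => ker (x - t))).
  apply: continuous_compact_integrable; first exact: segment_compact.
  by apply: continuous_subspaceT; exact: (@continuous_ker_sub x).
have -> : (\int[mu]_(t in F n) (ker (x - t))%:E = (\int[mu]_(t in F n) ker (x - t))%:E)%E.
  by rewrite /Rintegral fineK//; apply: integrable_fin_num iF; exact: measurable_itv.
by rewrite lee_fin Rintegral_ker.
Qed.

Lemma ker_integrable x : mu.-integrable setT (EFin \o (fun t => ker (x - t))).
Proof.
apply/integrableP; split.
  by apply/measurable_EFinP; exact: measurable_ker_sub.
apply: le_lt_trans (_ : (\int[mu]_t (ker (x - t))%:E < +oo)%E).
  by rewrite le_eqVlt; apply/orP; left; apply/eqP/eq_integral => t _; rewrite /= ger0_norm// ltW// ker_gt0.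
by apply: le_lt_trans (ker_integral x) _; rewrite ltry.
Qed.

Variable f : R -> R[i].
Hypothesis lf : L2 f.

Lemma ker_sqr_integrable x : mu.-integrable setT (EFin \o (fun t => ker (x - t) * nc (f t) ^+ 2)).
Proof.
have [mf h] := (L2_integrable f).1 lf; apply: le_integrable h => //.
  apply/measurable_EFinP; apply: measurable_funM; [exact: measurable_ker_sub|exact: cmeas_nc2].
move=> t _ /=; have k0 := ltW (ker_gt0 (x - t)); have s0 := sqr_ge0 (nc (f t)).
by rewrite lee_fin (ger0_norm (mulr_ge0 k0 s0)) (ger0_norm s0) ler_piMl// ker_le1.
Qed.

Lemma ker_nc_integrable x : mu.-integrable setT (EFin \o (fun t => ker (x - t) * nc (f t))).
Proof.
have [mf _] := (L2_integrable f).1 lf.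
apply: le_integrable (integrable_add measurableT (ker_integrable x) (ker_sqr_integrable x)) => //.
  apply/measurable_EFinP; apply: measurable_funM; [exact: measurable_ker_sub|exact: cmeas_nc].
move=> t _ /=; have kp := ker_gt0 (x - t); have k0 := ltW kp; have n0 := nc_ge0 (f t).
have ks := mulr_ge0 k0 (sqr_ge0 (nc (f t))).
rewrite lee_fin (ger0_norm (mulr_ge0 k0 n0)) (ger0_norm (addr_ge0 k0 ks)).
rewrite -[X in _ <= X + _]mulr1 -mulrDr ler_pM2l//.
by have := le_sqr_inv (nc (f t)) (@ltr01 R); rewrite invr1 mul1r addrC.
Qed.

Definition kconv x := \int[mu]_(t in setT) (ker (x - t) * nc (f t)).
Definition kconv2 x := \int[mu]_(t in setT) (ker (x - t) * nc (f t) ^+ 2).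

Lemma kconv_ge0 x : 0 <= kconv x.
Proof. by apply: Rintegral_ge0 => t _; rewrite mulr_ge0 ?nc_ge0// ltW// ker_gt0. Qed.

(** The Cauchy-Schwarz inequality for the measure with density [ker (x - t)], whose mass is at most
    [pi / d], by a <= n a^2 + 1 / (4 n). *)
Lemma kconv_sqr x : kconv x ^+ 2 <= pi / d * kconv2 x.
Proof.
have c0 : 0 < pi / d :> R by rewrite divr_gt0// pi_gt0.
have G0 : 0 <= kconv2 x by apply: Rintegral_ge0 => t _; rewrite mulr_ge0 ?sqr_ge0// ltW// ker_gt0.
have := kconv_ge0 x; rewrite le_eqVlt => /predU1P[<-|k0].
  by rewrite expr0n/= mulr_ge0// ltW.
have kc : \int[mu]_(t in setT) ker (x - t) <= pi / d.
  rewrite -lee_fin /Rintegral fineK; first exact: ker_integral.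
  exact: (integrable_fin_num measurableT (ker_integrable x)).
have amgm (n : R) : 0 < n -> kconv x <= n * kconv2 x + (pi / d) / (4 * n).
  move=> n0; apply: le_trans (_ : \int[mu]_(t in setT) (n * (ker (x - t) * nc (f t) ^+ 2) + (4 * n)^-1 * ker (x - t)) <= _).
    apply: le_Rintegral => //; first exact: ker_nc_integrable.
      by apply: integrable_add => //; apply: integrableZ => //; [exact: ker_sqr_integrable|exact: ker_integrable].
    move=> t _; rewrite [leRHS](_ : _ = ker (x - t) * (n * nc (f t) ^+ 2 + (4 * n)^-1)); last by ring.
    rewrite ler_pM2l ?ker_gt0//.
    have := sqr_ge0 (2 * n * nc (f t) - 1); have n4 : 0 < 4 * n by rewrite mulr_gt0.
    move: (nc (f t)) => a h; have -> : n * a ^+ 2 + (4 * n)^-1 = ((2 * n * a) ^+ 2 + 1) / (4 * n).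
      by field; rewrite gt_eqF.
    rewrite ler_pdivlMr//; nra.
  rewrite RintegralD//; last 2 first.
  - by apply: integrableZ => //; exact: ker_sqr_integrable.
  - by apply: integrableZ => //; exact: ker_integrable.
  rewrite !RintegralZl//; [|exact: ker_integrable|exact: ker_sqr_integrable].
  by rewrite lerD2l mulrC ler_wpM2r// invr_ge0 mulr_ge0// ltW.
(* The weight [(pi / d) / (2 * kconv x)] turns the bound into the required product. *)
have := amgm _ (divr_gt0 c0 (mulr_gt0 (ltr0Sn R 1) k0)).
move: (pi / d) (kconv x) (kconv2 x) c0 k0 G0 => c k g c0 k0 g0.
have -> : c / (2 * k) * g + c / (4 * (c / (2 * k))) = (c * g + k ^+ 2) / (2 * k).
  by field; rewrite !gt_eqF.
rewrite ler_pdivlMr ?mulr_gt0//; nra.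
Qed.

(** Tonelli's theorem exchanges the integrals; the kernel is symmetric, so that its sections in the
    other variable have mass at most [pi / d] as well. *)
Lemma kconv2_integral : (\int[mu]_x (kconv2 x)%:E <= (pi / d)%:E * sqint f)%E /\
  measurable_fun (setT : set (measurableTypeR R)) (fun x => (kconv2 x)%:E).
Proof.
have [mf _] := (L2_integrable f).1 lf.
pose g (z : measurableTypeR R * measurableTypeR R) := (ker (z.1 - z.2) * nc (f z.2) ^+ 2)%:E.
have mg : measurable_fun setT g.
  apply/measurable_EFinP; apply: measurable_funM.
    apply: (measurableT_comp (f := ker)).
      by apply: (@continuous_measurable_fun R); exact: continuous_ker.
    by apply: measurable_funB; [exact: measurable_fst|exact: measurable_snd].
  by apply: (measurableT_comp (f := fun t => nc (f t) ^+ 2)); [exact: cmeas_nc2|exact: measurable_snd].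
have g0 z : (0 <= g z)%E by rewrite lee_fin mulr_ge0 ?sqr_ge0// ltW// ker_gt0.
have conv2E x : (kconv2 x)%:E = fubini_F mu g x.
  by rewrite /kconv2 /Rintegral fineK// (integrable_fin_num measurableT (ker_sqr_integrable x)).
split; last first.
  rewrite (_ : (fun x => _) = fubini_F mu g); last by apply/funext.
  exact: measurable_fun_fubini_tonelli_F.
under eq_integral do rewrite conv2E.
rewrite -[leLHS]/(\int[mu]_x \int[mu]_t g (x, t))%E (fubini_tonelli g)//.
apply: le_trans (_ : \int[mu]_t ((pi / d)%:E * (nc (f t) ^+ 2)%:E) <= _)%E; last first.
  rewrite ge0_integralZl//; last 3 first.
  - by apply/measurable_EFinP; exact: cmeas_nc2.
  - by move=> t _; rewrite lee_fin sqr_ge0.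
  - by rewrite lee_fin divr_ge0 ?pi_ge0// ltW.
apply: ge0_le_integral => //.
- by move=> t _; apply: integral_ge0 => x _; exact: g0.
- exact: measurable_fun_fubini_tonelli_G.
- by apply: measurable_funeM; apply/measurable_EFinP; exact: cmeas_nc2.
move=> t _; under eq_integral do rewrite /g /= EFinM.
rewrite ge0_integralZr//; last 3 first.
- by apply/measurable_EFinP; under eq_fun do rewrite ker_sub; exact: measurable_ker_sub.
- by move=> x _; rewrite lee_fin ltW// ker_gt0.
- by rewrite lee_fin sqr_ge0.
rewrite lee_wpmul2r ?lee_fin ?sqr_ge0//; under eq_integral do rewrite ker_sub.
exact: ker_integral.
Qed.

(** Schur's test: the mass [pi / d] enters once through Cauchy-Schwarz and once through Tonelli. *)
Lemma sqint_conv y (C : R) : 0 <= C -> cmeas y -> (forall x, nc (y x) <= C * kconv x) ->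
  (sqint y <= ((C * (pi / d)) ^+ 2)%:E * sqint f)%E.
Proof.
move=> C0 my yC; have [le2 m2] := kconv2_integral.
have c0 : 0 <= pi / d :> R by rewrite divr_ge0 ?pi_ge0// ltW.
apply: le_trans (_ : \int[mu]_x ((C ^+ 2 * (pi / d))%:E * (kconv2 x)%:E) <= _)%E.
  apply: ge0_le_integral => //.
  - by move=> x _; rewrite lee_fin sqr_ge0.
  - by apply/measurable_EFinP; exact: cmeas_nc2.
  - exact: measurable_funeM.
  move=> x _; rewrite -EFinM lee_fin; apply: le_trans (_ : (C * kconv x) ^+ 2 <= _).
    by rewrite ler_sqr ?nnegrE ?nc_ge0 ?mulr_ge0 ?kconv_ge0.
  by rewrite exprMn -[leRHS]mulrA; apply: ler_wpM2l; [exact: sqr_ge0|exact: kconv_sqr].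
rewrite ge0_integralZl//; last 2 first.
- by move=> x _; rewrite lee_fin; apply: Rintegral_ge0 => t _; rewrite mulr_ge0 ?sqr_ge0// ltW// ker_gt0.
- by rewrite lee_fin mulr_ge0 ?sqr_ge0.
rewrite (_ : (C * (pi / d)) ^+ 2 = C ^+ 2 * (pi / d) * (pi / d)); last by ring.
by rewrite (EFinM (C ^+ 2 * (pi / d)) (pi / d)) -[leRHS]muleA; apply: lee_wpmul2l => //; rewrite lee_fin mulr_ge0 ?sqr_ge0.
Qed.

End Convolution.

(** * The bounded inverse given by two decaying solutions *)

Section Resolvent.
Context {R : realType}.
Variables (tau z0 : R[i]).
Hypothesis tau_gt0 : 0 < im tau.
Hypothesis z0_regular : forall x : R, ~ lattice tau (x%:C + z0).
Implicit Types (f y : R -> R[i]).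
Local Notation mu := (@lebesgue_measure R).
Local Notation meas := (@measurable _ (measurableTypeR R)).
Local Notation pot := (pot tau z0).
Local Notation sol := (sol tau z0).
Variables (l : R[i]) (yp yp1 ym ym1 : R -> R[i]) (r : R[i]) (d M : R).
Hypothesis d0 : 0 < d.
Hypothesis solp : sol l yp yp1.
Hypothesis solm : sol l ym ym1.
Hypothesis W0 : yp1 0 * ym 0 - yp 0 * ym1 0 != 0.
Hypothesis M0 : 0 <= M.
Hypothesis ypM : forall x, nc (yp x) <= M * expR (- (d * x)).
Hypothesis yp1M : forall x, nc (yp1 x) <= M * expR (- (d * x)).
Hypothesis ymM : forall x, nc (ym x) <= M * expR (d * x).
Hypothesis ym1M : forall x, nc (ym1 x) <= M * expR (d * x).

(** The difference is a square-integrable homogeneous solution. Its Wronskians with [yp] and [ym]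
    vanish, since [yp] is bounded for x >= 0 and [ym] for x <= 0; as these are independent, the
    difference is 0. *)
Lemma lame_injective y y' f : lame tau z0 y (fun x => l * y x + f x) ->
  lame tau z0 y' (fun x => l * y' x + f x) -> y = y'.
Proof.
move=> hy hy'; have := lame_sub hy hy'; set u := fun x => y x + -1 * y' x => hu.
have [u1 [lu lu1 du du1]] := lame_classical tau_gt0 z0_regular (ccont_cst 0) hu.
have su : sol l u u1 by split=> // x; apply: cder_eq (du1 x) _; rewrite addr0.
have le1 (s : R) : s <= 0 -> M * expR s <= M by move=> s0; rewrite ler_piMr// -expR0 ler_expR.
have cp : u1 0 * yp 0 - u 0 * yp1 0 = 0.
  apply: (L2_const_wronskian (M := M) lu lu1 (v := yp) (v1 := yp1)) => n; exists 0 => x /andP[x0 _].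
  have h : M * expR (- (d * x)) <= M by apply: le1; rewrite oppr_le0 mulr_ge0// ltW.
  split; [exact: (wronskian_const su solp)|exact: le_trans (ypM x) h|exact: le_trans (yp1M x) h].
have cm : u1 0 * ym 0 - u 0 * ym1 0 = 0.
  apply: (L2_const_wronskian (M := M) lu lu1 (v := ym) (v1 := ym1)) => n; exists (- n%:R) => x.
  rewrite addNr => /andP[_ x0]; have h : M * expR (d * x) <= M by apply: le1; rewrite mulr_ge0_le0// ltW.
  split; [exact: (wronskian_const su solm)|exact: le_trans (ymM x) h|exact: le_trans (ym1M x) h].
have u00 : u 0 = 0.
  apply: (mulIf W0); rewrite mul0r.
  have -> : u 0 * (yp1 0 * ym 0 - yp 0 * ym1 0) =
    (u1 0 * ym 0 - u 0 * ym1 0) * yp 0 - (u1 0 * yp 0 - u 0 * yp1 0) * ym 0 by ring.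
  by rewrite cp cm !mul0r subrr.
have u10 : u1 0 = 0.
  apply: (mulIf W0); rewrite mul0r.
  have -> : u1 0 * (yp1 0 * ym 0 - yp 0 * ym1 0) =
    (u1 0 * ym 0 - u 0 * ym1 0) * yp1 0 - (u1 0 * yp 0 - u 0 * yp1 0) * ym1 0 by ring.
  by rewrite cp cm !mul0r subrr.
apply/funext => x; have [ux _] := sol_unique tau_gt0 z0_regular su u00 u10 x.
by apply/eqP; rewrite -subr_eq0 -mulN1r -/(u x) ux.
Qed.

Section Solution.
Variable f : R -> R[i].
Hypothesis lf : L2 f.

Let cyp : ccont yp := cder_ccont solp.1.
Let cym : ccont ym := cder_ccont solm.1.
Let cyp1 : ccont yp1 := cder_ccont solp.2.
Let cym1 : ccont ym1 := cder_ccont solm.2.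
Let mf : cmeas f := ((L2_integrable f).1 lf).1.

(** The constant 8 is the factor 4 of [expR_le_ker] times the factor 2 of [nc_cI]. *)
Lemma half_line_bound (v : R -> R[i]) D (c x : R) : ccont v -> meas D -> 0 <= c ->
  (forall t, D t -> nc (v t) <= c * expR (- (d * `|x - t|))) ->
  cint D (fun t => v t * f t) /\ nc (cI D (fun t => v t * f t)) <= 8 * c * kconv d f x.
Proof.
move=> cv mD c0 vD.
have iF : mu.-integrable setT (EFin \o (fun t => 4 * c * (ker d (x - t) * nc (f t)))).
  by apply: integrableZ => //; exact: ker_nc_integrable.
have le t : D t -> nc (v t * f t) <= 4 * c * (ker d (x - t) * nc (f t)).
  move=> Dt; rewrite ncM mulrA ler_wpM2r ?nc_ge0//; apply: le_trans (vD t Dt) _.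
  by rewrite [4 * c]mulrC -mulrA ler_wpM2l// expR_le_ker.
have iD : mu.-integrable D (EFin \o (fun t => 4 * c * (ker d (x - t) * nc (f t)))) by exact: integrableS iF.
have ci : cint D (fun t => v t * f t).
  by apply: cint_dom iD le => //; apply: cmeasM => //; exact: ccont_cmeas.
split=> //; apply: le_trans (nc_cI mD ci iD le) _.
have -> : 8 * c * kconv d f x = 2 * (4 * c * kconv d f x) by ring.
rewrite ler_wpM2l// -RintegralZl//; last exact: ker_nc_integrable.
apply: Rintegral_subset => // t.
by rewrite !mulr_ge0 ?nc_ge0// ltW// ker_gt0.
Qed.

(** [ym] is integrated from the left and, in [green_p], [yp] from the right. After multiplication by
    the other solution each integrand carries a kernel bounded by a multiple of
    [expR (- (d * |x - t|))]. *)
Definition green_m x := cI `]-oo, x] (fun t => ym t * f t).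
Definition green_p x := cI `[x, +oo[ (fun t => yp t * f t).

Lemma green_m_bound x : cint `]-oo, x] (fun t => ym t * f t) /\
  nc (green_m x) <= 8 * (M * expR (d * x)) * kconv d f x.
Proof.
apply: half_line_bound => //; first by rewrite mulr_ge0// expR_ge0.
move=> t /=; rewrite in_itv/= => tx; apply: le_trans (ymM t) _.
by rewrite -mulrA -expRD ler_wpM2l// ler_expR ger0_norm ?subr_ge0//; lra.
Qed.

Lemma green_p_bound x : cint `[x, +oo[ (fun t => yp t * f t) /\
  nc (green_p x) <= 8 * (M * expR (- (d * x))) * kconv d f x.
Proof.
apply: half_line_bound => //; first by rewrite mulr_ge0// expR_ge0.
move=> t /=; rewrite in_itv/= andbT => tx; apply: le_trans (ypM t) _.
by rewrite -mulrA -expRD ler_wpM2l// ler_expR ler0_norm ?subr_le0//; lra.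
Qed.

Lemma green_m_primitive : primitive_of (fun t => ym t * f t) green_m.
Proof.
move=> a b ab; have [ib _] := green_m_bound b.
by rewrite /green_m (@cI_itvD _ -oo%O a b _ isT ab ib) addrC addKr.
Qed.

Lemma green_p_primitive : primitive_of (fun t => - yp t * f t) green_p.
Proof.
move=> a b ab; have [ia _] := green_p_bound a.
rewrite /green_p (@cI_itvD2 _ a b +oo%O _ ab isT ia).
have -> : cRintegral a b (fun t => - yp t * f t) = - cI `[a, b] (fun t => yp t * f t).
  rewrite -mulN1r -cIZ//; last by apply: lintM => //; exact: L2_lint.
  by congr cI; apply/funext => t; ring.
by ring.
Qed.

Let W := yp1 0 * ym 0 - yp 0 * ym1 0.

(** Variation of constants. On differentiation the two terms containing [f] cancel, so that [green1]
    has the same form. *)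
Definition green x := W^-1 * (yp x * green_m x + ym x * green_p x).
Definition green1 x := W^-1 * (yp1 x * green_m x + ym1 x * green_p x).

Lemma green_lame_bound (v w : R -> R[i]) : (forall x, nc (v x) <= M * expR (- (d * x))) ->
  (forall x, nc (w x) <= M * expR (d * x)) -> forall x,
  nc (W^-1 * (v x * green_m x + w x * green_p x)) <= 16 * M ^+ 2 / nc W * kconv d f x.
Proof.
move=> vM wM x; have [_ hm] := green_m_bound x; have [_ hp] := green_p_bound x.
have c0 := kconv_ge0 d f x.
rewrite ncM ncV [leRHS](_ : _ = (nc W)^-1 * (16 * M ^+ 2 * kconv d f x)); last by ring.
rewrite ler_wpM2l ?invr_ge0 ?nc_ge0//; apply: le_trans (ncD _ _) _; rewrite !ncM.
have := expRxMexpNx_1 (d * x) => e1.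
have -> : 16 * M ^+ 2 * kconv d f x = (M * expR (- (d * x))) * (8 * (M * expR (d * x)) * kconv d f x) +
    (M * expR (d * x)) * (8 * (M * expR (- (d * x))) * kconv d f x).
  transitivity (16 * M ^+ 2 * kconv d f x * (expR (d * x) * expR (- (d * x)))); first by rewrite e1 mulr1.
  by ring.
by apply: lerD; apply: ler_pM; rewrite ?nc_ge0.
Qed.

Lemma green_lame : lame tau z0 green (fun x => l * green x + f x) /\
  (sqint green <= ((16 * M ^+ 2 / nc W * (pi / d)) ^+ 2)%:E * sqint f)%E.
Proof.
have cA : ccont green_m by exact: primitive_ccont cym lf green_m_primitive.
have cB : ccont green_p by apply: primitive_ccont lf green_p_primitive; exact: ccontN.
have lA : lint (fun t => ym t * f t) by apply: lintM => //; exact: L2_lint.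
have lB : lint (fun t => - yp t * f t) by apply: lintM; [exact: ccontN|exact: L2_lint].
have cy : ccont green.
  by apply: ccontM; [exact: ccont_cst|apply: ccontD; exact: ccontM].
have cy1 : ccont green1.
  by apply: ccontM; [exact: ccont_cst|apply: ccontD; exact: ccontM].
have C0 : 0 <= 16 * M ^+ 2 / nc W by rewrite divr_ge0 ?nc_ge0// mulr_ge0// sqr_ge0.
have by_ := sqint_conv d0 lf C0 (ccont_cmeas cy) (green_lame_bound ypM ymM).
have by1 := sqint_conv d0 lf C0 (ccont_cmeas cy1) (green_lame_bound yp1M ym1M).
have Sf : (sqint f < +oo)%E by have [_] := (L2P f).1 lf.
have l2 g : ccont g -> (sqint g <= ((16 * M ^+ 2 / nc W * (pi / d)) ^+ 2)%:E * sqint f)%E -> L2 g.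
  move=> cg h; apply/L2P; split; first exact: ccont_cmeas.
  by apply: le_lt_trans h _; rewrite lte_mul_pinfty ?lee_fin ?sqr_ge0.
have [ly ly1] := (l2 _ cy by_, l2 _ cy1 by1).
pose q x := 12 * pot x + l.
have cq : ccont q := ccont_pot tau_gt0 z0_regular l.
pose d2y x := q x * green x + f x.
split=> //; exists d2y; last first.
  apply: aeW => x; have -> : wp tau (x%:C + z0) = pot x by [].
  by rewrite /d2y /q; ring.
have [K hK] := pot_bounded tau_gt0 z0_regular.
have qK x : nc (q x) <= 12 * K + nc l.
  apply: le_trans (ncD _ _) _; apply: lerD => //; rewrite ncM (nc_nat 12).
  by apply: ler_wpM2l => //; exact: hK.
have ld2 : L2 d2y := L2D (L2M (ccont_cmeas cq) qK ly) lf.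
have prim (v v1 w w1 : R -> R[i]) : (forall x, cder v (v1 x) x) -> (forall x, cder w (w1 x) x) ->
    ccont v1 -> ccont w1 ->
    primitive_of (fun x => W^-1 * ((v1 x * green_m x + v x * (ym x * f x)) +
      (w1 x * green_p x + w x * (- yp x * f x)))) (fun x => W^-1 * (v x * green_m x + w x * green_p x)).
  move=> dv dw cv1 cw1; have cv := cder_ccont dv; have cw := cder_ccont dw.
  have l1 : lint (fun x => v1 x * green_m x + v x * (ym x * f x)).
    by apply: lintD; [apply: lintM => //; exact: ccont_lint|exact: lintM].
  have l1' : lint (fun x => w1 x * green_p x + w x * (- yp x * f x)).
    by apply: lintD; [apply: lintM => //; exact: ccont_lint|exact: lintM].
  apply: primitiveZ; first exact: lintD.
  apply: primitiveD => //.
    exact: primitive_by_parts dv cv1 lA green_m_primitive cA.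
  exact: primitive_by_parts dw cw1 lB green_p_primitive cB.
exists green1; split; [exact: ly|exact: ly1|exact: ld2| |].
  rewrite (_ : green1 = (fun x => W^-1 * ((yp1 x * green_m x + yp x * (ym x * f x)) +
      (ym1 x * green_p x + ym x * (- yp x * f x))))); first exact: prim solp.1 solm.1 cyp1 cym1.
  by apply/funext => x; rewrite /green1; ring.
rewrite (_ : d2y = (fun x => W^-1 * ((q x * yp x * green_m x + yp1 x * (ym x * f x)) +
      (q x * ym x * green_p x + ym1 x * (- yp x * f x))))).
  by apply: prim solp.2 solm.2 _ _; exact: ccontM.
apply/funext => x; rewrite /d2y /green.
(* In the second derivative [f] appears with the Wronskian divided by [W] as coefficient, that is
   with coefficient 1. *)
have WE : yp1 x * ym x - yp x * ym1 x = W := wronskian_const solp solm x 0.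
have fE : f x = W^-1 * ((yp1 x * ym x - yp x * ym1 x) * f x) by rewrite WE mulKf.
by rewrite [X in _ + X = _]fE; ring.
Qed.

End Solution.

Lemma decaying_resolvent : resolvent_set (lame tau z0) l.
Proof.
have Wn := W0; set W := yp1 0 * ym 0 - yp 0 * ym1 0 in Wn.
have C0 : 0 <= 16 * M ^+ 2 / nc W * (pi / d).
  by rewrite mulr_ge0 ?divr_ge0 ?nc_ge0 ?pi_ge0 ?mulr_ge0 ?sqr_ge0// ltW.
exists (16 * M ^+ 2 / nc W * (pi / d)) => f lf; have [h1 h2] := green_lame lf.
exists (green f); split; [exact: h1|move=> y1 h; apply: aeW => x|exact: L2norm_le C0 h2].
by rewrite (lame_injective h h1).
Qed.

End Resolvent.

(** * The spectrum in terms of the multiplier *)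

Section FloquetSpectrum.
Context {R : realType}.
Variables (tau z0 : R[i]).
Hypothesis tau_gt0 : 0 < im tau.
Hypothesis z0_regular : forall x : R, ~ lattice tau (x%:C + z0).

Lemma floquet_spectrum (l r : R[i]) (yp yp1 ym ym1 : R -> R[i]) :
  sol tau z0 l yp yp1 -> sol tau z0 l ym ym1 -> r != 0 ->
  (forall x, yp (x + 1) = r * yp x) -> (forall x, yp1 (x + 1) = r * yp1 x) ->
  (forall x, ym (x + 1) = r^-1 * ym x) -> (forall x, ym1 (x + 1) = r^-1 * ym1 x) ->
  yp1 0 * ym 0 - yp 0 * ym1 0 != 0 ->
  spectrum (lame tau z0) l <-> nc r = 1.
Proof.
move=> solp solm r0 hp hp1 hm hm1 W0; split; last first.
  exact: (unimodular_spectrum tau_gt0 z0_regular solp solm hp hp1 W0).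
move=> spec; apply/eqP; apply: contraPT spec => r1; apply.
(* Exchanging [yp] and [ym] replaces [r] by its inverse, so that [yp] may be taken to decay to the
   right. *)
wlog lt1 : r yp yp1 ym ym1 solp solm r0 hp hp1 hm hm1 W0 r1 / nc r < 1 => [H|].
  have [lt1|gt1] := ltP (nc r) 1; first exact: (H r yp yp1 ym ym1).
  have {}gt1 : 1 < nc r by rewrite lt_neqAle eq_sym r1.
  apply: (H r^-1 ym ym1 yp yp1) => //; rewrite ?invr_eq0 ?invrK//.
  - by rewrite -oppr_eq0 opprB [ym 0 * _]mulrC [ym1 0 * _]mulrC.
  - by rewrite ncV invr_eq1.
  - by rewrite ncV invf_lt1 ?nc_gt0.
pose d := - ln (nc r); have d0 : 0 < d by rewrite oppr_gt0 ln_lt0// nc_gt0 r0.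
have e1 : nc r = expR (- d) by rewrite opprK lnK// posrE nc_gt0.
have e2 : nc r^-1 = expR d by rewrite ncV e1 expRN invrK.
have [M1 M10 h1] := multiplier_bound (cder_ccont solp.1) hp e1.
have [M2 M20 h2] := multiplier_bound (cder_ccont solp.2) hp1 e1.
have [M3 M30 h3] := multiplier_bound (cder_ccont solm.1) hm e2.
have [M4 M40 h4] := multiplier_bound (cder_ccont solm.2) hm1 e2.
have le (c : R) (s M : R) : c <= M * expR s -> M <= M1 + M2 + M3 + M4 -> c <= (M1 + M2 + M3 + M4) * expR s.
  by move=> h hM; apply: le_trans h _; rewrite ler_wpM2r ?expR_ge0.
apply: (decaying_resolvent tau_gt0 z0_regular d0 solp solm W0 (M := M1 + M2 + M3 + M4)).
- by rewrite !addr_ge0.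
- by move=> x; apply: (le _ _ M1); [rewrite -mulNr|lra].
- by move=> x; apply: (le _ _ M2); [rewrite -mulNr|lra].
- by move=> x; apply: (le _ _ M3); [|lra].
- by move=> x; apply: (le _ _ M4); [|lra].
Qed.

End FloquetSpectrum.

(** * Local structure of the spectrum *)

Section Polar.
Context {R : realType}.
Implicit Types (a b t : R) (z : R[i]).

Lemma expiD a b : expi (a + b) = expi a * expi b.
Proof. by apply: complexP; rewrite ?(reM, imM) /= ?cosD ?sinD//; ring. Qed.

Lemma expiX a n : expi a ^+ n = expi (n%:R * a).
Proof.
elim: n => [|n IH]; first by rewrite expr0 mul0r expi0.
by rewrite exprS IH -expiD mulrS mulrDl mul1r.
Qed.

Lemma expi_natpi n : expi (n%:R * pi) = (-1) ^+ n :> R[i].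
Proof. by rewrite -expiX expipi. Qed.

Lemma expi_pihalf : expi (pi / 2) = 'i%C :> R[i].
Proof. by apply: complexP; rewrite /= ?cos_pihalf ?sin_pihalf. Qed.

Lemma expi_per (k : int) a : expi (a + 2 * pi * k%:~R) = expi a.
Proof.
have nat_ (n : nat) a' : expi (a' + 2 * pi * n%:R) = expi a'.
  have -> : 2 * pi * n%:R = (2 * n)%:R * pi :> R by rewrite natrM; ring.
  by rewrite expiD expi_natpi exprM sqrrN !expr1n mulr1.
case: k => n; first exact: nat_.
by rewrite NegzE mulrNz mulrN -[LHS](nat_ n.+1) subrK.
Qed.

Lemma expi_onto z : nc z = 1 -> exists a, expi a = z.
Proof.
move=> z1; have := nc_sqr z; rewrite z1 expr1n => /esym E.
have hr : -1 <= re z <= 1 by rewrite -ler_norml -z1 nc_re.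
have sE : sin (acos (re z)) = `|im z|.
  by rewrite sin_acos// -E addrAC subrr add0r sqrtr_sqr.
have [i0|i0] := leP 0 (im z).
  by exists (acos (re z)); apply: complexP; rewrite /= ?acosK// sE ger0_norm.
by exists (- acos (re z)); apply: complexP; rewrite /= ?cosN ?sinN ?acosK// sE ltr0_norm// opprK.
Qed.

Lemma polar z : exists a, z = (nc z)%:C * expi a.
Proof.
have [->|z0] := eqVneq z 0; first by exists 0; rewrite nc0 mul0r.
have n0 : (nc z)%:C != 0 by rewrite -nc_eq0 nc_real (ger0_norm (nc_ge0 _)) gt_eqF// nc_gt0.
have [a ha] : exists a, expi a = z / (nc z)%:C.
  by apply: expi_onto; rewrite ncM ncV nc_real (ger0_norm (nc_ge0 _)) divff// gt_eqF// nc_gt0.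
by exists a; rewrite ha mulrC divfK.
Qed.

Lemma polar_from z a0 : exists2 a, a0 <= a < a0 + 2 * pi & z = (nc z)%:C * expi a.
Proof.
have [a ha] := polar z; have p0 : 0 < 2 * pi :> R by rewrite mulr_gt0// pi_gt0.
pose k := Num.floor ((a - a0) / (2 * pi)).
have /andP[] := floor_itv ((a - a0) / (2 * pi)); rewrite -/k intrD.
rewrite ler_pdivlMr// ltr_pdivrMr// => k1 k2.
exists (a - 2 * pi * k%:~R); first by apply/andP; split; [move: k1|move: k2]; move: (k%:~R) => x; lra.
by rewrite -[in RHS](expi_per k) subrK.
Qed.

Lemma cos_pi4_gt0 : 0 < cos (pi / 4) :> R.
Proof. by apply: cos_gt0_pihalf; have := pi_gt0 R; lra. Qed.

Lemma le_cos_pi4 t : `|t| <= pi / 4 -> cos (pi / 4) <= cos t.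
Proof.
move=> tp; have p0 := pi_gt0 R.
have -> : cos t = cos `|t| by case: ger0P => // _; rewrite cosN.
rewrite leNgt ltr_cos ?in_itv/= -?leNgt//; apply/andP; split=> //; lra.
Qed.

Lemma le_sin_pi4 t : pi / 4 <= t <= 3 / 4 * pi -> cos (pi / 4) <= sin t.
Proof.
move=> /andP[t1 t2]; have -> : sin t = cos (t - pi / 2).
  by rewrite cosB cos_pihalf sin_pihalf; ring.
by apply: le_cos_pi4; rewrite ler_norml; apply/andP; split; lra.
Qed.

(** The cosine decreases on [0, pi] and is symmetric about pi. *)
Lemma le_cos_out (x y : R) : 0 <= y <= pi -> y <= `|x| <= 2 * pi - y -> cos x <= cos y.
Proof.
move=> /andP[y0 yp] /andP[yx xy]; have p0 := pi_gt0 R.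
have -> : cos x = cos `|x| by case: ger0P => // _; rewrite cosN.
have le (z : R) : y <= z -> z <= pi -> cos z <= cos y.
  by move=> yz zp; rewrite leNgt ltr_cos ?in_itv/= -?leNgt//; apply/andP; split; lra.
have [xp|xp] := leP `|x| pi; first exact: le.
have -> : cos `|x| = cos (2 * pi - `|x|).
  by have := congr1 (@complex.Re R) (expi_per 1 (- `|x|)); rewrite /= cosN mulr1 addrC => ->.
by apply: le; lra.
Qed.

Lemma nc_expiB a t : nc (expi a - expi t) <= 2 * `|a - t|.
Proof.
have le (x y : R) : x <= y -> nc (expi y - expi x) <= 2 * (y - x).
  move=> xy; have := @cder_bound R expi (fun t => 'i%C * expi t) 1 x y xy (fun t _ => cder_expi t).
  by rewrite mulr1; apply => s _; rewrite -expi_pihalf ncM !nc_expi mulr1.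
by have [ta|/ltW at_] := leP t a; [rewrite ger0_norm ?subr_ge0// le|rewrite ler0_norm ?subr_le0// opprB ncBC le].
Qed.

End Polar.

(** * Counting connected components *)

Section ClopenComponents.
Context {R : realType}.
Variables (X : set R[i]) (k : nat) (B : nat -> set R[i]).
Hypothesis Bconn : forall j, (j < k)%N -> connected (B j).
Hypothesis Bneq0 : forall j, (j < k)%N -> B j !=set0.
Hypothesis XB : forall x, X x <-> exists2 j, (j < k)%N & B j x.
Hypothesis Bdisj : forall j j' x, (j < k)%N -> (j' < k)%N -> B j x -> B j' x -> j = j'.
Hypothesis Bclopen : forall j, (j < k)%N -> exists U K : set R[i],
  [/\ open U, closed K, forall x, X x -> U x <-> B j x & forall x, X x -> K x <-> B j x].

(** Being connected, [B j] lies in the component of each of its points; being cut out of [X] by an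
    open and by a closed set, it cannot be left by that component. *)
Lemma clopen_component j x : (j < k)%N -> B j x -> connected_component X x = B j.
Proof.
move=> jk Bx; have [U [K [oU cK UB KB]]] := Bclopen jk.
have BX : B j `<=` X by move=> y By; apply/XB; exists j.
have CX : connected_component X x `<=` X := @connected_component_sub _ X x.
apply/seteqP; split; last exact: connected_component_max Bx BX (Bconn jk).
have <- : connected_component X x `&` B j = connected_component X x; last by move=> y [].
apply: (@component_connected _ X x).
- by exists x; split=> //; apply: connected_component_refl; exact: BX.
- by exists U => //; apply/seteqP; split=> y [Cy By]; split=> //; [apply/(UB y (CX y Cy))|apply/(UB y (CX y Cy))].
- by exists K => //; apply/seteqP; split=> y [Cy By]; split=> //; [apply/(KB y (CX y Cy))|apply/(KB y (CX y Cy))].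
Qed.

Lemma card_components : (components X #= `I_k)%card.
Proof.
have -> : components X = B @` `I_k.
  apply/seteqP; split=> [C [x Xx <-]|C [j jk <-]].
    by have [j jk Bx] := (XB x).1 Xx; exists j => //; rewrite (clopen_component jk Bx).
  have [x Bx] := Bneq0 jk; exists x; first by apply/XB; exists j.
  exact: clopen_component.
apply: inj_card_eq => j j'; rewrite !inE /= => jk j'k E.
by have [x Bx] := Bneq0 jk; apply: (Bdisj jk j'k Bx); rewrite -E.
Qed.

End ClopenComponents.

Lemma is_derive_scale {R : realType} (a : R) (f : R -> R) (df t : R) : is_derive t (1 : R) f df ->
  is_derive t (1 : R) (fun s => a * f s) (a * df).
Proof.
move=> h; have [k _] := cderZ a%:C (cder_real h).
by apply: is_derive_ext k _ _ => [s|]; rewrite reM /= mul0r subr0.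
Qed.

(** * The zero set of a function like Re c (l - l0)^(n+1) near l0 *)

Section LocalArcs.
Context {R : realType}.
Variables (V : R[i] -> R) (G H : R[i] -> R[i]) (l0 : R[i]) (d : R) (n : nat) (S : set R[i]).
Hypothesis d0 : 0 < d.
Hypothesis V0 : V l0 = 0.
Hypothesis dV : forall (y y1 : R -> R[i]) t, cder y (y1 t) t -> nc (y t - l0) < d ->
  is_derive t (1 : R) (fun s => V (y s)) (re (G (y t) * y1 t)).
Hypothesis GH : forall l, nc (l - l0) < d -> G l = (l - l0) ^+ n * H l.
Hypothesis cH : cont_at H l0.
Hypothesis H0 : H l0 != 0.
Hypothesis SV : forall l, nc (l - l0) < d -> S l <-> V l = 0.

Let m : R := n.+1%:R.
Let c := nc (H l0).
(** The least value of the cosine on |t| <= pi / 4. A relative error of [H] below [k / 2] then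
    leaves the relevant signs unchanged. *)
Let k : R := cos (pi / 4).

Let m0 : 0 < m. Proof. by rewrite ltr0Sn. Qed.
Let c0 : 0 < c. Proof. by rewrite nc_gt0. Qed.
Let k0 : 0 < k. Proof. exact: cos_pi4_gt0. Qed.

Variable b : R.
Hypothesis bH : H l0 = c%:C * expi b.
Variable r0 : R.
Hypothesis r00 : 0 < r0.
Hypothesis r0d : r0 <= d.
Hypothesis Hr0 : forall l, nc (l - l0) < r0 -> nc (H l - H l0) < k / 2 * c.

(* The angle is measured so that [H l0 * (pt j r t - l0) ^+ n.+1] is a positive multiple of
   [(-1) ^+ j * 'i * expi t]; the j-th arc lies in the sector [|t| < pi / 4], where [F j r] decreases. *)
Let ang j t : R := (pi / 2 + j%:R * pi + t - b) / m.
Let pt j r t : R[i] := l0 + r%:C * expi (ang j t).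
Let F j r t : R := (-1) ^+ j * V (pt j r t).

Lemma nc_pt j r t : 0 <= r -> nc (pt j r t - l0) = r.
Proof. by move=> rp; rewrite /pt addrAC subrr add0r ncM nc_expi mulr1 nc_real ger0_norm. Qed.

Lemma angX j t : expi (ang j t) ^+ n.+1 * expi b = (-1) ^+ j * 'i%C * expi t.
Proof.
rewrite expiX -expiD -expi_pihalf -expi_natpi -!expiD; congr expi.
by rewrite -/m /ang; field; rewrite gt_eqF.
Qed.

(** In the coordinates [r] and [t] the gradient takes the same form for every [j], up to the sign
    [(-1) ^+ j] and a small relative error [e]. *)
Lemma GE j r t : 0 <= r < r0 -> exists2 e : R[i], nc e <= k / 2 &
  G (pt j r t) * expi (ang j t) = (r ^+ n * c * (-1) ^+ j)%:C * ('i%C * expi t * (1 + e)).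
Proof.
move=> /andP[rp rr]; have np := nc_pt j t rp.
have H00 := H0; pose e := H (pt j r t) / H l0 - 1.
have He : H (pt j r t) = H l0 * (1 + e) by rewrite /e addrC subrK mulrC divfK.
exists e.
  have -> : e = (H (pt j r t) - H l0) / H l0 by rewrite mulrBl divff.
  by rewrite ncM ncV ler_pdivrMr ?nc_gt0// ltW// Hr0// np.
rewrite GH ?np ?(lt_le_trans rr)// He bH {1}/pt addrAC subrr add0r exprMn.
transitivity ((r%:C ^+ n) * c%:C * ((expi (ang j t) ^+ n.+1) * expi b) * (1 + e)).
  by rewrite exprS; ring.
rewrite angX !rmorphM !rmorphXn /= rmorphN1; ring.
Qed.

Lemma re_bound t (e : R[i]) : nc e <= k / 2 -> `|re ('i%C * expi t * (1 + e)) + sin t| <= k / 2.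
Proof.
move=> he; have -> : re ('i%C * expi t * (1 + e)) + sin t = re ('i%C * expi t * e).
  by rewrite !(reM, imM, reD, imD) /=; ring.
apply: le_trans (nc_re _) _; rewrite !ncM nc_expi mulr1.
by rewrite -expi_pihalf nc_expi mul1r.
Qed.

Lemma im_bound t (e : R[i]) : nc e <= k / 2 -> `|re ('i%C * ('i%C * expi t * (1 + e))) + cos t| <= k / 2.
Proof.
move=> he; have -> : re ('i%C * ('i%C * expi t * (1 + e))) + cos t = re ('i%C * 'i%C * expi t * e).
  by rewrite !(reM, imM, reD, imD) /=; ring.
apply: le_trans (nc_re _) _; rewrite !ncM nc_expi mulr1.
by rewrite -expi_pihalf nc_expi !mul1r.
Qed.

Lemma sgn_sqr j : (-1) ^+ j * (-1) ^+ j = 1 :> R.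
Proof. by rewrite -exprMn mulrNN mulr1 expr1n. Qed.

Lemma F_radial j r t : 0 <= r < r0 -> exists2 a : R, `|a + sin t| <= k / 2 &
  is_derive r (1 : R) (fun s => F j s t) (r ^+ n * c * a).
Proof.
move=> /[dup] rr /andP[rp rlt]; have [e he GEe] := GE j t rr.
exists (re ('i%C * expi t * (1 + e))); first exact: re_bound.
have dp : cder (fun s => pt j s t) (expi (ang j t)) r.
  apply: cder_eq (cderD (cder_cst l0 _) (cderM (cder_real (is_derive_id r 1)) (cder_cst (expi (ang j t)) _))) _.
  by rewrite mulr0 add0r addr0 mul1r.
have h := dV (y1 := fun=> expi (ang j t)) dp (ltac:(by rewrite nc_pt//; apply: lt_le_trans rlt r0d)).
apply: is_derive_ext (is_derive_scale ((-1) ^+ j) h) _ _ => //.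
rewrite GEe reM /= mul0r subr0.
have -> s : (-1) ^+ j * (r ^+ n * c * (-1) ^+ j * s) = ((-1) ^+ j * (-1) ^+ j) * (r ^+ n * c * s) by ring.
by rewrite sgn_sqr mul1r.
Qed.

Lemma F_angular j r t : 0 <= r < r0 -> exists2 a : R, `|a + cos t| <= k / 2 &
  is_derive t (1 : R) (F j r) (r ^+ n.+1 * c / m * a).
Proof.
move=> /[dup] rr /andP[rp rlt]; have [e he GEe] := GE j t rr.
exists (re ('i%C * ('i%C * expi t * (1 + e)))); first exact: im_bound.
have da : is_derive t (1 : R) (ang j) m^-1.
  apply/is_deriveP => x x0; exists 1 => // s _.
  rewrite (_ : _ - _ - _ = 0) ?normr0 ?mulr_ge0 ?(ltW x0)//.
  by rewrite /ang; field; rewrite gt_eqF.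
have de : cder (fun s => expi (ang j s)) ('i%C * expi (ang j t) * (m^-1)%:C) t.
  have [h1 h2] := cder_expi (ang j t); split.
    by apply: is_derive_ext (is_derive1_comp h1 da) _ _ => //; rewrite reM /= mulr0 subr0.
  by apply: is_derive_ext (is_derive1_comp h2 da) _ _ => //; rewrite imM /= mulr0 add0r.
have dp : cder (pt j r) (r%:C * ('i%C * expi (ang j t) * (m^-1)%:C)) t.
  by apply: cder_eq (cderD (cder_cst l0 _) (cderZ r%:C de)) _; rewrite add0r.
have h := dV (y1 := fun=> r%:C * ('i%C * expi (ang j t) * (m^-1)%:C)) dp
  (ltac:(by rewrite nc_pt//; apply: lt_le_trans rlt r0d)).
apply: is_derive_ext (is_derive_scale ((-1) ^+ j) h) _ _ => //.
have -> : G (pt j r t) * (r%:C * ('i%C * expi (ang j t) * (m^-1)%:C)) =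
    (r ^+ n.+1 * c / m * (-1) ^+ j)%:C * ('i%C * ('i%C * expi t * (1 + e))).
  transitivity (r%:C * (m^-1)%:C * 'i%C * (G (pt j r t) * expi (ang j t))); first by ring.
  by rewrite GEe exprS !rmorphM /=; ring.
rewrite reM /= mul0r subr0.
have -> s : (-1) ^+ j * (r ^+ n.+1 * c / m * (-1) ^+ j * s) = ((-1) ^+ j * (-1) ^+ j) * (r ^+ n.+1 * c / m * s) by ring.
by rewrite sgn_sqr mul1r.
Qed.

(** The radial derivative is integrated from the centre, where [V] vanishes: [F] is the leading
    term, a negative multiple of [sin t], up to the fraction [k / 2] of its amplitude. *)
Lemma F_bound j r t : 0 <= r < r0 -> `|F j r t + r ^+ n.+1 * c / m * sin t| <= k / 2 * (r ^+ n.+1 * c / m).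
Proof.
move=> /andP[rp rr].
pose a s := if pselect (0 <= s < r0) is left h then projT1 (cid2 (F_radial j t h)) else 0.
have aP s : 0 <= s <= r -> `|a s + sin t| <= k / 2 /\ is_derive s (1 : R) (fun s => F j s t) (s ^+ n * c * a s).
  move=> /andP[s0 sr]; rewrite /a; case: pselect => [h|[]]; last by rewrite s0 (le_lt_trans sr).
  by case: cid2.
have dpow (q s : R) : is_derive s (1 : R) (fun s => s ^+ n.+1 * c / m * q) (s ^+ n * c * q).
  have h := is_derive_scale (c / m * q) (is_deriveX n.+1 (is_derive_id s (1 : R))).
  apply: is_derive_ext h _ _ => [x|]; first by rewrite exprfctE; ring.
  by rewrite /GRing.scale /= mulr1 -/m; field; rewrite gt_eqF.
have F0 : F j 0 t = 0 by rewrite /F /pt mul0r addr0 V0 mulr0.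
have le q s t' : 0 <= s <= r -> q <= t' -> s ^+ n * c * q <= s ^+ n * c * t'.
  by move=> /andP[s0 _] qt; rewrite ler_wpM2l// mulr_ge0 ?exprn_ge0// ltW.
have dF s hs := (aP s hs).2.
have lo := @le_derive R _ (fun s => F j s t) (fun s => s ^+ n * c * (- (k / 2) - sin t))
    (fun s => s ^+ n * c * a s) 0 r rp (fun s _ => dpow (- (k / 2) - sin t) s) dF.
have hi := @le_derive R (fun s => F j s t) _ (fun s => s ^+ n * c * a s)
    (fun s => s ^+ n * c * (k / 2 - sin t)) 0 r rp dF (fun s _ => dpow (k / 2 - sin t) s).
move: lo hi; rewrite F0 expr0n /= !mul0r !subr0 => lo hi.
rewrite ler_norml; apply/andP; split.
  suff : forall s, 0 <= s <= r -> s ^+ n * c * (- (k / 2) - sin t) <= s ^+ n * c * a s.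
    by move=> /lo; move: (r ^+ n.+1 * c / m) (F j r t) => p q; lra.
  by move=> s hs; apply: le => //; have [] := aP s hs; rewrite ler_norml => /andP[]; lra.
suff : forall s, 0 <= s <= r -> s ^+ n * c * a s <= s ^+ n * c * (k / 2 - sin t).
  by move=> /hi; move: (r ^+ n.+1 * c / m) (F j r t) => p q; lra.
by move=> s hs; apply: le => //; have [] := aP s hs; rewrite ler_norml => /andP[]; lra.
Qed.

Let amp r := r ^+ n.+1 * c / m.

Let amp_gt0 r : 0 < r -> 0 < amp r.
Proof. by move=> rp; rewrite divr_gt0// mulr_gt0// exprn_gt0. Qed.

(** On this range [sin t >= k], which outweighs the relative error [k / 2]. *)
Lemma F_lt0 j r t : 0 < r < r0 -> pi / 4 <= t <= 3 / 4 * pi -> F j r t < 0.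
Proof.
move=> /andP[rp rr] ht; have := F_bound j t (ltac:(by rewrite (ltW rp)) : 0 <= r < r0).
rewrite -/(amp r) ler_norml => /andP[_ h]; have a0 := amp_gt0 rp; have s0 := le_sin_pi4 ht; rewrite -/k in s0.
move: (amp r) (sin t) a0 s0 h => a s a0 s0 h.
have : 0 < k * a by exact: mulr_gt0.
have : 0 <= a * (s - k) by rewrite mulr_ge0 ?subr_ge0// ltW.
by move: (F j r t) h k0 => f; nra.
Qed.

Lemma F_gt0 j r t : 0 < r < r0 -> - (3 / 4 * pi) <= t <= - (pi / 4) -> 0 < F j r t.
Proof.
move=> /andP[rp rr] /andP[t1 t2]; have := F_bound j t (ltac:(by rewrite (ltW rp)) : 0 <= r < r0).
have ht : pi / 4 <= - t <= 3 / 4 * pi by apply/andP; split; lra.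
rewrite -/(amp r) ler_norml => /andP[h _]; have a0 := amp_gt0 rp; have s0 := le_sin_pi4 ht; rewrite -/k sinN in s0.
move: (amp r) (sin t) a0 s0 h => a s a0 s0 h.
have : 0 < k * a by exact: mulr_gt0.
have : 0 <= a * (- s - k) by rewrite mulr_ge0 ?subr_ge0// ltW.
by move: (F j r t) h k0 => f; nra.
Qed.

(** In the sector the angular derivative is at most [- (k / 2)] times the amplitude, because
    [cos t >= k] there. *)
Lemma F_decr j r t t' : 0 < r < r0 -> - (pi / 4) <= t -> t < t' -> t' <= pi / 4 -> F j r t' < F j r t.
Proof.
move=> /andP[rp rr] ht tt ht'; have a0 := amp_gt0 rp.
have rr' : 0 <= r < r0 by rewrite ltW.
pose a s := projT1 (cid2 (F_angular j s rr')).
have aP s : `|a s + cos s| <= k / 2 /\ is_derive s (1 : R) (F j r) (amp r * a s) by rewrite /a; case: cid2.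
have dl (s : R) : is_derive s (1 : R) (fun s => - (k / 2 * amp r) * s) (- (k / 2 * amp r)).
  by apply: is_derive_ext (is_derive_scale _ (is_derive_id s 1)) _ _ => //; rewrite mulr1.
have := @le_derive R (F j r) _ (fun s => amp r * a s) _ t t' (ltW tt) (fun s _ => (aP s).2) (fun s _ => dl s).
move=> /(_ _)/Wrap[s /andP[ts st]|].
  have [h _] := aP s; move: h; rewrite ler_norml => /andP[_ h].
  have ks : k <= cos s by apply: le_cos_pi4; rewrite ler_norml; apply/andP; split; lra.
  by rewrite -[k / 2 * _]mulrC -mulrN ler_pM2l//; lra.
have : 0 < k * amp r * (t' - t) by apply: mulr_gt0; [exact: mulr_gt0|rewrite subr_gt0].
move: (amp r) (F j r t) (F j r t') => p f f'; nra.
Qed.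

Lemma F_zero j r : 0 < r < r0 -> exists t, - (pi / 4) < t < pi / 4 /\ F j r t = 0.
Proof.
move=> rr; have p0 := pi_gt0 R; have rr' : 0 <= r < r0 by case/andP: rr => /ltW -> ->.
have cF : continuous (F j r) by move=> t; have [a _ /is_derive_cont] := F_angular j t rr'.
have Fm : 0 < F j r (- (pi / 4)) by apply: F_gt0 => //; apply/andP; split; lra.
have Fp : F j r (pi / 4) < 0 by apply: F_lt0 => //; apply/andP; split; lra.
have hm : Num.min (F j r (- (pi / 4))) (F j r (pi / 4)) <= 0 <= Num.max (F j r (- (pi / 4))) (F j r (pi / 4)).
  by rewrite ge_min le_max (ltW Fp) (ltW Fm) orbT.
have pp : - (pi / 4) <= pi / 4 :> R by lra.
have [t] := @IVT R (F j r) _ _ 0 pp (continuous_subspaceT cF) hm.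
rewrite in_itv/= => /andP[t1 t2] Ft; exists t; split=> //.
rewrite !lt_neqAle t1 t2 !andbT; apply/andP; split; apply/eqP => E.
  by move: Fm; rewrite E Ft ltxx.
by move: Fp; rewrite -E Ft ltxx.
Qed.

(** The zero in the j-th sector, unique by monotonicity; 0 is a default outside the admissible
    radii. *)
Definition theta j r : R := if pselect (0 < r < r0) is left h then projT1 (cid (F_zero j h)) else 0.

Lemma thetaP j r : 0 < r < r0 -> - (pi / 4) < theta j r < pi / 4 /\ F j r (theta j r) = 0.
Proof. by move=> h; rewrite /theta; case: pselect => // h'; case: cid. Qed.

Lemma theta_uniq j r t : 0 < r < r0 -> - (pi / 4) <= t <= pi / 4 -> F j r t = 0 -> t = theta j r.
Proof.
move=> rr /andP[t1 t2] Ft; have [/andP[s1 s2] Fs] := thetaP j rr.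
have [lt|gt|//] := ltgtP t (theta j r).
  by have := F_decr j rr t1 lt (ltW s2); rewrite Ft Fs ltxx.
by have := F_decr j rr (ltW s1) gt t2; rewrite Ft Fs ltxx.
Qed.

(** The strict signs of [F] at the angles [t - e1] and [t + e1] persist for nearby radii, and
    monotonicity keeps the zero between them. *)
Lemma theta_cont j r (e : R) : 0 < r < r0 -> 0 < e -> exists2 del : R, 0 < del &
  forall s, `|s - r| < del -> 0 < s < r0 /\ `|theta j s - theta j r| < e.
Proof.
move=> rr e0; have [/andP[s1 s2] Fs] := thetaP j rr; set t := theta j r in s1 s2 Fs *.
pose e1 := Num.min e (Num.min (pi / 4 - t) (t + pi / 4)).
have e10 : 0 < e1 by rewrite !lt_min e0 subr_gt0 s2/= -ltrBlDr sub0r s1.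
have [e1e [e11 e12]] : e1 <= e /\ (e1 <= pi / 4 - t /\ e1 <= t + pi / 4) by rewrite !ge_min !lexx !orbT.
clearbody e1; have rr' : 0 <= r < r0 by case/andP: rr => /ltW -> ->.
have cont t' : {for r, continuous (fun s => F j s t')} by have [a _ /is_derive_cont] := F_radial j t' rr'.
have Fm : 0 < F j r (t - e1) by rewrite -Fs; apply: F_decr => //; lra.
have Fp : F j r (t + e1) < 0 by rewrite -Fs; apply: F_decr => //; lra.
have /cvgrPdist_lt/(_ _ Fm)/nbhs_ballP[d1 /= d10 h1] := cont (t - e1).
have Fp' : 0 < - F j r (t + e1) by rewrite oppr_gt0.
have /cvgrPdist_lt/(_ _ Fp')/nbhs_ballP[d2 /= d20 h2] := cont (t + e1).
have /andP[rp rlt] := rr.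
exists (Num.min (Num.min d1 d2) (Num.min r (r0 - r))); first by rewrite !lt_min d10 d20 rp subr_gt0.
move=> s; rewrite distrC !lt_min => /andP[/andP[sd1 sd2] /andP[sr sr0]].
have ss : 0 < s < r0 by move: sr sr0; rewrite !ltr_norml => /andP[_ a] /andP[a' _]; apply/andP; split; lra.
split=> //; have [/andP[u1 u2] Fu] := thetaP j ss.
have {h1} g1 : 0 < F j s (t - e1).
  by have := h1 s sd1; rewrite /= ltr_norml => /andP[_]; lra.
have {h2} g2 : F j s (t + e1) < 0.
  by have := h2 s sd2; rewrite /= ltr_norml => /andP[]; lra.
set u := theta j s in u1 u2 Fu *.
have b1 : t - e1 <= pi / 4 by lra.
have b2 : - (pi / 4) <= t + e1 by lra.
have l1 : t - e1 < u.
  rewrite ltNge; apply/negP; rewrite le_eqVlt => /predU1P[E|lt]; first by rewrite -E Fu ltxx in g1.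
  by have := F_decr j ss (ltW u1) lt b1; rewrite Fu ltNge ltW.
have l2 : u < t + e1.
  rewrite ltNge; apply/negP; rewrite le_eqVlt => /predU1P[E|lt]; first by rewrite E Fu ltxx in g2.
  by have := F_decr j ss b2 lt (ltW u2); rewrite Fu ltNge ltW.
by rewrite ltr_norml; apply/andP; split; lra.
Qed.

Let gam j s := pt j s (theta j s).

Lemma nc_gam j s : 0 <= s -> nc (gam j s - l0) = s.
Proof. exact: nc_pt. Qed.

Lemma gam_cont j s (e : R) : 0 < s < r0 -> 0 < e -> exists2 del : R, 0 < del &
  forall s', `|s' - s| < del -> nc (gam j s' - gam j s) < e.
Proof.
move=> ss e0; have e1 : 0 < e / (4 * r0) by rewrite divr_gt0// mulr_gt0.
have [del del0 h] := theta_cont j ss e1.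
exists (Num.min del (e / 2)); first by rewrite lt_min del0 divr_gt0.
move=> s'; rewrite lt_min => /andP[s1 s2]; have [_ ht] := h s' s1.
have -> : gam j s' - gam j s = (s' - s)%:C * expi (ang j (theta j s')) +
    s%:C * (expi (ang j (theta j s')) - expi (ang j (theta j s))).
  by rewrite /gam /pt rmorphB /=; ring.
apply: le_lt_trans (ncD _ _) _; rewrite !ncM nc_expi mulr1 !nc_real.
have m1 : 1 <= m by rewrite ler1n.
have : nc (expi (ang j (theta j s')) - expi (ang j (theta j s))) <= 2 * `|theta j s' - theta j s|.
  apply: le_trans (nc_expiB _ _) _; rewrite ler_wpM2l//.
  have -> : ang j (theta j s') - ang j (theta j s) = (theta j s' - theta j s) / m by rewrite /ang; ring.
  by rewrite normrM normfV (gtr0_norm m0) ler_pdivrMr// ler_peMr.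
move: (nc _) (nc_ge0 (expi (ang j (theta j s')) - expi (ang j (theta j s)))) => q q0 hq.
have /andP[sp sr] := ss; rewrite (gtr0_norm sp).
have : s * q <= r0 * q by rewrite ler_wpM2r// ltW.
have : r0 * q < e / 2.
  rewrite -ltr_pdivlMl//; apply: le_lt_trans hq _.
  have -> : r0^-1 * (e / 2) = 2 * (e / (4 * r0)) by field; rewrite gt_eqF.
  by rewrite ltr_pM2l.
by lra.
Qed.

Definition arc j r1 : set R[i] := gam j @` [set` `]0, r1[].

Lemma arc_connected j r1 : r1 <= r0 -> connected (arc j r1).
Proof.
move=> r1r0; apply: connected_continuous_connected.
  by apply/connected_intervalP; exact: interval_is_interval.
apply: continuous_in_subspaceT => s; rewrite inE /= in_itv/= => /andP[sp sr].
have ss : 0 < s < r0 by rewrite sp (lt_le_trans sr).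
move=> A /nbhs_nc[e e0 eA]; have [del del0 h] := gam_cont j ss e0.
apply/nbhs_ballP; exists del => // s' /=; rewrite /ball /= distrC => ss'.
by apply: eA; rewrite ncBC; exact: h.
Qed.

(** Positive exactly on the open sector of half-opening [pi / 4 / m] about the axis of the j-th arc.
    Being Lipschitz, it produces the open and closed sets that single out one arc. *)
Let sect j l : R := re ((l - l0) * expi (- ang j 0)) - cos (pi / 4 / m) * nc (l - l0).

Lemma sect_lip j l l' : `|sect j l - sect j l'| <= 2 * nc (l - l').
Proof.
have -> : sect j l - sect j l' = re ((l - l') * expi (- ang j 0)) -
    cos (pi / 4 / m) * (nc (l - l0) - nc (l' - l0)).
  by rewrite /sect (_ : (l - l') * _ = (l - l0) * expi (- ang j 0) - (l' - l0) * expi (- ang j 0)) ?reD ?reN; ring.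
apply: le_trans (ler_normB _ _) _; rewrite mulr_natl mulr2n; apply: lerD.
  by apply: le_trans (nc_re _) _; rewrite ncM nc_expi mulr1.
rewrite normrM -[leRHS]mul1r; apply: ler_pM => //.
  by rewrite ler_norml cos_geN1 cos_le1.
have h1 := ncBl (l - l0) (l' - l0); have h2 := ncBl (l' - l0) (l - l0).
have e1 : l - l0 - (l' - l0) = l - l' by ring.
rewrite ncBC e1 in h2; rewrite e1 in h1.
by rewrite ler_norml; apply/andP; split; lra.
Qed.

Lemma sect_pt j j' s t : 0 <= s ->
  sect j (pt j' s t) = s * (cos (((j'%:R - j%:R) * pi + t) / m) - cos (pi / 4 / m)).
Proof.
move=> s0; rewrite /sect nc_pt//.
have -> : (pt j' s t - l0) * expi (- ang j 0) = s%:C * expi (ang j' t - ang j 0) by rewrite /pt expiD; ring.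
rewrite reM /= mul0r subr0.
have -> : ang j' t - ang j 0 = ((j'%:R - j%:R) * pi + t) / m by rewrite /ang; ring.
by ring.
Qed.

(** Neighbouring axes are [pi / m] apart and each arc deviates from its own by less than
    [pi / 4 / m], so another arc stays more than [3 / 4 * pi / m] away from the axis, in both
    directions around the circle. *)
Lemma sect_arc j j' s : (j < 2 * n.+1)%N -> (j' < 2 * n.+1)%N -> 0 < s < r0 ->
  if j == j' then 0 < sect j (gam j' s) else sect j (gam j' s) < 0.
Proof.
move=> jm jm' ss; have [/andP[t1 t2] _] := thetaP j' ss; have /andP[sp _] := ss.
rewrite /gam sect_pt ?(ltW sp)//; have p0 := pi_gt0 R.
have m1 : 1 <= m by rewrite ler1n.
have q4 : 0 <= pi / 4 / m <= pi.
  by rewrite !divr_ge0 ?(ltW p0) ?(ltW m0)//= ler_pdivrMr//; nra.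
case: eqVneq => [->|jj].
  rewrite subrr mul0r add0r pmulr_rgt0// subr_gt0.
  have -> : cos (theta j' s / m) = cos `|theta j' s / m| by case: ger0P => // _; rewrite cosN.
  have lt : `|theta j' s / m| < pi / 4 / m.
    by rewrite normrM normfV (gtr0_norm m0) ltr_pM2r ?invr_gt0// ltr_norml t1.
  rewrite ltr_cos ?in_itv//=; apply/andP; split=> //.
  by case/andP: q4 => _; apply: le_trans; exact: ltW.
rewrite pmulr_rlt0// subr_lt0.
have lt : cos (3 / 4 * pi / m) < cos (pi / 4 / m).
  rewrite ltr_cos ?in_itv//=; first by rewrite ltr_pM2r ?invr_gt0//; lra.
  by rewrite divr_ge0 ?(ltW m0)//= ?ler_pdivrMr//; nra.
apply: le_lt_trans lt; apply: le_cos_out.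
  by rewrite divr_ge0 ?(ltW m0)//= ?ler_pdivrMr//; nra.
rewrite normrM normfV (gtr0_norm m0) ler_pM2r ?invr_gt0// ler_pdivrMr//.
have -> : (2 * pi - 3 / 4 * pi / m) * m = 2 * m * pi - 3 / 4 * pi by field; rewrite gt_eqF.
have far (a a' : nat) : (a < a')%N -> (a' < 2 * n.+1)%N -> (1 : R) <= a'%:R - a%:R <= 2 * m - 1.
  move=> aa am; have : (a.+1)%:R <= a'%:R :> R by rewrite ler_nat.
  have : (a'.+1)%:R <= (2 * n.+1)%:R :> R by rewrite ler_nat.
  have : 0 <= a%:R :> R by exact: ler0n.
  by rewrite natrM -!natr1 -/m; move: (a%:R) (a'%:R) => x y *; apply/andP; split; lra.
have [lt|gt|E] := ltngtP j j'; last by rewrite E eqxx in jj.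
  have /andP[] := far _ _ lt jm'; move: (j'%:R - j%:R) => x x1 x2.
  have y1 : pi <= x * pi by rewrite ler_peMl// ltW.
  have y2 : x * pi <= (2 * m - 1) * pi by rewrite ler_pM2r.
  by rewrite ger0_norm; [apply/andP; split|]; lra.
have hfar := far _ _ gt jm; have -> : j'%:R - j%:R = - (j%:R - j'%:R) :> R by ring.
rewrite mulNr; move: (j%:R - j'%:R) hfar => x /andP[x1 x2].
have y1 : pi <= x * pi by rewrite ler_peMl// ltW.
have y2 : x * pi <= (2 * m - 1) * pi by rewrite ler_pM2r.
by rewrite ler0_norm; [apply/andP; split|]; lra.
Qed.

Lemma punctured_arcs r1 l : r1 <= r0 ->
  ((S `&` ball l0 r1%:C) `\ l0) l <-> exists2 j, (j < 2 * n.+1)%N & arc j r1 l.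
Proof.
move=> r1r0; split=> [[[Sl]]|[j jm [s /=]]]; last first.
  rewrite in_itv/= => /andP[sp sr] <-; have sr0 := lt_le_trans sr r1r0.
  have ss : 0 < s < r0 by rewrite sp.
  have ng := nc_gam j (ltW sp); split; last first.
    by move=> E; move: ng; rewrite E subrr nc0 => E'; rewrite -E' ltxx in sp.
  split; last by rewrite ball_nc ncBC ng.
  apply/SV; first by rewrite ng (lt_le_trans sr0).
  have [_] := thetaP j ss; rewrite /F => /eqP; rewrite mulf_eq0 expf_eq0 oppr_eq0 oner_eq0 andbF /=.
  by move/eqP.
rewrite ball_nc ncBC => lr /eqP ll0; pose s := nc (l - l0).
have sp : 0 < s by rewrite nc_gt0 subr_eq0.
have ss : 0 < s < r0 by rewrite sp (lt_le_trans lr).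
have Vl : V l = 0 by apply/SV => //; apply: lt_le_trans r0d; case/andP: ss.
have p0 := pi_gt0 R.
(* The circle is cut at the angle [ang 0 (- (pi / 4))]. The rescaled angle [u] then lies in [0, 2 m
   pi), the integer part of [u / pi] is the index of the arc, and the rest gives [t] in [- pi / 4, 3
   pi / 4). *)
have [a /andP[a1 a2] la] := polar_from (l - l0) (ang 0 (- (pi / 4))).
pose u := m * (a - ang 0 (- (pi / 4))).
have u0 : 0 <= u by rewrite mulr_ge0 ?(ltW m0)// subr_ge0.
have u2 : u < 2 * m * pi by rewrite /u -mulrA mulrCA ltr_pM2l//; lra.
pose j := Num.truncn (u / pi).
have /andP[] := truncn_itv (divr_ge0 u0 (ltW p0)); rewrite -/j ler_pdivlMr// ltr_pdivrMr// => j1 j2.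
have jm : (j < 2 * n.+1)%N.
  by rewrite -(ltr_nat R) natrM -(ltr_pM2r p0); apply: le_lt_trans j1 u2.
pose t := u - j%:R * pi - pi / 4.
have aE : a = ang j t by rewrite /t /u /ang; field; rewrite gt_eqF.
have lE : l = pt j s t by rewrite /pt -aE -la addrC subrK.
have F0 : F j s t = 0 by rewrite /F -lE Vl mulr0.
have t1 : - (pi / 4) <= t by rewrite /t; lra.
have t2 : t < 3 / 4 * pi by move: j2; rewrite -natr1 mulrDl mul1r /t; lra.
(* Beyond pi / 4 the function has a strict sign, so the point must lie in the sector of its arc. *)
have t3 : t <= pi / 4.
  rewrite leNgt; apply/negP => h; suff : F j s t < 0 by rewrite F0 ltxx.
  by apply: F_lt0 => //; rewrite (ltW h) ltW.
exists j => //; exists s; first by rewrite /= in_itv/= sp.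
by rewrite /gam -(theta_uniq ss _ F0) -?lE// t1.
Qed.

Lemma card_punctured_components r1 : 0 < r1 <= r0 ->
  (components ((S `&` ball l0 r1%:C) `\ l0) #= `I_(2 * n.+1))%card.
Proof.
move=> /andP[r10 r1r0]; apply: (@card_components R _ _ (fun j => arc j r1)).
- by move=> j _; exact: arc_connected.
- by move=> j _; exists (gam j (r1 / 2)), (r1 / 2) => //=; rewrite in_itv/=; lra.
- by move=> l; exact: punctured_arcs.
- move=> j j' x jm jm' [s /=]; rewrite in_itv/= => /andP[sp sr] <- [s' /=].
  rewrite in_itv/= => /andP[sp' sr'] E.
  have ss : 0 < s < r0 by rewrite sp (lt_le_trans sr).
  have ss' : 0 < s' < r0 by rewrite sp' (lt_le_trans sr').
  have h1 := sect_arc jm jm ss; have h2 := sect_arc jm jm' ss'; rewrite eqxx in h1.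
  by apply/eqP; move: h2; case: eqP => // _; rewrite E ltNge ltW.
(* On the punctured set [sect j] never vanishes, so that the strict and the weak inequality cut out
   the same arc. *)
- move=> j jm; exists [set l | 0 < sect j l], [set l | 0 <= sect j l].
  have char x : ((S `&` ball l0 r1%:C) `\ l0) x ->
      (0 < sect j x /\ arc j r1 x) \/ (sect j x < 0 /\ ~ arc j r1 x).
    move/(punctured_arcs x r1r0) => [j' jm' [s /=]]; rewrite in_itv/= => /andP[sp sr] <-.
    have ss : 0 < s < r0 by rewrite sp (lt_le_trans sr).
    have := sect_arc jm jm' ss; case: eqVneq => [->|jj] h.
      by left; split=> //; exists s => //=; rewrite in_itv/= sp.
    right; split=> // -[s' /=]; rewrite in_itv/= => /andP[sp' sr'] E.
    have ss' : 0 < s' < r0 by rewrite sp' (lt_le_trans sr').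
    by have := sect_arc jm jm ss'; rewrite eqxx E ltNge ltW.
  have open_pos (f : R[i] -> R) : (forall l l', `|f l - f l'| <= 2 * nc (l - l')) -> open [set l | 0 < f l].
    move=> lip; apply/open_nc => z /= fz; exists (f z / 2); first by rewrite divr_gt0.
    by move=> x h; have := lip z x; rewrite ler_norml => /andP[_]; lra.
  split.
  - by apply: open_pos; exact: sect_lip.
  - rewrite (_ : [set l | 0 <= sect j l] = ~` [set l | 0 < - sect j l]); last first.
      by apply/seteqP; split=> l /=; rewrite oppr_gt0 leNgt => /negP.
    apply: open_closedC; apply: open_pos => l l'.
    by rewrite -opprD normrN; exact: sect_lip.
  - by move=> x /char[[h1 h2]|[h1 h2]]; split=> //= h; rewrite ltNge ltW in h.
  - by move=> x /char[[h1 h2]|[h1 h2]]; split=> //= h; [exact: ltW|rewrite leNgt h1 in h].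
Qed.

End LocalArcs.

(** * The number of semi-arcs, and complex differentiation *)

Section SemiArcCount.
Context {R : realType}.

Lemma local_semi_arcs (V : R[i] -> R) (G H : R[i] -> R[i]) (l0 : R[i]) (d : R) n (S : set R[i]) :
  0 < d -> V l0 = 0 ->
  (forall (y y1 : R -> R[i]) t, cder y (y1 t) t -> nc (y t - l0) < d ->
    is_derive t (1 : R) (fun s => V (y s)) (re (G (y t) * y1 t))) ->
  (forall l, nc (l - l0) < d -> G l = (l - l0) ^+ n * H l) -> cont_at H l0 -> H l0 != 0 ->
  (forall l, nc (l - l0) < d -> S l <-> V l = 0) -> semi_arcs S l0 (2 * n.+1).
Proof.
move=> d0 V0 dV GH cH H0 SV; have [b bH] := polar (H l0).
have e0 : 0 < cos (pi / 4) / 2 * nc (H l0) by rewrite mulr_gt0 ?divr_gt0 ?cos_pi4_gt0 ?nc_gt0.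
have [r r0 hr] := cH _ e0; pose r1 := Num.min r d.
have r10 : 0 < r1 by rewrite lt_min r0.
have r1d : r1 <= d by rewrite ge_min lexx orbT.
have hr1 l : nc (l - l0) < r1 -> nc (H l - H l0) < cos (pi / 4) / 2 * nc (H l0).
  by rewrite lt_min => /andP[/hr].
have card := card_punctured_components V0 dV GH H0 SV bH r10 r1d hr1.
near=> s; apply: card; apply/andP; split; first by near: s; exact: nbhs_right_gt.
by near: s; exact: nbhs_right_le.
Unshelve. all: by end_near. Qed.

(** Both counts hold for all small radii, hence for a common one. *)
Lemma semi_arcs_uniq (S : set R[i]) l a b : semi_arcs S l a -> semi_arcs S l b -> a = b.
Proof.
move=> ha hb; have [r [h1 h2]] := filter_ex (filterI ha hb).
by apply/card_eq_II; exact: card_eq_trans (card_esym h1) h2.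
Qed.

Lemma cont_atM (F G : R[i] -> R[i]) l : cont_at F l -> cont_at G l -> cont_at (fun l' => F l' * G l') l.
Proof.
move=> cF cG e e0; pose K := nc (F l) + nc (G l) + 1.
have K0 : 0 < K by rewrite ltr_wpDl// addr_ge0 ?nc_ge0.
pose e1 := Num.min 1 (e / (3 * K)); have e10 : 0 < e1 by rewrite lt_min ltr01 divr_gt0// mulr_gt0.
have e11 : e1 <= 1 by rewrite ge_min lexx.
have e1e : e1 * (3 * K) <= e by rewrite -ler_pdivlMr ?mulr_gt0// ge_min lexx orbT.
have [r r0 hr] := cF _ e10; have [s s0 hs] := cG _ e10.
exists (Num.min r s) => [|l']; first by rewrite lt_min r0.
rewrite lt_min => /andP[/hr h1 /hs h2].
have -> : F l' * G l' - F l * G l = (F l' - F l) * (G l' - G l) + (F l' - F l) * G l + F l * (G l' - G l) by ring.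
apply: le_lt_trans (ncD _ _) _; apply: le_lt_trans (lerD (ncD _ _) (lexx _)) _; rewrite !ncM.
have := nc_ge0 (F l' - F l); have := nc_ge0 (G l' - G l); have := nc_ge0 (F l); have := nc_ge0 (G l).
clearbody e1; move: (nc (F l' - F l)) (nc (G l' - G l)) h1 h2 => x y hx hy g f y0 x0.
have a1 : x * y <= e1 * 1 by apply: ler_pM => //; [exact: ltW|apply: le_trans (ltW hy) e11].
have a2 : x * nc (G l) <= e1 * nc (G l) by rewrite ler_wpM2r// ltW.
have a3 : nc (F l) * y <= nc (F l) * e1 by rewrite ler_wpM2l// ltW.
have : 0 < e1 * K by exact: mulr_gt0.
by move: e1e a2 a3; rewrite /K; nra.
Qed.

Lemma cont_atV (F : R[i] -> R[i]) l : F l != 0 -> cont_at F l -> cont_at (fun l' => (F l')^-1) l.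
Proof.
move=> F0 cF e e0; pose K := nc (F l); have K0 : 0 < K by rewrite nc_gt0.
have e10 : 0 < Num.min (K / 2) (e * K * K / 2) by rewrite lt_min !divr_gt0// !mulr_gt0.
have [r r0 hr] := cF _ e10; exists r => // l' /hr; rewrite lt_min => /andP[h1 h2].
have F'0 : K / 2 < nc (F l') by have := ncBl (F l) (F l'); rewrite ncBC -/K; lra.
have F'n : F l' != 0 by rewrite -nc_gt0; apply: lt_trans F'0; rewrite divr_gt0.
have -> : (F l')^-1 - (F l)^-1 = - (F l' - F l) / (F l' * F l) by field; rewrite F'n F0.
rewrite ncM ncV ncM ncN ltr_pdivrMr ?mulr_gt0 ?nc_gt0//; apply: lt_le_trans h2 _.
have -> : e * K * K / 2 = e * (K / 2 * K) by ring.
have h3 : K / 2 * K <= nc (F l') * K by rewrite ler_wpM2r// ltW.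
exact: (ler_wpM2l (ltW e0) h3).
Qed.

Lemma cdiff_cont (F : R[i] -> R[i]) a l : cdiff F a l -> cont_at F l.
Proof.
move=> dF e e0; have [r r0 hr] := dF 1 ltr01; have k0 : 0 < 1 + nc a by rewrite ltr_pwDl// nc_ge0.
exists (Num.min r (e / (1 + nc a))) => [|l']; first by rewrite lt_min r0 divr_gt0.
have ll : l + (l' - l) = l' by ring.
rewrite lt_min ltr_pdivlMr// => /andP[/hr]; rewrite ll mul1r => h1; apply: le_lt_trans.
have -> : F l' - F l = (F l' - F l - a * (l' - l)) + a * (l' - l) by rewrite subrK.
apply: le_trans (ncD _ _) _; rewrite ncM.
by rewrite [leRHS](_ : _ = nc (l' - l) + nc a * nc (l' - l)) ?lerD2r//; ring.
Qed.

Lemma cdiff_cder (F : R[i] -> R[i]) a (y : R -> R[i]) y1 t : cdiff F a (y t) -> cder y y1 t ->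
  cder (fun s => F (y s)) (a * y1) t.
Proof.
move=> dF /cderP dy; apply/cderP => e e0.
pose K := nc a + nc y1 + 1; have K0 : 0 < K by rewrite ltr_wpDl// addr_ge0 ?nc_ge0.
pose e1 := Num.min 1 (e / (2 * K)); have e10 : 0 < e1 by rewrite lt_min ltr01 divr_gt0// mulr_gt0.
have e11 : e1 <= 1 by rewrite ge_min lexx.
have e1e : e1 * (2 * K) <= e by rewrite -ler_pdivlMr ?mulr_gt0// ge_min lexx orbT.
have [r r0 hr] := dF _ e10; have [s s0 hs] := dy _ e10.
exists (Num.min s (r / K)) => [|x]; first by rewrite lt_min s0 divr_gt0.
rewrite lt_min ltr_pdivlMr// => /andP[/hs h1 xr].
have yx : nc (y (t + x) - y t) <= `|x| * (nc y1 + 1).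
  have -> : y (t + x) - y t = (y (t + x) - y t - y1 * x%:C) + y1 * x%:C by rewrite subrK.
  apply: le_trans (ncD _ _) _; rewrite ncM nc_real.
  rewrite [leRHS](_ : _ = `|x| + nc y1 * `|x|); last by ring.
  by rewrite lerD2r; apply: le_trans h1 _; rewrite ler_piMl.
have := hr (y (t + x) - y t); have -> : y t + (y (t + x) - y t) = y (t + x) by ring.
move=> /(_ _)/Wrap[|h2].
  apply: le_lt_trans yx _; apply: le_lt_trans xr; rewrite ler_wpM2l// /K.
  by have := nc_ge0 a; lra.
have -> : F (y (t + x)) - F (y t) - a * y1 * x%:C =
  (F (y (t + x)) - F (y t) - a * (y (t + x) - y t)) + a * (y (t + x) - y t - y1 * x%:C) by ring.
apply: le_trans (ncD _ _) _; rewrite ncM.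
clearbody e1; apply: le_trans (lerD h2 (ler_wpM2l (nc_ge0 a) h1)) _.
apply: le_trans (lerD (ler_wpM2l (ltW e10) yx) (lexx _)) _.
have -> : e1 * (`|x| * (nc y1 + 1)) + nc a * (e1 * `|x|) = e1 * K * `|x| by rewrite /K; ring.
by rewrite ler_wpM2r//; have : 0 < e1 * K by [exact: mulr_gt0|]; lra.
Qed.

Lemma cont_at_conj (F : R[i] -> R[i]) l : cont_at F l -> cont_at (fun l' => (F l')^*%C) l.
Proof.
move=> cF e e0; have [r r0 hr] := cF e e0; exists r => // l' /hr.
by rewrite -rmorphB !nc_sqrtE re_conj im_conj sqrrN.
Qed.

Lemma entire_horner (p : {poly R[i]}) : entire (fun l => p.[l]).
Proof.
elim/poly_ind: p => [|p c IH].
  by rewrite (_ : (fun _ => _) = fun=> 0); [exact: entire_cst|apply/funext => l; rewrite horner0].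
rewrite (_ : (fun _ => _) = fun l => p.[l] * l + c); last by apply/funext => l; rewrite !hornerE.
by apply: entireD (entireM IH entire_id) (entire_cst c).
Qed.

End SemiArcCount.

Theorem theorem1p1 (R : realType) (tau z0 lambda0 : R[i])
    (tau_upper : 0 < complex.Im tau)
    (z0_regular : forall x : R, ~ lattice tau (x%:C + z0))
    (lambda0_spec : spectrum (lame tau z0) lambda0)
    (Q_neq0 : spectral_poly tau lambda0 <> 0) :
  inner_intersection_point (spectrum (lame tau z0)) lambda0 <->
  4 / 15 * lambda0 ^+ 3 + 8 / 5 * eta1 tau * lambda0 ^+ 2
    - 3 * g2 tau * lambda0 + 9 * g3 tau - 6 * eta1 tau * g2 tau = 0.
Proof.
pose f (l : R[i]) := 4 / 15 * l ^+ 3 + 8 / 5 * eta1 tau * l ^+ 2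
  - 3 * g2 tau * l + 9 * g3 tau - 6 * eta1 tau * g2 tau.
have nz k : (k.+1%:R : R[i]) != 0 by rewrite pnatr_eq0.
have w20 : w2 tau lambda0 != 0.
  rewrite /w2 mulf_eq0 expf_eq0 /= mulf_eq0 invr_eq0 !(negbTE (nz _)) /=.
  exact/eqP.
have [d [yp [yp1 [ym [ym1 [rho [W [d0 fam cW]]]]]]]] := floquet_exists tau_upper z0_regular w20.
(* As a polynomial [f] has leading coefficient 4 / 15; it is nonzero and has a finite multiplicity
   [n] at [lambda0], possibly 0. *)
pose p : {poly R[i]} := Poly [:: 9 * g3 tau - 6 * eta1 tau * g2 tau; - (3 * g2 tau); 8 / 5 * eta1 tau; 4 / 15].
have pE l : p.[l] = f l by rewrite horner_Poly /= /f; ring.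
have p0 : p != 0.
  apply/eqP => /(congr1 (fun q : {poly R[i]} => q`_3)); rewrite coef_Poly coef0 /= => /eqP.
  by rewrite mulf_eq0 invr_eq0 !(negbTE (nz _)).
have [n [q]] := multiplicity_XsubC p lambda0; rewrite p0 /= => q0 pq.
have fq l : f l = (l - lambda0) ^+ n * q.[l] by rewrite -pE pq hornerM horner_exp hornerXsubC mulrC.
have drho l : nc (l - lambda0) < d -> cdiff rho (rho l * (- (f l / 60) / W l)) l.
  move=> ld; have [P [dP Pf]] := Phi_integral tau_upper z0_regular l.
  by have := rho_derivative fam ld dP; rewrite Pf mulNr.
have spec l : nc (l - lambda0) < d -> spectrum (lame tau z0) l <-> nc (rho l) = 1.
  move=> ld; have [[_ _ s1 s2] [r0 m1 m2 m3 m4] W0 _ _] := fam l ld.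
  exact: (floquet_spectrum tau_upper z0_regular s1 s2 r0 m1 m2 m3 m4 W0).
have ld0 : nc (lambda0 - lambda0) < d by rewrite subrr nc0.
have [[_ W0 _ _] [rho0 _ _ _ _] _ _ _] := fam _ ld0.
(* [G] is the complex gradient of |rho|^2: along a curve [y] the derivative of |rho|^2 is the real
   part of [G (y t) * y1 t]. In [H] the zero of order [n] at [lambda0] has been divided out. *)
pose H l := 2 * (rho l * (rho l)^*%C) * (- (q.[l] / 60) / W l).
pose G l := 2 * (rho l * (rho l)^*%C) * (- (f l / 60) / W l).
have crho := cdiff_cont (drho _ ld0).
have cnt : semi_arcs (spectrum (lame tau z0)) lambda0 (2 * n.+1).
  apply: (@local_semi_arcs R (fun l => nc (rho l) ^+ 2 - 1) G H lambda0 d n) => //.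
  - by rewrite ((spec _ ld0).1 lambda0_spec) expr1n subrr.
  - move=> y y1 t dy ytd; have h := is_derive_nc2 (cdiff_cder (drho _ ytd) dy).
    have [h2 _] := cderB (cder_real h) (cder_cst 1 t).
    apply: is_derive_ext h2 _ _ => [s|]; first by rewrite reD reN.
    rewrite /G mul_conj; move: (- (f (y t) / 60) / W (y t)) => g.
    rewrite reD reN -!mulrA; move: (g * y1 t) => z; rewrite !(reM, imM) /= nc_sqr; ring.
  - by move=> l _; rewrite /G /H fq; ring.
  - apply: cont_atM; first by apply: cont_atZ; apply: cont_atM => //; exact: cont_at_conj.
    apply: cont_atM; last exact: cont_atV.
    rewrite (_ : (fun l => _) = (fun l => - 60^-1 * q.[l])); last by apply/funext => l; ring.
    by apply: cont_atZ; apply: entire_cont; exact: entire_horner.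
  - rewrite /H mul_conj mulf_neq0 ?mulf_neq0 ?invr_eq0 ?oppr_eq0 ?mulf_neq0 ?invr_eq0//.
    by rewrite -nc_eq0 nc_real normr_eq0 expf_eq0 nc_eq0.
  - move=> l ld; split=> [/(spec l ld) ->|/eqP]; first by rewrite expr1n subrr.
    by rewrite subr_eq0 sqrp_eq1 ?nc_ge0// => /eqP /(spec l ld).
(* Uniqueness of the count identifies [k] with [n + 1]; thus [k >= 2] means [n >= 1], and [f]
   vanishes at [lambda0]. *)
rewrite -/(f lambda0); split=> [[_ [k k2 hk]]|f0].
  have := semi_arcs_uniq cnt hk => /eqP; rewrite eqn_pmul2l// => /eqP E.
  by move: k2; rewrite -E fq subrr; case: n {fq pq cnt E} => // n _; rewrite expr0n mul0r.
(* Conversely [n = 0] is impossible at a root, since [q] would then vanish at [lambda0]; so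
   [n + 1 >= 2]. *)
split=> //; exists n.+1 => //; case: n fq {pq cnt} => // fq.
by move: q0; rewrite /root; have := fq lambda0; rewrite f0 expr0 mul1r => <-; rewrite eqxx.
Qed.
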